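(* Let $d\ge3$, let $\Omega,\omega\subset\mathbb{R}^d$ be admissible domains, and let $u^a,u^b$ be admissible functions on $\Omega$, not identically zero in a neighborhood of $0$, with (finite) orders of vanishing $\overline k^a,\overline k^b$ at $0$. For $l=a,b$ let $u^l_{\#,\overline k^l}(t)=\sum_{|\beta|=\overline k^l}\frac{D^\beta u^l(0)}{\beta!}t^\beta$ and let $\mathsf u^l_{\overline k^l}$ be the unique solution in $C^{1,\alpha}_{\mathrm{loc}}(\mathbb{R}^d\setminus\omega)$ of \[ \Delta\mathsf u^l_{\overline k^l}=0\ \text{ in }\mathbb{R}^d\setminus\overline\omega,\qquad \mathsf u^l_{\overline k^l}=u^l_{\#,\overline k^l}\ \text{ on }\partial\omega,\qquad \lim_{t\to\infty}\mathsf u^l_{\overline k^l}(t)=0 . \] Let the coefficients $\{c_n\}_{n\in\mathbb{N}}$ and the number $\varepsilon_{\mathrm c}>0$ be as in the context. Then \[ \mathrm{Cap}_\Omega(\varepsilon\overline\omega,u^a,u^b)=\varepsilon^{\overline k^a+\overline k^b+d-2}\Bigg(\int_{\mathbb{R}^d\setminus\overline\omega}\nabla\mathsf u^a_{\overline k^a}\cdot\nabla\mathsf u^b_{\overline k^b}\,dt+\int_\omega\nabla u^a_{\#,\overline k^a}\cdot\nabla u^b_{\#,\overline k^b}\,dt\Bigg)+\sum_{n=\overline k^a+\overline k^b+d-1}^\infty\varepsilon^nc_n \] for all $\varepsilon\in\,]0,\varepsilon_{\mathrm c}[$.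
   Context: **Domains, functions, capacity.** $\mathbb{N}$ contains $0$. An admissible domain is an open, bounded, connected set $\Omega\subset\mathbb{R}^d$ of Schauder class $C^{1,\alpha}$ for some $\alpha\in\,]0,1[$, with $0\in\Omega$ and $\mathbb{R}^d\setminus\overline\Omega$ connected; fix a common $\alpha$ for $\Omega$ and $\omega$. An admissible function is a $u\in H^1(\Omega)$ that is real-analytic in a neighborhood of $0$. The order of vanishing of $u$ at $0$ is the integer $\overline k\ge0$ such that $D^\gamma u(0)=0$ for $|\gamma|<\overline k$ and $D^\beta u(0)\ne0$ for some $|\beta|=\overline k$. For $K\subseteq\Omega$ compact and $u\in H^1(\Omega)$, $V_{K,u}$ is the unique function in $H^1_0(\Omega)$ with $V_{K,u}-\eta_Ku\in H^1_0(\Omega\setminus K)$ and $\int_\Omega\nabla V_{K,u}\cdot\nabla\varphi\,dx=0$ for all $\varphi\in H^1_0(\Omega\setminus K)$, where $\eta_K$ is any smooth function compactly supported in $\Omega$ and equal to $1$ near $K$; and $\mathrm{Cap}_\Omega(K,u^a,u^b)\equiv\int_\Omega\nabla V_{K,u^a}\cdot\nabla V_{K,u^b}\,dx$. **Layer potentials.** $s_d$ is the $(d-1)$-dimensional measure of the unit sphere, $S_d(x)\equiv\frac{1}{(2-d)s_d|x|^{d-2}}$ for $x\ne0$. For $\mathcal O$ open bounded of class $C^{1,\alpha}$ with outward unit normal $\nu_{\mathcal O}$: $v[\partial\mathcal O,\phi](x)=\int_{\partial\mathcal O}\phi(y)S_d(x-y)\,d\sigma_y$ for $x\in\mathbb{R}^d$,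 and $v^-[\partial\mathcal O,\phi]$ is its restriction to $\mathbb{R}^d\setminus\mathcal O$; $w[\partial\mathcal O,\psi](x)=-\int_{\partial\mathcal O}\psi(y)\,\nu_{\mathcal O}(y)\cdot\nabla S_d(x-y)\,d\sigma_y$, and $w^-[\partial\mathcal O,\psi]$ is the $C^{1,\alpha}_{\mathrm{loc}}$ extension to $\mathbb{R}^d\setminus\mathcal O$ of its restriction to $\mathbb{R}^d\setminus\overline{\mathcal O}$. For $x\in\partial\mathcal O$: $W_{\mathcal O}[\psi](x)=-\int_{\partial\mathcal O}\psi(y)\nu_{\mathcal O}(y)\cdot\nabla S_d(x-y)\,d\sigma_y$ and $W^*_{\mathcal O}[\phi](x)=\int_{\partial\mathcal O}\phi(y)\nu_{\mathcal O}(x)\cdot\nabla S_d(x-y)\,d\sigma_y$. $C^{1,\alpha}(\partial\omega)_0$ is the subspace of functions in $C^{1,\alpha}(\partial\omega)$ with zero integral. Below $\beta$ ranges over $\mathbb{N}^d$ unless stated otherwise. **Sequence $(\rho^o_k,\rho^i_k)$ in $C^{0,\alpha}(\partial\Omega)\times C^{0,\alpha}(\partial\omega)$**: the unique solutions of the following systems. For $k=0$: $\frac12\rho^o_0+W^*_\Omega[\rho^o_0]=-\nu_\Omega\cdot\nabla S_d$ on $\partial\Omega$; $\frac12\rho^i_0-W^*_\omega[\rho^i_0]=0$ on $\partial\omega$; $\int_{\partial\omega}\rho^i_0\,d\sigma=1$. For $1\le k\le d-2$: $\rho^i_k=0$ and, for $x\in\partial\Omega$, $\frac12\rho^o_k(x)+W^*_\Omega[\rho^o_k](x)=(-1)^{k+1}\sum_{|\beta|=k}\frac{k!}{\beta!}\nu_\Omega(x)\cdot(\nabla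 D^\beta S_d)(x)\int_{\partial\omega}\rho^i_0(s)s^\beta\,d\sigma_s$. For $k\ge d-1$: for $x\in\partial\Omega$, $t\in\partial\omega$, \[ \tfrac12\rho^o_k(x)+W^*_\Omega[\rho^o_k](x)=\sum_{j=0}^k\binom kj(-1)^{j+1}\sum_{|\beta|=j}\frac{j!}{\beta!}\nu_\Omega(x)\cdot(\nabla D^\beta S_d)(x)\int_{\partial\omega}\rho^i_{k-j}(s)s^\beta\,d\sigma_s, \] \[ \tfrac12\rho^i_k(t)-W^*_\omega[\rho^i_k](t)=\frac{k!}{(k-(d-1))!}\sum_{j=0}^{k-(d-1)}\binom{k-(d-1)}{j}\sum_{|\beta|=j}\frac{j!}{\beta!}(-1)^{j+1}t^\beta\nu_\omega(t)\cdot\int_{\partial\Omega}\rho^o_{k-(d-1)-j}\nabla D^\beta S_d\,d\sigma, \] and $\int_{\partial\omega}\rho^i_k\,d\sigma=0$. **Sequence $(\theta^o_k,\theta^i_k)$ in $C^{1,\alpha}(\partial\Omega)\times C^{1,\alpha}(\partial\omega)_0$**: put \[ F_k(t)\equiv\sum_{|\beta|=k}\frac{k!}{\beta!}t^\beta(D^\beta u^a)(0)-\sum_{l=0}^k\sum_{|\beta|=l}\binom kl\frac{l!}{\beta!}\int_{\partial\omega}s^\beta(D^\beta u^a)(0)\rho^i_{k-l}(s)\,d\sigma_s . \] $(\theta^o_0,\theta^i_0)=(0,0)$ and $\theta^o_k=0$ for $0\le k\le d-1$; for $0\le k\le d-1$, $\theta^i_k$ is the unique solution of $\frac12\theta^i_k-W_\omega[\theta^i_k]=F_k$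 on $\partial\omega$; for $k\ge d$, $(\theta^o_k,\theta^i_k)$ is the unique solution of (for $x\in\partial\Omega$, $t\in\partial\omega$) \[ \tfrac12\theta^o_k(x)+W_\Omega[\theta^o_k](x)=\frac{k!}{(k-(d-1))!}\sum_{j=0}^{k-d}\binom{k-(d-1)}{j}(-1)^{j+1}\sum_{|\beta|=j}\frac{j!}{\beta!}(\nabla D^\beta S_d)(x)\cdot\int_{\partial\omega}\theta^i_{k-(d-1)-j}(s)\nu_\omega(s)s^\beta\,d\sigma_s, \] \[ \tfrac12\theta^i_k(t)-W_\omega[\theta^i_k](t)=\sum_{j=0}^{k-(d-1)}\binom kj(-1)^{j+1}\sum_{|\beta|=j}\frac{j!}{\beta!}t^\beta\int_{\partial\Omega}\theta^o_{k-j}\,\nu_\Omega\cdot\nabla D^\beta S_d\,d\sigma+F_k(t). \] **Auxiliary quantities.** For $t\in\mathbb{R}^d\setminus\omega$: $u^a_{\mathrm m,0}=0$, $u^a_{\mathrm m,k}=-\frac1{k!}w^-[\partial\omega,\theta^i_k]$ for $1\le k\le d-1$, and for $k\ge d$ \[ u^a_{\mathrm m,k}(t)=\frac1{k!}\sum_{j=0}^{k-d}\binom kj(-1)^j\sum_{|\beta|=j}\frac{j!}{\beta!}t^\beta\int_{\partial\Omega}\theta^o_{k-j}\,\nu_\Omega\cdot(\nabla D^\beta S_d)\,d\sigma-\frac1{k!}w^-[\partial\omega,\theta^i_k](t). \] For $k\in\mathbb{N}$ (terms containing the sum $\sum_{j=0}^{k-(d-2)}$ are omitted if $k<d-2$):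 \[ v_{\mathrm m,k}(t)=\frac1{(k-(d-2))!}\sum_{j=0}^{k-(d-2)}\binom{k-(d-2)}{j}(-1)^j\sum_{|\beta|=j}\frac{j!}{\beta!}t^\beta\int_{\partial\Omega}\rho^o_{k-(d-2)-j}D^\beta S_d\,d\sigma+\frac1{k!}v^-[\partial\omega,\rho^i_k](t), \] \[ g^a_k=\frac1{k!}\sum_{l=0}^k\sum_{|\beta|=l}\binom kl\frac{l!}{\beta!}\int_{\partial\omega}s^\beta(D^\beta u^a)(0)\rho^i_{k-l}(s)\,d\sigma_s, \] \[ r_k=\frac{1}{(k-(d-2))!\int_{\partial\omega}d\sigma}\sum_{j=0}^{k-(d-2)}\binom{k-(d-2)}{j}(-1)^j\sum_{|\beta|=j}\frac{j!}{\beta!}\int_{\partial\omega}s^\beta\,d\sigma_s\int_{\partial\Omega}\rho^o_{k-(d-2)-j}D^\beta S_d\,d\sigma+\frac{1}{k!\int_{\partial\omega}d\sigma}\int_{\partial\omega}v[\partial\omega,\rho^i_k]\,d\sigma \] (and $r_0\ne0$). For $l=a,b$: $u^l_{\#,k}(t)=\sum_{|\beta|=k}\frac{D^\beta u^l(0)}{\beta!}t^\beta$. On $\partial\omega$: $\tilde u_k=\sum_{l=0}^k(\nu_\omega\cdot\nabla u^a_{\mathrm m,l})\,u^b_{\#,k-l}$, $\tilde v_k=\nu_\omega\cdot\nabla v_{\mathrm m,k}$, $\tilde g_k=\sum_{l=0}^kg^a_l\,u^b_{\#,k-l}$, $\tilde a_n=\sum_{k=0}^n\tilde g_{n-k}\tilde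 v_k$, $\tilde\lambda_0=\tilde a_0/r_0$, and for $n\ge1$ \[ \tilde\lambda_n=\tilde u_n+\frac{\tilde a_n}{r_0}+\sum_{k=1}^n\tilde a_{n-k}\sum_{j=1}^k\frac{(-1)^j}{r_0^{j+1}}\sum_{\substack{\beta\in(\mathbb{N}\setminus\{0\})^j\\|\beta|=k}}\prod_{h=1}^jr_{\beta_h}. \] Further $\xi_n=0$ for $0\le n\le d-1$ and $\xi_n=\sum_{j=1}^d\sum_{l=0}^{n-d}\int_\omega\partial_ju^a_{\#,l+1}(t)\,\partial_ju^b_{\#,n-l-(d-1)}(t)\,dt$ for $n\ge d$. **Coefficients $c_n$ and number $\varepsilon_{\mathrm c}$.** $c_n\equiv0$ for $0\le n\le d-3$ and $c_n\equiv-\int_{\partial\omega}\tilde\lambda_{n-(d-2)}\,d\sigma+\xi_n$ for $n\ge d-2$. The number $\varepsilon_{\mathrm c}>0$ is such that $\varepsilon\overline\omega\subseteq\Omega$ for $|\varepsilon|<\varepsilon_{\mathrm c}$, $\sum_nc_n\varepsilon^n$ converges absolutely for $\varepsilon\in\,]-\varepsilon_{\mathrm c},\varepsilon_{\mathrm c}[$, and $\mathrm{Cap}_\Omega(\varepsilon\overline\omega,u^a,u^b)=\sum_{n=0}^\infty c_n\varepsilon^n$ for all $\varepsilon\in\,]0,\varepsilon_{\mathrm c}[$ (such a number exists). *)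

(* Defs.v *)
From HB Require Import structures.
From mathcomp Require Import all_boot all_order all_algebra.
From mathcomp Require Import all_classical all_reals all_analysis.

Set Implicit Arguments.
Unset Strict Implicit.
Unset Printing Implicit Defensive.

Import Order.TTheory GRing.Theory Num.Theory.
Import numFieldNormedType.Exports.

Local Open Scope classical_set_scope.
Local Open Scope ring_scope.

(* Points of R^d are row vectors.  The library's norm on matrices is the sup
   norm; it is used only through the (standard) topology it induces, and every
   metric notion below is stated with the Euclidean norm [enorm]. *)
Section euclidean.
Context {R : realType} {d : nat}.
Implicit Types x y : 'rV[R]_d.

Definition dot x y : R := \sum_i x 0 i * y 0 i.
Definition enorm x : R := Num.sqrt (dot x x).
Definition eball x (r : R) : set 'rV[R]_d := [set y | enorm (y - x) < r].
Definition ediam (A : set 'rV[R]_d) : \bar R :=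
  ereal_sup [set (enorm (p.1 - p.2))%:E | p in A `*` A].
Definition bdry (O : set 'rV[R]_d) : set 'rV[R]_d := closure O `\` interior O.
End euclidean.

(* [mu_ext] computes infima over countable covers by measurable sets; on this
   copy of T every set is measurable, so covers are by arbitrary sets. *)
Definition discr (T : Type) := T.
HB.instance Definition _ (T : pointedType) := Pointed.on (discr T).
HB.instance Definition _ (T : pointedType) := @isMeasurable.Build default_measure_display
  (discr T) (@discrete_measurable (discr T)) (@discrete_measurable0 _)
  (@discrete_measurableC _) (@discrete_measurableU _).

Section lebesgue.
Context (R : realType) (d : nat).
Local Open Scope ereal_scope.

Definition box_gauge (A : set (discr 'rV[R]_d)) : \bar R :=
  if A == set0 then 0 else
  ereal_inf [set v | exists a b : 'rV[R]_d,
    [/\ forall i, (a 0 i <= b 0 i)%R,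
        A `<=` [set x : 'rV[R]_d | forall i, (a 0 i <= x 0 i <= b 0 i)%R] &
        v = (\prod_i (b 0 i - a 0 i))%R%:E]].

Definition leb_outer : set 'rV[R]_d -> \bar R := mu_ext box_gauge.

Let box_gauge0 : box_gauge set0 = 0. Proof. by rewrite /box_gauge eqxx. Qed.
Let box_gauge_ge0 A : 0 <= box_gauge A.
Proof.
rewrite /box_gauge; case: ifP => // _; apply: le_ereal_inf_tmp.
move=> _ [a [b [ab _ ->]]]; rewrite lee_fin prodr_ge0 // => i _.
by rewrite subr_ge0.
Qed.

HB.instance Definition _ := isOuterMeasure.Build R 'rV[R]_d leb_outer
  (mu_ext0 box_gauge0 box_gauge_ge0) (mu_ext_ge0 box_gauge_ge0)
  (le_mu_ext box_gauge) (mu_ext_sigma_subadditive box_gauge_ge0).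

Definition leb_om : {outer_measure set 'rV[R]_d -> \bar R} := leb_outer.

(* Lebesgue measure on R^d, on the Caratheodory sigma-algebra. *)
Definition leb : {measure set (caratheodory_type leb_om) -> \bar R} :=
  [the measure _ _ of leb_om : set (caratheodory_type leb_om) -> \bar R].
End lebesgue.

Section hausdorff.
Context (R : realType) (d : nat).
Local Open Scope ereal_scope.

Definition hausdorff_gauge (s : nat) (delta : R) (A : set (discr 'rV[R]_d)) :
    \bar R :=
  if A == set0 then 0 else
  if ediam A <= delta%:E then (fine (ediam A) ^+ s)%:E else +oo.

Definition hausdorff (s : nat) (A : set 'rV[R]_d) : \bar R :=
  ereal_sup [set mu_ext (hausdorff_gauge s delta) A | delta in [set r | (0 < r)%R]].

Definition unit_face : set 'rV[R]_d :=
  [set x : 'rV[R]_d | forall i : 'I_d,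
     if i == 0%N :> nat then (x 0 i = 0)%R else (0 <= x 0 i <= 1)%R].

(* (d-1)-dimensional Hausdorff measure on R^d, normalized to agree with
   Lebesgue measure on hyperplanes. *)
Definition surf_outer (A : set 'rV[R]_d) : \bar R :=
  ((fine (hausdorff d.-1 unit_face))^-1)%:E * hausdorff d.-1 A.

Let hausdorff_gauge0 s e : hausdorff_gauge s e set0 = 0.
Proof. by rewrite /hausdorff_gauge eqxx. Qed.

Let ediam_ge0 (A : set 'rV[R]_d) : A != set0 -> 0 <= ediam A.
Proof.
move=> /set0P[x Ax]; apply: (@le_trans _ _ (enorm (x - x))%:E).
  by rewrite lee_fin sqrtr_ge0.
by apply: ereal_sup_ubound; exists (x, x).
Qed.

Let hausdorff_gauge_ge0 s e A : 0 <= hausdorff_gauge s e A.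
Proof.
rewrite /hausdorff_gauge; case: ifPn => // A0; case: ifP => // _.
by rewrite lee_fin exprn_ge0// fine_ge0// ediam_ge0.
Qed.

Let hausdorff_ge0 s A : 0 <= hausdorff s A.
Proof.
apply: (@le_trans _ _ (mu_ext (hausdorff_gauge s 1) A)).
  exact: mu_ext_ge0 (hausdorff_gauge_ge0 s 1) A.
by apply: ereal_sup_ubound; exists 1%R => //=.
Qed.

Let c_ge0 : 0 <= ((fine (hausdorff d.-1 unit_face))^-1)%:E.
Proof. by rewrite lee_fin invr_ge0 fine_ge0. Qed.

Let surf_outer0 : surf_outer set0 = 0.
Proof.
rewrite /surf_outer [X in _ * X](_ : _ = 0) ?mule0//.
apply/eqP; rewrite eq_le hausdorff_ge0 andbT; apply: ge_ereal_sup.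
by move=> _ [e _ <-]; rewrite (mu_ext0 (hausdorff_gauge0 _ _)).
Qed.

Let surf_outer_ge0 A : 0 <= surf_outer A.
Proof. exact: mule_ge0. Qed.

Let le_surf_outer : {homo surf_outer : A B / A `<=` B >-> A <= B}.
Proof.
move=> A B AB; apply: lee_wpmul2l => //; apply: ge_ereal_sup => _ [e e0 <-].
apply: (@le_trans _ _ (mu_ext (hausdorff_gauge d.-1 e) B)).
  exact: le_mu_ext.
by apply: ereal_sup_ubound; exists e.
Qed.

Let surf_outer_sigma : sigma_subadditive surf_outer.
Proof.
move=> F; rewrite /surf_outer nneseriesZl//; apply: lee_wpmul2l => //.
apply: ge_ereal_sup => _ [e e0 <-].
apply: (le_trans (mu_ext_sigma_subadditive (hausdorff_gauge_ge0 _ e) F)).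
apply: lee_nneseries => [i _ _|i _]; first exact: mu_ext_ge0.
by apply: ereal_sup_ubound; exists e.
Qed.

HB.instance Definition _ := isOuterMeasure.Build R 'rV[R]_d surf_outer
  surf_outer0 surf_outer_ge0 le_surf_outer surf_outer_sigma.

Definition surf_om : {outer_measure set 'rV[R]_d -> \bar R} := surf_outer.

Definition surf : {measure set (caratheodory_type surf_om) -> \bar R} :=
  [the measure _ _ of surf_om : set (caratheodory_type surf_om) -> \bar R].
End hausdorff.

Definition volint {R : realType} {d : nat} (D : set 'rV[R]_d) (f : 'rV[R]_d -> R) : R :=
  Rintegral (leb R d) D f.

Definition surfint {R : realType} {d : nat} (D : set 'rV[R]_d) (f : 'rV[R]_d -> R) : R :=
  Rintegral (surf R d) D f.

Section calculus.
Context {R : realType} {d : nat}.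
Local Notation E := 'rV[R]_d.
Implicit Types (f u : E -> R) (x y t : E).

Definition partial (i : 'I_d) f x : R := 'D_(delta_mx 0 i : E) f x.
Definition grad f x : E := \row_i partial i f x.

Definition smooth f := forall s : seq 'I_d,
  let g := foldr partial f s in
  continuous g /\ forall x i, derivable g x (delta_mx 0 i : E).

Definition mindex := {ffun 'I_d -> nat}.
Definition mdeg (b : mindex) : nat := (\sum_i b i)%N.
Definition mfact (b : mindex) : nat := (\prod_i (b i)`!)%N.
Definition mpow t (b : mindex) : R := \prod_i t 0 i ^+ b i.
(* The list of all multi-indices b with |b| = k. *)
Definition midx (k : nat) : seq mindex :=
  [seq [ffun i => val (b i)]
     | b : {ffun 'I_d -> 'I_k.+1} <- enum predT & (\sum_i b i == k)%N].
(* k! / b! *)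
Definition mcoef (k : nat) (b : mindex) : R := k`!%:R / (mfact b)%:R.
Definition mderiv (b : mindex) f : E -> R :=
  foldr (fun i g => iter (b i) (partial i) g) f (enum 'I_d).

Definition analytic_at f x := exists (a : mindex -> R) (r : R), 0 < r /\
  forall h : E, enorm h < r ->
    cvgn (series (fun k => \sum_(b <- midx k) `|a b * mpow h b|)) /\
    series (fun k => \sum_(b <- midx k) a b * mpow h b) @ \oo --> f (x + h).

Definition vanishing_order u (k : nat) :=
  (forall b : mindex, (mdeg b < k)%N -> mderiv b u 0 = 0) /\
  (exists b : mindex, mdeg b = k /\ mderiv b u 0 != 0).

(* u_{#,k}, the homogeneous part of degree k of the Taylor series of u at 0. *)
Definition usharp u (k : nat) t : R :=
  \sum_(b <- midx k) mderiv b u 0 / (mfact b)%:R * mpow t b.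

Definition holder_on (al : R) (A : set E) f := exists C : R,
  forall x y, A x -> A y -> `|f x - f y| <= C * enorm (x - y) `^ al.

Definition C1alpha_on (al : R) (A : set E) f := forall i,
  (forall x, A x -> derivable f x (delta_mx 0 i : E)) /\
  holder_on al A (partial i f).

Definition harmonic_on (A : set E) f := forall x, A x ->
  (forall i, derivable f x (delta_mx 0 i : E)) /\
  (forall i j, derivable (partial i f) x (delta_mx 0 j : E) /\
               {for x, continuous (partial j (partial i f))}) /\
  \sum_i partial i (partial i f) x = 0.
End calculus.

Arguments mindex : clear implicits.

Section domains.
Context {R : realType} {d : nat}.
Local Notation E := 'rV[R]_d.
Implicit Types (f : E -> R) (x p : E) (O : set E).

(* Near p, O is one side of the graph of a C^{1,al} function g of the
   coordinates other than the i-th; s selects the side. *)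
Definition local_graph (al : R) O p (i : 'I_d) (s : bool) (r : R)
    (g : 'rV[R]_d.-1 -> R) :=
  [/\ 0 < r, C1alpha_on al (eball (col' i p) r) g &
      forall x, eball p r x -> (O x <-> (-1) ^+ s * x 0 i < g (col' i x))].

Definition graph_point (i : 'I_d) (s : bool) (g : 'rV[R]_d.-1 -> R)
    (y : 'rV[R]_d.-1) : E :=
  \row_j (if unlift i j is Some k then y 0 k else (-1) ^+ s * g y).

Definition schauder (al : R) O := forall p, bdry O p ->
  exists i s r g, local_graph al O p i s r g.

Definition admissible_domain (al : R) O :=
  [/\ open O, bounded_set O & connected O] /\
  [/\ schauder al O, O 0 & connected (~` closure O)].

Definition C0a_bdry (al : R) O f := holder_on al (bdry O) f.

(* C^{1,al}(dO): f composed with local parametrizations of dO is C^{1,al}. *)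
Definition C1a_bdry (al : R) O f := forall p, bdry O p ->
  exists i s r g, local_graph al O p i s r g /\
  exists2 r', 0 < r' &
    C1alpha_on al (eball (col' i p) r') (f \o graph_point i s g).

(* C^{1,al}_loc(R^d \ O): Hoelder continuity up to dO of the first derivatives
   makes them extend continuously to dO. *)
Definition C1a_loc_ext (al : R) O f :=
  {within ~` O, continuous f} /\
  forall r : R, C1alpha_on al (eball 0 r `\` closure O) f.

(* For C^1 domains this determines n: directions making an obtuse angle with n
   enter O, those making an acute angle leave its closure. *)
Definition is_outward_normal O x (n : E) := enorm n = 1 /\ forall v : E,
  (dot v n < 0 -> \forall h \near 0^'+, O (x + h *: v)) /\
  (0 < dot v n -> \forall h \near 0^'+, ~ closure O (x + h *: v)).
Definition nu O x : E := xget 0 [set n | is_outward_normal O x n].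

(* Limit at x from the exterior of O, i.e. the value at x of the continuous
   extension to R^d \ O of the restriction of f to the exterior. *)
Definition ext_lim O f x : R := lim (f @ within (~` closure O) (nbhs x)).
Definition ext_dnu O f x : R := \sum_i nu O x 0 i * ext_lim O (partial i f) x.
End domains.

Section sobolev.
Context {R : realType} {d : nat}.
Local Notation E := 'rV[R]_d.
Implicit Types (u V w f : E -> R) (Om U K : set E).

Definition test_fun U f := smooth f /\
  exists K, [/\ compact K, K `<=` U & forall x, ~ K x -> f x = 0].

Definition L2 Om f :=
  measurable_fun (Om : set (caratheodory_type (leb_om R d))) f /\
  (\int[leb R d]_(x in Om) (f x ^+ 2)%:E < +oo)%E.

Definition is_weak_grad Om u (G : 'I_d -> E -> R) := forall i, L2 Om (G i) /\
  forall phi, test_fun Om phi ->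
    volint Om (fun x => u x * partial i phi x)
    = - volint Om (fun x => G i x * phi x).
Definition wgrad Om u : 'I_d -> E -> R :=
  xget (fun _ _ => 0) [set G | is_weak_grad Om u G].

Definition H1 Om u := L2 Om u /\ exists G, is_weak_grad Om u G.

(* H^1_0(U) for U open in Om, its elements being extended by zero to Om:
   closure of C_c^oo(U) in H^1(Om). *)
Definition H10 Om U w := H1 Om w /\ exists phi : nat -> E -> R,
  (forall n, test_fun U (phi n)) /\
  (fun n => (\int[leb R d]_(x in Om) ((phi n x - w x) ^+ 2
     + \sum_i (partial i (phi n) x - wgrad Om w i x) ^+ 2)%:E)%E) @ \oo --> 0%E.

Definition dirichlet Om u w : R :=
  volint Om (fun x => \sum_i wgrad Om u i x * wgrad Om w i x).

Definition is_potential Om K u V :=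
  [/\ H10 Om Om V,
      forall eta, test_fun Om eta ->
        (exists N, [/\ open N, K `<=` N & forall x, N x -> eta x = 1]) ->
        H10 Om (Om `\` K) (fun x => V x - eta x * u x) &
      forall phi, H10 Om (Om `\` K) phi -> dirichlet Om V phi = 0].
Definition potential Om K u : E -> R :=
  xget (fun=> 0) [set V | is_potential Om K u V].

Definition Cap Om K ua ub : R :=
  dirichlet Om (potential Om K ua) (potential Om K ub).

Definition admissible_fun Om u :=
  H1 Om u /\ \forall x \near (0 : E), analytic_at u x.
End sobolev.

Section layer_potentials.
Context {R : realType} {d : nat}.
Local Notation E := 'rV[R]_d.
Implicit Types (phi psi : E -> R) (O : set E) (x y : E).

Definition sphere_area : R := fine (surf R d [set x : E | enorm x = 1]).
Definition Sd x : R :=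
  ((2 - d%:R) * sphere_area * enorm x ^+ (d - 2))^-1.

Definition vpot O phi x : R := surfint (bdry O) (fun y => phi y * Sd (x - y)).

(* At points of dO this is also the operator W_O. *)
Definition wpot O psi x : R :=
  - surfint (bdry O) (fun y => psi y * dot (nu O y) (grad Sd (x - y))).
Definition wpotm O psi x : R := ext_lim O (wpot O psi) x.

Definition Wstar O phi x : R :=
  surfint (bdry O) (fun y => phi y * dot (nu O x) (grad Sd (x - y))).
End layer_potentials.

Section expansion.
Context {R : realType} {d : nat}.
Local Notation E := 'rV[R]_d.
Variables (Om om : set E).

Local Notation dOm := (bdry Om).
Local Notation dom := (bdry om).
Local Notation DS b := (mderiv b (@Sd R d)).

Definition vsurfint (B : set E) (F : E -> E) : E :=
  \row_i surfint B (fun y => F y 0 i).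

(* k! / (k - m)! *)
Definition fallq (k m : nat) : R := k`!%:R / (k - m)`!%:R.

Definition rho_system (al : R) (rho_o rho_i : nat -> E -> R) : Prop :=
  [/\ forall k, C0a_bdry al Om (rho_o k) /\ C0a_bdry al om (rho_i k),
   [/\ forall x, dOm x -> 2^-1 * rho_o 0%N x + Wstar Om (rho_o 0%N) x
         = - dot (nu Om x) (grad Sd x),
       forall t, dom t -> 2^-1 * rho_i 0%N t - Wstar om (rho_i 0%N) t = 0 &
       surfint dom (rho_i 0%N) = 1],
   forall k, (1 <= k <= d - 2)%N ->
     (forall t, dom t -> rho_i k t = 0) /\
     (forall x, dOm x -> 2^-1 * rho_o k x + Wstar Om (rho_o k) x
       = (-1) ^+ k.+1 * \sum_(b <- midx k) mcoef k b
           * dot (nu Om x) (grad (DS b) x)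
           * surfint dom (fun s => rho_i 0%N s * mpow s b)) &
   forall k, (d - 1 <= k)%N ->
     [/\ forall x, dOm x -> 2^-1 * rho_o k x + Wstar Om (rho_o k) x
           = \sum_(0 <= j < k.+1) 'C(k, j)%:R * (-1) ^+ j.+1
               * \sum_(b <- midx j) mcoef j b
                   * dot (nu Om x) (grad (DS b) x)
                   * surfint dom (fun s => rho_i (k - j)%N s * mpow s b),
         forall t, dom t -> 2^-1 * rho_i k t - Wstar om (rho_i k) t
           = fallq k (d - 1)
             * \sum_(0 <= j < (k - (d - 1)).+1) 'C(k - (d - 1), j)%:R
               * \sum_(b <- midx j) mcoef j b * (-1) ^+ j.+1 * mpow t b
                   * dot (nu om t) (vsurfint dOm (fun y =>
                       rho_o (k - (d - 1) - j)%N y *: grad (DS b) y)) &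
         surfint dom (rho_i k) = 0]].

Variables (ua ub : E -> R) (rho_o rho_i : nat -> E -> R).

Definition Fk (k : nat) (t : E) : R :=
  \sum_(b <- midx k) mcoef k b * mpow t b * mderiv b ua 0
  - \sum_(0 <= l < k.+1) \sum_(b <- midx l) 'C(k, l)%:R * mcoef l b
      * surfint dom (fun s => mpow s b * mderiv b ua 0 * rho_i (k - l)%N s).

Definition theta_system (al : R) (th_o th_i : nat -> E -> R) : Prop :=
  [/\ forall k, [/\ C1a_bdry al Om (th_o k), C1a_bdry al om (th_i k) &
                    surfint dom (th_i k) = 0],
   forall t, dom t -> th_i 0%N t = 0,
   forall k, (k <= d - 1)%N ->
     (forall x, dOm x -> th_o k x = 0) /\
     (forall t, dom t -> 2^-1 * th_i k t - wpot om (th_i k) t = Fk k t) &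
   forall k, (d <= k)%N ->
     (forall x, dOm x -> 2^-1 * th_o k x + wpot Om (th_o k) x
       = fallq k (d - 1)
         * \sum_(0 <= j < (k - d).+1) 'C(k - (d - 1), j)%:R * (-1) ^+ j.+1
           * \sum_(b <- midx j) mcoef j b
             * dot (grad (DS b) x) (vsurfint dom (fun s =>
                 (th_i (k - (d - 1) - j)%N s * mpow s b) *: nu om s))) /\
     (forall t, dom t -> 2^-1 * th_i k t - wpot om (th_i k) t
       = \sum_(0 <= j < (k - (d - 1)).+1) 'C(k, j)%:R * (-1) ^+ j.+1
           * \sum_(b <- midx j) mcoef j b * mpow t b
             * surfint dOm (fun y =>
                 th_o (k - j)%N y * dot (nu Om y) (grad (DS b) y))
         + Fk k t)].

Variables (th_o th_i : nat -> E -> R).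

(* [um] and [vm] are defined everywhere but meaningful off om; their normal
   derivatives on dom are exterior ones, see [ext_dnu].  Subtraction on nat is
   truncated, hence the tests before the sums running up to k - (d - 2). *)

Definition um (k : nat) (t : E) : R :=
  if k == 0%N then 0
  else if (k < d)%N then - (k`!%:R)^-1 * wpotm om (th_i k) t
  else (k`!%:R)^-1
       * \sum_(0 <= j < (k - d).+1) 'C(k, j)%:R * (-1) ^+ j
         * \sum_(b <- midx j) mcoef j b * mpow t b
           * surfint dOm (fun y =>
               th_o (k - j)%N y * dot (nu Om y) (grad (DS b) y))
       - (k`!%:R)^-1 * wpotm om (th_i k) t.

Definition vm (k : nat) (t : E) : R :=
  (if (d - 2 <= k)%N then
     ((k - (d - 2))`!%:R)^-1
     * \sum_(0 <= j < (k - (d - 2)).+1) 'C(k - (d - 2), j)%:R * (-1) ^+ j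
       * \sum_(b <- midx j) mcoef j b * mpow t b
         * surfint dOm (fun y => rho_o (k - (d - 2) - j)%N y * DS b y)
   else 0)
  + (k`!%:R)^-1 * vpot om (rho_i k) t.

Definition gk (k : nat) : R :=
  (k`!%:R)^-1
  * \sum_(0 <= l < k.+1) \sum_(b <- midx l) 'C(k, l)%:R * mcoef l b
      * surfint dom (fun s => mpow s b * mderiv b ua 0 * rho_i (k - l)%N s).

Definition rk (k : nat) : R :=
  let area := surfint dom (fun=> 1) in
  (if (d - 2 <= k)%N then
     ((k - (d - 2))`!%:R * area)^-1
     * \sum_(0 <= j < (k - (d - 2)).+1) 'C(k - (d - 2), j)%:R * (-1) ^+ j
       * \sum_(b <- midx j) mcoef j b * surfint dom (fun s => mpow s b)
         * surfint dOm (fun y => rho_o (k - (d - 2) - j)%N y * DS b y)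
   else 0)
  + (k`!%:R * area)^-1 * surfint dom (vpot om (rho_i k)).

Definition u_til (k : nat) (t : E) : R :=
  \sum_(0 <= l < k.+1) ext_dnu om (um l) t * usharp ub (k - l) t.
Definition v_til (k : nat) (t : E) : R := ext_dnu om (vm k) t.
Definition g_til (k : nat) (t : E) : R :=
  \sum_(0 <= l < k.+1) gk l * usharp ub (k - l) t.
Definition a_til (n : nat) (t : E) : R :=
  \sum_(0 <= k < n.+1) g_til (n - k) t * v_til k t.

Definition lambda_til (n : nat) (t : E) : R :=
  let r0 := rk 0 in
  if n == 0%N then a_til 0 t / r0
  else u_til n t + a_til n t / r0
    + \sum_(1 <= k < n.+1) a_til (n - k) t
      * \sum_(1 <= j < k.+1) (-1) ^+ j / r0 ^+ j.+1
        * \sum_(b : {ffun 'I_j -> 'I_k.+1}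
                | [forall h, 0 < b h]%N && (\sum_h b h == k)%N)
            \prod_h rk (b h).

Definition xi (n : nat) : R :=
  if (n < d)%N then 0
  else \sum_(j < d) \sum_(0 <= l < (n - d).+1)
    volint om (fun t => partial j (usharp ua l.+1) t
                        * partial j (usharp ub (n - l - (d - 1))) t).

Definition cn (n : nat) : R :=
  if (n < d - 2)%N then 0
  else - surfint dom (lambda_til (n - (d - 2))) + xi n.
End expansion.

(* The decaying solution of the exterior Dirichlet problem with datum h. *)
Definition ext_dirichlet_sol {R : realType} {d : nat} (al : R)
    (om : set 'rV[R]_d) (h f : 'rV[R]_d -> R) : Prop :=
  [/\ C1a_loc_ext al om f,
      harmonic_on (~` closure om) f,
      forall t, bdry om t -> f t = h t &
      forall e : R, 0 < e -> exists M : R, forall t, M < enorm t -> `|f t| < e].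

(* Main.v *)
(* By hypothesis Cap(e) = sum_n c_n e^n on ]0, eps_c[, and this determines the
   c_n.  Hence it is enough to show that Cap(e) / e^N tends to the bracket, with
   N = ka + kb + d - 2: then c_n = 0 for n < N and c_N is the bracket.  No layer
   potential is needed.

   The limit is obtained variationally.  The potential of u on e om is the
   orthogonal projection of any trial function W equal to u near e om, so that
   Cap(e) = <grad Wa, grad Wb> up to the dual norms of grad Wa and grad Wb on
   H^1_0(Om \ e om).  With zeta a cutoff equal to 1 near closure om, take
     W(x) = zeta(x / e) u(x) + e^k tau_n(f - zeta u_#)(x / e),
   where f is the exterior solution and tau_n a truncation which vanishes on
   [-1/n, 1/n].  As f - zeta u_# is zero on the boundary of om and at infinity,
   the second term is C^1 with compact support outside closure om; harmonicity
   of f gives its energy bound and, by dominated convergence, after rescaling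
   grad W tends in L^2 to the gradient of f outside om and of u_# inside. *)

(* The obstacle is the boundary of [om]: the difference between f and the cut-off datum, extended by
   0, is continuous, but its gradient in general jumps there. A truncation is C^1 with compact
   support in the exterior, so that integration by parts reduces to translation invariance of the
   measure, with no trace and no divergence theorem. The price is a degenerate set: the derivative
   of the truncation tends to 1 only where the difference is not 0, so its gradient has to vanish
   almost everywhere on the zero set; this holds because the part of a C^1 level set where a partial
   derivative is nonzero is null. The same truncations give finite energy, by Fatou, from
   qualitative decay at infinity.

   Two facts close the estimate. The limit field Y is orthogonal to gradients of functions supported
   in the exterior, so the residual of a trial function is controlled by its L^2 distance to Y,
   which tends to 0 at fixed scaling; and the capacity error is bounded by the product of the
   residuals of both factors. Mollification serves the condition near K: it has to hold for every
   cutoff eta, and away from the origin u is merely an H^1 function. *)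
From HB Require Import structures.
From mathcomp Require Import all_boot all_order all_algebra.
From mathcomp Require Import all_classical all_reals all_analysis.
From mathcomp Require Import measurable_realfun ring lra.
Require Import Defs.

Set Implicit Arguments.
Unset Strict Implicit.
Unset Printing Implicit Defensive.

Import Order.TTheory GRing.Theory Num.Theory.
Import numFieldNormedType.Exports.

Local Open Scope classical_set_scope.
Local Open Scope ring_scope.

(** * Lebesgue measure on R^d *)

Section lebesgue_measure_Rd.
Context {R : realType} {d : nat}.
Local Notation E := 'rV[R]_d.
Local Notation T := (caratheodory_type (leb_om R d)).

Local Open Scope ereal_scope.

Lemma box_gauge_le_box (A : set (discr E)) (a b : E) :
  (forall i, (a 0%R i <= b 0%R i)%R) ->
  A `<=` [set x : E | forall i, (a 0%R i <= x 0%R i <= b 0%R i)%R] ->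
  box_gauge A <= (\prod_i (b 0%R i - a 0%R i))%R%:E.
Proof.
move=> ab AB; rewrite /box_gauge; case: ifP => _.
  by rewrite lee_fin prodr_ge0 // => i _; rewrite subr_ge0.
by apply: ereal_inf_lbound; exists a, b.
Qed.

Lemma box_gauge_ge0 (A : set (discr E)) : 0 <= box_gauge A.
Proof.
rewrite /box_gauge; case: ifP => // _; apply: le_ereal_inf_tmp.
by move=> _ [a [b [ab _ ->]]]; rewrite lee_fin prodr_ge0 // => i _; rewrite subr_ge0.
Qed.

Lemma box_gauge0 : box_gauge (set0 : set (discr E)) = 0.
Proof. by rewrite /box_gauge eqxx. Qed.

(** The preimage of a box of sides b_i - a_i under x -> c x + h is a box of sides (b_i - a_i) / c,
    whence the factor c^-d. An inequality suffices here; equality for the measure comes by inverting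
    the map. *)
Lemma box_gauge_affine_le (c : R) (h : E) (A : set (discr E)) : (0 < c)%R ->
  box_gauge ((fun x : E => c *: x + h)%R @^-1` A : set (discr E))
    <= (c ^- d)%:E * box_gauge A.
Proof.
move=> c0; rewrite {2}/box_gauge; case: ifPn => [/eqP ->|A0].
  by rewrite preimage_set0 box_gauge0 mule0.
rewrite lee_pdivlMl ?exprn_gt0//.
apply: le_ereal_inf_tmp => _ [a [b [ab AB ->]]].
rewrite -lee_pdivlMl ?exprn_gt0//.
rewrite (le_trans (@box_gauge_le_box _ (c^-1 *: (a - h))%R (c^-1 *: (b - h))%R _ _))//.
- by move=> i; rewrite !mxE ler_pM2l ?invr_gt0// lerD2r.
- move=> x /AB /= xab i; have := xab i; rewrite !mxE.
  rewrite ler_pdivrMl// ler_pdivlMl//; lra.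
- rewrite -EFinM lee_fin [leRHS]mulrC.
  have -> : (c ^- d = \prod_(i < d) c^-1)%R by rewrite prodr_const card_ord exprVn.
  rewrite -big_split/= le_eqVlt; apply/orP; left; apply/eqP/eq_bigr => i _.
  by rewrite !mxE -mulrBr opprB addrA subrK mulrC.
Qed.

Lemma leb_outer_affine_le (c : R) (h : E) (A : set E) : (0 < c)%R ->
  leb_outer ((fun x : E => c *: x + h)%R @^-1` A) <= (c ^- d)%:E * leb_outer A.
Proof.
move=> c0; rewrite lee_pdivlMl ?exprn_gt0//.
apply: le_ereal_inf_tmp => _ [F [mF AF] <-].
rewrite -lee_pdivlMl ?exprn_gt0//.
rewrite -nneseriesZl//; last by move=> *; exact: box_gauge_ge0.
apply: (@le_trans _ _ (\sum_(k <oo) box_gauge ((fun x : E => c *: x + h)%R @^-1` F k))).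
  apply: ereal_inf_lbound; exists (fun k => (fun x : E => c *: x + h)%R @^-1` F k) => //.
  by split=> // x /= /AF [k _ Fk]; exists k.
by apply: lee_nneseries => [*|*]; [exact: box_gauge_ge0|exact: box_gauge_affine_le].
Qed.

(** The reverse inequality is the previous one for the inverse map x -> c^-1 x - c^-1 h, applied to
    the preimage of A. *)
Lemma leb_outer_affine (c : R) (h : E) (A : set E) : (0 < c)%R ->
  leb_outer ((fun x : E => c *: x + h)%R @^-1` A) = (c ^- d)%:E * leb_outer A.
Proof.
move=> c0; apply/eqP; rewrite eq_le leb_outer_affine_le//=.
have c0' : (0 < c^-1)%R by rewrite invr_gt0.
rewrite lee_pdivrMl ?exprn_gt0//.
have := @leb_outer_affine_le c^-1 (- (c^-1 *: h))%R ((fun x : E => c *: x + h)%R @^-1` A) c0'.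
rewrite exprVn invrK; congr (_ <= _); congr leb_outer.
apply/seteqP; split => x /=;
  by rewrite scalerDr scalerA divff ?gt_eqF// scale1r scalerN scalerA divff ?gt_eqF// scale1r subrK.
Qed.

(** A coordinate hyperplane cuts a box into two boxes whose volumes add up. Summed over a cover,
    this is the Caratheodory criterion for half-spaces, from which measurability of the coordinates
    and of open sets follows. *)
Lemma box_gauge_halfspace (i : 'I_d) (c : R) (F : set (discr E)) :
  box_gauge (F `&` [set x : E | (x 0%R i <= c)%R] : set (discr E)) +
  box_gauge (F `&` ~` [set x : E | (x 0%R i <= c)%R] : set (discr E)) <= box_gauge F.
Proof.
rewrite {3}/box_gauge; case: ifPn => [/eqP ->|F0].
  by rewrite !set0I !box_gauge0 adde0.
apply: le_ereal_inf_tmp => _ [a [b [ab AB ->]]].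
have le_box : box_gauge F <= (\prod_i (b 0%R i - a 0%R i))%R%:E.
  exact: box_gauge_le_box.
have [ca|ac] := ltP c (a 0%R i).
  rewrite (_ : F `&` _ = set0) ?box_gauge0 ?add0e.
    rewrite (_ : F `&` _ = F)//; apply/setIidPl => x /AB/= /(_ i) /andP[ax _] /=.
    by apply/negP; rewrite -ltNge; exact: lt_le_trans ax.
  apply/seteqP; split => x //= [/AB/= /(_ i) /andP[ax _]].
  by move=> /(le_trans ax); rewrite leNgt ca.
have [bc|cb] := leP (b 0%R i) c.
  rewrite addeC (_ : F `&` ~` _ = set0) ?box_gauge0 ?add0e.
    rewrite (_ : F `&` _ = F)//; apply/setIidPl => x /AB/= /(_ i) /andP[_ xb] /=.
    exact: le_trans bc.
  apply/seteqP; split => x //= [/AB/= /(_ i) /andP[_ xb]].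
  by apply; exact: le_trans bc.
(* [upd] moves the i-th coordinate of a corner to the cutting hyperplane: the two halves are the
   boxes [a, upd b] and [upd a, b]. *)
pose upd (v : E) : E := (\row_j (if j == i then c else v 0 j))%R.
apply: (@le_trans _ _ ((\prod_j (upd b 0 j - a 0 j))%R%:E + (\prod_j (b 0 j - upd a 0 j))%R%:E)).
  apply: leeD; apply: box_gauge_le_box.
  - by move=> j; rewrite mxE; case: eqP => // ->.
  - move=> x /= [/AB/= xab xc] j; rewrite mxE; have := xab j.
    by case: eqP => // -> /andP[-> _].
  - by move=> j; rewrite mxE; case: eqP => // ->; exact: ltW.
  - move=> x /= [/AB/= xab /negP]; rewrite -ltNge => xc j; rewrite mxE; have := xab j.
    by case: eqP => // -> /andP[_ ->]; rewrite ltW.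
rewrite -EFinD lee_fin.
rewrite (bigD1 i)//= [X in (_ + X <= _)%R](bigD1 i)//= [leRHS](bigD1 i)//= !mxE eqxx.
rewrite le_eqVlt; apply/orP; left; apply/eqP.
have H1 : (\prod_(j < d | j != i) (upd b 0 j - a 0 j) = \prod_(j < d | j != i) (b 0 j - a 0 j))%R.
  by apply: eq_bigr => j ji; rewrite mxE (negbTE ji).
have H2 : (\prod_(j < d | j != i) (b 0 j - upd a 0 j) = \prod_(j < d | j != i) (b 0 j - a 0 j))%R.
  by apply: eq_bigr => j ji; rewrite mxE (negbTE ji).
by rewrite H1 H2 -mulrDl; congr (_ * _)%R; lra.
Qed.

Lemma measurable_halfspace (i : 'I_d) (c : R) :
  measurable ([set x : E | (x 0 i <= c)%R] : set T).
Proof.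
apply: le_caratheodory_measurable => X.
apply: le_ereal_inf_tmp => _ [F [mF XF] <-].
set H := [set x | _].
apply: (@le_trans _ _ (\sum_(k <oo) box_gauge (F k `&` H : set (discr E)) +
    \sum_(k <oo) box_gauge (F k `&` ~` H : set (discr E)))).
  apply: leeD; apply: ereal_inf_lbound.
    exists (fun k => F k `&` H) => //; split => // x [/XF[k _ Fk] Hx].
    by exists k.
  exists (fun k => F k `&` ~` H) => //; split => // x [/XF[k _ Fk] Hx].
  by exists k.
rewrite -nneseriesD; last 2 first.
- by move=> *; exact: box_gauge_ge0.
- by move=> *; exact: box_gauge_ge0.
apply: lee_nneseries => [k _ _|k _]; last exact: box_gauge_halfspace.
by apply: adde_ge0; exact: box_gauge_ge0.
Qed.

Lemma measurable_coord (i : 'I_d) :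
  measurable_fun (setT : set T) (fun x : E => x 0%R i : R).
Proof.
apply: (measurability _ (RGenOInfty.measurableE R)) => _ [_ [r ->] <-].
rewrite setTI (_ : _ @^-1` _ = ~` [set x : E | (x 0 i <= r)%R]).
  by apply: measurableC; exact: measurable_halfspace.
by apply/seteqP; split => x /=; rewrite in_itv/= andbT ltNge => /negP.
Qed.

End lebesgue_measure_Rd.

Section sup_norm.
Context {R : realType} {d : nat}.
Local Notation E := 'rV[R]_d.

Lemma ler_coord_norm (x : E) i : `|x 0 i| <= `|x|.
Proof.
by rewrite [leRHS]mx_normrE; exact: (le_bigmax _ (fun ij : 'I_1 * 'I_d => `|x ij.1 ij.2|) (0, i)).
Qed.

Lemma ler_norm_coord (x : E) (e : R) : 0 <= e -> (forall i, `|x 0 i| <= e) -> `|x| <= e.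
Proof.
move=> e0 xe; rewrite [leLHS]mx_normrE; apply/bigmax_leP; split => // -[j i] _ /=.
by rewrite ord1.
Qed.

Lemma ltr_norm_coord (x : E) (e : R) : 0 < e -> (forall i, `|x 0 i| < e) -> `|x| < e.
Proof.
move=> e0 xe; rewrite [ltLHS]mx_normrE; apply/bigmax_ltP; split => // -[j i] _ /=.
by rewrite ord1.
Qed.

Lemma open_ballP (U : set E) (x : E) : open U -> U x ->
  exists2 r : R, 0 < r & forall y, `|y - x| < r -> U y.
Proof.
move=> oU Ux; have /nbhs_ballP[r r0 rU] : nbhs x U by exact: open_nbhs_nbhs.
by exists r => // y yx; apply: rU; rewrite -ball_normE /ball_/= distrC.
Qed.

Lemma dense_rat_row (x : E) (e : R) : 0 < e ->
  exists q : 'rV[rat]_d, `|map_mx ratr q - x| < e.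
Proof.
move=> e0.
have H i : exists q : rat, `|ratr q - x 0 i| < e.
  have : (x 0 i - e < x 0 i + e)%R by rewrite ltrD2l gt0_cp.
  move=> /rat_in_itvoo [q]; rewrite in_itv/= => /andP[q1 q2].
  by exists q; rewrite ltr_distl q1.
have [q Hq] := choice H.
exists (\row_i q i); apply: ltr_norm_coord => // i.
by rewrite !mxE; exact: Hq.
Qed.

End sup_norm.

Section lebesgue_topology.
Context {R : realType} {d : nat}.
Local Notation E := 'rV[R]_d.
Local Notation T := (caratheodory_type (leb_om R d)).

Lemma measurable_norm_ball (x : E) (r : R) :
  measurable ([set y : E | `|y - x| < r] : set T).
Proof.
have [r0|r0] := leP r 0.
  rewrite (_ : [set _ | _] = set0)//; apply/seteqP; split => y //=.
  by rewrite ltNge (le_trans r0).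
rewrite (_ : [set _ | _] =
    ~` \bigcup_(i in [set: 'I_d]) ((fun y : E => y 0 i) @^-1` ~` ball (x 0 i) r)).
  apply: measurableC; apply: fin_bigcup_measurable => // i _.
  rewrite -[X in measurable X]setTI; apply: measurable_coord => //.
  by apply: measurableC; exact: measurable_ball.
apply/seteqP; split => y /=.
  move=> yx [i _ /=]; apply; rewrite -ball_normE/= distrC; apply: le_lt_trans yx.
  by have := ler_coord_norm (y - x) i; rewrite !mxE.
move=> H; apply: ltr_norm_coord => // i; rewrite !mxE.
apply: contrapT => yx; apply: H; exists i => //=; apply: contra_not yx.
by rewrite -ball_normE/= distrC.
Qed.

(** Sup-norm balls are products of intervals, hence measurable, and an open set is the union of
    those with rational centre and radius 1 / (n + 1) that it contains. *)
Lemma open_measurable_Rd (U : set E) : open U -> measurable (U : set T).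
Proof.
move=> oU.
pose B (p : 'rV[rat]_d * nat) := [set y : E | `|y - map_mx ratr p.1| < p.2.+1%:R^-1].
rewrite (_ : U = \bigcup_p (if `[< B p `<=` U >] then B p else set0)).
  apply: countable_bigcupT_measurable => // p.
  by case: ifP => // _; exact: measurable_norm_ball.
apply/seteqP; split => x.
  move=> /(open_ballP oU)[r r0 xU].
  have [n nr] : exists n : nat, n.+1%:R^-1 < r / 2.
    have r2 : 0 < r / 2 by rewrite divr_gt0.
    have [n] := ltr_add_invr r2.
    by rewrite add0r; exists n.
  have [q xq] := @dense_rat_row R d x n.+1%:R^-1 (ltac:(by [])).
  exists (q, n) => //=; case: asboolP => [_|nB]; first by rewrite /B/= distrC.
  exfalso; apply: nB => y; rewrite /B/= => yq; apply: xU.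
  have := ler_normD (y - map_mx ratr q) (map_mx ratr q - x); rewrite addrA subrK.
  by move=> /le_lt_trans; apply; rewrite (splitr r) ltrD// (lt_trans _ nr).
by move=> [p _]; case: asboolP => // + Bx; exact.
Qed.

Lemma closed_measurable_Rd (F : set E) : closed F -> measurable (F : set T).
Proof.
by move=> /closed_openC /open_measurable_Rd/measurableC; rewrite setCK.
Qed.

Lemma continuous_measurable_Rd (f : E -> R) (D : set E) :
  continuous f -> measurable_fun (D : set T) f.
Proof.
move=> cf; apply: (@measurable_funS _ _ _ _ setT) => //.
apply: (measurability _ (RGenOpens.measurableE R)) => _ [_ [a [b ->] <-]].
rewrite setTI; apply: open_measurable_Rd.
by apply: open_comp => // x _; exact: cf.
Qed.

Lemma measurable_open_continuous (f : E -> R) (U : set E) : open U ->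
  (forall x, U x -> {for x, continuous f}) -> measurable_fun (U : set T) f.
Proof.
move=> oU cf mU.
have H : forall A : set R, open A -> measurable (U `&` f @^-1` A : set T).
  move=> A oA; apply: open_measurable_Rd; rewrite openE => x [Ux fx].
  apply: filterI; first exact: open_nbhs_nbhs.
  by apply: (cf x Ux); exact: open_nbhs_nbhs.
apply: (measurability _ (RGenOpens.measurableE R)) => // _ [_ [a [b ->] <-]].
exact: H.
Qed.

Lemma leb_bounded (A : set E) (M : R) :
  (forall x, A x -> `|x| <= M) -> (leb R d A < +oo)%E.
Proof.
move=> AM; have [M0|M0] := ltP M 0.
  rewrite (_ : A = set0); first by rewrite measure0.
  by apply/seteqP; split => x // /AM; rewrite leNgt (lt_le_trans M0).
apply: (@le_lt_trans _ _ (box_gauge (A : set (discr E)))).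
  rewrite /leb/=/leb_om/= /leb_outer/=.
  apply: (@le_trans _ _ (\sum_(k <oo) box_gauge ((bigcup2 A set0) k : set (discr E)))%E).
    apply: ereal_inf_lbound; exists (bigcup2 A set0) => //; split => //.
    by move=> x Ax; exists 0%N.
  rewrite (@nneseries_split _ _ 0 1); last by move=> *; exact: box_gauge_ge0.
  rewrite big_mkord big_ord1 /= eseries0 ?adde0//.
  by move=> [|[|k]] //= _ _; exact: box_gauge0.
apply: (le_lt_trans (@box_gauge_le_box R d A (- const_mx M) (const_mx M) _ _)).
- by move=> i; rewrite !mxE; lra.
- move=> x /AM xM i; rewrite !mxE -ler_norml.
  exact: le_trans (ler_coord_norm x i) xM.
- exact: ltry.
Qed.

Lemma leb_sigma_finite : sigma_finite setT (leb R d).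
Proof.
exists (fun n => [set x : E | `|x - 0| < n.+1%:R]).
  apply/seteqP; split => // x _; exists (Num.truncn `|x|) => //=.
  by rewrite subr0 truncnS_gt.
move=> n; split; first exact: measurable_norm_ball.
by apply: (@leb_bounded _ n.+1%:R) => x /=; rewrite subr0 => /ltW.
Qed.

(** The measure is repackaged together with its sigma-finiteness so that Tonelli's theorem applies
    to it in [young_convol]. *)
Definition leb_fun : set T -> \bar R := leb R d.
HB.instance Definition _ := Measure.copy leb_fun (leb R d).
HB.instance Definition _ := Measure_isSigmaFinite.Build _ _ _ leb_fun leb_sigma_finite.
Definition leb_sfin : {sigma_finite_measure set T -> \bar R} := leb_fun.

Lemma eq_integral_leb_sfin (D : set T) (f : T -> \bar R) :
  (\int[leb_sfin]_(x in D) f x = \int[leb R d]_(x in D) f x)%E.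
Proof. by []. Qed.

End lebesgue_topology.

(** * Projections and square integrable functions *)

Section semi_hilbert.
Context {R : realType} {V : lmodType R}.

(** Elements of L^2 stay functions instead of classes modulo null sets: the form is only
    semi-definite and lives on a subset [L] of a space of functions, so limits and projections are
    determined up to vectors of norm 0. *)
Record pre_hilbert (L : set V) (ip : V -> V -> R) : Prop := PreHilbert {
  preh0 : L 0;
  prehD : forall u v, L u -> L v -> L (u + v);
  prehZ : forall a u, L u -> L (a *: u);
  preh_sym : forall u v, L u -> L v -> ip u v = ip v u;
  preh_addl : forall u v w, L u -> L v -> L w -> ip (u + v) w = ip u w + ip v w;
  preh_scalel : forall a u v, L u -> L v -> ip (a *: u) v = a * ip u v;
  preh_ge0 : forall u, L u -> 0 <= ip u u }.

Variables (L : set V) (ip : V -> V -> R).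
Hypothesis PH : pre_hilbert L ip.

Lemma prehN u : L u -> L (- u).
Proof. by rewrite -scaleN1r; exact: (prehZ PH). Qed.

Lemma prehB u v : L u -> L v -> L (u - v).
Proof. by move=> Lu Lv; apply: (prehD PH) => //; exact: prehN. Qed.

Lemma preh_oppl u v : L u -> L v -> ip (- u) v = - ip u v.
Proof. by move=> Lu Lv; rewrite -scaleN1r (preh_scalel PH)// mulN1r. Qed.

Lemma preh_subl u v w : L u -> L v -> L w -> ip (u - v) w = ip u w - ip v w.
Proof. by move=> Lu Lv Lw; rewrite (preh_addl PH) ?preh_oppl//; exact: prehN. Qed.

Lemma preh_addr u v w : L u -> L v -> L w -> ip w (u + v) = ip w u + ip w v.
Proof.
by move=> Lu Lv Lw; rewrite !(preh_sym PH Lw) ?(preh_addl PH)//; exact: (prehD PH).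
Qed.

Lemma preh_subr u v w : L u -> L v -> L w -> ip w (u - v) = ip w u - ip w v.
Proof.
by move=> Lu Lv Lw; rewrite !(preh_sym PH Lw) ?preh_subl//; exact: prehB.
Qed.

Lemma preh_scaler a u v : L u -> L v -> ip v (a *: u) = a * ip v u.
Proof.
by move=> Lu Lv; rewrite !(preh_sym PH Lv) ?(preh_scalel PH)//; exact: (prehZ PH).
Qed.

Lemma preh_sqrD a u v : L u -> L v ->
  ip (u + a *: v) (u + a *: v) = ip u u + 2 * a * ip u v + a ^+ 2 * ip v v.
Proof.
move=> Lu Lv; have Lav := prehZ PH a Lv.
rewrite (preh_addl PH) ?preh_addr//; last exact: (prehD PH).
rewrite (preh_sym PH Lav Lu) (preh_scaler _ Lv Lu) (preh_scaler _ Lv Lav).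
by rewrite (preh_scalel PH _ Lv Lv); ring.
Qed.

Lemma preh_cs u v : L u -> L v -> ip u v ^+ 2 <= ip u u * ip v v.
Proof.
move=> Lu Lv.
have H a : 0 <= ip u u + 2 * a * ip u v + a ^+ 2 * ip v v.
  rewrite -preh_sqrD//; apply: (preh_ge0 PH).
  by apply: (prehD PH) => //; exact: (prehZ PH).
have [vv|vv0] := eqVneq (ip v v) 0.
  suff -> : ip u v = 0 by rewrite vv mulr0 expr0n.
  apply/eqP; apply: contrapT => /negP uv0.
  (* With <v, v> = 0 the quadratic is affine in a; this value of a would make it equal to -1. *)
  have := H (- (ip u u + 1) / (2 * ip u v)); rewrite vv mulr0 addr0.
  rewrite (_ : ip u u + _ = -1) ?ler0N1//.
  by field.
have vvgt0 : 0 < ip v v by rewrite lt_neqAle eq_sym vv0 (preh_ge0 PH).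
have := H (- ip u v / ip v v).
rewrite (_ : ip u u + _ + _ = ip u u - ip u v ^+ 2 / ip v v); last by field.
by rewrite subr_ge0 ler_pdivrMr.
Qed.

Lemma preh_sqrB_le u v w : L u -> L v -> L w ->
  ip (u - w) (u - w) <= 2 * ip (u - v) (u - v) + 2 * ip (v - w) (v - w).
Proof.
move=> Lu Lv Lw; have Lx := prehB Lu Lv; have Ly := prehB Lv Lw.
have -> : u - w = (u - v) + 1 *: (v - w) by rewrite scale1r addrA subrK.
have := preh_ge0 PH (prehB Lx Ly).
have -> : (u - v) - (v - w) = (u - v) + (-1) *: (v - w) by rewrite scaleN1r.
by rewrite !preh_sqrD//; lra.
Qed.

Lemma cvg_preh (s : nat -> V) (l u : V) : (forall n, L (s n)) -> L l -> L u ->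
  (fun n => ip (s n - l) (s n - l)) @ \oo --> 0 ->
  (fun n => ip (s n) u) @ \oo --> ip l u.
Proof.
move=> Ls Ll Lu sl; apply/cvgrPdist_lt => e e0.
(* Cauchy-Schwarz against the fixed vector u dictates e^2 / <u, u>; the added 1 covers the case <u,
   u> = 0. *)
have e1 : 0 < e ^+ 2 / (ip u u + 1).
  by rewrite divr_gt0 ?exprn_gt0// ltr_wpDl// (preh_ge0 PH).
move/cvgrPdist_lt : sl => /(_ _ e1); apply: filterS => n.
rewrite sub0r normrN ger0_norm => [Hn|]; last by apply: (preh_ge0 PH); exact: prehB.
rewrite distrC -(preh_subl (Ls n))// -ltr_sqr ?nnegrE ?(ltW e0)//.
rewrite real_normK ?num_real//; have := preh_cs (prehB (Ls n) Ll) Lu.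
move=> /le_lt_trans; apply.
have u1 : 0 < ip u u + 1 by rewrite ltr_wpDl// (preh_ge0 PH).
move: Hn; rewrite ltr_pdivlMr// mulrDr mulr1; apply: le_lt_trans.
by rewrite lerDl; apply: (preh_ge0 PH); exact: prehB.
Qed.

Definition preh_complete := forall s : nat -> V, (forall n, L (s n)) ->
  (forall e, 0 < e -> exists N, forall m n, (N <= m)%N -> (N <= n)%N ->
    ip (s m - s n) (s m - s n) < e) ->
  exists2 l, L l & (fun n => ip (s n - l) (s n - l)) @ \oo --> 0.

(** The subspace [S] need not be closed, so the projection [p] is a limit of elements of [S] and the
    approximating sequence is part of the conclusion. A minimizing sequence for the distance to u is
    Cauchy by the parallelogram law. *)
Lemma hilbert_projection (S : set V) (u : V) : preh_complete ->
  S 0 -> S `<=` L -> (forall v w, S v -> S w -> S (v + w)) ->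
  (forall a v, S v -> S (a *: v)) -> L u ->
  exists s : nat -> V, exists p : V, [/\ forall n, S (s n), L p,
    (fun n => ip (s n - p) (s n - p)) @ \oo --> 0 &
    forall v, S v -> ip (u - p) v = 0].
Proof.
move=> cpl S0 SL SD SZ Lu.
pose q v := ip (u - v) (u - v).
pose m := inf [set q v | v in S].
have q0 v : S v -> 0 <= q v by move=> /SL Lv; apply: (preh_ge0 PH); exact: prehB.
have hi : has_inf [set q v | v in S].
  by split; [exists (q 0); exists 0|exists 0 => _ [v /q0 ? <-]].
have mq v : S v -> m <= q v by move=> Sv; apply: ge_inf; [exact: hi.2|exists v].
have /choice[s Hs] n : exists v, S v /\ q v < m + n.+1%:R^-1.
  have [|_ [v Sv <-] qv] := @inf_adherent R _ n.+1%:R^-1 _ hi.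
    by rewrite invr_gt0.
  by exists v.
have Ss n := (Hs n).1; have qs n := (Hs n).2.
have Ls n : L (s n) by exact: SL.
have parallelogram v w : S v -> S w ->
    ip (v - w) (v - w) <= 2 * (q v - m) + 2 * (q w - m).
  move=> Sv Sw; have Lx := prehB Lu (SL _ Sv); have Ly := prehB Lu (SL _ Sw).
  have -> : v - w = (u - w) + (-1) *: (u - v).
    by rewrite scaleN1r opprB [RHS]addrC addrA subrK.
  (* The midpoint of v and w is in [S], so its squared distance to u is at least m. *)
  have := mq (2^-1 *: (v + w)) (SZ _ _ (SD _ _ Sv Sw)); rewrite /q.
  have -> : u - 2^-1 *: (v + w) = 2^-1 *: ((u - w) + 1 *: (u - v)).
    rewrite scale1r addrACA -opprD [w + v]addrC scalerBr -mulr2n -(scaler_nat 2 u).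
    by rewrite scalerA mulVf ?pnatr_eq0// scale1r.
  have Lz : L (u - w + 1 *: (u - v)) by rewrite scale1r; exact: (prehD PH).
  rewrite (preh_scalel PH)//; last exact: (prehZ PH).
  rewrite preh_scaler// !preh_sqrD//; lra.
have inv0 : forall e : R, 0 < e -> exists N, forall n, (N <= n)%N -> n.+1%:R^-1 < e.
  move=> e e0; exists (Num.truncn e^-1) => n Nn.
  rewrite invf_plt ?posrE//; apply: lt_le_trans (truncnS_gt _) _.
  by rewrite ler_nat.
have [|p Lp sp] := cpl s Ls.
  move=> e e0; have e4 : 0 < e / 4 by rewrite divr_gt0.
  have [N HN] := inv0 _ e4; exists N => i j Ni Nj.
  apply: le_lt_trans (parallelogram _ _ (Ss i) (Ss j)) _.
  have Hi : q (s i) < m + e / 4 by rewrite (lt_trans (qs i))// ltrD2l HN.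
  have Hj : q (s j) < m + e / 4 by rewrite (lt_trans (qs j))// ltrD2l HN.
  by move: Hi Hj; rewrite /q; lra.
exists s, p; split => // v Sv; have Lv := SL _ Sv.
(* First variation: the competitor s n + t v is compared with the infimum, and n tends to
   infinity. *)
have key t : 2 * t * ip (u - p) v <= t ^+ 2 * ip v v.
  have H1 : (fun n => 2 * t * (ip u v - ip (s n) v)) @ \oo --> 2 * t * ip (u - p) v.
    rewrite preh_subl//; apply: cvgMr; apply: cvgB; first exact: cvg_cst.
    exact: cvg_preh.
  have H2 : (fun n : nat => n.+1%:R^-1 + t ^+ 2 * ip v v) @ \oo --> t ^+ 2 * ip v v.
    rewrite -[X in _ --> X]add0r; apply: cvgD; last exact: cvg_cst.
    exact: cvg_harmonic.
  rewrite -(cvg_lim _ H1)// -(cvg_lim _ H2)//; apply: ler_lim.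
  - by apply/cvg_ex; eexists; exact: H1.
  - by apply/cvg_ex; eexists; exact: H2.
  apply: nearW => n; rewrite -preh_subl//.
  have Lx := prehB Lu (Ls n).
  have := mq (s n + t *: v) (SD _ _ (Ss n) (SZ _ _ Sv)); rewrite /q.
  have -> : u - (s n + t *: v) = (u - s n) + (- t) *: v.
    by rewrite opprD addrA scaleNr.
  rewrite preh_sqrD// sqrrN; have := qs n; rewrite /q.
  by move: (n.+1%:R^-1) (ip (u - s n) v) (t ^+ 2) => r x y; lra.
apply/eqP; apply: contrapT => /negP a0.
set a := ip (u - p) v in key a0 *; set b := ip v v in key.
have b0 : 0 <= b by exact: (preh_ge0 PH).
(* This t contradicts [key] as soon as a <> 0; the shift by 1 keeps the denominator positive when
   <v, v> = 0. *)
have := key (a / (b + 1)).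
have b1 : 0 < b + 1 by lra.
rewrite leNgt => /negP; apply; rewrite -subr_gt0.
rewrite (_ : _ - _ = (a / (b + 1)) ^+ 2 * (b + 2)); last by field; rewrite gt_eqF.
apply: mulr_gt0; last by lra.
by rewrite exprn_even_gt0//= mulf_neq0// invr_neq0// gt_eqF.
Qed.

End semi_hilbert.

Section square_integrable.
Context {dd : measure_display} {T : measurableType dd} {R : realType}.
Variables (mu : {measure set T -> \bar R}) (D : set T).
Hypothesis mD : measurable D.
Implicit Types f g h : T -> R.

Definition sqint f := measurable_fun D f /\ (\int[mu]_(x in D) (f x ^+ 2)%:E < +oo)%E.

Local Notation intg f := (mu.-integrable D (EFin \o f)).
Local Notation Int f := (\int[mu]_(x in D) f x).

Lemma integrable_le f g : measurable_fun D f -> (forall x, D x -> `|f x| <= g x) ->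
  intg g -> intg f.
Proof.
move=> mf fg; apply: le_integrable => //; first exact/measurable_EFinP.
by move=> x Dx /=; rewrite lee_fin (le_trans (fg x Dx))// ler_norm.
Qed.

Lemma integrable_sqr f : sqint f -> intg (fun x => f x ^+ 2).
Proof.
move=> [mf foo]; apply/integrableP; split.
  exact/measurable_EFinP/measurable_funX.
rewrite (eq_integral (fun x => (f x ^+ 2)%:E))// => x _ /=.
by rewrite ger0_norm ?sqr_ge0.
Qed.

Lemma sqintP f : measurable_fun D f -> intg (fun x => f x ^+ 2) -> sqint f.
Proof.
move=> mf /integrableP[_ foo]; split => //; apply: le_lt_trans foo.
rewrite le_eqVlt; apply/orP; left; apply/eqP; apply: eq_integral => x _ /=.
by rewrite ger0_norm ?sqr_ge0.
Qed.

Lemma integrable_addr f g : intg f -> intg g -> intg (fun x => f x + g x).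
Proof. by move=> If Ig; exact: (integrableD mD If Ig). Qed.

Lemma integrable_mulr c f : intg f -> intg (fun x => c * f x).
Proof. by move=> If; have := integrableZl mD c If. Qed.

Lemma integrable_subr f g : intg f -> intg g -> intg (fun x => f x - g x).
Proof. by move=> If Ig; exact: (integrableB mD If Ig). Qed.

Lemma integrable_sumr I (s : seq I) (F : I -> T -> R) : (forall i, intg (F i)) ->
  intg (fun x => \sum_(i <- s) F i x).
Proof.
move=> HF; elim: s => [|i s IHs].
  under [X in _.-integrable _ X]eq_fun do rewrite /= big_nil.
  exact: integrable0.
have -> : (fun x => \sum_(j <- i :: s) F j x) = (fun x => F i x + \sum_(j <- s) F j x).
  by apply/funext => x; rewrite big_cons.
exact: integrable_addr.
Qed.

Lemma Rintegral_sumr I (s : seq I) (F : I -> T -> R) : (forall i, intg (F i)) ->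
  Int (fun x => \sum_(i <- s) F i x) = \sum_(i <- s) Int (F i).
Proof.
move=> HF; elim: s => [|i s IHs].
  rewrite big_nil; under eq_Rintegral do rewrite big_nil.
  by rewrite Rintegral_cst// mul0r.
rewrite big_cons -IHs -RintegralD//; last exact: integrable_sumr.
by apply: eq_Rintegral => x _; rewrite big_cons.
Qed.

Lemma integrable_mul_sqint f g : sqint f -> sqint g -> intg (fun x => f x * g x).
Proof.
move=> sf sg; apply: (@integrable_le _ (fun x => f x ^+ 2 + g x ^+ 2)).
- by apply: measurable_funM; [case: sf|case: sg].
- move=> x _; rewrite ler_norml.
  have := sqr_ge0 (f x - g x); have := sqr_ge0 (f x + g x).
  have := sqr_ge0 (f x); have := sqr_ge0 (g x).
  by rewrite !expr2; nra.
- by apply: integrable_addr; exact: integrable_sqr.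
Qed.

Lemma sqint0 : sqint (fun=> 0).
Proof.
split; first exact: measurable_cst.
by under eq_integral do rewrite expr0n; rewrite integral0.
Qed.

Lemma sqintD f g : sqint f -> sqint g -> sqint (fun x => f x + g x).
Proof.
move=> sf sg; apply: sqintP.
  by apply: measurable_funD; [case: sf|case: sg].
have -> : (fun x => (f x + g x) ^+ 2) =
    (fun x => (f x ^+ 2 + g x ^+ 2) + 2 * (f x * g x)).
  by apply/funext => x; ring.
apply: integrable_addr; last exact/integrable_mulr/integrable_mul_sqint.
by apply: integrable_addr; exact: integrable_sqr.
Qed.

Lemma sqintZ c f : sqint f -> sqint (fun x => c * f x).
Proof.
move=> sf; apply: sqintP.
  by apply: measurable_funM; [exact: measurable_cst|case: sf].
have -> : (fun x => (c * f x) ^+ 2) = (fun x => c ^+ 2 * f x ^+ 2).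
  by apply/funext => x; ring.
exact/integrable_mulr/integrable_sqr.
Qed.

Lemma sqintN f : sqint f -> sqint (fun x => - f x).
Proof.
move=> sf; have -> : (fun x => - f x) = (fun x => -1 * f x).
  by apply/funext => x; rewrite mulN1r.
exact: sqintZ.
Qed.

Lemma sqintB f g : sqint f -> sqint g -> sqint (fun x => f x - g x).
Proof. by move=> sf sg; apply: sqintD => //; exact: sqintN. Qed.

Lemma sqint_le f g c : measurable_fun D f -> (forall x, D x -> `|f x| <= c * `|g x|) ->
  sqint g -> sqint f.
Proof.
move=> mf fg sg; apply: sqintP => //.
apply: (@integrable_le _ (fun x => c ^+ 2 * g x ^+ 2)).
- exact: measurable_funX.
- move=> x Dx; rewrite normrX -(real_normK (num_real (g x))) -exprMn.
  by rewrite ler_sqr ?nnegrE ?fg// (le_trans _ (fg x Dx)).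
- exact/integrable_mulr/integrable_sqr.
Qed.

Lemma sqintM_bounded f g c : measurable_fun D f -> (forall x, D x -> `|f x| <= c) ->
  sqint g -> sqint (fun x => f x * g x).
Proof.
move=> mf fc sg; apply: (@sqint_le _ g c) => //.
  by apply: measurable_funM => //; case: sg.
by move=> x Dx; rewrite normrM ler_wpM2r// fc.
Qed.

Lemma integrable_cst_fin (c : R) : (mu D < +oo)%E -> intg (fun=> c).
Proof.
move=> muD; apply/integrableP; split; first exact/measurable_EFinP/measurable_cst.
by rewrite /= integral_cst// lte_mul_pinfty.
Qed.

Lemma sqint_bounded f c : (mu D < +oo)%E -> measurable_fun D f ->
  (forall x, D x -> `|f x| <= c) -> sqint f.
Proof.
move=> muD mf fc; apply: (@sqint_le _ (fun=> 1) c) => //.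
  by move=> x Dx; rewrite normr1 mulr1 fc.
apply: sqintP; first exact: measurable_cst.
exact: integrable_cst_fin.
Qed.

Lemma integrable_bounded f c : (mu D < +oo)%E -> measurable_fun D f ->
  (forall x, D x -> `|f x| <= c) -> intg f.
Proof.
move=> muD mf fc; apply: (@integrable_le _ (cst c)) => //.
exact: integrable_cst_fin.
Qed.

Lemma sqint_integrable f : (mu D < +oo)%E -> sqint f -> intg f.
Proof.
move=> muD sf; have -> : f = (fun x => f x * 1) by apply/funext => x; rewrite mulr1.
apply: integrable_mul_sqint => //; apply: (@sqint_bounded _ 1) => //.
by move=> x _; rewrite normr1.
Qed.

Lemma pre_hilbert_sqint : pre_hilbert (V := T -> R^o) sqint (fun f g => Int (fun x => f x * g x)).
Proof.
split.
- exact: sqint0.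
- exact: sqintD.
- by move=> a u; exact: sqintZ.
- by move=> u v _ _; apply: eq_Rintegral => x _; rewrite mulrC.
- move=> u v w su sv sw; rewrite -RintegralD//; try exact: integrable_mul_sqint.
  by apply: eq_Rintegral => x _; rewrite /= mulrDl.
- move=> a u v su sv; rewrite -RintegralZl//; try exact: integrable_mul_sqint.
  by apply: eq_Rintegral => x _; rewrite /= -mulrA.
- by move=> u su; apply: Rintegral_ge0 => x _; rewrite -expr2 sqr_ge0.
Qed.

Lemma eq_Rintegral_ae f g : measurable_fun D f -> measurable_fun D g ->
  {ae mu, forall x, D x -> f x = g x} -> Int f = Int g.
Proof.
move=> mf mg fg; congr fine; apply: ae_eq_integral => //; try exact/measurable_EFinP.
by apply: filterS fg => x fgx /fgx ->.
Qed.

Lemma Rintegral_dominated (F : nat -> T -> R) f g : (forall n, measurable_fun D (F n)) ->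
  measurable_fun D f -> intg g ->
  {ae mu, forall x, D x -> F ^~ x @ \oo --> f x} ->
  (forall n x, D x -> `|F n x| <= g x) ->
  intg f /\ (fun n => Int (F n)) @ \oo --> Int f.
Proof.
move=> mF mf ig Ff Fg.
have [|||//||If _ Icv] := @dominated_convergence _ T R mu D mD (fun n => EFin \o F n) (EFin \o f) (EFin \o g).
- by move=> n; exact/measurable_EFinP.
- exact/measurable_EFinP.
- by apply: filterS Ff => x Fx /Fx Dx; apply: cvg_EFin => //; apply: nearW.
- by apply: aeW => x n Dx /=; rewrite lee_fin Fg.
split => //; apply: fine_cvg; rewrite fineK//.
exact: integrable_fin_num.
Qed.

End square_integrable.

(** * Completeness of L^2 (Riesz-Fischer) *)

Section L2_complete.
Context {dd : measure_display} {T : measurableType dd} {R : realType}.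
Variables (mu : {measure set T -> \bar R}) (D : set T).
Hypothesis mD : measurable D.
Implicit Types f g h : T -> R.

Local Notation Int f := (\int[mu]_(x in D) f x).
Local Notation sqint := (sqint mu D).

(** The limit is not known to be integrable beforehand: the bound on the approximants is what
    delivers it, both for completeness of L^2 and for the energy of the exterior solution. *)
Lemma fatou_bound (F : nat -> T -> R) f (c : R) (N : nat) :
  (forall n, measurable_fun D (F n)) -> measurable_fun D f ->
  (forall n x, D x -> 0 <= F n x) ->
  {ae mu, forall x, D x -> F ^~ x @ \oo --> f x} ->
  (forall n, (N <= n)%N -> (\int[mu]_(x in D) (F n x)%:E <= c%:E)%E) ->
  (\int[mu]_(x in D) (f x)%:E <= c%:E)%E.
Proof.
move=> mF mf F0 Ff Fc.
have mF' n : measurable_fun D (fun x => (F n x)%:E) by exact/measurable_EFinP.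
have -> : (\int[mu]_(x in D) (f x)%:E = \int[mu]_(x in D) limn_einf (fun n => (F n x)%:E))%E.
  apply: ae_eq_integral => //; first exact/measurable_EFinP.
    have -> : (fun x => limn_einf (fun n => (F n x)%:E)) =
        (fun x => - limn_esup (fun n => (- F n x)%:E))%E.
      apply/funext => x.
      by rewrite -[LHS]oppeK -limn_esupN.
    apply/measurableT_comp => //; apply: measurable_fun_limn_esup => n.
    exact/measurable_EFinP/measurable_funN.
  apply: filterS Ff => x Fx Dx; have {}Fx := Fx Dx.
  have : (fun n => (F n x)%:E) @ \oo --> (f x)%:E.
    by apply: cvg_EFin => //; apply: nearW.
  by move/cvg_limn_einf_sup => [-> _].
apply: (le_trans (fatou mu mD mF' _)); first by move=> n x Dx; rewrite lee_fin F0.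
rewrite limn_einf_lim; apply: lime_le; first exact: is_cvg_einfs.
(* The tail infimum of rank n is at most the integral of rank max(n, N), where the bound holds. *)
apply: nearW => n; apply: (@le_trans _ _ (\int[mu]_(x in D) (F (maxn n N) x)%:E)%E).
  by apply: ereal_inf_lbound; exists (maxn n N) => //=; exact: leq_maxl.
by apply: Fc; exact: leq_maxr.
Qed.

Lemma integral_sqr_fin f : sqint f ->
  (\int[mu]_(x in D) (f x ^+ 2)%:E)%E = (Int (fun x => f x * f x))%:E.
Proof.
move=> sf; rewrite fineK//.
exact/integrable_fin_num/integrable_sqr.
Qed.

(** The weights 4^n, set against squared increments of size 8^-n, leave a convergent series. So
    almost everywhere 4^n |f_(n+1) - f_n|^2 is bounded in n, and the increments are dominated by a
    geometric sequence of ratio 1/2. *)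
Lemma ae_cvg_subsequence (f : nat -> T -> R) : (forall n, sqint (f n)) ->
  (forall n, Int (fun x => (f n.+1 x - f n x) * (f n.+1 x - f n x)) <= 8%:R ^- n) ->
  {ae mu, forall x, D x -> cvgn (f ^~ x)}.
Proof.
move=> sf f8.
pose h n x := 4 ^+ n * (f n.+1 x - f n x) ^+ 2.
have sD n : sqint (fun x => f n.+1 x - f n x) by exact: sqintB.
have h0 n x : 0 <= h n x by apply: mulr_ge0; [exact: exprn_ge0|exact: sqr_ge0].
have mh n : measurable_fun D (h n).
  by apply: measurable_funM; [exact: measurable_cst|apply: measurable_funX; case: (sD n)].
pose S x := (\sum_(n <oo) (h n x)%:E)%E.
have mS : measurable_fun D S.
  apply: ge0_emeasurable_sum => n; first by move=> x _ _; rewrite lee_fin.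
  by move=> _; exact/measurable_EFinP.
have S0 x : (0 <= S x)%E by apply: nneseries_ge0 => n _ _; rewrite lee_fin.
have IS : (\int[mu]_(x in D) S x <= 2%:E)%E.
  rewrite integral_nneseries//; last 2 first.
  - by move=> n; exact/measurable_EFinP.
  - by move=> n x _; rewrite lee_fin.
  apply: lime_le.
    by apply: is_cvg_nneseries => n _ _; apply: integral_ge0 => x _; rewrite lee_fin.
  apply: nearW => n; apply: (@le_trans _ _ (\sum_(0 <= i < n) (2^-1 ^+ i)%:E)%E).
    apply: lee_sum => i _.
    have -> : (\int[mu]_(x in D) (h i x)%:E =
        (4 ^+ i)%:E * \int[mu]_(x in D) ((f i.+1 x - f i x) ^+ 2)%:E)%E.
      rewrite -ge0_integralZl//.
      - by apply/measurable_EFinP/measurable_funX; case: (sD i).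
      - by move=> x _; rewrite lee_fin sqr_ge0.
    rewrite integral_sqr_fin// -EFinM lee_fin.
    apply: (le_trans (ler_wpM2l _ (f8 i))); first by rewrite exprn_ge0.
    by rewrite -exprVn -exprMn; rewrite (_ : 4 / 8 = 2^-1 :> R) //; lra.
  rewrite sumEFin lee_fin.
  suff -> : \sum_(0 <= i < n) (2^-1 ^+ i) = 2 - 2 * 2^-1 ^+ n :> R.
    by rewrite lerBlDr lerDl mulr_ge0// exprn_ge0// invr_ge0.
  elim: n => [|n IHn]; first by rewrite big_nil expr0; lra.
  by rewrite big_nat_recr//= IHn exprS; lra.
have intS : mu.-integrable D S.
  apply/integrableP; split => //.
  under eq_integral do rewrite gee0_abs//.
  by apply: le_lt_trans IS _; rewrite ltry.
have := integrable_ae mD intS; apply: filterS => x Sx Dx.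
have {}Sx := Sx Dx.
have hS n : h n x <= fine (S x).
  rewrite -lee_fin fineK//; rewrite /S (nneseries_split 0 n.+1).
    by rewrite big_mkord/= big_ord_recr/= -addeA addeCA leeDl// adde_ge0//;
      [apply: sume_ge0 => *; rewrite lee_fin|apply: nneseries_ge0 => *; rewrite lee_fin].
  by move=> *; rewrite lee_fin.
have fS0 : 0 <= fine (S x) by exact: fine_ge0.
(* 1 + s in place of the square root of s, since s <= (1 + s)^2. *)
set C := 1 + fine (S x).
have fC n : `|f n.+1 x - f n x| <= geometric C 2^-1 n.
  rewrite /= -ler_pdivrMr ?exprn_gt0 ?invr_gt0// -exprVn invrK.
  rewrite -ler_sqr ?nnegrE// ?addr_ge0// ?mulr_ge0 ?exprn_ge0//.
  rewrite exprMn real_normK ?num_real//.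
  rewrite -exprM mulnC exprM (_ : 2 ^+ 2 = 4 :> R); last by rewrite expr2; lra.
  rewrite mulrC; apply: (le_trans (hS n)).
  by rewrite /C; move: fS0; move: (fine _) => y; nra.
have : cvgn (series (telescope (f ^~ x))).
  apply: normed_cvg; apply: (@series_le_cvg _ _ (geometric C 2^-1)) => //.
  - by move=> n; exact: normr_ge0.
  - by move=> n; apply: mulr_ge0; [exact: addr_ge0|exact: exprn_ge0].
  - by apply: is_cvg_geometric_series; rewrite ger0_norm//; lra.
rewrite telescopeK => fcv.
have -> : f ^~ x = (fun n => (f n x - f 0%N x) + f 0%N x).
  by apply/funext => n; rewrite subrK.
by apply: is_cvgD fcv _; exact: is_cvg_cst.
Qed.

Lemma sqint_complete :
  preh_complete (V := T -> R^o) sqint (fun f g => Int (fun x => f x * g x)).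
Proof.
move=> f sf cauchy_f.
pose nrm g := Int (fun x => g x * g x).
have PH := pre_hilbert_sqint mu mD : pre_hilbert (V := T -> R^o) _ _.
have /choice[K HK] (n : nat) : exists N, forall i j, (N <= i)%N -> (N <= j)%N ->
    nrm (f i - f j) < 8%:R ^- n by apply: cauchy_f; rewrite invr_gt0 exprn_gt0.
(* The index is at least [K n], past which increments are below 8^-n, and it does not decrease with
   n. *)
pose k n := (n + \sum_(i < n.+1) K i)%N.
have Kk n : (K n <= k n)%N by rewrite /k big_ord_recr/= addnA leq_addl.
have kk n : (k n <= k n.+1)%N.
  by rewrite /k [X in (_ <= _ + X)%N]big_ord_recr/= leq_add// leq_addr.
have aecv : {ae mu, forall x, D x -> cvgn (fun n => f (k n) x)}.
  apply: (@ae_cvg_subsequence (fun n => f (k n))) => // n.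
  by apply/ltW/(HK n); [exact: leq_trans (kk n)|exact: Kk].
(* The upper limit is measurable and defined everywhere, and it is the limit wherever the
   subsequence converges. *)
pose g x := fine (limn_esup (fun n => (f (k n) x)%:E)).
have mg : measurable_fun D g.
  apply: measurableT_comp; first exact: fine_measurable.
  by apply: measurable_fun_limn_esup => n; apply/measurable_EFinP; case: (sf (k n)).
have aeg : {ae mu, forall x, D x -> (fun n => f (k n) x) @ \oo --> g x}.
  apply: filterS aecv => x cvx Dx; have {}cvx := cvx Dx; rewrite /g.
  have : (fun n => (f (k n) x)%:E) @ \oo --> (limn (fun n => f (k n) x))%:E.
    by apply: cvg_EFin => //; apply: nearW.
  by move/cvg_limn_einf_sup => [_ ->].
(* Fatou along the subsequence turns the Cauchy estimate into an estimate of the distance to g. *)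
have key m e : (forall n, (m <= n)%N -> nrm (f m - f n) <= e) ->
    (\int[mu]_(x in D) ((f m x - g x) ^+ 2)%:E <= e%:E)%E.
  move=> He; apply: (@fatou_bound (fun n x => (f m x - f (k n) x) ^+ 2) _ _ m).
  - by move=> n; apply/measurable_funX/measurable_funB; [case: (sf m)|case: (sf (k n))].
  - by apply/measurable_funX/measurable_funB => //; case: (sf m).
  - by move=> n x _; exact: sqr_ge0.
  - apply: filterS aeg => x gx Dx.
    by apply: cvgM; apply: cvgB; try exact: cvg_cst; exact: gx.
  - move=> n mn; rewrite integral_sqr_fin; last exact: sqintB.
    by rewrite lee_fin; apply: He; rewrite (leq_trans mn)// leq_addr.
have sfg m e : (forall n, (m <= n)%N -> nrm (f m - f n) <= e) ->
    sqint (fun x => f m x - g x).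
  move=> He; split; first by apply: measurable_funB => //; case: (sf m).
  by apply: le_lt_trans (key m e He) _; rewrite ltry.
have sg : sqint g.
  have [N HN] := cauchy_f 1 ltr01.
  have -> : g = (fun x => f N x - (f N x - g x)) by apply/funext => x; rewrite subKr.
  by apply: sqintB => //; apply: (@sfg N 1) => n Nn; apply/ltW/HN.
exists g => //; apply/cvgrPdist_lt => e e0.
have e2 : 0 < e / 2 by rewrite divr_gt0.
have [N HN] := cauchy_f _ e2.
exists N => // n /= Nn; rewrite sub0r normrN ger0_norm; last first.
  by apply: (preh_ge0 PH); exact: sqintB.
apply: (@le_lt_trans _ _ (e / 2)); last by lra.
rewrite -lee_fin -integral_sqr_fin; last exact: sqintB.
by apply: key => m nm; apply/ltW/HN => //; exact: leq_trans nm.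
Qed.

End L2_complete.

Lemma cvg_sumr {R : realType} {T : Type} (F : set_system T) {FF : Filter F} (I : Type) (r : seq I)
    (f : I -> T -> R) (a : I -> R) : (forall i, f i x @[x --> F] --> a i) ->
  (\sum_(i <- r) f i x) @[x --> F] --> \sum_(i <- r) a i.
Proof.
move=> fa; elim: r => [|i r IHr].
  by rewrite big_nil; under eq_fun do rewrite big_nil; exact: cvg_cst.
by rewrite big_cons; under eq_fun do rewrite big_cons; apply: cvgD.
Qed.

Section vector_L2.
Context {dd : measure_display} {T : measurableType dd} {R : realType}.
Variables (mu : {measure set T -> \bar R}) (D : set T) (I : finType).
Hypothesis mD : measurable D.
Local Notation sqint := (sqint mu D).
Local Notation Int f := (\int[mu]_(x in D) f x).

Definition vsqint (G : I -> T -> R^o) := forall i, sqint (G i).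
Definition vip (G H : I -> T -> R^o) : R := \sum_i Int (fun x => G i x * H i x).

Lemma pre_hilbert_vsqint : pre_hilbert vsqint vip.
Proof.
have PH := pre_hilbert_sqint mu mD.
split.
- by move=> i; exact: (preh0 PH).
- by move=> u v su sv i; exact: (prehD PH).
- by move=> a u su i; exact: (prehZ PH).
- by move=> u v su sv; apply: eq_bigr => i _; exact: (preh_sym PH).
- move=> u v w su sv sw; rewrite -big_split/=; apply: eq_bigr => i _.
  exact: (preh_addl PH).
- move=> a u v su sv; rewrite mulr_sumr; apply: eq_bigr => i _.
  exact: (preh_scalel PH).
- by move=> u su; apply: sumr_ge0 => i _; exact: (preh_ge0 PH).
Qed.

Lemma vsqint_complete : preh_complete vsqint vip.
Proof.
have PH := pre_hilbert_sqint mu mD.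
move=> s ss cs.
have le_vip i m n : Int (fun x => (s m - s n) i x * (s m - s n) i x) <= vip (s m - s n) (s m - s n).
  rewrite /vip (bigD1 i)//= lerDl; apply: sumr_ge0 => j _.
  by apply: Rintegral_ge0 => x _; rewrite -expr2; exact: sqr_ge0.
have /choice[l Hl] (i : I) : exists l, sqint l /\
    (fun n => Int (fun x => (s n i x - l x) * (s n i x - l x))) @ \oo --> 0.
  have [|e e0|l sl cl] := @sqint_complete _ _ _ mu D mD (fun n => s n i).
  - by move=> n; exact: ss.
  - have [N HN] := cs e e0; exists N => m n Nm Nn.
    exact: le_lt_trans (le_vip i m n) (HN m n Nm Nn).
  - by exists l.
exists l; first by move=> i; exact: (Hl i).1.
suff : (fun n => vip (s n - l) (s n - l)) @ \oo --> \sum_(i : I) (0 : R) by rewrite big1.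
apply: (@cvg_sumr R nat \oo _ I (index_enum I)
  (fun i n => Int (fun x => (s n i x - l i x) * (s n i x - l i x))) (fun=> 0)) => i.
exact: (Hl i).2.
Qed.

End vector_L2.

(** * Affine changes of variables and integration by parts *)

Section affine_change_of_variables.
Context {R : realType} {d : nat}.
Local Notation E := 'rV[R]_d.
Local Notation T := (caratheodory_type (leb_om R d)).
Local Notation mu := (leb R d).
Variables (c : R) (h : E).
Hypothesis c0 : 0 < c.
Let S : T -> T := fun x : E => (c *: x + h : E).

Let inv_S (x : E) : c^-1 *: ((S x : E) - h) = x.
Proof. by rewrite /S addrK scalerA mulVf ?gt_eqF// scale1r. Qed.

(** Measurability is the Caratheodory criterion, so it has to be checked against every test set. The
    map being a bijection, each test set is a preimage, and [leb_outer_affine] scales the three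
    terms alike. *)
Lemma measurable_affine : measurable_fun (setT : set T) S.
Proof.
move=> _ A mA; rewrite setTI.
have cA : caratheodory_measurable (leb_om R d) A := mA.
suff : caratheodory_measurable (leb_om R d) (S @^-1` A) by [].
move=> X.
have -> : X = S @^-1` [set y | X (c^-1 *: (y - h))].
  by apply/seteqP; split => x /=; rewrite inv_S.
set Y := [set y | _].
rewrite preimage_setC -!preimage_setI.
have L B : (leb_om R d (S @^-1` B) = (c ^- d)%:E * leb_om R d B)%E := leb_outer_affine h B c0.
rewrite !L (cA Y) ge0_muleDr//; exact: outer_measure_ge0.
Qed.

Let cd0 : 0 <= c ^- d. Proof. by rewrite invr_ge0 exprn_ge0// ltW. Qed.

Let nu : {measure set T -> \bar R} := mscale (NngNum cd0) mu.
Let pf : {measure set T -> \bar R} :=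
  measure_function_pushforward__canonical__measure_function_Measure mu measurable_affine.

Lemma ge0_integral_affine (f : T -> \bar R) : measurable_fun setT f ->
  (forall x, 0 <= f x)%E ->
  (\int[mu]_x f (S x) = (c ^- d)%:E * \int[mu]_x f x)%E.
Proof.
move=> mf f0.
have E1 : (\int[pf]_x f x = \int[mu]_x f (S x))%E.
  by rewrite (ge0_integral_pushforward measurable_affine)// preimage_setT.
have E2 : (\int[nu]_x f x = (c ^- d)%:E * \int[mu]_x f x)%E.
  by rewrite ge0_integral_mscale.
(* The pushforward of the measure and its multiple by c^-d agree on measurable sets. *)
rewrite -E1 -E2; apply: (@eq_measure_integral _ T R setT nu pf f) => A mA _.
exact: (leb_outer_affine h A c0).
Qed.

Lemma integrable_affine (f : T -> R) : mu.-integrable setT (EFin \o f) ->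
  mu.-integrable setT (EFin \o (fun x => f (S x))).
Proof.
move=> /integrableP[mf foo]; apply/integrableP; split.
  exact: (measurableT_comp mf measurable_affine).
have maf : measurable_fun setT (fun x => `|(f x)%:E|%E) by exact: measurableT_comp.
have := ge0_integral_affine maf (fun=> abse_ge0 _) => /= ->.
by rewrite lte_mul_pinfty.
Qed.

Let Rintegral_affine_ge0 (f : T -> R) : (forall x, 0 <= f x) ->
  mu.-integrable setT (EFin \o f) -> \int[mu]_x f (S x) = c ^- d * \int[mu]_x f x.
Proof.
move=> f0 If; rewrite /Rintegral.
rewrite (ge0_integral_affine (f := EFin \o f)).
- by rewrite fineM//; exact: integrable_fin_num.
- by case/integrableP : If.
- by move=> x; rewrite lee_fin.
Qed.

Lemma Rintegral_affine (f : T -> R) : mu.-integrable setT (EFin \o f) ->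
  \int[mu]_x f (S x) = c ^- d * \int[mu]_x f x.
Proof.
move=> If; have Ip := integrable_funrpos measurableT If.
have In := integrable_funrneg measurableT If.
have -> : f = (fun x => f^\+ x - f^\- x) by apply/funext => x; rewrite -[in LHS](funrposBneg f).
rewrite (RintegralB measurableT Ip In).
rewrite (RintegralB measurableT (integrable_affine Ip) (integrable_affine In)).
by rewrite !Rintegral_affine_ge0// mulrBr.
Qed.

End affine_change_of_variables.

(** * Mean value inequalities *)

Section directional_derivatives.
Context {R : realType} {V : normedModType R}.
Implicit Types (f : V -> R) (x v : V).

Lemma is_derive_line f x v (s : R) : derivable f (x + s *: v) v ->
  is_derive s (1 : R) (fun t : R => f (x + t *: v)) ('D_v f (x + s *: v)).
Proof.
move=> df.
have E : (fun h : R => h^-1 *: (((fun t : R => f (x + t *: v)) \o shift s) (h *: 1) - f (x + s *: v))) =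
    (fun h : R => h^-1 *: ((f \o shift (x + s *: v)) (h *: v) - f (x + s *: v))).
  by apply/funext => h /=; rewrite [h *: 1]mulr1 scalerDl addrCA.
by split; [rewrite /derivable E|rewrite /derive E].
Qed.

(** The mean value theorem on a line; [Num.min] and [Num.max] allow t of either sign. *)
Lemma mvt_bound f x v (t M : R) :
  (forall s, Num.min 0 t <= s <= Num.max 0 t -> derivable f (x + s *: v) v) ->
  (forall s, Num.min 0 t <= s <= Num.max 0 t -> `|'D_v f (x + s *: v)| <= M) ->
  `|f (x + t *: v) - f x| <= M * `|t|.
Proof.
move=> df bf.
pose g (s : R) := f (x + s *: v).
have H a b : a < b -> (forall s, a <= s <= b -> derivable f (x + s *: v) v) ->
  (forall s, a <= s <= b -> `|'D_v f (x + s *: v)| <= M) -> `|g b - g a| <= M * (b - a).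
  move=> ab dab bab.
  have dg s : a <= s <= b -> is_derive s (1 : R) g ('D_v f (x + s *: v)).
    by move=> /dab; exact: is_derive_line.
  have [||s + ->] := @MVT _ g (fun s => 'D_v f (x + s *: v)) _ _ ab.
  - by move=> s; rewrite in_itv/= => /andP[s1 s2]; apply: dg; rewrite !ltW.
  - apply: derivable_within_continuous => s; rewrite in_itv/= => sab.
    by have := dg s sab; case.
  rewrite in_itv/= => /andP[s1 s2]; rewrite normrM (gtr0_norm (_ : 0 < b - a)) ?subr_gt0//.
  by rewrite ler_wpM2r ?subr_ge0 ?(ltW ab)// bab// !ltW.
have [t0|t0|<-] := ltgtP 0 t.
- have := H 0 t t0; rewrite /g scale0r addr0 subr0 (gtr0_norm t0).
  by move: df bf; rewrite (min_l (ltW t0)) (max_r (ltW t0)) => df bf; apply.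
- have := H t 0 t0; rewrite /g scale0r addr0 sub0r distrC (ltr0_norm t0).
  by move: df bf; rewrite (min_r (ltW t0)) (max_l (ltW t0)) => df bf; apply.
- by rewrite scale0r addr0 subrr !normr0 mulr0.
Qed.

(** The increments are the terms of a sequence, 1 / (n + 1), because dominated convergence is stated
    for sequences. *)
Lemma cvg_difference_quotient f x v : derivable f x v ->
  (fun n : nat => n.+1%:R * (f (x + n.+1%:R^-1 *: v) - f x)) @ \oo --> 'D_v f x.
Proof.
move=> df.
have H : (fun n : nat => (n.+1%:R^-1 : R)) @ \oo --> (0:R)^'.
  move=> A [e /= e0 eA].
  have /cvgrPdist_lt/(_ e e0) := @cvg_harmonic R.
  apply: filterS => n /=; rewrite sub0r normrN => ne.
  by apply: eA => //=; rewrite ?invr_neq0 ?pnatr_eq0// sub0r normrN.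
have := cvg_comp _ _ H df; rewrite -/('D_v f x).
by apply: cvg_trans; apply: near_eq_cvg; apply: nearW => n /=; rewrite invrK [_ + x]addrC.
Qed.

End directional_derivatives.

Section coordinatewise_C1.
Context {R : realType} {d : nat}.
Local Notation E := 'rV[R]_d.
Implicit Types (f : E -> R) (x y : E).

Lemma norm_delta_mx (i : 'I_d) (s : R) : `|s *: (delta_mx 0 i : E)| <= `|s|.
Proof.
apply: ler_norm_coord => // j; rewrite !mxE eqxx/=.
by case: eqP => _; rewrite ?mulr1// mulr0 normr0.
Qed.

(** From x to y one coordinate at a time: a sup-norm ball is a cube, so the intermediate points stay
    in it and the mean value inequality applies on each edge. *)
Lemma partial_bounded_lipschitz f (x0 : E) (r M : R) :
  (forall x i, `|x - x0| < r -> derivable f x (delta_mx 0 i : E)) ->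
  (forall x i, `|x - x0| < r -> `|partial i f x| <= M) ->
  forall x y, `|x - x0| < r -> `|y - x0| < r -> `|f y - f x| <= M * d%:R * `|y - x|.
Proof.
move=> df bf x y xr yr.
have r0 : 0 < r by exact: le_lt_trans xr.
pose z k : E := \row_j (if (j < k)%N then y 0 j else x 0 j).
have z0 : z 0%N = x by apply/rowP => j; rewrite mxE.
have zd : z d = y by apply/rowP => j; rewrite mxE ltn_ord.
have step k : (k < d)%N -> `|f (z k.+1) - f (z k)| <= M * `|y - x|.
  move=> kd; pose i := Ordinal kd; pose t := y 0 i - x 0 i.
  have -> : z k.+1 = z k + t *: delta_mx 0 i.
    apply/rowP => j; rewrite !mxE eqxx/= ltnS leq_eqVlt.
    have -> : (j == i) = (j == k :> nat) by [].
    case: eqP => [jk|_] /=; last by rewrite mulr0 addr0.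
    have -> : j = i by apply: val_inj.
    by rewrite /= ltnn mulr1 /t addrC subrK.
  have zs s : Num.min 0 t <= s <= Num.max 0 t -> `|z k + s *: delta_mx 0 i - x0| < r.
    move=> st; apply: ltr_norm_coord => // j; rewrite !mxE eqxx/=.
    have Hx := le_lt_trans (ler_coord_norm (x - x0) j) xr.
    have Hy := le_lt_trans (ler_coord_norm (y - x0) j) yr.
    rewrite !mxE in Hx Hy.
    have [ji|ji] := eqVneq j i; last by rewrite mulr0 addr0; case: ifP.
    rewrite ji /= ltnn mulr1; rewrite ji in Hx Hy; move: st Hx Hy; rewrite /t.
    move: (x 0 i) (y 0 i) (x0 0 i) => a b c.
    by rewrite !ltr_norml; case: (leP 0 (b - a)) => _ /andP[] ? ? /andP[] ? ? /andP[] ? ?; apply/andP; split; lra.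
  apply: (@le_trans _ _ (M * `|t|)).
    by apply: mvt_bound => s st; [apply: df|apply: bf]; exact: zs.
  have M0 : 0 <= M by exact: le_trans (bf x i xr).
  by rewrite ler_wpM2l//; have := ler_coord_norm (y - x) i; rewrite !mxE.
have H k : (k <= d)%N -> `|f (z k) - f x| <= M * k%:R * `|y - x|.
  elim: k => [|k IHk] kd; first by rewrite z0 subrr normr0 mulr0 mul0r.
  rewrite -[f (z k.+1)](subrK (f (z k))) -addrA; apply: (le_trans (ler_normD _ _)).
  rewrite -natr1 mulrDr mulrDl mulr1 [leRHS]addrC lerD//; first exact: step.
  exact/IHk/ltnW.
by have := H d (leqnn d); rewrite zd.
Qed.

Lemma partial_bounded_continuous f (x0 : E) (r : R) :
  (forall x i, `|x - x0| < r -> derivable f x (delta_mx 0 i : E)) ->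
  (forall i, exists C, forall x, `|x - x0| < r -> `|partial i f x| <= C) ->
  forall x, `|x - x0| < r -> {for x, continuous f}.
Proof.
move=> df /choice[C HC] x xr; pose L := (\sum_i `|C i|) * d%:R.
have lip y : `|y - x0| < r -> `|f y - f x| <= L * `|y - x|.
  move=> yr; apply: (partial_bounded_lipschitz df) => // z i zr; apply: (le_trans (HC i z zr)).
  by rewrite (le_trans (ler_norm _))// (bigD1 i)//= lerDl sumr_ge0.
apply/(@cvgrPdist_lt _ _ _ (nbhs (x : E))) => e e0.
have L0 : 0 < L + 1 by rewrite ltr_wpDl// mulr_ge0// sumr_ge0.
apply/nbhs_ballP; exists (Num.min (r - `|x - x0|) (e / (L + 1))) => [|y].
  by rewrite /= lt_min subr_gt0 xr divr_gt0.
rewrite -ball_normE /ball_/= lt_min distrC => /andP[y1 y2].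
have yr : `|y - x0| < r.
  have := ler_normD (y - x) (x - x0); rewrite addrA subrK => /le_lt_trans; apply.
  by rewrite -ltrBrDr.
rewrite distrC; apply: (le_lt_trans (lip y yr)).
apply: (@le_lt_trans _ _ ((L + 1) * `|y - x|)); first by rewrite ler_wpM2r// lerDl.
by rewrite mulrC -ltr_pdivlMr.
Qed.

End coordinatewise_C1.

Section integration_by_parts.
Context {R : realType} {d : nat}.
Local Notation E := 'rV[R]_d.
Local Notation T := (caratheodory_type (leb_om R d)).
Local Notation mu := (leb R d).
Local Notation intg f := (mu.-integrable (setT : set T) (EFin \o f)).

Definition bsupp (M : R) (f : E -> R) := forall x, M < `|x| -> f x = 0.

Lemma measurable_norm_le (M : R) : measurable ([set x : E | `|x| <= M] : set T).
Proof.
apply: closed_measurable_Rd.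
apply: (@closed_comp _ _ (fun x : E => `|x|) [set y | y <= M]); last exact: closed_le.
by move=> x _; exact: norm_continuous.
Qed.

Lemma leb_norm_le (M : R) : (mu [set x : E | (`|x| <= M)%R] < +oo)%E.
Proof. exact: (@leb_bounded _ _ _ M). Qed.

Lemma restrict_bsupp M f : bsupp M f -> f \_ [set x : E | `|x| <= M] = f.
Proof.
move=> sf; apply/funext => x; rewrite /patch; case: ifPn => //.
by rewrite notin_setE/= => /negP; rewrite -ltNge => /sf ->.
Qed.

Lemma integrable_bsupp M C f : measurable_fun (setT : set T) f -> bsupp M f ->
  (forall x, `|f x| <= C) -> intg f.
Proof.
move=> mf sf fC; rewrite -(restrict_bsupp sf) -restrict_EFin.
apply/(integrable_mkcond _ (measurable_norm_le M)).
apply: (@integrable_bounded _ _ _ mu _ (measurable_norm_le M) _ C) => //.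
- exact: leb_norm_le.
- exact: measurable_funS mf.
Qed.

Lemma Rintegral_supp (D : set T) (f : T -> R) : (forall x, ~ D x -> f x = 0) ->
  \int[mu]_x f x = \int[mu]_(x in D) f x.
Proof.
move=> fD; rewrite [RHS]Rintegral_mkcond; apply: eq_Rintegral => x _.
by rewrite /patch; case: ifPn => //; rewrite notin_setE => /fD.
Qed.

(** By translation invariance each difference quotient has integral 0, and dominated convergence
    carries this over to the derivative. *)
Lemma Rintegral_partial_eq0 (f : E -> R) (i : 'I_d) (M C : R) :
  measurable_fun (setT : set T) f -> bsupp M f ->
  (forall x, derivable f x (delta_mx 0 i : E)) ->
  (forall x, `|partial i f x| <= C) -> intg f ->
  measurable_fun (setT : set T) (partial i f) /\ volint setT (partial i f) = 0.
Proof.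
move=> mf sf df fC If.
pose e : E := delta_mx 0 i.
pose F (n : nat) (x : T) : R := n.+1%:R * (f (x + n.+1%:R^-1 *: e) - f x).
have E1 (n : nat) x : f (x + n.+1%:R^-1 *: e) = f ((1 : R) *: x + n.+1%:R^-1 *: e) by rewrite scale1r.
have Is (n : nat) : intg (fun x : E => f (x + n.+1%:R^-1 *: e)).
  under [X in _.-integrable _ (_ \o X)]eq_fun do rewrite E1.
  exact: (integrable_affine _ ltr01).
have mF n : measurable_fun setT (F n).
  apply: measurable_funM; first exact: measurable_cst.
  apply: measurable_funB; last exact: mf.
  by apply/measurable_EFinP; case/integrableP : (Is n).
have FD (x : E) : (fun n => F n x) @ \oo --> partial i f x by exact: cvg_difference_quotient.
have mD : measurable_fun (setT : set T) (partial i f : T -> R).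
  exact: (measurable_fun_cvg mF (fun x _ => FD x)).
split=> //.
(* The increments are at most 1, so the difference quotients vanish for |x| > M + 1; elsewhere they
   are bounded by C. *)
pose B := [set x : E | `|x| <= M + 1].
pose g : E -> R := (fun=> C) \_ B.
have Ig : intg g.
  rewrite /g -restrict_EFin; apply/(integrable_mkcond _ (measurable_norm_le _)).
  by apply: integrable_cst_fin; [exact: measurable_norm_le|exact: leb_norm_le].
have Fg n x : setT x -> `|F n x| <= g x.
  move=> _; rewrite /F /g /patch normrM ger0_norm//; case: ifPn => [_|].
    rewrite -ler_pdivlMl// mulrC -[X in C * X]ger0_norm ?invr_ge0//.
    by apply: mvt_bound => s _; [exact: df|exact: fC].
  rewrite notin_setE => /negP; rewrite -ltNge => xM; rewrite !sf ?subrr ?normr0 ?mulr0//; first by lra.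
  have := ler_normD (x + n.+1%:R^-1 *: e) (- (n.+1%:R^-1 *: e)).
  rewrite addrK normrN; have := @norm_delta_mx R d i n.+1%:R^-1.
  rewrite (ger0_norm (_ : 0 <= n.+1%:R^-1)) ?invr_ge0// => H1 H2.
  have : n.+1%:R^-1 <= 1 :> R by rewrite invf_le1 ?ltr0n// ler1n.
  by move: H1 H2; rewrite -/e; move: (n.+1%:R^-1) => r; lra.
have [_ cI] := Rintegral_dominated measurableT mF mD Ig (aeW mu (fun (x : T) _ => FD x)) Fg.
rewrite /volint -(cvg_lim _ cI)//; apply/cvg_lim => //.
rewrite (_ : (fun n => _) = fun=> 0); first exact: cvg_cst.
apply/funext => n.
rewrite (RintegralZl _ measurableT (integrable_subr measurableT (Is n) If)).
rewrite (RintegralB measurableT (Is n) If).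
under eq_Rintegral do rewrite E1.
by rewrite (Rintegral_affine _ ltr01 If) expr1n invr1 mul1r subrr mulr0.
Qed.

End integration_by_parts.

(** * Smooth functions and cutoffs *)

Section smooth_functions.
Context {R : realType} {d : nat}.
Local Notation E := 'rV[R]_d.
Local Notation e_ i := (delta_mx 0 i : E).
Implicit Types (f g : E -> R) (x : E) (i j : 'I_d).

Lemma derive_from_line f x (v : E) (l : R) :
  is_derive (0 : R) (1 : R) (fun t : R => f (x + t *: v)) l ->
  derivable f x v /\ 'D_v f x = l.
Proof.
move=> [df fl].
have EQ : (fun h : R => h^-1 *: (((fun t : R => f (x + t *: v)) \o shift 0) (h *: 1) - f (x + 0 *: v))) =
    (fun h : R => h^-1 *: ((f \o shift x) (h *: v) - f x)).
  by apply/funext => h /=; rewrite [h *: 1]mulr1 scale0r !addr0 [x + _]addrC.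
move: df fl; rewrite /derivable /derive EQ => df fl; split => //.
Qed.

(** [smooth] quantifies over lists of partial derivatives; this recursive form lets products,
    inverses and compositions be treated by induction on n. The case n = 1 is also the regularity
    class of the trial functions. *)
Fixpoint Ck n f : Prop :=
  if n is n'.+1 then
    [/\ continuous f, forall x i, derivable f x (e_ i) & forall i, Ck n' (partial i f)]
  else continuous f.

Lemma CkS n f : Ck n.+1 f -> Ck n f.
Proof.
elim: n f => [|n IHn] f [cf df pf] //.
by split => // i; apply: IHn; exact: pf.
Qed.

Lemma smooth_partial f i : smooth f -> smooth (partial i f).
Proof. by move=> sf s; have := sf (rcons s i); rewrite foldr_rcons. Qed.

Lemma smooth_continuous f : smooth f -> continuous f.
Proof. by move=> /(_ [::]) []. Qed.

Lemma smooth_derivable f x i : smooth f -> derivable f x (e_ i).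
Proof. by move=> /(_ [::]) [_]; exact. Qed.

Lemma smoothP f : smooth f <-> forall n, Ck n f.
Proof.
split.
  move=> sf n; elim: n f sf => [|n IHn] f sf; first exact: smooth_continuous.
  split; [exact: smooth_continuous|by move=> *; exact: smooth_derivable|].
  by move=> i; apply: IHn; exact: smooth_partial.
move=> Cf s; elim/last_ind: s f Cf => [|s i IHs] f Cf /=.
  by have [] := Cf 1%N.
by rewrite foldr_rcons; apply: IHs => n; have [_ _] := Cf n.+1; exact.
Qed.

Lemma partialD f g x i : derivable f x (e_ i) -> derivable g x (e_ i) ->
  partial i (fun y => f y + g y) x = partial i f x + partial i g x.
Proof. by move=> df dg; exact: (deriveD df dg). Qed.

Lemma partialM f g x i : derivable f x (e_ i) -> derivable g x (e_ i) ->
  partial i (fun y => f y * g y) x = f x * partial i g x + g x * partial i f x.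
Proof. by move=> df dg; exact: (deriveM df dg). Qed.

Lemma partialZ c f x i : derivable f x (e_ i) ->
  partial i (fun y => c * f y) x = c * partial i f x.
Proof. by move=> df; exact: (deriveZ c df). Qed.

Lemma partial_cst c x i : partial i (fun=> c) x = 0.
Proof. exact: (derive_cst c). Qed.

Lemma Ck_cst n (c : R) : Ck n (fun=> c).
Proof.
elim: n c => [|n IHn] c; first exact: cst_continuous.
split; [exact: cst_continuous|by move=> x i; exact: (derivable_cst c)|] => i.
have -> : partial i (fun=> c) = fun=> 0 by apply/funext => x; exact: partial_cst.
exact: IHn.
Qed.

Lemma CkD n f g : Ck n f -> Ck n g -> Ck n (fun x => f x + g x).
Proof.
elim: n f g => [|n IHn] f g; first by move=> cf cg x; exact: (continuousD (cf x) (cg x)).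
move=> [cf df pf] [cg dg pg]; split.
- by move=> x; exact: (continuousD (cf x) (cg x)).
- by move=> x i; exact: (derivableD (df x i) (dg x i)).
move=> i; have -> : partial i (fun x => f x + g x) = fun x => partial i f x + partial i g x.
  by apply/funext => x; exact: partialD.
by apply: IHn; [exact: pf|exact: pg].
Qed.

Lemma CkM n f g : Ck n f -> Ck n g -> Ck n (fun x => f x * g x).
Proof.
elim: n f g => [|n IHn] f g; first by move=> cf cg x; exact: (continuousM (cf x) (cg x)).
move=> Cf Cg; have [cf df pf] := Cf; have [cg dg pg] := Cg; split.
- by move=> x; exact: (continuousM (cf x) (cg x)).
- by move=> x i; exact: (derivableM (df x i) (dg x i)).
move=> i; have -> : partial i (fun x => f x * g x) =
    fun x => f x * partial i g x + g x * partial i f x.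
  by apply/funext => x; exact: partialM.
by apply: CkD; apply: IHn; [exact: CkS|exact: pg|exact: CkS|exact: pf].
Qed.

Lemma CkV n f : (forall x, f x != 0) -> Ck n f -> Ck n (fun x => (f x)^-1).
Proof.
move=> f0; elim: n => [|n IHn]; first by move=> cf x; exact: (continuousV (f0 x) (cf x)).
move=> Cf; have [cf df pf] := Cf; split.
- by move=> x; exact: (continuousV (f0 x) (cf x)).
- by move=> x i; exact: (derivableV (f0 x) (df x i)).
move=> i; have -> : partial i (fun x => (f x)^-1) =
    fun x => (-1 * ((f x)^-1 * (f x)^-1)) * partial i f x.
  apply/funext => x; rewrite /partial (deriveV (f0 x) (df x i)).
  by rewrite -exprVn expr2 mulN1r.
have Cv : Ck n (fun x => (f x)^-1) by apply: IHn; exact: CkS.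
by apply: CkM; [apply: CkM; [exact: Ck_cst|exact: CkM]|exact: pf].
Qed.

Lemma Ck_sum n (I : Type) (r : seq I) (F : I -> E -> R) :
  (forall k, Ck n (F k)) -> Ck n (fun x => \sum_(k <- r) F k x).
Proof.
move=> CF; elim: r => [|k r IHr].
  by under eq_fun do rewrite big_nil; exact: Ck_cst.
by under eq_fun do rewrite big_cons; exact: CkD.
Qed.

Lemma Ck_prod n (I : Type) (r : seq I) (F : I -> E -> R) :
  (forall k, Ck n (F k)) -> Ck n (fun x => \prod_(k <- r) F k x).
Proof.
move=> CF; elim: r => [|k r IHr].
  by under eq_fun do rewrite big_nil; exact: Ck_cst.
by under eq_fun do rewrite big_cons; exact: CkM.
Qed.

Lemma derive_affine f (c : R) (h x v : E) : derivable f (c *: x + h) v ->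
  derivable (fun y : E => f (c *: y + h)) x v /\
  'D_v (fun y : E => f (c *: y + h)) x = c * 'D_v f (c *: x + h).
Proof.
move=> df; apply: derive_from_line.
have EQ : (fun t : R => f (c *: (x + t *: v) + h)) =
    (fun t : R => f ((c *: x + h) + t *: v)) \o (c \*: id).
  by apply/funext => t /=; rewrite scalerDr scalerA addrAC.
rewrite EQ mulrC; apply: is_derive1_comp.
  rewrite /= scaler0; have := @is_derive_line R E f (c *: x + h) v 0.
  by rewrite scale0r addr0 => /(_ df).
by apply: is_derive_eq; rewrite [c *: 1]mulr1.
Qed.

Lemma continuous_affine (c : R) (h : E) : continuous (fun x : E => c *: x + h).
Proof.
move=> x; apply: continuousD; last exact: cst_continuous.
exact: scaler_continuous.
Qed.

Lemma Ck_affine n f (c : R) (h : E) : Ck n f -> Ck n (fun x => f (c *: x + h)).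
Proof.
elim: n f => [|n IHn] f.
  by move=> cf x; apply: (continuous_comp (@continuous_affine c h x)); exact: cf.
move=> [cf df pf]; split.
- by move=> x; apply: (continuous_comp (@continuous_affine c h x)); exact: cf.
- by move=> x i; have [] := derive_affine (df (c *: x + h) i).
move=> i; have -> : partial i (fun x => f (c *: x + h)) = fun x => c * partial i f (c *: x + h).
  by apply/funext => x; have [_] := derive_affine (df (c *: x + h) i).
by apply: CkM; [exact: Ck_cst|exact/(IHn (partial i f))/pf].
Qed.

(** The function of one variable is given through the sequence of its successive derivatives, so
    each differentiation just advances the index. *)
Lemma Ck_coord n (b : nat -> R -> R) (k : nat) (a c : R) i :
  (forall m t, is_derive t (1 : R) (b m) (b m.+1 t)) ->
  Ck n (fun x => b k (a * x 0 i + c)).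
Proof.
move=> db.
have ct m : continuous (fun x : E => b m (a * x 0 i + c)).
  move=> x; apply: (@continuous_comp _ _ _ (fun x : E => a * x 0 i + c) (b m)); last first.
    by apply: differentiable_continuous; apply/derivable1_diffP; case: (db m (a * x 0 i + c)).
  apply: continuousD; last exact: cst_continuous.
  by apply: continuousM; [exact: cst_continuous|exact: coord_continuous].
have dd m x j : derivable (fun x : E => b m (a * x 0 i + c)) x (e_ j) /\
    'D_(e_ j) (fun x : E => b m (a * x 0 i + c)) x = (a * (j == i)%:R) * b m.+1 (a * x 0 i + c).
  apply: derive_from_line.
  have -> : (fun t : R => b m (a * (x + t *: e_ j) 0 i + c)) =
     b m \o ((a * (j == i)%:R) \*: id + cst (a * x 0 i + c)).
    apply/funext => t /=; congr (b m _).
    rewrite !mxE eqxx/= [i == j]eq_sym /GRing.scale/=.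
    transitivity (a * (j == i)%:R * t + (a * x 0 i + c)) => //; ring.
  rewrite [X in is_derive _ _ _ X]mulrC; apply: is_derive1_comp; last first.
    by apply: is_derive_eq; rewrite addr0; exact: mulr1.
  suff -> : ((a * (j == i)%:R) \*: id + cst (a * x 0 i + c)) (0 : R) = a * x 0 i + c by [].
  by transitivity (a * (j == i)%:R * 0 + (a * x 0 i + c)) => //; rewrite mulr0 add0r.
elim: n k => [|n IHn] k; first exact: ct.
split; [exact: ct|by move=> x j; exact: (dd k x j).1|] => j.
have -> : partial j (fun x => b k (a * x 0 i + c)) =
    fun x => (a * (j == i)%:R) * b k.+1 (a * x 0 i + c).
  by apply/funext => x; exact: (dd k x j).2.
by apply: CkM; [exact: Ck_cst|exact: IHn].
Qed.

End smooth_functions.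

Section bump.
Context {R : realType}.

(** Differentiating P(1 / x) exp(- 1 / x) gives x^-2 (P - P')(1 / x) exp(- 1 / x), whence the
    recursion and its factor ['X^2]. *)
Fixpoint bump_poly (n : nat) : {poly R} :=
  if n is n'.+1 then 'X^2 * (bump_poly n' - (bump_poly n')^`()) else 1.

(* The [n]-th derivative of the flat function [exp (- 1 / x)], [0] for [x <= 0]. *)
Definition flat (n : nat) (x : R) : R :=
  if 0 < x then (bump_poly n).[x^-1] * expR (- x^-1) else 0.

(** Each power is absorbed by the exponential: y^i <= i! exp y for y >= 0. *)
Lemma poly_expR_bound (Q : {poly R}) :
  exists2 C, 0 <= C & forall y, 0 <= y -> `|Q.[y]| * expR (- y) <= C.
Proof.
exists (\sum_(i < size Q) `|Q`_i| * i`!%:R).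
  by apply: sumr_ge0 => i _; rewrite mulr_ge0.
move=> y y0; rewrite horner_coef.
rewrite expRN ler_pdivrMr ?expR_gt0// mulr_suml.
apply: (le_trans (ler_norm_sum _ _ _)); apply: ler_sum => i _.
rewrite normrM -mulrA ler_wpM2l// normrX (ger0_norm y0).
case: (nat_of_ord i) => [|k].
  by rewrite expr0 mul1r (le_trans _ (expR_ge1Dx y))// lerDl.
have H := expR_ge1Dxn k y0.
rewrite -ler_pdivrMl ?ltr0n ?fact_gt0// [_^-1 * _]mulrC.
by apply: le_trans H; rewrite lerDr.
Qed.

Let flat0 n : is_derive (0 : R) (1 : R) (flat n) (flat n.+1 0).
Proof.
have -> : flat n.+1 0 = 0 by rewrite /flat ltxx.
(* The quotient h^-1 P(1 / h) exp(- 1 / h) is h times (X^2 P)(1 / h) exp(- 1 / h); bounding the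
   latter makes it O(h). *)
have [C C0 HC] := poly_expR_bound ('X^2 * bump_poly n).
have lim : (fun h : R => h^-1 *: ((flat n \o shift 0) (h *: 1) - flat n 0)) @ 0^' --> (0 : R).
  have C1 : 0 < C + 1 by lra.
  apply/cvgrPdist_lt => e e0; near=> h.
  rewrite sub0r normrN /= addr0 [h *: 1]mulr1 /flat ltxx subr0.
  case: ifPn => h0; last by rewrite scaler0 normr0.
  have hi : 0 < h^-1 by rewrite invr_gt0.
  have := HC _ (ltW hi); rewrite hornerM hornerXn normrM => H.
  rewrite normrM (gtr0_norm hi) normrM (gtr0_norm (expR_gt0 _)).
  have : `|h^-1 ^+ 2| * `|(bump_poly n).[h^-1]| * expR (- h^-1) * h <= C * h.
    by rewrite ler_wpM2r// ltW.
  rewrite normrX (gtr0_norm hi) => H'.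
  have -> : h^-1 * (`|(bump_poly n).[h^-1]| * expR (- h^-1)) =
     h^-1 ^+ 2 * `|(bump_poly n).[h^-1]| * expR (- h^-1) * h.
    by field; rewrite gt_eqF.
  apply: (le_lt_trans H').
  have hd : h < e / (C + 1).
    rewrite -(gtr0_norm h0); near: h.
    by apply: dnbhs0_lt; rewrite divr_gt0.
  move: hd; rewrite ltr_pdivlMr// mulrC mulrDl mul1r; lra.
split; first by apply/cvg_ex; exists 0.
exact/cvg_lim.
Unshelve. all: by end_near. Qed.

Lemma is_derive_flat n (x : R) : is_derive x (1 : R) (flat n) (flat n.+1 x).
Proof.
have [x0|x0|<-] := ltgtP 0 x; last exact: flat0.
- pose F (y : R) := (bump_poly n).[y^-1] * expR (- y^-1).
  have nearF : {near x, F =1 flat n}.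
    near=> y; rewrite /flat ifT//; near: y; exact: lt_nbhsr.
  suff : is_derive x (1 : R) F (flat n.+1 x) by exact: near_eq_is_derive.
  have xn0 : x != 0 by rewrite gt_eqF.
  have dV : is_derive x (1 : R) (fun y : R => y^-1) (- x ^- 2).
    have := @is_deriveV R id x 1 1 xn0 (is_derive_id _ _); rewrite [_ *: 1]mulr1; exact.
  have dP : is_derive x (1 : R) (fun y : R => (bump_poly n).[y^-1])
      ((bump_poly n)^`().[x^-1] * - x ^- 2).
    exact: (@is_derive1_comp R (horner (bump_poly n)) (fun y => y^-1)).
  have dE : is_derive x (1 : R) (fun y : R => expR (- y^-1)) (expR (- x^-1) * x ^- 2).
    apply: (@is_derive1_comp R expR (fun y => - y^-1)).
    by rewrite -[X in is_derive _ _ _ X]opprK; exact: is_deriveN.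
  apply: (is_derive_eq (is_deriveM dP dE)).
  rewrite /flat x0 /= hornerM hornerXn hornerD hornerN -exprVn /GRing.scale/=.
  by ring.
- have nearF : {near x, cst 0 =1 flat n}.
    near=> y; rewrite /flat ifF//; apply/negbTE; rewrite -leNgt ltW//.
    near: y; exact: lt_nbhsl.
  have -> : flat n.+1 x = 0 by rewrite /flat ltNge (ltW x0).
  exact: near_eq_is_derive nearF (is_derive_cst _ _ _).
Unshelve. all: by end_near. Qed.

End bump.

Section cutoff.
Context {R : realType} {d : nat}.
Local Notation E := 'rV[R]_d.

Lemma flat_gt0 (x : R) : 0 < x -> 0 < flat 0 x.
Proof. by move=> x0; rewrite /flat x0 hornerC mul1r expR_gt0. Qed.

Lemma flat_le0 n (x : R) : x <= 0 -> flat n x = 0.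
Proof. by move=> x0; rewrite /flat ltNge x0. Qed.

Lemma flat_ge0 (x : R) : 0 <= flat 0 x.
Proof. by have [/flat_le0->//|/flat_gt0/ltW] := leP x 0. Qed.

(** x and 1 - x are never both nonpositive, so the denominator of [step] does not vanish. *)
Lemma flat_sum_gt0 (x : R) : 0 < flat 0 x + flat 0 (1 - x).
Proof.
have [x0|x0] := leP x 0; last by rewrite ltr_pwDl ?flat_gt0 ?flat_ge0.
by rewrite ltr_wpDl ?flat_ge0// flat_gt0//; lra.
Qed.

Definition step (t : R) := flat 0 t / (flat 0 t + flat 0 (1 - t)).

Lemma step_ge0 t : 0 <= step t.
Proof. by rewrite divr_ge0 ?flat_ge0// ltW// flat_sum_gt0. Qed.

Lemma step_le1 t : step t <= 1.
Proof. by rewrite ler_pdivrMr ?flat_sum_gt0// mul1r lerDl flat_ge0. Qed.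

Lemma step_eq0 t : t <= 0 -> step t = 0.
Proof. by move=> t0; rewrite /step flat_le0// mul0r. Qed.

Lemma step_eq1 t : 1 <= t -> step t = 1.
Proof.
move=> t1; rewrite /step (@flat_le0 0 (1 - t)) ?subr_le0// addr0 divff//.
by rewrite gt_eqF// flat_gt0//; lra.
Qed.

(** A product over the coordinates because the norm is the sup norm: for 0 < s and r < s it is 1 on
    the cube |x| <= r and 0 where |x| >= s, the two factors of index i cutting x_i at its two
    ends. *)
Definition cutoff (r s : R) (x : E) : R :=
  \prod_i (step ((s - x 0 i) / (s - r)) * step ((s + x 0 i) / (s - r))).

Lemma cutoff_ge0 r s x : 0 <= cutoff r s x.
Proof. by apply: prodr_ge0 => i _; rewrite mulr_ge0 ?step_ge0. Qed.

Lemma cutoff_le1 r s x : cutoff r s x <= 1.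
Proof.
suff /andP[] : 0 <= cutoff r s x <= 1 by [].
rewrite /cutoff; elim/big_ind : _ => [|a b /andP[a0 a1] /andP[b0 b1]|i _].
- by rewrite ler01 lexx.
- by rewrite mulr_ge0// mulr_ile1.
- by rewrite mulr_ge0 ?step_ge0//= mulr_ile1 ?step_ge0 ?step_le1.
Qed.

Lemma cutoff_eq1 r s x : r < s -> `|x| <= r -> cutoff r s x = 1.
Proof.
move=> rs xr; rewrite /cutoff big1// => i _.
have := le_trans (ler_coord_norm x i) xr; rewrite ler_norml => /andP[x1 x2].
by rewrite !step_eq1 ?mulr1// ler_pdivlMr ?subr_gt0// mul1r; lra.
Qed.

Lemma cutoff_eq0 r s x : 0 < s -> r < s -> s <= `|x| -> cutoff r s x = 0.
Proof.
move=> s0 rs; rewrite leNgt => /negP sx; apply/eqP; apply/negPn/negP => c0; apply: sx.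
apply: ltr_norm_coord => // i; rewrite ltNge; apply/negP => sx.
move/negP : c0; apply; rewrite /cutoff (bigD1 i)//= mulf_eq0; apply/orP; left.
have sr0 : 0 < (s - r)^-1 by rewrite invr_gt0 subr_gt0.
have [x0|x0] := leP 0 (x 0 i).
  move: sx; rewrite ger0_norm// => sx.
  by rewrite step_eq0 ?mul0r// pmulr_lle0//; lra.
move: sx; rewrite ltr0_norm// => sx.
by rewrite [X in _ * X]step_eq0 ?mulr0// pmulr_lle0//; lra.
Qed.

Lemma cutoffN r s x : cutoff r s (- x) = cutoff r s x.
Proof. by apply: eq_bigr => i _; rewrite mxE opprK mulrC. Qed.

Lemma smooth_cutoff r s : smooth (cutoff r s).
Proof.
apply/smoothP => n; apply: Ck_prod => i.
have H (a c : R) : Ck n (fun x : E => step (a * x 0 i + c)).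
  apply: CkM; first exact: Ck_coord is_derive_flat.
  apply: CkV; first by move=> x; rewrite gt_eqF// flat_sum_gt0.
  apply: CkD; first exact: Ck_coord is_derive_flat.
  have -> : (fun x : E => flat 0 (1 - (a * x 0 i + c))) = (fun x : E => flat 0 ((- a) * x 0 i + (1 - c))).
    by apply/funext => x; congr flat; ring.
  exact: Ck_coord is_derive_flat.
have -> : (fun x : E => step ((s - x 0 i) / (s - r)) * step ((s + x 0 i) / (s - r))) =
   (fun x : E => step ((- (s - r)^-1) * x 0 i + s / (s - r)) * step ((s - r)^-1 * x 0 i + s / (s - r))).
  by apply/funext => x; congr (step _ * step _); ring.
exact: CkM.
Qed.

End cutoff.

Section test_functions.
Context {R : realType} {d : nat}.
Local Notation E := 'rV[R]_d.
Local Notation T := (caratheodory_type (leb_om R d)).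
Local Notation mu := (leb R d).
Local Notation e_ i := (delta_mx 0 i : E).
Implicit Types (f g phi : E -> R) (U K : set E).

Lemma smoothD f g : smooth f -> smooth g -> smooth (fun x => f x + g x).
Proof. by move=> /smoothP sf /smoothP sg; apply/smoothP => n; exact: CkD. Qed.

Lemma smoothM f g : smooth f -> smooth g -> smooth (fun x => f x * g x).
Proof. by move=> /smoothP sf /smoothP sg; apply/smoothP => n; exact: CkM. Qed.

Lemma smooth_cst (c : R) : smooth (fun _ : E => c).
Proof. by apply/smoothP => n; exact: Ck_cst. Qed.

Lemma smooth_affine f (c : R) (h : E) : smooth f -> smooth (fun x => f (c *: x + h)).
Proof. by move=> /smoothP sf; apply/smoothP => n; exact: Ck_affine. Qed.

Lemma compact_norm_le (p : E) (r : R) : compact [set x : E | `|x - p| <= r].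
Proof.
apply: bounded_closed_compact.
  exists (r + `|p|); split; first exact: num_real.
  move=> y ry x /= xr; apply: le_trans (ltW ry).
  by rewrite -[x](subrK p) (le_trans (ler_normD _ _))// lerD2r.
apply: (@closed_comp _ _ (fun x : E => `|x - p|) [set y | y <= r]); last exact: closed_le.
move=> x _; apply: continuous_comp; last exact: norm_continuous.
by apply: continuousB; [exact: cvg_id|exact: cst_continuous].
Qed.

Lemma compact_bound f K : compact K -> (forall x, K x -> {for x, continuous f}) ->
  exists2 C, 0 <= C & forall x, K x -> `|f x| <= C.
Proof.
move=> cK cf.
have cfK : {within K, continuous f}.
  by apply: continuous_in_subspaceT => x /set_mem Kx; exact: cf.
have /compact_bounded[M [Mr HM]] := continuous_compact cfK cK.
exists (`|M| + 1) => [|x Kx]; first by rewrite addr_ge0.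
apply: HM; last by exists x.
by rewrite (le_lt_trans (ler_norm M))// ltrDl.
Qed.

Lemma compact_norm_bound K : compact K -> exists2 M, 0 <= M & forall x, K x -> `|x| <= M.
Proof.
move=> /compact_bounded[M [Mr HM]].
exists (`|M| + 1) => [|x Kx]; first by rewrite addr_ge0.
apply: HM => //.
by rewrite (le_lt_trans (ler_norm M))// ltrDl.
Qed.

Lemma test_fun_bsupp U f : test_fun U f -> exists2 M, 0 <= M & bsupp M f.
Proof.
move=> [_ [K [cK _ fK]]]; have [M M0 KM] := compact_norm_bound cK.
exists M => // x Mx; apply: fK => /KM.
by rewrite leNgt Mx.
Qed.

Lemma continuous_bsupp_bounded f M : continuous f -> bsupp M f ->
  exists2 C, 0 <= C & forall x, `|f x| <= C.
Proof.
move=> cf sf; have [C C0 HC] := compact_bound (@compact_norm_le 0 M) (fun x _ => cf x).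
exists C => // x; have [xM|/sf ->] := leP `|x| M; last by rewrite normr0.
by apply: HC => /=; rewrite subr0.
Qed.

Lemma test_fun_bounded U f : test_fun U f -> exists2 C, 0 <= C & forall x, `|f x| <= C.
Proof.
move=> tf; have [M _ sf] := test_fun_bsupp tf.
by apply: continuous_bsupp_bounded sf; apply: smooth_continuous; case: tf.
Qed.

Lemma partial_near0 f x i : (\forall y \near x, f y = 0) ->
  derivable f x (e_ i) /\ partial i f x = 0.
Proof.
move=> fx; have : is_derive x (e_ i) f 0.
  by apply: near_eq_is_derive (is_derive_cst (0:R) x (e_ i)); apply: filterS fx => y ->.
by case.
Qed.

Lemma test_fun_partial U f i : test_fun U f -> test_fun U (partial i f).
Proof.
move=> [sf [K [cK KU fK]]]; split; first exact: smooth_partial.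
exists K; split => // x Kx; apply: (partial_near0 i _).2.
have oK : open (~` K) by apply: closed_openC; exact: compact_closed.
by apply: filterS (open_nbhs_nbhs (conj oK Kx)) => y; exact: fK.
Qed.

Lemma test_funM U f g : smooth g -> test_fun U f -> test_fun U (fun x => g x * f x).
Proof.
move=> sg [sf [K [cK KU fK]]]; split; first exact: smoothM.
by exists K; split => // x Kx; rewrite fK ?mulr0.
Qed.

Lemma test_funZ U c f : test_fun U f -> test_fun U (fun x => c * f x).
Proof. exact: (test_funM (smooth_cst c)). Qed.

Lemma test_funD U f g : test_fun U f -> test_fun U g -> test_fun U (fun x => f x + g x).
Proof.
move=> [sf [K [cK KU fK]]] [sg [K' [cK' KU' gK]]]; split; first exact: smoothD.
exists (K `|` K'); split; first exact: compactU.
  by move=> x [/KU|/KU'].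
by move=> x /not_orP[Kx K'x]; rewrite fK ?gK ?addr0.
Qed.

Lemma test_fun0 U : test_fun U (fun=> 0).
Proof.
split; first exact: smooth_cst.
by exists set0; split => //; exact: compact0.
Qed.

Lemma test_fun_sub U V f : U `<=` V -> test_fun U f -> test_fun V f.
Proof.
by move=> UV [sf [K [cK KU fK]]]; split => //; exists K; split => // x /KU /UV.
Qed.

Lemma test_fun_out U f x : test_fun U f -> ~ U x -> f x = 0.
Proof. by move=> [_ [K [_ KU fK]]] Ux; apply: fK => /KU. Qed.

Lemma smooth_measurable f (D : set T) : smooth f -> measurable_fun D f.
Proof. by move=> /smooth_continuous; exact: continuous_measurable_Rd. Qed.

Lemma sqint_bsupp (D : set T) f M C : measurable D -> measurable_fun D f ->
  bsupp M f -> (forall x, `|f x| <= C) -> sqint mu D f.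
Proof.
move=> mD mf sf fC; have C0 : 0 <= C by exact: le_trans (fC 0).
pose g : E -> R := (fun=> C ^+ 2) \_ [set x : E | `|x| <= M].
apply: sqintP => //; apply: (@integrable_le _ _ _ _ _ mD _ g).
- exact: measurable_funX.
- move=> x _; rewrite /g /patch; case: ifPn => [_|].
    by rewrite normrX ler_sqr ?nnegrE.
  by rewrite notin_setE/= => /negP; rewrite -ltNge => /sf ->; rewrite expr0n normr0.
- apply: (@integrableS _ _ _ _ setT) => //.
  rewrite /g -restrict_EFin; apply/(integrable_mkcond _ (measurable_norm_le _)).
  by apply: integrable_cst_fin; [exact: measurable_norm_le|exact: leb_norm_le].
Qed.

Lemma test_fun_sqint U (D : set T) f : measurable D -> test_fun U f -> sqint mu D f.
Proof.
move=> mD tf; have [M _ sf] := test_fun_bsupp tf; have [C _ fC] := test_fun_bounded tf.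
by apply: sqint_bsupp sf fC => //; apply: smooth_measurable; case: tf.
Qed.

Lemma test_cutoff U (p : E) (r s : R) : 0 < s -> r < s ->
  (forall x, `|x - p| <= s -> U x) -> test_fun U (fun x => cutoff r s (x - p)).
Proof.
move=> s0 rs HU; split.
  have -> : (fun x : E => cutoff r s (x - p)) = (fun x : E => cutoff r s (1 *: x + - p)).
    by apply/funext => x; rewrite scale1r.
  exact/smooth_affine/smooth_cutoff.
exists [set x : E | `|x - p| <= s]; split => //; first exact: compact_norm_le.
by move=> x /= /negP; rewrite -ltNge => xs; rewrite cutoff_eq0// ltW.
Qed.

(* Smooth exhaustion of an open set from the countably many rational cubes it contains. *)
Lemma bump_exhaustion U : open U -> exists phi : nat -> E -> R, exists N : nat -> set E,
  [/\ forall n, test_fun U (phi n), forall n x, 0 <= phi n x <= 1,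
      forall n x, N n x -> phi n x = 1,
      (forall n, open (N n)) /\ (forall m n, (m <= n)%N -> N m `<=` N n) &
      U `<=` \bigcup_n N n].
Proof.
move=> oU.
pose rad (m : nat) : R := m.+1%:R^-1.
have rad0 m : 0 < rad m by rewrite invr_gt0.
pose good (p : 'rV[rat]_d * nat) := forall y : E, `|y - map_mx ratr p.1| <= rad p.2 -> U y.
pose b (k : nat) : E -> R := if unpickle k is Some p then
  if `[< good p >] then fun x => cutoff (rad p.2 / 2) (rad p.2) (x - map_mx ratr p.1) else fun=> 0
  else fun=> 0.
pose B (k : nat) : set E := if @unpickle ('rV[rat]_d * nat)%type k is Some p then
  if `[< good p >] then [set x : E | `|x - map_mx ratr p.1| < rad p.2 / 2] else set0
  else set0.
have tb k : test_fun U (b k).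
  rewrite /b; case: unpickle => [p|]; last exact: test_fun0.
  case: asboolP => [gp|_]; last exact: test_fun0.
  by apply: test_cutoff => //; rewrite ltr_pdivrMr// ltr_pMr// ltr1n.
have b01 k x : 0 <= b k x <= 1.
  rewrite /b; case: unpickle => [p|]; last by rewrite lexx ler01.
  by case: asboolP => [gp|_]; rewrite ?cutoff_ge0 ?cutoff_le1// lexx ler01.
have bB k x : B k x -> b k x = 1.
  rewrite /B /b; case: unpickle => [p|//]; case: asboolP => [gp|//] /= /ltW xp.
  by rewrite cutoff_eq1// ltr_pdivrMr// ltr_pMr// ltr1n.
have oB k : open (B k).
  rewrite /B; case: unpickle => [p|]; last exact: open0.
  case: asboolP => [gp|_]; last exact: open0.
  apply: (@open_comp _ _ (fun x : E => `|x - map_mx ratr p.1|) [set y | y < rad p.2 / 2]); last exact: open_lt.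
  move=> x _; apply: continuous_comp; last exact: norm_continuous.
  by apply: continuousB; [exact: cvg_id|exact: cst_continuous].
(* A smooth substitute for the maximum of the first n bumps: 1 minus the product of the 1 - b_k,
   equal to 1 wherever one of them is. *)
pose phi (n : nat) (x : E) := 1 + -1 * \prod_(k < n) (1 + -1 * b k x).
have pr01 n x : 0 <= \prod_(k < n) (1 + -1 * b k x) <= 1.
  elim/big_ind : _ => [|u v /andP[u0 u1] /andP[v0 v1]|k _].
  - by rewrite ler01 lexx.
  - by rewrite mulr_ge0// mulr_ile1.
  - by have := b01 k x => /andP[]; lra.
have tphi n : test_fun U (phi n).
  elim: n => [|n IHn].
    have -> : phi 0%N = fun=> 0 by apply/funext => x; rewrite /phi big_ord0; lra.
    exact: test_fun0.
  have -> : phi n.+1 = (fun x => phi n x + (1 + -1 * phi n x) * b n x).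
    by apply/funext => x; rewrite /phi big_ord_recr/=; ring.
  apply: test_funD => //; apply: test_funM => //.
  apply: smoothD; first exact: smooth_cst.
  by apply: smoothM; [exact: smooth_cst|case: IHn].
exists phi, (fun n => \bigcup_(k in [set k | (k < n)%N]) B k); split.
- exact: tphi.
- by move=> n x; rewrite /phi; have := pr01 n x => /andP[]; lra.
- move=> n x [k /= kn Bk]; rewrite /phi.
  by rewrite (bigD1 (Ordinal kn))//= (bB _ _ Bk); lra.
- split=> [n|m n mn x [k /= km Bk]]; first by apply: bigcup_open => k _; exact: oB.
  by exists k => //=; exact: leq_trans mn.
move=> x /(open_ballP oU)[r r0 xU].
have [m mr] : exists m : nat, rad m < r / 2.
  have r2 : 0 < r / 2 by rewrite divr_gt0.
  by have [m] := ltr_add_invr r2; rewrite add0r; exists m.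
have [|q xq] := @dense_rat_row R d x (rad m / 2); first by rewrite divr_gt0.
have gq : good (q, m).
  move=> y yq; apply: xU; rewrite -(subrK (map_mx ratr q) y) -addrA.
  apply: (le_lt_trans (ler_normD _ _)); rewrite (splitr r) ler_ltD//.
    exact: le_trans (ltW mr).
  by rewrite (lt_trans xq)// (le_lt_trans _ mr)// ler_pdivrMr// ler_pMr// ler1n.
exists (pickle (q, m)).+1 => //; exists (pickle (q, m)) => //=.
by rewrite /B pickleK/=; case: asboolP => // _ /=; rewrite distrC.
Qed.

(** The plateaus of the exhaustion form an increasing open cover, so by compactness one of them
    contains K. *)
Lemma cutoff_compact U K : open U -> compact K -> K `<=` U ->
  exists eta, exists N, [/\ test_fun U eta, forall x, 0 <= eta x <= 1, open N, K `<=` N &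
    forall x, N x -> eta x = 1].
Proof.
move=> oU cK KU; have [phi [N [tphi phi01 phiN [oN mN] UN]]] := bump_exhaustion oU.
suff [n KN] : exists n, K `<=` N n by exists (phi n), (N n); split => //; exact: phiN.
have := cK; rewrite compact_cover => /(_ nat setT N) [//|x /KU/UN //|F _ KF].
exists (\max_(i <- finmap.enum_fset F) i)%N => x /KF [k /= kF Nk].
by apply: mN Nk; rewrite (big_rem k)//= leq_maxl.
Qed.

End test_functions.

(** * Weak gradients and Sobolev spaces *)

Section outer_regularity.
Context {R : realType} {d : nat}.
Local Notation E := 'rV[R]_d.
Local Notation T := (caratheodory_type (leb_om R d)).
Local Notation mu := (leb R d).

Lemma leb_le_box_gauge (A : set E) : (mu A <= box_gauge (A : set (discr E)))%E.
Proof.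
apply: (@le_trans _ _ (\sum_(k <oo) box_gauge ((bigcup2 A set0) k : set (discr E)))%E).
  apply: ereal_inf_lbound; exists (bigcup2 A set0) => //; split => //.
  by move=> x Ax; exists 0%N.
rewrite (@nneseries_split _ _ 0 1); last by move=> *; exact: box_gauge_ge0.
rewrite big_mkord big_ord1 /= eseries0 ?adde0//.
by move=> [|[|k]] //= _ _; exact: box_gauge0.
Qed.

(** A nearly optimal box is enlarged by t on every side; its volume is a polynomial in t, hence
    close to the original one for small t. *)
Lemma box_gauge_open_cover (A : set E) (e : R) : 0 < e ->
  (box_gauge (A : set (discr E)) < +oo)%E ->
  exists V : set E, [/\ open V, A `<=` V & (mu V <= box_gauge (A : set (discr E)) + e%:E)%E].
Proof.
move=> e0 Aoo.
have [A0|A0] := eqVneq A set0.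
  by exists set0; split; [exact: open0|rewrite A0|rewrite measure0 adde_ge0 ?box_gauge_ge0// lee_fin ltW].
have gfin : box_gauge (A : set (discr E)) \is a fin_num.
  by rewrite ge0_fin_numE ?box_gauge_ge0.
have e2 : 0 < e / 2 by rewrite divr_gt0.
have [v + vg] := lb_ereal_inf_adherent e2 (ltac:(move: gfin; rewrite /box_gauge (negbTE A0); exact) : _ \is a fin_num).
move=> [a [b [ab AB vE]]].
pose p : {poly R} := \prod_i ((b 0 i - a 0 i)%:P + 2 *: 'X).
have pE t : p.[t] = \prod_i ((b 0 i - a 0 i) + 2 * t).
  by rewrite horner_prod; apply: eq_bigr => i _; rewrite !hornerE.
have p0 : p.[0] = \prod_i (b 0 i - a 0 i).
  by rewrite pE; apply: eq_bigr => i _; rewrite mulr0 addr0.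
have [t [t0 pt]] : exists t, 0 < t /\ p.[t] < p.[0] + e / 2.
  have cp : {for 0, continuous (horner p)} by exact: continuous_horner.
  move/cvgrPdist_lt : cp => /(_ _ e2) [r /= r0 Hr].
  exists (r / 2); split; first by rewrite divr_gt0.
  have := Hr (r / 2); rewrite /= sub0r normrN gtr0_norm ?divr_gt0// ltr_pdivrMr// ltr_pMr// ltr1n.
  by move=> /(_ isT); rewrite ltr_norml => /andP[]; lra.
exists [set x : E | forall i, a 0 i - t < x 0 i < b 0 i + t]; split.
- rewrite openE => x Hx.
  have Hi i : \forall y \near x, a 0 i - t < (y : E) 0 i < b 0 i + t.
    have /andP[x1 x2] := Hx i.
    have ci := @coord_continuous R 1 d 0 i x.
    near=> y; apply/andP; split; near: y.
      by apply: (cvgr_gt (x 0 i)) => //; exact: ci.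
    by apply: (cvgr_lt (x 0 i)) => //; exact: ci.
  exact: (@filter_forall E 'I_d (fun i (y : E) => a 0 i - t < y 0 i < b 0 i + t) (nbhs x) _ Hi).
- by move=> x /AB/= Hx i; have /andP[? ?] := Hx i; apply/andP; split; lra.
apply: (le_trans (leb_le_box_gauge _)).
apply: (@le_trans _ _ (p.[t])%:E).
  have -> : p.[t] = \prod_i ((b + const_mx t) 0 i - (a - const_mx t) 0 i).
    by rewrite pE; apply: eq_bigr => i _; rewrite !mxE; lra.
  apply: box_gauge_le_box => [i|x /= Hx i].
    by rewrite !mxE; have := ab i; lra.
  by rewrite !mxE; have /andP[? ?] := Hx i; apply/andP; split; lra.
move: vg; rewrite vE -p0 => /ltW vg.
have -> : e = e / 2 + e / 2 by lra.
apply: (@le_trans _ _ (p.[0]%:E + (e / 2)%:E)%E); first by rewrite lee_fin ltW.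
by rewrite EFinD addeA; apply: leeD2r; move: vg; rewrite /box_gauge (negbTE A0).
Unshelve. all: by end_near. Qed.

(** Each member of a nearly optimal cover is enlarged to an open set with error e / 2^(k+2). Since A
    is measurable of finite measure, the measure of V splits along A and the bound on V becomes one
    on V \ A. *)
Lemma leb_outer_regular (A : set T) (e : R) : measurable A -> (mu A < +oo)%E -> 0 < e ->
  exists V : set E, [/\ open V, A `<=` V & (mu (V `\` A : set T) <= e%:E)%E].
Proof.
move=> mA Aoo e0; have e2 : 0 < e / 2 by rewrite divr_gt0.
have muA : mu A \is a fin_num by rewrite ge0_fin_numE ?measure_ge0.
have [v [F [mF AF] vE] vg] := lb_ereal_inf_adherent e2 muA.
have Foo k : (box_gauge (F k : set (discr E)) < +oo)%E.
  have voo : (v < +oo)%E by apply: (lt_trans vg); rewrite -[X in (X + _)%E](fineK muA) ltry.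
  apply: le_lt_trans voo; rewrite -vE (nneseries_split 0 k.+1).
    by rewrite big_mkord/= big_ord_recr/= -addeA addeCA leeDl// adde_ge0//;
      [apply: sume_ge0 => *; exact: box_gauge_ge0|apply: nneseries_ge0 => *; exact: box_gauge_ge0].
  by move=> *; exact: box_gauge_ge0.
have /choice[V HV] (k : nat) : exists V : set E, [/\ open V, F k `<=` V &
    (mu V <= box_gauge (F k : set (discr E)) + (e / 2 / 2 ^+ k.+1)%:E)%E].
  by apply: box_gauge_open_cover => //; rewrite divr_gt0// exprn_gt0.
have oV : open (\bigcup_k V k) by apply: bigcup_open => k _; have [] := HV k.
have AV : A `<=` \bigcup_k V k.
  by move=> x /AF[k _ Fk]; exists k => //; have [_ + _] := HV k; exact.
exists (\bigcup_k V k); split => //.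
have muV : (mu (\bigcup_k V k) <= mu A + e%:E)%E.
  apply: (le_trans (outer_measure_sigma_subadditive (leb_om R d) V)).
  apply: (@le_trans _ _ (\sum_(k <oo) (box_gauge (F k : set (discr E)) + (e / 2 / (2 ^ k.+1)%:R)%:E))%E).
    apply: lee_nneseries => [k _ _|k _]; first exact: outer_measure_ge0.
    by rewrite natrX; have [_ _] := HV k.
  apply: (le_trans (epsilon_trick _ _ _)).
  - by move=> k; exact: box_gauge_ge0.
  - exact: ltW.
  rewrite vE (_ : e%:E = (e / 2)%:E + (e / 2)%:E)%E; last by rewrite -EFinD; congr EFin; lra.
  by rewrite addeA; apply: leeD2r; exact: ltW.
have : mu (\bigcup_k V k) = (mu A + mu ((\bigcup_k V k) `\` A : set T))%E.
  rewrite (_ : mu A = mu ((\bigcup_k V k) `&` A)); last by congr (mu _); rewrite setIidr.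
  by rewrite setDE; exact: (mA : caratheodory_measurable (leb_om R d) A).
by move=> H; move: muV; rewrite H leeD2lE.
Qed.

End outer_regularity.

(** * Fundamental lemma of the calculus of variations and density of test functions *)

Section fundamental_lemma.
Context {R : realType} {d : nat}.
Local Notation E := 'rV[R]_d.
Local Notation T := (caratheodory_type (leb_om R d)).
Local Notation mu := (leb R d).
Variable U : set E.
Hypotheses (oU : open U) (Uoo : (mu U < +oo)%E).
Local Notation Int f := (\int[mu]_(x in (U : set T)) f x).
Local Notation intg f := (mu.-integrable (U : set T) (EFin \o f)).

Let mU : measurable (U : set T). Proof. exact: open_measurable_Rd. Qed.

Let sqint_indic (A : set T) : measurable A -> sqint mu U (\1_A : T -> R).
Proof.
move=> mA; apply: (@sqint_bounded _ _ _ _ _ mU _ 1) => //.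
by move=> x _; rewrite indicE; case: (x \in A); rewrite ?normr1 ?normr0.
Qed.

Let Int_indic (A : set T) : measurable A -> A `<=` U -> Int (fun x => \1_A x * \1_A x) = fine (mu A).
Proof.
move=> mA AU; have -> : (fun x => \1_A x * \1_A x) = (fun x => (\1_A x : R)).
  by apply/funext => x; rewrite indicE; case: (x \in A); rewrite /= ?mulr1 ?mulr0.
by rewrite /Rintegral integral_indic// setIidl.
Qed.

(** The integral of h against an indicator vanishes for open sets by bump exhaustion, then for
    measurable sets by outer regularity; taking the sets where h > 0 and h <= 0 gives the integral
    of |h|. *)
Lemma test_fun_orthogonal_eq0 (h : T -> R) : sqint mu U h ->
  (forall phi, test_fun U phi -> Int (fun x => h x * phi x) = 0) ->
  {ae mu, forall x, U x -> h x = 0}.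
Proof.
move=> sh hphi; have PH := pre_hilbert_sqint mu mU.
have mh : measurable_fun (U : set T) h by case: sh.
have step1 (V : set E) : open V -> V `<=` U -> Int (fun x => h x * \1_V x) = 0.
  move=> oV VU; have [phi [N [tphi phi01 phiN [_ mN] VN]]] := bump_exhaustion oV.
  have mphi n : measurable_fun (U : set T) (phi n : T -> R) by apply: smooth_measurable; case: (tphi n).
  have [||||| _ cI] := @Rintegral_dominated _ T R mu U mU (fun n x => h x * phi n x)
    (fun x => h x * \1_V x) (fun x => `|h x|).
  - by move=> n; exact: measurable_funM.
  - by apply: measurable_funM => //; case: (sqint_indic (open_measurable_Rd oV)).
  - by apply: integrable_norm; apply: sqint_integrable.
  - apply: aeW => x Ux; apply: cvgM; first exact: cvg_cst.
    rewrite indicE; have [/set_mem Vx|/negP Vx] := boolP (x \in V); last first.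
      rewrite (_ : (fun n => _) = fun=> 0); first exact: cvg_cst.
      by apply/funext => n; apply: test_fun_out (tphi n) _ => Vx'; apply: Vx; exact/mem_set.
    have [n _ Nx] := VN x Vx.
    apply: cvg_near_cst; exists n => // k /= nk.
    by apply: phiN; exact: mN Nx.
  - move=> n x _; rewrite normrM ler_piMr// ger0_norm; by have /andP[] := phi01 n x.
  rewrite -(cvg_lim _ cI)//; apply/cvg_lim => //.
  rewrite (_ : (fun n => _) = fun=> 0); first exact: cvg_cst.
  apply/funext => n; apply: hphi.
  exact: test_fun_sub VU (tphi n).
have step2 (A : set T) : measurable A -> A `<=` U -> Int (fun x => h x * \1_A x) = 0.
  move=> mA AU; apply/eqP; rewrite -sqrf_eq0 eq_le sqr_ge0 andbT.
  have Aoo : (mu A < +oo)%E by apply: le_lt_trans Uoo; apply: le_measure => //; rewrite inE.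
  set c := Int (fun x => h x * h x).
  have c0 : 0 <= c by exact: (preh_ge0 PH).
  apply/ler_addgt0Pr => e e0; rewrite add0r.
  (* By Cauchy-Schwarz the excess of V over A costs at most c |V \ A| in the square, whence e / (c +
     1); the added 1 covers c = 0. *)
  have e1 : 0 < e / (c + 1) by rewrite divr_gt0// ltr_wpDl.
  have [V [oV AV VA]] := leb_outer_regular mA Aoo e1.
  pose W := V `&` U; have oW : open W by exact: openI.
  have mW : measurable (W : set T) by exact: open_measurable_Rd.
  pose B : set T := W `\` A; have mB : measurable B by exact: measurableD.
  have BU : B `<=` U by move=> x [[]].
  have -> : Int (fun x => h x * \1_A x) = - Int (fun x => h x * \1_B x).
    apply/eqP; rewrite -subr_eq0 opprK; apply/eqP.
    rewrite -RintegralD//; try by apply: integrable_mul_sqint => //; exact: sqint_indic.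
    rewrite -(step1 W oW (@subIsetr _ _ _)); apply: eq_Rintegral => x /set_mem Ux.
    rewrite -mulrDr; congr (_ * _); rewrite !indicE.
    have [/set_mem Ax|/negP Ax] := boolP (x \in A).
      rewrite (mem_set (_ : W x)); last by split => //; exact: AV.
      rewrite (_ : x \in B = false) ?addr0//; apply/negbTE/negP => /set_mem[_]; exact.
    have [/set_mem Wx|/negP Wx] := boolP (x \in W).
      by rewrite (mem_set (_ : B x)) ?add0r//; split => // Ax'; apply: Ax; exact: mem_set.
    rewrite (_ : x \in B = false) ?addr0//; apply/negbTE/negP => /set_mem[Wx' _].
    by apply: Wx; exact: mem_set.
  rewrite sqrrN; apply: (le_trans (preh_cs PH sh (sqint_indic mB))).
  rewrite Int_indic//; apply: (@le_trans _ _ (c * (e / (c + 1)))).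
    rewrite ler_wpM2l// -lee_fin fineK; last first.
      rewrite ge0_fin_numE ?measure_ge0//; apply: le_lt_trans Uoo.
      by apply: le_measure => //; rewrite inE.
    apply: le_trans VA; apply: le_outer_measure => x [[Vx _] Ax]; split => //.
  by rewrite mulrCA ler_piMr ?(ltW e0)// ler_pdivrMr ?mul1r ?lerDl// ltr_wpDl.
have hI : Int (fun x => `|h x|) = 0.
  pose A : set T := U `&` [set x | 0 < h x].
  have mA : measurable A.
    rewrite (_ : A = U `&` h @^-1` `]0, +oo[%classic); first by apply: mh => //; exact: measurable_itv.
    by apply/seteqP; split => x [Ux /=]; rewrite ?in_itv/= ?andbT.
  pose B : set T := U `\` A; have mB : measurable B by exact: measurableD.
  transitivity (Int (fun x => h x * \1_A x - h x * \1_B x)).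
    apply: eq_Rintegral => x /set_mem Ux; rewrite !indicE.
    have [hx|hx] := ltP 0 (h x).
      rewrite gtr0_norm// (mem_set (_ : A x))//.
      rewrite (_ : x \in B = false) ?mulr0 ?mulr1 ?subr0//; apply/negbTE/negP => /set_mem[_]; exact.
    have Ax : ~ A x by move=> [_ /=]; rewrite ltNge hx.
    rewrite ler0_norm// (mem_set (_ : B x))//.
    by rewrite (_ : x \in A = false) ?mulr0 ?mulr1 ?sub0r//; apply/negbTE/negP => /set_mem.
  rewrite RintegralB//; try by apply: integrable_mul_sqint => //; exact: sqint_indic.
  by rewrite !step2 ?subrr//; [move=> x []|move=> x []].
have Ih : intg h by exact: sqint_integrable.
have : (\int[mu]_(x in (U : set T)) `|(h x)%:E| = 0)%E.
  rewrite -[LHS]fineK; first exact: (congr1 EFin hI).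
  by apply: integrable_fin_num => //; exact: integrable_abse.
move=> /ae_eq_integral_abs H.
have /H : measurable_fun (U : set T) (fun x => (h x)%:E) by exact/measurable_EFinP.
move=> /(_ mU); apply: filterS => x Hx Ux.
by have [] := Hx Ux.
Qed.

(** Projecting g on the closure of the test functions leaves a residual orthogonal to all of them,
    hence zero almost everywhere. *)
Lemma test_fun_dense (g : T -> R) : sqint mu U g ->
  exists phi : nat -> E -> R, (forall n, test_fun U (phi n)) /\
    (fun n => Int (fun x => (phi n x - g x) * (phi n x - g x))) @ \oo --> 0.
Proof.
move=> sg; have PH := pre_hilbert_sqint mu mU.
have [|||||s [p [ts sp cp op]]] := @hilbert_projection R _ _ _ PH [set f : T -> R^o | test_fun U (f : E -> R)] g (sqint_complete mU).
- exact: test_fun0.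
- by move=> f tf; exact: (test_fun_sqint mU tf).
- by move=> v w; exact: test_funD.
- by move=> a v; exact: test_funZ.
- exact: sg.
exists s; split => //.
have sgp : sqint mu U (fun x => g x - p x) by exact: sqintB.
have gp := test_fun_orthogonal_eq0 sgp op.
apply: cvg_trans cp; apply: near_eq_cvg; apply: nearW => n.
have ms : measurable_fun (U : set T) (s n) by apply: smooth_measurable; case: (ts n).
have mp : measurable_fun (U : set T) p by case: sp.
have mg : measurable_fun (U : set T) g by case: sg.
have mB (f g' : T -> R) : measurable_fun (U : set T) f -> measurable_fun (U : set T) g' ->
    measurable_fun (U : set T) (fun x => (f x - g' x) * (f x - g' x)).
  by move=> mf mg'; apply: measurable_funM; exact: measurable_funB.
apply: (eq_Rintegral_ae mU (mB _ _ ms mp) (mB _ _ ms mg)).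
apply: (@filterS _ _ (ae_filter_ringOfSetsType mu) _ _ _ gp) => x Hx Ux.
by have /eqP := Hx Ux; rewrite subr_eq0 => /eqP ->.
Qed.

End fundamental_lemma.

Section sobolev_space.
Context {R : realType} {d : nat}.
Local Notation E := 'rV[R]_d.
Local Notation T := (caratheodory_type (leb_om R d)).
Local Notation mu := (leb R d).
Local Notation e_ i := (delta_mx 0 i : E).
Variables (Om : set E) (M : R).
Hypotheses (oOm : open Om) (bOm : forall x, Om x -> `|x| <= M).
Local Notation Int f := (\int[mu]_(x in (Om : set T)) f x).
Local Notation L2 := (sqint mu (Om : set T)).
Implicit Types (u v w : E -> R) (G H : 'I_d -> E -> R).

Lemma mOm : measurable (Om : set T). Proof. exact: open_measurable_Rd. Qed.
Lemma Omoo : (mu Om < +oo)%E. Proof. exact: leb_bounded bOm. Qed.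
Let PH1 := pre_hilbert_sqint mu mOm.

Lemma smooth_bounded_on f : smooth f -> exists2 C, 0 <= C & forall x, Om x -> `|f x| <= C.
Proof.
move=> sf; have [C C0 HC] := compact_bound (@compact_norm_le R d 0 M)
  (fun x _ => smooth_continuous sf (x := x)).
by exists C => // x /bOm xM; apply: HC; rewrite /= subr0.
Qed.

Lemma smooth_sqint f : smooth f -> L2 f.
Proof.
move=> sf; have [C _ HC] := smooth_bounded_on sf.
by apply: (sqint_bounded mOm Omoo _ HC); exact: smooth_measurable.
Qed.

Lemma smoothM_sqint f u : smooth f -> L2 u -> L2 (fun x => f x * u x).
Proof.
move=> sf su; have [C _ HC] := smooth_bounded_on sf.
by apply: (sqintM_bounded mOm _ HC su); exact: smooth_measurable.
Qed.

Lemma weak_grad_unique u G H : is_weak_grad Om u G -> is_weak_grad Om u H ->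
  forall i, {ae mu, forall x, Om x -> G i x = H i x}.
Proof.
move=> uG uH i; have [sG gG] := uG i; have [sH gH] := uH i.
have sB : L2 (fun x => G i x - H i x) by exact: (sqintB mOm sG sH).
have := test_fun_orthogonal_eq0 oOm Omoo sB.
move=> /(_ _)/(@filterS _ _ (ae_filter_ringOfSetsType mu)); apply.
  by move=> x Hx Ox; have /eqP := Hx Ox; rewrite subr_eq0 => /eqP.
move=> phi tphi; have sphi : L2 phi by exact: test_fun_sqint mOm tphi.
rewrite (preh_subl PH1 sG sH sphi).
by apply/eqP; rewrite subr_eq0 -eqr_opp -(gG _ tphi) -(gH _ tphi).
Qed.

Lemma H1_wgrad u : H1 Om u -> L2 u /\ is_weak_grad Om u (wgrad Om u).
Proof. by move=> [su [G uG]]; split => //; apply: xgetPex; exists G. Qed.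

Lemma weak_gradD u v G H : L2 u -> L2 v -> is_weak_grad Om u G -> is_weak_grad Om v H ->
  is_weak_grad Om (fun x => u x + v x) (fun i x => G i x + H i x).
Proof.
move=> su sv uG vH i; have [sG gG] := uG i; have [sH gH] := vH i.
split; first exact: (sqintD mOm sG sH).
move=> phi tphi; have sphi : L2 phi by exact: test_fun_sqint mOm tphi.
have sdphi : L2 (partial i phi) by exact: test_fun_sqint mOm (test_fun_partial i tphi).
have := preh_addl PH1 su sv sdphi; have := preh_addl PH1 sG sH sphi.
by rewrite /volint => -> ->; rewrite opprD -(gG _ tphi) -(gH _ tphi).
Qed.

Lemma weak_gradZ c u G : L2 u -> is_weak_grad Om u G ->
  is_weak_grad Om (fun x => c * u x) (fun i x => c * G i x).
Proof.
move=> su uG i; have [sG gG] := uG i.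
split; first exact: (sqintZ mOm c sG).
move=> phi tphi; have sphi : L2 phi by exact: test_fun_sqint mOm tphi.
have sdphi : L2 (partial i phi) by exact: test_fun_sqint mOm (test_fun_partial i tphi).
have := preh_scalel PH1 c su sdphi; have := preh_scalel PH1 c sG sphi.
by rewrite /volint => -> ->; rewrite -mulrN -(gG _ tphi).
Qed.

Lemma weak_gradB u v G H : L2 u -> L2 v -> is_weak_grad Om u G -> is_weak_grad Om v H ->
  is_weak_grad Om (fun x => u x - v x) (fun i x => G i x - H i x).
Proof.
move=> su sv uG vH; have := weak_gradD su (sqintZ mOm (-1) sv) uG (weak_gradZ (-1) sv vH).
have -> : (fun x => u x + -1 * v x) = (fun x => u x - v x).
  by apply/funext => x; rewrite mulN1r.
suff -> : (fun i x => G i x + -1 * H i x) = (fun i x => G i x - H i x) by [].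
by apply/funext => i; apply/funext => x; rewrite mulN1r.
Qed.

Lemma weak_gradM eta u G : smooth eta -> L2 u -> is_weak_grad Om u G ->
  is_weak_grad Om (fun x => eta x * u x) (fun i x => eta x * G i x + partial i eta x * u x).
Proof.
move=> seta su uG i; have [sG gG] := uG i.
have s1 : L2 (fun x => eta x * G i x) by exact: smoothM_sqint.
have s2 : L2 (fun x => partial i eta x * u x) := smoothM_sqint (smooth_partial i seta) su.
split; first exact: (sqintD mOm s1 s2).
move=> phi tphi; have sphi : L2 phi by exact: test_fun_sqint mOm tphi.
have tep : test_fun Om (fun x => eta x * phi x) by exact: test_funM.
have sdep : L2 (partial i (fun x => eta x * phi x)).
  exact: test_fun_sqint mOm (test_fun_partial i tep).
have E1 : (fun x => (eta x * u x) * partial i phi x) =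
    (fun x => u x * partial i (fun x => eta x * phi x) x - (partial i eta x * u x) * phi x).
  apply/funext => x; rewrite partialM; first by ring.
  - exact: smooth_derivable.
  - by apply: smooth_derivable; case: tphi.
have := preh_addl PH1 s1 s2 sphi; rewrite /volint => ->.
rewrite E1 RintegralB//; [|exact: mOm|exact: (integrable_mul_sqint mOm)..].
have := gG _ tep; rewrite /volint => ->.
rewrite opprD; congr (- _ - _); apply: eq_Rintegral => x _; ring.
Qed.

(** The product f phi has compact support even when f has not, so its i-th derivative has integral
    0. *)
Lemma weak_grad_C1 f : continuous f -> (forall x i, derivable f x (e_ i)) ->
  (forall i, continuous (partial i f)) ->
  forall i phi, test_fun Om phi ->
    Int (fun x => f x * partial i phi x) = - Int (fun x => partial i f x * phi x).
Proof.
move=> cf df cpf i phi tphi; have [N N0 sphi] := test_fun_bsupp tphi.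
have cphi : continuous phi by apply: smooth_continuous; case: tphi.
have dphi x : derivable phi x (e_ i) by apply: smooth_derivable; case: tphi.
have cdphi : continuous (partial i phi).
  by apply: smooth_continuous; case: (test_fun_partial i tphi).
have EP x : partial i (fun x => f x * phi x) x = f x * partial i phi x + phi x * partial i f x.
  exact: partialM.
have c1 : continuous (fun x => f x * phi x) by move=> x; exact: continuousM (cf x) (cphi x).
have c2 : continuous (fun x => f x * partial i phi x) by move=> x; exact: continuousM (cf x) (cdphi x).
have c3 : continuous (fun x => phi x * partial i f x) by move=> x; exact: continuousM (cphi x) (cpf i x).
have s1 : bsupp N (fun x => f x * phi x) by move=> x /sphi ->; rewrite mulr0.
have near0 x : N < `|x| -> \forall y \near x, phi y = 0.
  move=> Nx; have oN : open [set y : E | N < `|y|].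
    apply: (@open_comp _ _ (fun y : E => `|y|) [set t | N < t]); last exact: open_gt.
    by move=> y _; exact: norm_continuous.
  by apply: filterS (open_nbhs_nbhs (conj oN Nx)) => y; exact: sphi.
have s2 : bsupp N (fun x => f x * partial i phi x).
  by move=> x /near0 H; rewrite (partial_near0 i H).2 mulr0.
have s3 : bsupp N (fun x => phi x * partial i f x) by move=> x /sphi ->; rewrite mul0r.
have I2 (g : E -> R) : continuous g -> bsupp N g -> mu.-integrable (setT : set T) (EFin \o g).
  move=> cg sg; have [C _ gC] := continuous_bsupp_bounded cg sg.
  by apply: integrable_bsupp sg gC; exact: continuous_measurable_Rd.
have [C _ HC] := continuous_bsupp_bounded c2 s2.
have [C' _ HC'] := continuous_bsupp_bounded c3 s3.
have [|||||_] := @Rintegral_partial_eq0 R d (fun x => f x * phi x) i N (C + C').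
- exact: continuous_measurable_Rd.
- exact: s1.
- by move=> x; exact: (derivableM (df x i) (dphi x)).
- by move=> x; rewrite EP (le_trans (ler_normD _ _))// lerD.
- exact: I2.
have -> : partial i (fun x => f x * phi x) = fun x => f x * partial i phi x + phi x * partial i f x.
  by apply/funext => x; exact: EP.
rewrite /volint RintegralD//; [|exact: I2..].
rewrite (@Rintegral_supp _ _ Om); last first.
  by move=> x Ox; rewrite (test_fun_out (test_fun_partial i tphi) Ox) mulr0.
rewrite (@Rintegral_supp _ _ Om); last first.
  by move=> x Ox; rewrite (test_fun_out tphi Ox) mul0r.
move=> /eqP; rewrite addr_eq0 => /eqP ->; congr (- _).
by apply: eq_Rintegral => x _; rewrite mulrC.
Qed.

Lemma weak_grad_smooth f : smooth f -> is_weak_grad Om f (fun i => partial i f).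
Proof.
move=> sf i; split; first by apply: smooth_sqint; exact: smooth_partial.
apply: weak_grad_C1 => [|x j|j]; first exact: smooth_continuous.
- exact: smooth_derivable.
- exact/smooth_continuous/smooth_partial.
Qed.

(** [wgrad] is an arbitrary choice among the weak gradients; their almost everywhere uniqueness lets
    the form be computed with whichever one is explicit. *)
Lemma dirichletE u w G H : is_weak_grad Om u G -> is_weak_grad Om w H ->
  dirichlet Om u w = vip mu (Om : set T) G H.
Proof.
move=> uG wH.
have uG' : is_weak_grad Om u (wgrad Om u) by apply: xgetPex; exists G.
have wH' : is_weak_grad Om w (wgrad Om w) by apply: xgetPex; exists H.
rewrite /dirichlet /volint /vip.
have -> : Int (fun x => \sum_i wgrad Om u i x * wgrad Om w i x) =
    \sum_i Int (fun x => wgrad Om u i x * wgrad Om w i x).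
  apply: (Rintegral_sumr mOm) => i.
  by apply: (integrable_mul_sqint mOm); [case: (uG' i)|case: (wH' i)].
apply: eq_bigr => i _.
have mM u1 u2 : L2 u1 -> L2 u2 -> measurable_fun (Om : set T) (fun x => u1 x * u2 x).
  by move=> [m1 _] [m2 _]; exact: measurable_funM.
apply: (eq_Rintegral_ae mOm); [exact: (mM _ _ (uG' i).1 (wH' i).1)|exact: (mM _ _ (uG i).1 (wH i).1)|].
have A1 := weak_grad_unique uG' uG i; have A2 := weak_grad_unique wH' wH i.
apply: (@filterS2 _ _ (ae_filter_ringOfSetsType mu) _ _ _ _ A1 A2) => x H1 H2 Ox.
by rewrite H1// H2.
Qed.

End sobolev_space.

(** * The space H^1_0 *)

Section H10_space.
Context {R : realType} {d : nat}.
Local Notation E := 'rV[R]_d.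
Local Notation T := (caratheodory_type (leb_om R d)).
Local Notation mu := (leb R d).
Variables (Om : set E) (M : R).
Hypotheses (oOm : open Om) (bOm : forall x, Om x -> `|x| <= M).
Local Notation Int f := (\int[mu]_(x in (Om : set T)) f x).
Local Notation L2 := (sqint mu (Om : set T)).
Local Notation mOm := (mOm oOm).
Implicit Types (u v w : E -> R) (G H : 'I_d -> E -> R) (U : set E).

(** A function and its gradient form one vector, the index [None] carrying the function, so that the
    H^1 norm inherits the inequalities of vector-valued L^2. *)
Definition jet u G (o : option 'I_d) : T -> R^o := if o is Some i then G i else u.

Definition jnorm u G : R := vip mu (Om : set T) (jet u G) (jet u G).

Lemma jnormE u G : jnorm u G =
  Int (fun x => u x * u x) + \sum_i Int (fun x => G i x * G i x).
Proof.
rewrite /jnorm /vip (bigD1 None)//=; congr (_ + _).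
rewrite (reindex_omap Some id)/=; last by case.
by apply: eq_bigl => i; rewrite eqxx.
Qed.

Lemma vsqint_jet u G : L2 u -> (forall i, L2 (G i)) -> vsqint mu (Om : set T) (jet u G).
Proof. by move=> su sG [i|]//=. Qed.

Let PHJ := @pre_hilbert_vsqint _ T R mu Om (option 'I_d) mOm.

Lemma jnorm_sub_le u v w G H K :
  L2 u -> L2 v -> L2 w -> (forall i, L2 (G i)) -> (forall i, L2 (H i)) -> (forall i, L2 (K i)) ->
  jnorm (fun x => u x - w x) (fun i x => G i x - K i x) <=
    2 * jnorm (fun x => u x - v x) (fun i x => G i x - H i x) +
    2 * jnorm (fun x => v x - w x) (fun i x => H i x - K i x).
Proof.
move=> su sv sw sG sH sK.
have := preh_sqrB_le PHJ (vsqint_jet su sG) (vsqint_jet sv sH) (vsqint_jet sw sK).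
have E1 u1 u2 G1 G2 : jet u1 G1 - jet u2 G2 = jet (fun x => u1 x - u2 x) (fun i x => G1 i x - G2 i x).
  by apply/funext => -[i|]; apply/funext.
by rewrite !E1.
Qed.

Lemma jnorm_ge0 u G : L2 u -> (forall i, L2 (G i)) -> 0 <= jnorm u G.
Proof. by move=> su sG; apply: (preh_ge0 PHJ); exact: vsqint_jet. Qed.

Lemma eq_jnorm_ae u G H : L2 u -> (forall i, L2 (G i)) -> (forall i, L2 (H i)) ->
  (forall i, {ae mu, forall x, Om x -> G i x = H i x}) -> jnorm u G = jnorm u H.
Proof.
move=> su sG sH GH; rewrite !jnormE; congr (_ + _); apply: eq_bigr => i _.
have mM f : L2 f -> measurable_fun (Om : set T) (fun x => f x * f x).
  by move=> [mf _]; exact: measurable_funM.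
apply: (eq_Rintegral_ae mOm (mM _ (sG i)) (mM _ (sH i))).
by apply: (@filterS _ _ (ae_filter_ringOfSetsType mu) _ _ _ (GH i)) => x Hx Ox; rewrite Hx.
Qed.

Lemma integral_jnorm u G : L2 u -> (forall i, L2 (G i)) ->
  (\int[mu]_(x in (Om : set T)) (u x ^+ 2 + \sum_i G i x ^+ 2)%:E)%E = (jnorm u G)%:E.
Proof.
move=> su sG.
have iu := integrable_sqr su.
have iG i := integrable_sqr (sG i).
have iS := integrable_sumr mOm (index_enum 'I_d) iG.
have -> : jnorm u G = Int (fun x => u x ^+ 2 + \sum_i G i x ^+ 2).
  rewrite jnormE (RintegralD mOm iu iS) (Rintegral_sumr mOm (index_enum 'I_d) iG).
  by [].
rewrite fineK//; apply: integrable_fin_num; first exact: mOm.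
exact: (integrable_addr mOm iu iS).
Qed.

Lemma test_fun_L2 U phi : test_fun U phi -> L2 phi.
Proof. by move=> tphi; exact: test_fun_sqint mOm tphi. Qed.

Lemma test_fun_partial_L2 U phi i : test_fun U phi -> L2 (partial i phi).
Proof. by move=> tphi; exact: test_fun_sqint mOm (test_fun_partial i tphi). Qed.

(** Trades the sequence and the chosen gradient of the definition for an epsilon statement with some
    weak gradient, the form in which membership is proved and linear closure is checked. *)
Lemma H10P U w : H10 Om U w <-> exists G, [/\ L2 w, is_weak_grad Om w G &
  forall e, 0 < e -> exists phi, test_fun U phi /\
    jnorm (fun x => phi x - w x) (fun i x => partial i phi x - G i x) < e].
Proof.
split.
  move=> [Hw [phi [tphi cphi]]]; have [sw wG] := H1_wgrad Hw.
  exists (wgrad Om w); split => // e e0.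
  have sG i : L2 (wgrad Om w i) by case: (wG i).
  have E1 n : (\int[mu]_(x in (Om : set T)) ((phi n x - w x) ^+ 2 +
      \sum_i (partial i (phi n) x - wgrad Om w i x) ^+ 2)%:E)%E =
      (jnorm (fun x => phi n x - w x) (fun i x => partial i (phi n) x - wgrad Om w i x))%:E.
    apply: (integral_jnorm (u := fun x => phi n x - w x)
      (G := fun i x => partial i (phi n) x - wgrad Om w i x)).
      exact: (sqintB mOm (test_fun_L2 (tphi n)) sw).
    by move=> i; exact: (sqintB mOm (test_fun_partial_L2 i (tphi n)) (sG i)).
  move: cphi; rewrite (eq_cvg _ _ E1) => /fine_cvgP[_ /cvgrPdist_lt/(_ e e0)[n _ Hn]].
  exists (phi n); split => //.
  have := Hn n (leqnn n); rewrite /= sub0r normrN; apply: le_lt_trans.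
  exact: ler_norm.
move=> [G [sw wG HG]].
have Hw : H1 Om w by split => //; exists G.
have [_ wG'] := H1_wgrad Hw.
have sG i : L2 (G i) by case: (wG i).
have sG' i : L2 (wgrad Om w i) by case: (wG' i).
split => //.
have /choice[phi Hphi] (n : nat) : exists phi, test_fun U phi /\
    jnorm (fun x => phi x - w x) (fun i x => partial i phi x - G i x) < n.+1%:R^-1.
  by apply: HG; rewrite invr_gt0.
exists phi; split; first by move=> n; case: (Hphi n).
pose a n := jnorm (fun x => phi n x - w x) (fun i x => partial i (phi n) x - G i x).
have E1 n : (\int[mu]_(x in (Om : set T)) ((phi n x - w x) ^+ 2 +
      \sum_i (partial i (phi n) x - wgrad Om w i x) ^+ 2)%:E)%E = (a n)%:E.
  have [tphi _] := Hphi n.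
  have sB : L2 (fun x => phi n x - w x) := sqintB mOm (test_fun_L2 tphi) sw.
  have sB1 i : L2 (fun x => partial i (phi n) x - G i x) :=
    sqintB mOm (test_fun_partial_L2 i tphi) (sG i).
  have sB2 i : L2 (fun x => partial i (phi n) x - wgrad Om w i x) :=
    sqintB mOm (test_fun_partial_L2 i tphi) (sG' i).
  rewrite (integral_jnorm (u := fun x => phi n x - w x)
      (G := fun i x => partial i (phi n) x - wgrad Om w i x) sB sB2).
  congr EFin; apply: eq_jnorm_ae => // i.
  have A := weak_grad_unique oOm bOm wG wG' i.
  by apply: (@filterS _ _ (ae_filter_ringOfSetsType mu) _ _ _ A) => x Hx Ox; rewrite Hx.
rewrite (eq_cvg _ _ E1); apply: cvg_EFin; first exact: nearW.
have a0 n : 0 <= a n.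
  have [tphi _] := Hphi n; apply: jnorm_ge0.
    exact: (sqintB mOm (test_fun_L2 tphi) sw).
  by move=> i; exact: (sqintB mOm (test_fun_partial_L2 i tphi) (sG i)).
apply: (squeeze_cvgr (f := fun=> 0) (h := @harmonic R)).
- by apply: nearW => n; rewrite a0/= ltW//; case: (Hphi n).
- exact: cvg_cst.
- exact: cvg_harmonic.
Qed.

Lemma H10_weak_grad U w G : H10 Om U w -> is_weak_grad Om w G ->
  forall e, 0 < e -> exists phi, test_fun U phi /\
    jnorm (fun x => phi x - w x) (fun i x => partial i phi x - G i x) < e.
Proof.
move=> /H10P[G' [sw wG' HG']] wG e /HG'[phi [tphi Hphi]]; exists phi; split => //.
have sG i : L2 (G i) by case: (wG i).
have sG' i : L2 (G' i) by case: (wG' i).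
suff -> : jnorm (fun x => phi x - w x) (fun i x => partial i phi x - G i x) =
    jnorm (fun x => phi x - w x) (fun i x => partial i phi x - G' i x) by [].
apply: eq_jnorm_ae.
- exact: (sqintB mOm (test_fun_L2 tphi) sw).
- by move=> i; exact: (sqintB mOm (test_fun_partial_L2 i tphi) (sG i)).
- by move=> i; exact: (sqintB mOm (test_fun_partial_L2 i tphi) (sG' i)).
- move=> i; have A := weak_grad_unique oOm bOm wG wG' i.
  by apply: (@filterS _ _ (ae_filter_ringOfSetsType mu) _ _ _ A) => x Hx Ox; rewrite Hx.
Qed.

Lemma H10D U v w : H10 Om U v -> H10 Om U w -> H10 Om U (fun x => v x + w x).
Proof.
move=> /H10P[G [sv vG HG]] /H10P[H [sw wH HH]]; apply/H10P.
exists (fun i x => G i x + H i x); split.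
- exact: (sqintD mOm sv sw).
- exact: weak_gradD.
have sG i : L2 (G i) by case: (vG i).
have sH i : L2 (H i) by case: (wH i).
move=> e e0; have e4 : 0 < e / 4 by rewrite divr_gt0.
have [phi [tphi Hphi]] := HG _ e4; have [psi [tpsi Hpsi]] := HH _ e4.
exists (fun x => phi x + psi x); split; first exact: test_funD.
(* The sum of the errors is written as a difference so that [jnorm_sub_le] applies with 0 as
   intermediate point. *)
have E1 : (fun x => phi x + psi x - (v x + w x)) = (fun x => (phi x - v x) - (w x - psi x)).
  by apply/funext => x; lra.
have E2 : (fun i x => partial i (fun x => phi x + psi x) x - (G i x + H i x)) =
    (fun i x => (partial i phi x - G i x) - (H i x - partial i psi x)).
  apply/funext => i; apply/funext => x; rewrite partialD; first by lra.
  - by apply: smooth_derivable; case: tphi.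
  - by apply: smooth_derivable; case: tpsi.
rewrite E1 E2.
have s0 : L2 (fun=> 0) := sqint0 mu (Om : set T).
have s1 := sqintB mOm (test_fun_L2 tphi) sv.
have s2 := sqintB mOm sw (test_fun_L2 tpsi).
have s3 i := sqintB mOm (test_fun_partial_L2 i tphi) (sG i).
have s4 i := sqintB mOm (sH i) (test_fun_partial_L2 i tpsi).
apply: (le_lt_trans (jnorm_sub_le s1 s0 s2 s3 (fun=> s0) s4)).
rewrite !jnormE in Hphi Hpsi *.
under eq_Rintegral do rewrite !subr0.
under eq_bigr do under eq_Rintegral do rewrite !subr0.
have E3 : Int (fun x => (0 - (w x - psi x)) * (0 - (w x - psi x))) =
    Int (fun x => (psi x - w x) * (psi x - w x)).
  by apply: eq_Rintegral => x _; rewrite sub0r opprB.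
have E4 : \sum_i Int (fun x => (0 - (H i x - partial i psi x)) * (0 - (H i x - partial i psi x))) =
    \sum_i Int (fun x => (partial i psi x - H i x) * (partial i psi x - H i x)).
  by apply: eq_bigr => i _; apply: eq_Rintegral => x _; rewrite sub0r opprB.
rewrite E3 E4; lra.
Qed.

Lemma H10Z U c w : H10 Om U w -> H10 Om U (fun x => c * w x).
Proof.
move=> /H10P[H [sw wH HH]]; apply/H10P.
exists (fun i x => c * H i x); split; [exact: (sqintZ mOm c sw)|exact: weak_gradZ|].
have sH i : L2 (H i) by case: (wH i).
(* Scaling multiplies the squared norm by c^2; the added 1 covers c = 0. *)
move=> e e0; have c1 : 0 < c ^+ 2 + 1 by rewrite ltr_wpDl ?sqr_ge0.
have [phi [tphi Hphi]] := HH (e / (c ^+ 2 + 1)) (divr_gt0 e0 c1).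
exists (fun x => c * phi x); split; first exact: test_funZ.
have E1 : jnorm (fun x => c * phi x - c * w x)
    (fun i x => partial i (fun x => c * phi x) x - c * H i x) =
    c ^+ 2 * jnorm (fun x => phi x - w x) (fun i x => partial i phi x - H i x).
  have sc f : L2 f -> Int (fun x => (c * f x) * (c * f x)) = c ^+ 2 * Int (fun x => f x * f x).
    move=> sf; rewrite -(RintegralZl _ mOm (integrable_mul_sqint mOm sf sf)).
    by apply: eq_Rintegral => x _; ring.
  rewrite !jnormE mulrDr mulr_sumr; congr (_ + _).
    rewrite -sc; last exact: (sqintB mOm (test_fun_L2 tphi) sw).
    by apply: eq_Rintegral => x _; ring.
  apply: eq_bigr => i _.
  rewrite -sc; last exact: (sqintB mOm (test_fun_partial_L2 i tphi) (sH i)).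
  apply: eq_Rintegral => x _; rewrite partialZ; first by ring.
  by apply: smooth_derivable; case: tphi.
rewrite E1; set n := jnorm _ _ in Hphi *.
have n0 : 0 <= n.
  apply: jnorm_ge0; first exact: (sqintB mOm (test_fun_L2 tphi) sw).
  by move=> i; exact: (sqintB mOm (test_fun_partial_L2 i tphi) (sH i)).
move: Hphi; rewrite ltr_pdivlMr// mulrDr mulr1 mulrC => H1.
by apply: le_lt_trans H1; rewrite lerDl.
Qed.

End H10_space.

(** * Mollification *)

Section convolution.
Context {R : realType} {d : nat}.
Local Notation E := 'rV[R]_d.
Local Notation T := (caratheodory_type (leb_om R d)).
Local Notation mu := (leb R d).
Local Notation e_ i := (delta_mx 0 i : E).
Local Notation IntT f := (\int[mu]_x f x).
Local Notation intg f := (mu.-integrable (setT : set T) (EFin \o f)).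
Implicit Types (h : T -> R) (psi : E -> R).

Definition convol h psi (x : E) : R := IntT (fun y => h y * psi (x - y)).

Lemma test_fun_lipschitz U psi : test_fun U psi ->
  exists2 L, 0 <= L & forall x y, `|psi x - psi y| <= L * `|x - y|.
Proof.
move=> tpsi.
have /choice[C HC] (i : 'I_d) : exists C, 0 <= C /\ forall x, `|partial i psi x| <= C.
  by have [C C0 HC] := test_fun_bounded (test_fun_partial i tpsi); exists C.
exists ((\sum_i C i) * d%:R).
  by rewrite mulr_ge0// sumr_ge0// => i _; case: (HC i).
move=> x y; apply: (@partial_bounded_lipschitz R d psi 0 (`|x| + `|y| + 1)).
- by move=> z i _; apply: smooth_derivable; case: tpsi.
- move=> z i _; apply: (le_trans ((HC i).2 z)); rewrite (bigD1 i)//= lerDl.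
  by apply: sumr_ge0 => j _; case: (HC j).
- by rewrite subr0; have := normr_ge0 x; lra.
- by rewrite subr0; have := normr_ge0 y; lra.
Qed.

(** A quadratic remainder, uniform in z, is what differentiation under the convolution integral
    needs. *)
Lemma test_fun_taylor U psi i : test_fun U psi ->
  exists2 L, 0 <= L & forall z s,
    `|psi (z + s *: e_ i) - psi z - s * partial i psi z| <= L * `|s| * `|s|.
Proof.
move=> tpsi; have [L L0 HL] := test_fun_lipschitz (test_fun_partial i tpsi).
exists L => // z s; pose a := partial i psi z.
have dpsi x : derivable psi x (e_ i) by apply: smooth_derivable; case: tpsi.
(* Without its linear part, the function has a derivative bounded by L |s| between 0 and s. *)
pose k (t : R) := psi (z + t *: e_ i) - t * a.
have dk t : is_derive t (1 : R) k (partial i psi (z + t *: e_ i) - a).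
  have d1 := is_derive_line (dpsi (z + t *: e_ i)).
  have d2 : is_derive t (1 : R) (fun t : R => t * a) a.
    have -> : (fun t : R => t * a) = a \*: id by apply/funext => u; rewrite mulrC.
    by apply: is_derive_eq; exact: mulr1.
  exact: is_deriveB.
have := @mvt_bound R R k 0 1 s (L * `|s|).
rewrite /k !add0r !scale0r addr0 mul0r subr0 [s *: 1]mulr1.
have -> : psi (z + s *: e_ i) - psi z - s * a = psi (z + s *: e_ i) - s * a - psi z by lra.
apply=> t tt; rewrite add0r [t *: 1]mulr1; have [dkt kt] := dk t => //.
rewrite kt; apply: (le_trans (HL _ _)); rewrite addrC addKr ler_wpM2l//.
apply: (le_trans (norm_delta_mx _ _)).
move: tt; case: (leP 0 s) => s0 /andP[t1 t2].
  by rewrite !ger0_norm.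
by rewrite !ler0_norm ?lerN2// ltW.
Qed.

Lemma continuous_sub (x : E) psi : continuous psi -> continuous (fun y : E => psi (x - y)).
Proof.
move=> cpsi y; apply: continuous_comp; last exact: cpsi.
by apply: continuousB; [exact: cst_continuous|exact: cvg_id].
Qed.

Lemma measurable_sub (x : E) psi : continuous psi ->
  measurable_fun (setT : set T) (fun y : E => psi (x - y)).
Proof. by move=> cpsi; apply: continuous_measurable_Rd; exact: continuous_sub. Qed.

Section fixed_function.
Variable h : T -> R.
Hypothesis Ih : intg h.

Let mh : measurable_fun (setT : set T) h.
Proof. by apply/measurable_EFinP; case/integrableP : Ih. Qed.

Lemma integrable_mulr_bounded (f : T -> R) C : measurable_fun (setT : set T) f ->
  (forall y, `|f y| <= C) -> intg (fun y => h y * f y).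
Proof.
move=> mf fC; apply: (@integrable_le _ T R mu setT measurableT _ (fun y => C * `|h y|)).
- exact: measurable_funM.
- by move=> y _; rewrite normrM mulrC ler_wpM2r.
- apply: (integrable_mulr measurableT C); exact: (integrable_norm Ih).
Qed.

Lemma integrable_convol U psi x : test_fun U psi -> intg (fun y => h y * psi (x - y)).
Proof.
move=> tpsi; have [C _ HC] := test_fun_bounded tpsi.
apply: (@integrable_mulr_bounded _ C); last by move=> y; exact: HC.
by apply: measurable_sub; apply: smooth_continuous; case: tpsi.
Qed.

Let H1 := IntT (fun y => `|h y|).
Let H1_ge0 : 0 <= H1. Proof. exact: Rintegral_ge0. Qed.

Lemma norm_Rintegral_mul_le (f : T -> R) C : measurable_fun (setT : set T) f ->
  (forall y, `|f y| <= C) -> `|IntT (fun y => h y * f y)| <= C * H1.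
Proof.
move=> mf fC; have I1 := integrable_mulr_bounded mf fC.
apply: (le_trans (le_normr_Rintegral measurableT I1)).
rewrite -(RintegralZl C measurableT (integrable_norm Ih)).
apply: le_Rintegral => //.
- exact: (integrable_norm I1).
- exact: (integrable_mulr measurableT C (integrable_norm Ih)).
- by move=> y _; rewrite normrM mulrC ler_wpM2r.
Qed.

Lemma convol_continuous U psi : test_fun U psi -> continuous (convol h psi).
Proof.
move=> tpsi x; have [L L0 HL] := test_fun_lipschitz tpsi.
have cpsi : continuous psi by apply: smooth_continuous; case: tpsi.
have key z : `|convol h psi x - convol h psi z| <= L * `|x - z| * H1.
  rewrite /convol -(RintegralB measurableT (integrable_convol x tpsi) (integrable_convol z tpsi)).
  under eq_Rintegral do rewrite -mulrBr.
  apply: norm_Rintegral_mul_le.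
    by apply: measurable_funB; exact: measurable_sub.
  move=> y; apply: (le_trans (HL _ _)).
  by rewrite (_ : x - y - (z - y) = x - z)// opprB addrA subrK.
apply/(@cvgrPdist_lt _ _ _ (nbhs (x : E))) => e e0.
have L1 : 0 < L * H1 + 1 by rewrite ltr_wpDl// mulr_ge0.
apply/nbhs_ballP; exists (e / (L * H1 + 1)); first by rewrite /= divr_gt0.
move=> z; rewrite -ball_normE /= ltr_pdivlMr// => Hz.
apply: (le_lt_trans (key z)); apply: le_lt_trans Hz.
by rewrite mulrAC [leRHS]mulrC ler_wpM2r// lerDl.
Qed.

(** The quadratic remainder of psi, integrated against h, leaves an error O(s^2) in the
    increment. *)
Lemma convol_partial U psi x i : test_fun U psi ->
  derivable (convol h psi) x (e_ i) /\
  partial i (convol h psi) x = convol h (partial i psi) x.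
Proof.
move=> tpsi; have [L L0 HL] := test_fun_taylor i tpsi.
have cpsi : continuous psi by apply: smooth_continuous; case: tpsi.
have tdpsi := test_fun_partial i tpsi.
have cdpsi : continuous (partial i psi) by apply: smooth_continuous; case: tdpsi.
have key s : `|convol h psi (x + s *: e_ i) - convol h psi x - s * convol h (partial i psi) x|
    <= L * `|s| * `|s| * H1.
  have I1 := integrable_convol (x + s *: e_ i) tpsi.
  have I2 := integrable_convol x tpsi.
  have I3 := integrable_convol x tdpsi.
  rewrite /convol -(RintegralZl s measurableT I3).
  rewrite -(RintegralB measurableT I1 I2).
  rewrite -(RintegralB measurableT (integrable_subr measurableT I1 I2) (integrable_mulr measurableT s I3)).
  have -> : IntT (fun y => h y * psi (x + s *: e_ i - y) - h y * psi (x - y) -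
      s * (h y * partial i psi (x - y))) =
    IntT (fun y => h y * (psi (x + s *: e_ i - y) - psi (x - y) - s * partial i psi (x - y))).
    by apply: eq_Rintegral => y _; ring.
  apply: norm_Rintegral_mul_le.
    apply: measurable_funB.
      by apply: measurable_funB; exact: measurable_sub.
    by apply: measurable_funM; [exact: measurable_cst|exact: measurable_sub].
  move=> y; have := HL (x - y) s.
  by rewrite (_ : x + s *: e_ i - y = x - y + s *: e_ i)// addrAC.
have lim : (fun s : R => s^-1 *: ((convol h psi \o shift x) (s *: e_ i) - convol h psi x)) @ 0^'
    --> convol h (partial i psi) x.
  apply/cvgrPdist_lt => e e0.
  have L1 : 0 < L * H1 + 1 by rewrite ltr_wpDl// mulr_ge0.
  near=> s.
  have s0 : s != 0 by near: s; exact: nbhs_dnbhs_neq.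
  have sn : 0 < `|s| by rewrite normr_gt0.
  rewrite /= [s *: _ + x]addrC distrC.
  have -> : s^-1 *: (convol h psi (x + s *: e_ i) - convol h psi x) - convol h (partial i psi) x =
     s^-1 * (convol h psi (x + s *: e_ i) - convol h psi x - s * convol h (partial i psi) x).
    by rewrite [_ *: _]/(_ * _) [RHS]mulrBr mulKf.
  rewrite normrM normfV -ltr_pdivlMl ?invr_gt0// invrK.
  apply: (le_lt_trans (key s)).
  have -> : L * `|s| * `|s| * H1 = `|s| * ((L * H1) * `|s|) by ring.
  rewrite ltr_pM2l//.
  apply: (@le_lt_trans _ _ ((L * H1 + 1) * `|s|)); first by rewrite ler_wpM2r// lerDl.
  rewrite mulrC -ltr_pdivlMr//; near: s.
  by apply: dnbhs0_lt; rewrite divr_gt0.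
split; first by apply/cvg_ex; exists (convol h (partial i psi) x).
exact: (cvg_lim _ lim).
Unshelve. all: by end_near. Qed.

Lemma convol_smooth U psi : test_fun U psi -> smooth (convol h psi).
Proof.
move=> tpsi; apply/smoothP => n.
elim: n psi tpsi => [|n IHn] psi tpsi; first exact: convol_continuous tpsi.
split.
- exact: convol_continuous tpsi.
- by move=> x i; have [] := convol_partial x i tpsi.
move=> i; have -> : partial i (convol h psi) = convol h (partial i psi).
  by apply/funext => x; have [_] := convol_partial x i tpsi.
exact: IHn (test_fun_partial i tpsi).
Qed.

Lemma convol_eq0 psi x : (forall y, h y <> 0 -> psi (x - y) = 0) -> convol h psi x = 0.
Proof.
move=> H; rewrite /convol.
have -> : (fun y => h y * psi (x - y)) = (fun=> 0).
  apply/funext => y; have [->|/eqP/H ->] := eqVneq (h y) 0; by rewrite ?mul0r ?mulr0.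
by rewrite (Rintegral_cst _ measurableT) mul0r.
Qed.

(** The i-th derivative of y -> psi(x - y) is minus that of psi at x - y, and this sign cancels the
    one of the weak formulation. *)
Lemma convol_weak_derivative (G : T -> R) U psi i x : test_fun U psi ->
  (forall phi, test_fun setT phi ->
     IntT (fun y => h y * partial i phi y) = - IntT (fun y => G y * phi y)) ->
  convol h (partial i psi) x = convol G psi x.
Proof.
move=> tpsi hG.
have tphi : test_fun (setT : set E) (fun y => psi (x - y)).
  have Ex : (fun y => psi (x - y)) = (fun y => psi ((-1) *: y + x)).
    by apply/funext => y; rewrite scaleN1r addrC.
  split; first by rewrite Ex; apply: smooth_affine; case: tpsi.
  have [N N0 HN] := test_fun_bsupp tpsi.
  exists [set y : E | `|y - x| <= N]; split => //; first exact: compact_norm_le.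
  by move=> y /= /negP; rewrite -ltNge distrC; exact: HN.
have := hG _ tphi.
have -> : (fun y => h y * partial i (fun y => psi (x - y)) y) =
    (fun y => -1 * (h y * partial i psi (x - y))).
  apply/funext => y.
  have dpsi : derivable psi ((-1) *: y + x) (e_ i) by apply: smooth_derivable; case: tpsi.
  have [_] := derive_affine dpsi.
  have -> : (fun y0 : E => psi ((-1) *: y0 + x)) = (fun y => psi (x - y)).
    by apply/funext => z; rewrite scaleN1r addrC.
  rewrite /partial => ->; rewrite scaleN1r [- y + x]addrC; ring.
rewrite (RintegralZl _ measurableT (integrable_convol x (test_fun_partial i tpsi))).
by rewrite mulN1r => /oppr_inj.
Qed.

End fixed_function.
End convolution.

Section mollification.
Context {R : realType} {d : nat}.
Local Notation E := 'rV[R]_d.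
Local Notation T := (caratheodory_type (leb_om R d)).
Local Notation mu := (leb R d).
Local Notation IntT f := (\int[mu]_x f x).
Local Notation intg f := (mu.-integrable (setT : set T) (EFin \o f)).
Local Notation L2T := (sqint mu (setT : set T)).

(** A dichotomy in place of the volume of a cube: if one ball is null, its countably many rational
    translates cover the space, so everything is null. Mollifiers can be normalized in the second
    case, and in the first one all integrals are 0. *)
Lemma leb_null_or_ball_gt0 : (mu setT = 0)%E \/
  forall r : R, 0 < r -> (0 < mu [set x : E | (`|x| < r)%R])%E.
Proof.
have [H|H] := pselect (forall r : R, 0 < r -> (0 < mu [set x : E | (`|x| < r)%R])%E); first by right.
left; move: H => /existsNP[r /not_implyP[r0 Hr]].
have B0 : mu [set x : E | `|x| < r] = 0%E.
  by apply/eqP; rewrite eq_le measure_ge0 andbT leNgt; apply/negP.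
have Bq (q : E) : mu [set x : E | `|x - q| < r] = 0%E.
  have -> : [set x : E | `|x - q| < r] = (fun x : E => 1 *: x + - q) @^-1` [set x : E | `|x| < r].
    by apply/seteqP; split => x /=; rewrite scale1r.
  rewrite [LHS](leb_outer_affine (- q) _ ltr01) expr1n invr1 mul1e.
  exact: B0.
pose F (k : nat) : set E := if @unpickle ('rV[rat]_d) k is Some q then
  [set x : E | `|x - map_mx ratr q| < r] else set0.
have F0 k : mu (F k) = 0%E by rewrite /F; case: unpickle => [q|]; [exact: Bq|exact: measure0].
apply/eqP; rewrite eq_le measure_ge0 andbT.
apply: (@le_trans _ _ (mu (\bigcup_k F k))).
  apply: le_outer_measure => x _; have [q xq] := dense_rat_row x r0.
  by exists (pickle q) => //; rewrite /F pickleK/= distrC.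
apply: (le_trans (outer_measure_sigma_subadditive (leb_om R d) F)).
by rewrite eseries0// => k _ _; exact: F0.
Qed.

Let rad (n : nat) : R := n.+1%:R^-1.
Let rad0 n : 0 < rad n. Proof. by rewrite invr_gt0. Qed.
Let rad2 n : rad n / 2 < rad n. Proof. by rewrite ltr_pdivrMr// ltr_pMr// ltr1n. Qed.
Let mol (n : nat) : E -> R := cutoff (rad n / 2) (rad n).
Let tmol n : test_fun setT (mol n).
Proof.
have -> : mol n = (fun x => cutoff (rad n / 2) (rad n) (x - 0)) by apply/funext => x; rewrite subr0.
exact: test_cutoff.
Qed.

Lemma test_fun_intg U f : test_fun U f -> intg f.
Proof.
move=> tf; have [M _ sf] := test_fun_bsupp tf; have [C _ fC] := test_fun_bounded tf.
by apply: integrable_bsupp sf fC; apply: smooth_measurable; case: tf.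
Qed.

Let mass n := IntT (mol n).

Let mass_gt0 n : (mu setT != 0)%E -> 0 < mass n.
Proof.
move=> muT; have [/eqP|H] := leb_null_or_ball_gt0; first by rewrite (negbTE muT).
pose B := [set x : E | `|x| < rad n / 2].
have mB : measurable (B : set T).
  have -> : B = [set x : E | `|x - 0| < rad n / 2].
    by apply/seteqP; split => x; rewrite /B /= subr0.
  exact: measurable_norm_ball.
have Boo : (mu B < +oo)%E by apply: (@leb_bounded _ _ _ (rad n / 2)) => x /ltW.
apply: (@lt_le_trans _ _ (fine (mu B))).
  by rewrite fine_gt0// Boo andbT H// divr_gt0.
have IB : intg (\1_B : T -> R).
  apply: (@integrable_bsupp R d (rad n / 2) 1).
  - exact: measurable_indic.
  - move=> x xr; rewrite indicE (_ : x \in B = false)//; apply/negbTE/negP => /set_mem.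
    by rewrite /B /= ltNge (ltW xr).
  - by move=> x; rewrite indicE; case: (x \in B); rewrite ?normr1 ?normr0.
have -> : fine (mu B) = IntT (\1_B : T -> R) by rewrite /Rintegral integral_indic// setIT.
apply: (le_Rintegral measurableT IB (test_fun_intg (tmol n))) => x _.
rewrite indicE; have [/set_mem Bx|_] := boolP (x \in B); last exact: cutoff_ge0.
by rewrite /mol cutoff_eq1//; exact: ltW.
Qed.

Definition mollifier (n : nat) : E -> R := fun x => (mass n)^-1 * mol n x.

Section mollifier_properties.
Hypothesis muT : (mu setT != 0)%E.
Variable n : nat.
Local Notation rho := (mollifier n).

Lemma test_mollifier : test_fun setT rho. Proof. exact: test_funZ. Qed.

Lemma mollifier_ge0 x : 0 <= rho x.
Proof. by rewrite mulr_ge0 ?invr_ge0 ?cutoff_ge0// ltW// mass_gt0. Qed.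

Lemma mollifierN x : rho (- x) = rho x.
Proof. by rewrite /mollifier /mol cutoffN. Qed.

Lemma mollifier_supp x : rad n <= `|x| -> rho x = 0.
Proof. by move=> xr; rewrite /mollifier /mol cutoff_eq0// mulr0. Qed.

Lemma Rintegral_mollifier (x : E) : IntT (fun y => rho (x - y)) = 1.
Proof.
have -> : (fun y => rho (x - y)) = (fun y => rho (1 *: y + - x)).
  by apply/funext => y; rewrite scale1r -mollifierN opprB.
rewrite (Rintegral_affine _ ltr01 (test_fun_intg test_mollifier)) expr1n invr1 mul1r.
by rewrite (RintegralZl _ measurableT (test_fun_intg (tmol n))) mulVf// gt_eqF// mass_gt0.
Qed.

Lemma measurable_step : measurable_fun setT (@step R).
Proof.
have cf n' : continuous (@flat R n').
  by move=> x; apply: differentiable_continuous; apply/derivable1_diffP; case: (is_derive_flat n' x).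
apply: continuous_measurable_fun => x; apply: continuousM; first exact: cf.
apply: continuousV; first by rewrite gt_eqF// flat_sum_gt0.
apply: continuousD; first exact: cf.
apply: continuous_comp; last exact: cf.
by apply: continuousB; [exact: cst_continuous|exact: cvg_id].
Qed.

(** Tonelli asks for measurability with respect to the product sigma-algebra, where only the
    coordinates are at hand; the cutoff is therefore rewritten as a finite product of functions of
    coordinate differences. *)
Lemma measurable_mollifier_sub :
  measurable_fun (setT : set (T * T)) (fun p : T * T => rho ((p.1 : E) - (p.2 : E))).
Proof.
apply: measurable_funM; first exact: measurable_cst.
have mc i : measurable_fun (setT : set (T * T)) (fun p : T * T => ((p.1 : E) 0 i - (p.2 : E) 0 i : R)).
  apply: measurable_funB.
    exact: (measurableT_comp (measurable_coord i) measurable_fst).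
  exact: (measurableT_comp (measurable_coord i) measurable_snd).
have ms (a c : R) i : measurable_fun (setT : set (T * T))
    (fun p : T * T => step (a * ((p.1 : E) 0 i - (p.2 : E) 0 i) + c)).
  apply: (measurableT_comp measurable_step); apply: measurable_funD; last exact: measurable_cst.
  by apply: measurable_funM; [exact: measurable_cst|exact: mc].
have H (s : seq 'I_d) : measurable_fun (setT : set (T * T)) (fun p : T * T =>
    \prod_(i <- s) (step ((- (rad n - rad n / 2)^-1) * ((p.1 : E) 0 i - (p.2 : E) 0 i) + rad n / (rad n - rad n / 2)) *
      step ((rad n - rad n / 2)^-1 * ((p.1 : E) 0 i - (p.2 : E) 0 i) + rad n / (rad n - rad n / 2)))).
  elim: s => [|i s IHs].
    by under eq_fun do rewrite big_nil; exact: measurable_cst.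
  under eq_fun do rewrite big_cons.
  by apply: measurable_funM; [apply: measurable_funM; exact: ms|exact: IHs].
have -> : (fun p : T * T => mol n ((p.1 : E) - (p.2 : E))) = (fun p : T * T =>
    \prod_(i <- index_enum 'I_d) (step ((- (rad n - rad n / 2)^-1) * ((p.1 : E) 0 i - (p.2 : E) 0 i) + rad n / (rad n - rad n / 2)) *
      step ((rad n - rad n / 2)^-1 * ((p.1 : E) 0 i - (p.2 : E) 0 i) + rad n / (rad n - rad n / 2)))).
  apply/funext => p; apply: eq_bigr => i _; rewrite !mxE.
  by congr (step _ * step _); ring.
exact: H.
Qed.

Variable h : T -> R.
Hypotheses (Ih : intg h) (sh : L2T h).

(** Jensen's inequality for the probability density y -> rho(x - y): with B the mean of h, the
    integral of (h - B)^2 rho is nonnegative. *)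
Lemma sqr_convol_le x : convol h rho x ^+ 2 <= IntT (fun y => h y ^+ 2 * rho (x - y)).
Proof.
set B := convol h rho x.
have crho : continuous rho by apply: smooth_continuous; case: test_mollifier.
have mr : measurable_fun (setT : set T) (fun y : E => rho (x - y)) by exact: measurable_sub.
have [C _ HC] := test_fun_bounded test_mollifier.
have I0 : intg (fun y : E => rho (x - y)).
  have -> : (fun y => rho (x - y)) = (fun y => rho (1 *: y + - x)).
    by apply/funext => y; rewrite scale1r -mollifierN opprB.
  exact: (integrable_affine _ ltr01 (test_fun_intg test_mollifier)).
have I1 : intg (fun y => h y * rho (x - y)) := integrable_convol Ih x test_mollifier.
have I2 : intg (fun y => h y ^+ 2 * rho (x - y)).
  exact: (integrable_mulr_bounded (integrable_sqr sh) mr (fun y => HC _)).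
have H : 0 <= IntT (fun y => (h y ^+ 2 * rho (x - y) - (2 * B) * (h y * rho (x - y))) + B ^+ 2 * rho (x - y)).
  apply: Rintegral_ge0 => y _.
  have -> : (h y ^+ 2 * rho (x - y) - (2 * B) * (h y * rho (x - y))) + B ^+ 2 * rho (x - y) =
    (h y - B) ^+ 2 * rho (x - y) by ring.
  by rewrite mulr_ge0 ?sqr_ge0 ?mollifier_ge0.
have I3 := integrable_mulr measurableT (2 * B) I1.
have I4 := integrable_mulr measurableT (B ^+ 2) I0.
move: H; rewrite (RintegralD measurableT (integrable_subr measurableT I2 I3) I4).
rewrite (RintegralB measurableT I2 I3) (RintegralZl _ measurableT I1) (RintegralZl _ measurableT I0).
rewrite Rintegral_mollifier mulr1 -/B -[IntT (fun y => h y * rho (x - y))]/B.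
set A := (X in X - _ + _) => H; apply: (@le_trans _ _ A); last exact: lexx.
by clearbody A; rewrite !expr2 in H *; lra.
Qed.

(** Jensen pointwise, then Tonelli: integrating first in x leaves the total mass 1 of the
    mollifier. *)
Lemma young_convol : L2T (convol h rho) /\
  IntT (fun x => convol h rho x * convol h rho x) <= IntT (fun x => h x * h x).
Proof.
have crho : continuous rho by apply: smooth_continuous; case: test_mollifier.
have mconv : measurable_fun (setT : set T) (convol h rho).
  exact: (smooth_measurable (D := setT) (convol_smooth Ih test_mollifier)).
have mh : measurable_fun (setT : set T) h by case: sh.
pose F (p : T * T) : \bar R := (h p.2 ^+ 2 * rho ((p.1 : E) - (p.2 : E)))%:E.
have mF : measurable_fun setT F.
  apply/measurable_EFinP; apply: measurable_funM; last exact: measurable_mollifier_sub.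
  by apply: measurable_funX; exact: (measurableT_comp mh measurable_snd).
have F0 p : (0 <= F p)%E by rewrite lee_fin mulr_ge0 ?sqr_ge0 ?mollifier_ge0.
have tonelli := @fubini_tonelli _ _ T T R (leb_sfin : {sigma_finite_measure set T -> \bar R})
  (leb_sfin : {sigma_finite_measure set T -> \bar R}) F mF F0.
have E1 y : (\int[leb_sfin]_x F (x, y) = (h y ^+ 2)%:E)%E.
  have mr : measurable_fun (setT : set T) (fun x : E => rho (x - y)).
    have -> : (fun x : E => rho (x - y)) = (fun x : E => rho (y - x)).
      by apply/funext => x; rewrite -mollifierN opprB.
    exact: measurable_sub.
  transitivity (\int[mu]_x ((h y ^+ 2)%:E * (rho ((x : E) - y))%:E))%E.
    by apply: eq_integral => x _; rewrite /F /= EFinM.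
  have mrE : measurable_fun (setT : set T) (fun x : E => (rho (x - y))%:E).
    exact/measurable_EFinP.
  have r0 x : (setT : set T) x -> (0 <= (rho ((x : E) - y))%:E)%E.
    by move=> _; rewrite lee_fin mollifier_ge0.
  have h0 : (0 <= (h y ^+ 2)%:E)%E by rewrite lee_fin sqr_ge0.
  rewrite (ge0_integralZl mu measurableT mrE r0 h0).
  have -> : (\int[mu]_x (rho ((x : E) - y))%:E = (IntT (fun x => rho (y - x)))%:E)%E.
    rewrite fineK; first by apply: eq_integral => x _; rewrite -mollifierN opprB.
    have I0 : intg (fun x => rho (y - x)).
      have -> : (fun x => rho (y - x)) = (fun x => rho (1 *: x + - y)).
        by apply/funext => x; rewrite scale1r -mollifierN opprB.
      exact: (integrable_affine _ ltr01 (test_fun_intg test_mollifier)).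
    exact: (integrable_fin_num measurableT I0).
  by rewrite Rintegral_mollifier mule1.
have E2 x : ((convol h rho x ^+ 2)%:E <= \int[leb_sfin]_y F (x, y))%E.
  apply: (@le_trans _ _ (IntT (fun y => h y ^+ 2 * rho ((x : E) - y)))%:E).
    by rewrite lee_fin sqr_convol_le.
  rewrite fineK; [exact: lexx|]; 
  have [C _ HC] := test_fun_bounded test_mollifier.
  apply: (integrable_fin_num measurableT).
  exact: (integrable_mulr_bounded (integrable_sqr sh) (measurable_sub x crho) (fun y => HC _)).
have key : (\int[mu]_x (convol h rho x ^+ 2)%:E <= \int[mu]_y (h y ^+ 2)%:E)%E.
  have mc2 : measurable_fun (setT : set T) (fun x => (convol h rho x ^+ 2)%:E).
    exact/measurable_EFinP/measurable_funX.
  have mFF : measurable_fun (setT : set T) (fun x => (\int[leb_sfin]_y F (x, y))%E).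
    exact: measurable_fun_fubini_tonelli_F.
  have c0 x : (setT : set T) x -> (0 <= (convol h rho x ^+ 2)%:E)%E by rewrite lee_fin sqr_ge0.
  have := ge0_le_integral mu measurableT c0 mc2 mFF (fun x _ => E2 x).
  move/le_trans; apply.
  rewrite -eq_integral_leb_sfin tonelli -[leRHS]eq_integral_leb_sfin le_eqVlt; apply/orP; left.
  by apply/eqP/eq_integral => y _; rewrite E1.
have sconv : L2T (convol h rho).
  by split; [exact: mconv|apply: le_lt_trans key _; case: sh].
split; first exact: sconv.
rewrite -lee_fin -(integral_sqr_fin measurableT sconv) -(integral_sqr_fin measurableT sh).
exact: key.
Qed.

End mollifier_properties.
End mollification.

Section mollifier_convergence.
Context {R : realType} {d : nat}.
Local Notation E := 'rV[R]_d.
Local Notation T := (caratheodory_type (leb_om R d)).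
Local Notation mu := (leb R d).
Local Notation IntT f := (\int[mu]_x f x).
Local Notation intg f := (mu.-integrable (setT : set T) (EFin \o f)).
Local Notation L2T := (sqint mu (setT : set T)).

Lemma sqint_restrict (D : set T) (h : T -> R) : measurable D -> L2T h -> sqint mu D h.
Proof.
move=> mD sh; apply: sqintP.
  by case: sh => mh _; exact: measurable_funS mh.
exact: (integrableS measurableT mD (@subsetT _ _) (integrable_sqr sh)).
Qed.

Lemma sqint_extend (D : set T) (h : T -> R) : measurable D -> (forall x, ~ D x -> h x = 0) ->
  sqint mu D h -> L2T h.
Proof.
move=> mD hD sh; have hE : h = h \_ D.
  apply/funext => x; rewrite /patch; case: ifPn => //.
  by rewrite notin_setE => /hD.
apply: sqintP.
  by rewrite hE; apply/(measurable_restrictT h mD); case: sh.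
have -> : (fun x => h x ^+ 2) = (fun x => h x ^+ 2) \_ D.
  apply/funext => x; rewrite /patch; case: ifPn => //.
  by rewrite notin_setE => /hD ->; rewrite expr0n.
rewrite -restrict_EFin; apply/(integrable_mkcond _ mD).
exact: integrable_sqr sh.
Qed.

Lemma sqint_bsupp_integrable N (h : T -> R) : bsupp N h -> L2T h -> intg h.
Proof.
move=> sh h2; rewrite -(restrict_bsupp sh) -restrict_EFin.
apply/(integrable_mkcond _ (measurable_norm_le N)).
apply: (sqint_integrable (measurable_norm_le N) (leb_norm_le N)).
exact: (sqint_restrict (measurable_norm_le N) h2).
Qed.

Lemma open_norm_lt (r : R) : open [set x : E | `|x| < r].
Proof.
apply: (@open_comp _ _ (fun x : E => `|x|) [set y | y < r]); last exact: open_lt.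
by move=> x _; exact: norm_continuous.
Qed.

Section nontrivial.
Hypothesis muT : (mu setT != 0)%E.

(** [phi x] is also an average against the mollifier, whose support has radius 1 / (n + 1), so the
    Lipschitz constant bounds the difference. *)
Lemma convol_test_close (phi : E -> R) U : test_fun U phi ->
  exists2 L, 0 <= L & forall n x, `|convol phi (mollifier n) x - phi x| <= L * n.+1%:R^-1.
Proof.
move=> tphi; have [L L0 HL] := test_fun_lipschitz tphi; exists L => // n x.
have Iphi : intg phi := test_fun_intg tphi.
have tm := @test_mollifier R d n.
have I1 := integrable_convol Iphi x tm.
have I0 : intg (fun y : E => mollifier n (x - y)).
  have -> : (fun y : E => mollifier n (x - y)) = (fun y : E => mollifier n (1 *: y + - x)).
    by apply/funext => y; rewrite scale1r -mollifierN opprB.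
  exact: (integrable_affine _ ltr01 (test_fun_intg tm)).
have I2 := integrable_mulr measurableT (phi x) I0.
have -> : convol phi (mollifier n) x - phi x =
    IntT (fun y => phi y * mollifier n (x - y) - phi x * mollifier n (x - y)).
  rewrite (RintegralB measurableT I1 I2) (RintegralZl _ measurableT I0).
  by rewrite Rintegral_mollifier// mulr1.
have I3 := integrable_subr measurableT I1 I2.
apply: (le_trans (le_normr_Rintegral measurableT I3)).
have -> : L * n.+1%:R^-1 = IntT (fun y => (L * n.+1%:R^-1) * mollifier n (x - y)).
  by rewrite (RintegralZl _ measurableT I0) Rintegral_mollifier// mulr1.
apply: (le_Rintegral measurableT (integrable_norm I3) (integrable_mulr measurableT _ I0)) => y _.
rewrite /= -mulrBl normrM (ger0_norm (mollifier_ge0 _ _ _))//.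
have [xy|xy] := leP n.+1%:R^-1 `|x - y|; first by rewrite mollifier_supp// !mulr0.
rewrite ler_wpM2r ?mollifier_ge0//; apply: (le_trans (HL _ _)).
by rewrite ler_wpM2l// distrC ltW.
Qed.

Lemma convolB (h g : T -> R) psi U x : intg h -> intg g -> test_fun U psi ->
  convol (fun y => h y - g y) psi x = convol h psi x - convol g psi x.
Proof.
move=> Ih Ig tpsi.
have I1 := integrable_convol Ih x tpsi; have I2 := integrable_convol Ig x tpsi.
by rewrite /convol -(RintegralB measurableT I1 I2); apply: eq_Rintegral => y _; rewrite mulrBl.
Qed.

Lemma convol_bsupp (h : T -> R) N n : bsupp N h -> bsupp (N + n.+1%:R^-1) (convol h (mollifier n)).
Proof.
move=> sh x Nx; apply: convol_eq0 => y hy; apply: mollifier_supp.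
have yN : `|y : E| <= N by rewrite leNgt; apply/negP => /sh.
have : `|x| <= `|x - y| + `|y : E| by rewrite -{1}(subrK y x) ler_normD.
by move: Nx yN; move: (n.+1%:R^-1) => r; lra.
Qed.

Let PHT := pre_hilbert_sqint mu (measurableT : measurable (setT : set T)).

(** h is replaced by a nearby test function f: convolution does not increase the L^2 distance, and
    for f the convergence is uniform with supports in a fixed cube. *)
Lemma convol_cvg N (h : T -> R) : bsupp N h -> L2T h ->
  forall e, 0 < e -> exists n0, forall n, (n0 <= n)%N -> L2T (convol h (mollifier n)) /\
    IntT (fun x => (convol h (mollifier n) x - h x) * (convol h (mollifier n) x - h x)) < e.
Proof.
move=> sh h2 e e0.
(* Two uses of |x + y|^2 <= 2 |x|^2 + 2 |y|^2 put weights 2, 4 and 4 on terms below e / 16. *)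
have arith (a b c b' k : R) : a <= 2 * b + 2 * c -> c <= 2 * b' + 2 * k ->
    b < e / 16 -> b' < e / 16 -> k < e / 16 -> a < e by lra.
have Ih := sqint_bsupp_integrable sh h2.
pose U := [set x : E | `|x| < `|N| + 1].
have oU : open U by exact: open_norm_lt.
have mU : measurable (U : set T) by exact: open_measurable_Rd.
have Uoo : (mu U < +oo)%E by apply: (@leb_bounded _ _ _ (`|N| + 1)) => x /ltW.
have hU x : ~ U x -> h x = 0.
  by move=> /negP; rewrite -leNgt => H; apply: sh; have := ler_norm N; lra.
have [phi [tphi cphi]] := test_fun_dense oU Uoo (sqint_restrict mU h2).
have e16 : 0 < e / 16 by rewrite divr_gt0.
have [k Hk] : exists k, IntT (fun x => (phi k x - h x) * (phi k x - h x)) < e / 16.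
  move/cvgrPdist_lt : cphi => /(_ _ e16)[k _ Hk]; exists k.
  have := Hk k (leqnn k); rewrite /= sub0r normrN => H; apply: le_lt_trans H.
  apply: le_trans (ler_norm _); rewrite (@Rintegral_supp _ _ (U : set T))// => x Ux.
  by rewrite (test_fun_out (tphi k) Ux) (hU _ Ux) subrr mulr0.
pose f := phi k; have tf : test_fun U f := tphi k.
have [L L0 HL] := convol_test_close tf.
have [N1 N10 sf] := test_fun_bsupp tf.
have If : intg f := test_fun_intg tf.
have f2 : L2T f := test_fun_sqint measurableT tf.
have hf2 : L2T (fun x => h x - f x) := sqintB measurableT h2 f2.
pose V := fine (mu [set x : E | (`|x| <= N1 + 1)%R]).
have V0 : 0 <= V by exact: fine_ge0.
have [n0 Hn0] : exists n0, forall n, (n0 <= n)%N -> (L * n.+1%:R^-1) ^+ 2 * V < e / 16.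
  have H : (fun n : nat => (L * n.+1%:R^-1) * (L * n.+1%:R^-1) * V) @ \oo --> (L * 0) * (L * 0) * V.
    by apply: cvgM; [apply: cvgM; (apply: cvgM; [exact: cvg_cst|exact: cvg_harmonic])|exact: cvg_cst].
  rewrite !mulr0 mul0r in H; move/cvgrPdist_lt : H => /(_ _ e16)[n0 _ Hn]; exists n0 => n nn.
  by have := Hn n nn; rewrite /= sub0r normrN; apply: le_lt_trans; exact: ler_norm.
exists n0 => n nn; have tm := @test_mollifier R d n.
have [ch2 _] := young_convol muT n Ih h2.
have [cf2 _] := young_convol muT n If f2.
have Ihf : intg (fun x => h x - f x) := integrable_subr measurableT Ih If.
have [_ yhf] := young_convol muT n Ihf hf2.
split; first exact: ch2.
have B1 := preh_sqrB_le PHT ch2 cf2 h2.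
have B2 := preh_sqrB_le PHT cf2 f2 h2.
have Y : IntT (fun x => (convol h (mollifier n) x - convol f (mollifier n) x) *
      (convol h (mollifier n) x - convol f (mollifier n) x)) < e / 16.
  apply: le_lt_trans Hk; apply: le_trans (le_trans yhf _).
    rewrite le_eqVlt; apply/orP; left; apply/eqP; apply: eq_Rintegral => x _.
    by rewrite -(convolB _ Ih If tm).
  rewrite le_eqVlt; apply/orP; left; apply/eqP; apply: eq_Rintegral => x _.
  by rewrite -mulrNN !opprB.
have C : IntT (fun x => (convol f (mollifier n) x - f x) * (convol f (mollifier n) x - f x)) < e / 16.
  apply: le_lt_trans (Hn0 n nn).
  pose B := [set x : E | (`|x| <= N1 + 1)%R].
  have mB : measurable (B : set T) by exact: measurable_norm_le.
  rewrite (@Rintegral_supp _ _ (B : set T)); last first.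
    move=> x /negP; rewrite -ltNge => Bx; rewrite sf; last by rewrite (lt_trans _ Bx)// ltrDl.
    rewrite (convol_bsupp sf) ?subrr ?mulr0//.
    by apply: le_lt_trans Bx; rewrite lerD2l invf_le1 ?ltr0n// ler1n.
  have cfB : sqint mu (B : set T) (fun x => convol f (mollifier n) x - f x).
    by apply: (sqint_restrict mB); exact: (sqintB measurableT cf2 f2).
  rewrite /V -(Rintegral_cst mu mB).
  apply: (le_Rintegral mB (integrable_mul_sqint mB cfB cfB)).
    exact: (integrable_cst_fin mB _ (leb_norm_le _)).
  move=> x _; rewrite -expr2 -[leLHS]ger0_norm ?sqr_ge0// normrX ler_sqr ?nnegrE ?mulr_ge0//.
exact: (arith _ _ _ _ _ B1 B2 Y C Hk).
Qed.

End nontrivial.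
End mollifier_convergence.

(** * H^1 functions of compact support belong to H^1_0 *)

Section compactly_supported_H1.
Context {R : realType} {d : nat}.
Local Notation E := 'rV[R]_d.
Local Notation T := (caratheodory_type (leb_om R d)).
Local Notation mu := (leb R d).
Local Notation e_ i := (delta_mx 0 i : E).
Local Notation IntT f := (\int[mu]_x f x).
Local Notation L2T := (sqint mu (setT : set T)).

Lemma near_eq_partial (f g : E -> R) x i : (\forall y \near x, f y = g y) ->
  partial i f x = partial i g x.
Proof.
have e0 : e_ i != 0.
  apply/eqP => /rowP/(_ i); rewrite !mxE !eqxx /= => /eqP.
  by rewrite oner_eq0.
by move=> fg; exact: near_eq_derive.
Qed.

Lemma near_eq_derivable_partial (f g : E -> R) x i : (\forall y \near x, f y = g y) ->
  derivable f x (e_ i) -> derivable g x (e_ i).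
Proof. by move=> fg; exact: near_eq_derivable. Qed.

(** K' is the superlevel set where a cutoff equal to 1 on K is at least 1/2: the cutoff is
    Lipschitz, so moving by delta lowers it by at most 1/2. *)
Lemma compact_margin (K U : set E) : compact K -> open U -> K `<=` U ->
  exists delta K', [/\ (0 : R) < delta, compact K', K' `<=` U &
    forall x y, K x -> `|y - x| <= delta -> K' y].
Proof.
move=> cK oU KU; have [eta [N [teta _ _ KN etaN]]] := cutoff_compact oU cK KU.
have [L L0 HL] := test_fun_lipschitz teta.
have ceta : continuous eta by apply: smooth_continuous; case: teta.
pose K' := [set y : E | 2^-1 <= eta y].
have clK : closed K'.
  by apply: (@closed_comp _ _ eta [set t | 2^-1 <= t]); [move=> x _; exact: ceta|exact: closed_ge].
have [M M0 sM] := test_fun_bsupp teta.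
exists (2 * (L + 1))^-1, K'; split.
- by rewrite invr_gt0 mulr_gt0// ltr_wpDl.
- apply: (subclosed_compact clK (@compact_norm_le R d 0 M)) => y; rewrite /K' /= subr0 => Hy.
  by rewrite leNgt; apply/negP => /sM y0; move: Hy; rewrite y0 leNgt invr_gt0 ltr0n.
- move=> y; rewrite /K' /= => Hy; apply: contrapT => /(test_fun_out teta) y0.
  by move: Hy; rewrite y0 leNgt invr_gt0 ltr0n.
move=> x y Kx xy; rewrite /K' /=.
have := HL y x; rewrite (etaN _ (KN _ Kx)) => H.
have : `|eta y - 1| <= 2^-1.
  apply: (le_trans H); apply: (@le_trans _ _ (L * (2 * (L + 1))^-1)).
    by rewrite ler_wpM2l.
  by rewrite invfM mulrCA ler_piMr// ler_pdivrMr ?mul1r ?lerDl// ltr_wpDl.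
by rewrite ler_norml => /andP[]; lra.
Qed.

Lemma Rintegral_sqr_subset (D : set T) (f : T -> R) : measurable D -> L2T f ->
  \int[mu]_(x in D) (f x * f x) <= IntT (fun x => f x * f x).
Proof.
move=> mD sf; rewrite Rintegral_mkcond.
have I1 := integrable_mul_sqint measurableT sf sf.
apply: (le_Rintegral measurableT _ I1).
  rewrite -restrict_EFin; apply/(integrable_mkcond _ mD).
  exact: (integrableS measurableT mD (@subsetT _ _) I1).
by move=> x _; rewrite /patch; case: ifP => // _; rewrite -expr2 sqr_ge0.
Qed.

Definition weak_grad_Rd (h : E -> R) (G : 'I_d -> E -> R) :=
  forall i phi, test_fun setT phi ->
    IntT (fun y : T => h y * partial i phi y) = - IntT (fun y : T => G i y * phi y).

Variables (Om : set E) (M : R).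
Hypotheses (oOm : open Om) (bOm : forall x, Om x -> `|x| <= M).
Local Notation Int f := (\int[mu]_(x in (Om : set T)) f x).
Local Notation L2 := (sqint mu (Om : set T)).
Local Notation mOm := (mOm oOm).

(** A test function on the whole space is multiplied by a cutoff equal to 1 near K, which changes
    neither side of the identity. *)
Lemma weak_grad_Rd_extend (g : E -> R) G (K : set E) : compact K -> K `<=` Om ->
  is_weak_grad Om g G -> (forall x, ~ K x -> g x = 0) -> (forall i x, ~ K x -> G i x = 0) ->
  weak_grad_Rd g G.
Proof.
move=> cK KOm gG gK GK i phi tphi.
have [eta [N [teta _ oN KN etaN]]] := cutoff_compact oOm cK KOm.
have sphi : smooth phi by case: tphi.
have tpsi : test_fun Om (fun x => phi x * eta x) by exact: test_funM.
rewrite (@Rintegral_supp _ _ (Om : set T)); last first.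
  by move=> x Ox; rewrite gK ?mul0r// => /KOm.
rewrite [in RHS](@Rintegral_supp _ _ (Om : set T)); last first.
  by move=> x Ox; rewrite GK ?mul0r// => /KOm.
have [_ /(_ _ tpsi)] := gG i.
have -> : volint Om (fun x => g x * partial i (fun x => phi x * eta x) x) =
    Int (fun x => g x * partial i phi x).
  apply: eq_Rintegral => x _; have [Kx|Kx] := pselect (K x); last by rewrite gK// !mul0r.
  congr (_ * _); apply: near_eq_partial.
  apply: filterS (open_nbhs_nbhs (conj oN (KN _ Kx))) => y /etaN ->.
  by rewrite mulr1.
move=> ->; congr (- _); apply: eq_Rintegral => x _.
have [Kx|Kx] := pselect (K x); last by rewrite GK// !mul0r.
by rewrite (etaN _ (KN _ Kx)) mulr1.
Qed.

(** Extended by zero, g has the weak gradient G on the whole space, so mollification commutes with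
    the gradient. Once its radius is below the margin of K in U, the mollified functions are test
    functions of U. *)
Lemma H10_mollify (g : E -> R) G (K U : set E) : compact K -> open U -> K `<=` U -> U `<=` Om ->
  L2 g -> is_weak_grad Om g G -> (forall x, ~ K x -> g x = 0) -> (forall i x, ~ K x -> G i x = 0) ->
  H10 Om U g.
Proof.
move=> cK oU KU UOm sg gG gK GK.
have KOm : K `<=` Om by move=> x /KU /UOm.
have sG i : L2 (G i) by case: (gG i).
apply/(H10P oOm bOm); exists G; split=> // e e0.
(* If the whole space is null, all norms are 0 and the zero function approximates g; otherwise the
   mollifiers have positive mass. *)
have [muT|muT] := eqVneq (mu setT) 0%E.
  exists (fun=> 0); split; first exact: test_fun0.
  have muO : mu (Om : set T) = 0%E.
    by apply/eqP; rewrite eq_le measure_ge0 andbT -muT; apply: le_outer_measure.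
  have I0 f : L2 f -> Int (fun x => f x * f x) = 0.
    move=> [mf _].
    have mff : measurable_fun (Om : set T) (fun x => (f x * f x)%:E).
      by apply/measurable_EFinP; exact: measurable_funM.
    by rewrite /Rintegral (null_set_integral mOm mff muO).
  have s1 := sqintB mOm (test_fun_L2 oOm (test_fun0 U)) sg.
  have s2 i := sqintB mOm (test_fun_partial_L2 oOm i (test_fun0 U)) (sG i).
  rewrite jnormE (I0 _ s1) add0r (eq_bigr (fun=> 0)); first by rewrite big1.
  by move=> i _; exact: (I0 _ (s2 i)).
have [delta [K' [delta0 cK' K'U HK']]] := compact_margin cK oU KU.
have [N N0 KN] := compact_norm_bound cK.
have out x : N < `|x| -> ~ K x by move=> Nx /KN; rewrite leNgt Nx.
have g2 : L2T g by apply: (sqint_extend mOm _ sg) => x Ox; apply: gK => /KOm.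
have G2 i : L2T (G i) by apply: (sqint_extend mOm _ (sG i)) => x Ox; apply: GK => /KOm.
have bg : bsupp N g by move=> x /out; exact: gK.
have bG i : bsupp N (G i) by move=> x /out; exact: GK.
have Ig := sqint_bsupp_integrable bg g2.
have hG := weak_grad_Rd_extend cK KOm gG gK GK.
(* The squared H^1 norm is a sum of d + 1 integrals, each allowed e / (d + 1). *)
pose e' := e / d.+1%:R; have e'0 : 0 < e' by rewrite divr_gt0.
have [n1 Hn1] := convol_cvg muT bg g2 e'0.
have /choice[n2 Hn2] i := convol_cvg muT (bG i) (G2 i) e'0.
have [n3 Hn3] : exists n3, forall n, (n3 <= n)%N -> n.+1%:R^-1 < delta.
  have /cvgrPdist_lt/(_ _ delta0)[n3 _ H] := @cvg_harmonic R; exists n3 => n nn.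
  by have := H n nn; rewrite /= sub0r normrN ger0_norm.
pose n := (n1 + n3 + \sum_i n2 i)%N.
have nn1 : (n1 <= n)%N by rewrite /n -addnA leq_addr.
have nn3 : (n3 <= n)%N by rewrite /n [(n1 + n3)%N]addnC -addnA leq_addr.
have nn2 i : (n2 i <= n)%N by rewrite /n (bigD1 i)//= addnCA leq_addr.
have tm := @test_mollifier R d n.
pose phi := convol g (mollifier n).
have dphi i : partial i phi = convol (G i) (mollifier n).
  apply/funext => x; have [_ ->] := convol_partial Ig x i tm.
  by apply: convol_weak_derivative tm _ => // phi' tphi'; exact: hG.
exists phi; split.
  split; first exact: (convol_smooth Ig tm).
  exists K'; split => // x K'x; apply: convol_eq0 => y gy; apply: mollifier_supp.
  rewrite leNgt; apply/negP => xy; apply: K'x; apply: (HK' y x).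
    by apply: contrapT => /gK.
  by rewrite ltW// (lt_trans xy)// Hn3.
have [c2 cg] := Hn1 n nn1.
have B1 : Int (fun x => (phi x - g x) * (phi x - g x)) < e'.
  exact: le_lt_trans (Rintegral_sqr_subset mOm (sqintB measurableT c2 g2)) cg.
have B2 i : Int (fun x => (partial i phi x - G i x) * (partial i phi x - G i x)) <= e'.
  have [ci cGi] := Hn2 i n (nn2 i); rewrite dphi.
  exact/ltW/(le_lt_trans (Rintegral_sqr_subset mOm (sqintB measurableT ci (G2 i))) cGi).
rewrite jnormE; apply: (@lt_le_trans _ _ (e' + \sum_(i < d) e')).
  by apply: ltr_leD => //; apply: ler_sum => i _; exact: B2.
rewrite sumr_const card_ord -mulr_natr /e' -{1}[e / _]mulr1 -mulrDr -natr1 [1 + _]addrC.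
by rewrite divfK ?gt_eqF// natr1 ltr0n.
Qed.

(** The chosen [wgrad] may be nonzero off the support of g. Multiplying by a cutoff eta equal to 1
    near C leaves g unchanged and exhibits eta times [wgrad] as a weak gradient with compact support
    in U. *)
Lemma H10_compact_support (g : E -> R) (C U : set E) : compact C -> open U -> C `<=` U ->
  U `<=` Om -> H1 Om g -> (forall x, ~ C x -> g x = 0) -> H10 Om U g.
Proof.
move=> cC oU CU UOm Hg gC; have [sg gG] := H1_wgrad Hg.
have [eta [N [teta _ oN CN etaN]]] := cutoff_compact oU cC CU.
have seta : smooth eta by case: teta.
have [_ [K [cK KU etaK]]] := teta.
have := weak_gradM oOm bOm seta sg gG.
have -> : (fun x => eta x * g x) = g.
  apply/funext => x; have [Cx|/gC ->] := pselect (C x); last by rewrite mulr0.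
  by rewrite (etaN _ (CN _ Cx)) mul1r.
have -> : (fun i x => eta x * wgrad Om g i x + partial i eta x * g x) =
    (fun i x => eta x * wgrad Om g i x).
  apply/funext => i; apply/funext => x.
  have [Cx|/gC ->] := pselect (C x); last by rewrite mulr0 addr0.
  rewrite (@near_eq_partial eta (fun=> 1)) ?partial_cst ?mul0r ?addr0//.
  by apply: filterS (open_nbhs_nbhs (conj oN (CN _ Cx))) => y; exact: etaN.
move=> gG1; apply: (H10_mollify (K := C `|` K) _ oU _ UOm sg gG1).
- exact: compactU.
- by move=> x [/CU|/KU].
- by move=> x /not_orP[/gC].
- by move=> i x /not_orP[_ /etaK ->]; rewrite mul0r.
Qed.

End compactly_supported_H1.

(** * Capacitary potentials *)

Section coordinate_functions.
Context {R : realType} {d : nat}.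
Local Notation E := 'rV[R]_d.
Local Notation e_ i := (delta_mx 0 i : E).

Lemma partial_coord (i j : 'I_d) (x : E) :
  derivable (fun y : E => y 0 i) x (e_ j) /\ partial j (fun y : E => y 0 i) x = (j == i)%:R.
Proof.
apply: derive_from_line.
have -> : (fun t : R => (x + t *: e_ j) 0 i) = (j == i)%:R \*: id + cst (x 0 i).
  apply/funext => t; rewrite !mxE eqxx/= [i == j]eq_sym.
  by rewrite addrC mulrC.
by apply: is_derive_eq; rewrite addr0; exact: mulr1.
Qed.

Lemma smooth_coord (i : 'I_d) : smooth (fun y : E => y 0 i).
Proof.
apply/smoothP => -[|n]; first exact: coord_continuous.
split; [exact: coord_continuous|by move=> x j; case: (partial_coord i j x)|] => j.
have -> : partial j (fun y : E => y 0 i) = fun=> (j == i)%:R.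
  by apply/funext => x; case: (partial_coord i j x).
exact: Ck_cst.
Qed.

End coordinate_functions.

Section capacitary_potential.
Context {R : realType} {d : nat}.
Local Notation E := 'rV[R]_d.
Local Notation T := (caratheodory_type (leb_om R d)).
Local Notation mu := (leb R d).
Local Notation e_ i := (delta_mx 0 i : E).
Variables (Om : set E) (M : R).
Hypotheses (oOm : open Om) (bOm : forall x, Om x -> `|x| <= M).
Local Notation Int f := (\int[mu]_(x in (Om : set T)) f x).
Local Notation L2 := (sqint mu (Om : set T)).
Local Notation mOm := (mOm oOm).
Local Notation vipO := (vip mu (Om : set T)).
Local Notation vL2 := (vsqint mu (Om : set T)).
Implicit Types (G H : 'I_d -> T -> R^o).

Let PH1 := pre_hilbert_sqint mu mOm.
Let PHV := @pre_hilbert_vsqint _ T R mu Om 'I_d mOm.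

Definition gradf (phi : E -> R) : 'I_d -> T -> R^o := fun i => partial i phi.

Lemma vL2_gradf U phi : test_fun U phi -> vL2 (gradf phi).
Proof. by move=> tphi i; exact: (test_fun_partial_L2 oOm i tphi). Qed.

(** Testing the weak derivative of x_i phi against phi shows that the integral of phi^2 is -2 times
    that of x_i phi d_i phi. As |x_i| <= M, Young's inequality absorbs half of it, which gives the
    constant 4 M^2. *)
Lemma poincare (i : 'I_d) phi : test_fun Om phi ->
  Int (fun x => phi x * phi x) <= 4 * M ^+ 2 * Int (fun x => partial i phi x * partial i phi x).
Proof.
move=> tphi; have sphi : smooth phi by case: tphi.
have sxphi : smooth (fun x : E => x 0 i * phi x) := smoothM (smooth_coord i) sphi.
have [_ /(_ _ tphi)] := weak_grad_smooth oOm bOm sxphi i; rewrite /volint.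
pose A := Int (fun x : E => x 0 i * phi x * partial i phi x).
pose B := Int (fun x : E => partial i (fun y : E => y 0 i * phi y) x * phi x).
rewrite -/A -/B => AB.
have L1 : L2 phi := test_fun_L2 oOm tphi.
have L2' : L2 (partial i phi) := test_fun_partial_L2 oOm i tphi.
have L3 : L2 (fun x : E => x 0 i * phi x) := smooth_sqint oOm bOm sxphi.
have I1 := integrable_mul_sqint mOm L1 L1.
have I2 := integrable_mul_sqint mOm L3 L2'.
have I3 := integrable_mul_sqint mOm L2' L2'.
have EB : B = Int (fun x => phi x * phi x) + A.
  rewrite /B /A -(RintegralD mOm I1 I2); apply: eq_Rintegral => x _.
  have [dc pc] := partial_coord i i x.
  rewrite (partialM dc (smooth_derivable sphi)) pc eqxx.
  by rewrite /= mulr1n; move: (phi x) (partial i phi x) (x 0 i) => a b c; ring.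
have HA : Int (fun x => phi x * phi x) = - 2 * A by move: AB; rewrite EB; lra.
have LE : - 2 * A <= 2^-1 * Int (fun x => phi x * phi x) +
    2 * M ^+ 2 * Int (fun x => partial i phi x * partial i phi x).
  rewrite -(RintegralZl (- 2) mOm I2) -(RintegralZl 2^-1 mOm I1) -(RintegralZl (2 * M ^+ 2) mOm I3).
  have J1 := integrable_mulr mOm 2^-1 I1.
  have J3 := integrable_mulr mOm (2 * M ^+ 2) I3.
  rewrite -(RintegralD mOm J1 J3).
  apply: (le_Rintegral mOm (integrable_mulr mOm (- 2) I2) (integrable_addr mOm J1 J3)) => x /bOm xM.
  have := le_trans (ler_coord_norm x i) xM.
  move: (x 0 i) (phi x) (partial i phi x) => t a b tM.
  have t2 : t ^+ 2 <= M ^+ 2.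
    by rewrite -(real_normK (num_real t)) ler_sqr ?nnegrE// (le_trans _ tM).
  have : (t ^+ 2) * (b * b) <= M ^+ 2 * (b * b) by rewrite ler_wpM2r// -expr2 sqr_ge0.
  have : 0 <= (a + 2 * (t * b)) ^+ 2 by exact: sqr_ge0.
  by rewrite !expr2; nra.
by move: HA LE; lra.
Qed.

Lemma H10_approx U w H : H10 Om U w -> is_weak_grad Om w H ->
  exists phi : nat -> E -> R, [/\ forall n, test_fun U (phi n),
    (fun n => Int (fun x => (phi n x - w x) * (phi n x - w x))) @ \oo --> 0 &
    (fun n => vipO (gradf (phi n) - H) (gradf (phi n) - H)) @ \oo --> 0].
Proof.
move=> Hw wH; have [[sw _] _] := Hw.
have sH i : L2 (H i) by case: (wH i).
have /choice[phi Hphi] (n : nat) : exists phi, test_fun U phi /\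
    jnorm Om (fun x => phi x - w x) (fun i x => partial i phi x - H i x) < n.+1%:R^-1.
  by apply: (H10_weak_grad oOm bOm Hw wH); rewrite invr_gt0.
exists phi; have tphi n : test_fun U (phi n) by case: (Hphi n).
have s1 n : L2 (fun x => phi n x - w x) := sqintB mOm (test_fun_L2 oOm (tphi n)) sw.
have s2 n : vL2 (gradf (phi n) - H).
  by move=> i; exact: (sqintB mOm (test_fun_partial_L2 oOm i (tphi n)) (sH i)).
have a0 n : 0 <= Int (fun x => (phi n x - w x) * (phi n x - w x)).
  exact: (preh_ge0 PH1 (s1 n)).
have b0 n : 0 <= vipO (gradf (phi n) - H) (gradf (phi n) - H) by exact: (preh_ge0 PHV (s2 n)).
have ab n : Int (fun x => (phi n x - w x) * (phi n x - w x)) +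
    vipO (gradf (phi n) - H) (gradf (phi n) - H) < n.+1%:R^-1.
  by have [_] := Hphi n; rewrite jnormE.
split => //.
- apply: (squeeze_cvgr (f := fun=> 0) (h := @harmonic R)); [|exact: cvg_cst|exact: cvg_harmonic].
  apply: nearW => n; rewrite a0/=; apply: le_trans (ltW (ab n)).
  by rewrite lerDl.
- apply: (squeeze_cvgr (f := fun=> 0) (h := @harmonic R)); [|exact: cvg_cst|exact: cvg_harmonic].
  apply: nearW => n; rewrite b0/=; apply: le_trans (ltW (ab n)).
  by rewrite lerDr.
Qed.

(** Both sides are continuous for L^2 convergence of gradients, so a bound known on test functions
    passes to H^1_0. *)
Lemma H10_vip_le U w H A c : vL2 A -> H10 Om U w -> is_weak_grad Om w H ->
  (forall phi, test_fun U phi -> vipO A (gradf phi) ^+ 2 <= c * vipO (gradf phi) (gradf phi)) ->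
  vipO A H ^+ 2 <= c * vipO H H.
Proof.
move=> sA Hw wH HA; have [phi [tphi _ cphi]] := H10_approx Hw wH.
have sH : vL2 H by move=> i; case: (wH i).
have sp n : vL2 (gradf (phi n)) := vL2_gradf (tphi n).
have c1 : (fun n => vipO (gradf (phi n)) A) @ \oo --> vipO H A.
  exact: (cvg_preh PHV sp sH sA cphi).
have c2 : (fun n => vipO (gradf (phi n)) H) @ \oo --> vipO H H.
  exact: (cvg_preh PHV sp sH sH cphi).
have c3 : (fun n => vipO (gradf (phi n)) (gradf (phi n))) @ \oo --> vipO H H.
  have -> : (fun n => vipO (gradf (phi n)) (gradf (phi n))) =
      (fun n => vipO (gradf (phi n) - H) (gradf (phi n) - H) + 2 * vipO (gradf (phi n)) H - vipO H H).
    apply/funext => n; rewrite -scaleN1r (preh_sqrD PHV)//; ring.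
  rewrite -[X in _ --> X](_ : 0 + 2 * vipO H H - vipO H H = _); last by ring.
  apply: cvgB; last exact: cvg_cst.
  by apply: cvgD => //; apply: cvgM => //; exact: cvg_cst.
have L1 : (fun n => vipO (gradf (phi n)) A * vipO (gradf (phi n)) A) @ \oo --> vipO H A * vipO H A.
  exact: cvgM.
have L2' : (fun n => c * vipO (gradf (phi n)) (gradf (phi n))) @ \oo --> c * vipO H H.
  by apply: cvgM => //; exact: cvg_cst.
rewrite (preh_sym PHV sA sH) expr2 -(cvg_lim _ L1)// -(cvg_lim _ L2')//; apply: ler_lim.
- by apply/cvg_ex; eexists; exact: L1.
- by apply/cvg_ex; eexists; exact: L2'.
by apply: nearW => n; rewrite -expr2 (preh_sym PHV (sp n) sA); exact: HA.
Qed.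

Lemma H10_vip_eq0 U w H A : vL2 A -> H10 Om U w -> is_weak_grad Om w H ->
  (forall phi, test_fun U phi -> vipO A (gradf phi) = 0) -> vipO A H = 0.
Proof.
move=> sA Hw wH HA; have : vipO A H ^+ 2 <= 0 * vipO H H.
  by apply: (H10_vip_le sA Hw wH) => phi tphi; rewrite HA// expr0n mul0r.
by rewrite mul0r => H0; apply/eqP; rewrite -sqrf_eq0 eq_le H0 sqr_ge0.
Qed.

(** The projection is taken among L^2 vector fields, on the closure of the gradients of test
    functions. Poincare's inequality, in the direction [i0], makes the approximating test functions
    themselves Cauchy, so the limit field is the gradient of some r in H^1_0(U). *)
Lemma H10_projection (i0 : 'I_d) U A : U `<=` Om -> vL2 A ->
  exists r P, [/\ H10 Om U r, L2 r, is_weak_grad Om r P &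
    forall phi, test_fun U phi -> vipO (A - P) (gradf phi) = 0].
Proof.
move=> UOm sA.
pose S : set ('I_d -> T -> R^o) := [set G | exists2 phi, test_fun U phi & G = gradf phi].
have gD phi psi : test_fun U phi -> test_fun U psi ->
    gradf (fun x => phi x + psi x) = gradf phi + gradf psi.
  move=> [sphi _] [spsi _]; apply/funext => i; apply/funext => x.
  by apply: partialD; exact: smooth_derivable.
have gZ c phi : test_fun U phi -> gradf (fun x => c * phi x) = c *: gradf phi.
  move=> [sphi _]; apply/funext => i; apply/funext => x.
  by apply: partialZ; exact: smooth_derivable.
have [|||||s [P [Ss sP cP oP]]] := @hilbert_projection R _ _ _ PHV S A (@vsqint_complete _ T R mu Om 'I_d mOm).
- exists (fun=> 0); first exact: test_fun0.
  by apply/funext => i; apply/funext => x; rewrite /gradf partial_cst.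
- by move=> _ [phi tphi ->]; exact: vL2_gradf tphi.
- move=> _ _ [phi tphi ->] [psi tpsi ->]; exists (fun x => phi x + psi x); first exact: test_funD.
  by rewrite gD.
- move=> a _ [phi tphi ->]; exists (fun x => a * phi x); first exact: test_funZ.
  by rewrite gZ.
- exact: sA.
have /choice[phi Hphi] n : exists phi, test_fun U phi /\ s n = gradf phi.
  by have [phi tphi sE] := Ss n; exists phi.
have tphi n : test_fun U (phi n) by case: (Hphi n).
have sE n : s n = gradf (phi n) by case: (Hphi n).
have sp n : vL2 (s n) by rewrite sE; exact: vL2_gradf (tphi n).
have C1 : 0 < 4 * M ^+ 2 + 1 by rewrite ltr_wpDl// mulr_ge0// sqr_ge0.
have dist m n : Int (fun x => (phi m x - phi n x) * (phi m x - phi n x)) <=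
    4 * M ^+ 2 * vipO (s m - s n) (s m - s n).
  have tmn : test_fun Om (fun x => phi m x + -1 * phi n x).
    apply: test_funD; first exact: test_fun_sub UOm (tphi m).
    by apply: test_funZ; exact: test_fun_sub UOm (tphi n).
  have psiE : (fun x => phi m x + -1 * phi n x) = (fun x => phi m x - phi n x).
    by apply/funext => x; rewrite mulN1r.
  rewrite psiE in tmn; apply: (le_trans (poincare i0 tmn)); rewrite ler_wpM2l//; first by rewrite mulr_ge0// sqr_ge0.
  have -> : partial i0 (fun x => phi m x - phi n x) = (s m - s n) i0.
    rewrite !sE; apply/funext => x.
    rewrite -psiE; have d1 : derivable (phi m) x (e_ i0) by apply: smooth_derivable; case: (tphi m).
    have d2 : derivable (phi n) x (e_ i0) by apply: smooth_derivable; case: (tphi n).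
    have d3 : derivable (fun x => -1 * phi n x) x (e_ i0).
      by apply: smooth_derivable; case: (test_funZ (-1) (tphi n)).
    by rewrite (partialD d1 d3) (partialZ _ d2) mulN1r.
  rewrite [leRHS](bigD1 i0)//= lerDl; apply: sumr_ge0 => j _.
  by apply: Rintegral_ge0 => x _; rewrite -expr2 sqr_ge0.
have [|e e0|r sr cr] := @sqint_complete _ T R mu Om mOm phi.
- by move=> n; exact: (test_fun_L2 oOm (tphi n)).
(* Distances to P below e' give squared mutual distances below 4 e', which Poincare's constant,
   enlarged to 4 M^2 + 1 to be positive, turns into e. *)
- pose e' := e / (4 * (4 * M ^+ 2 + 1)); have e'0 : 0 < e' by rewrite divr_gt0// mulr_gt0.
  move/cvgrPdist_lt : cP => /(_ _ e'0)[N _ HN]; exists N => m n Nm Nn.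
  have sN k : (N <= k)%N -> vipO (s k - P) (s k - P) < e'.
    by move=> Nk; have := HN k Nk; rewrite /= sub0r normrN; apply: le_lt_trans; exact: ler_norm.
  apply: (le_lt_trans (dist m n)).
  have := preh_sqrB_le PHV (sp m) sP (sp n).
  have -> : vipO (P - s n) (P - s n) = vipO (s n - P) (s n - P).
    have sB := prehB PHV (sp n) sP; have sB' := prehN PHV sB.
    by rewrite -(opprB (s n) P) (preh_oppl PHV sB sB') (preh_sym PHV sB sB') (preh_oppl PHV sB sB) opprK.
  move=> H; have H4 : vipO (s m - s n) (s m - s n) < 4 * e'.
    by apply: (le_lt_trans H); move: (sN m Nm) (sN n Nn); lra.
  apply: (@lt_le_trans _ _ ((4 * M ^+ 2 + 1) * (4 * e'))).
    apply: (@le_lt_trans _ _ ((4 * M ^+ 2 + 1) * vipO (s m - s n) (s m - s n))).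
      by apply: ler_wpM2r; [exact: (preh_ge0 PHV (prehB PHV (sp m) (sp n)))|rewrite lerDl].
    by rewrite ltr_pM2l.
  by rewrite mulrCA mulrA /e' mulrC divfK// gt_eqF// mulr_gt0.
have wP : is_weak_grad Om r P.
  move=> i; split; first exact: sP.
  move=> psi tpsi; rewrite /volint.
  have spsi := test_fun_L2 oOm tpsi; have sdpsi := test_fun_partial_L2 oOm i tpsi.
  have l1 := cvg_preh PH1 (fun n => test_fun_L2 oOm (tphi n)) sr sdpsi cr.
  have ci : (fun n => Int (fun x => (s n i x - P i x) * (s n i x - P i x))) @ \oo --> 0.
    apply: (squeeze_cvgr (f := fun=> 0) (h := fun n => vipO (s n - P) (s n - P))) => //; last exact: cvg_cst.
    apply: nearW => n; apply/andP; split.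
      by apply: Rintegral_ge0 => x _; rewrite -expr2 sqr_ge0.
    rewrite [leRHS](bigD1 i)//= lerDl; apply: sumr_ge0 => j _.
    by apply: Rintegral_ge0 => x _; rewrite -expr2 sqr_ge0.
  have l2 := cvg_preh PH1 (fun n => sp n i) (sP i) spsi ci.
  have fE : (fun n => Int (fun x => phi n x * partial i psi x)) =
      (- (fun n => Int (fun x => s n i x * psi x))).
    apply/funext => n; change (Int (fun x => phi n x * partial i psi x) = - Int (fun x => s n i x * psi x)).
    rewrite sE; by have [_ /(_ _ tpsi)] := weak_grad_smooth oOm bOm (tphi n).1 i.
  rewrite fE in l1; exact: (cvg_unique (@norm_hausdorff _ _) l1 (cvgN l2)).
exists r, P; split => //; last by move=> psi tpsi; apply: oP; exists psi.
apply/(H10P oOm bOm); exists P; split => // e e0.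
have e2 : 0 < e / 2 by rewrite divr_gt0.
move/cvgrPdist_lt : cP => /(_ _ e2)[N1 _ H1]; move/cvgrPdist_lt : cr => /(_ _ e2)[N2 _ H2].
pose n := maxn N1 N2; exists (phi n); split => //.
have := H1 n (leq_maxl _ _); have := H2 n (leq_maxr _ _); rewrite /= !sub0r !normrN => h2 h1.
rewrite jnormE; have -> : \sum_i Int (fun x => (partial i (phi n) x - P i x) * (partial i (phi n) x - P i x)) =
    vipO (s n - P) (s n - P) by rewrite sE.
have := le_lt_trans (ler_norm _) h1; have := le_lt_trans (ler_norm _) h2; lra.
Qed.

End capacitary_potential.

Section capacity.
Context {R : realType} {d : nat}.
Local Notation E := 'rV[R]_d.
Local Notation T := (caratheodory_type (leb_om R d)).
Local Notation mu := (leb R d).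
Variables (Om : set E) (M : R).
Hypotheses (oOm : open Om) (bOm : forall x, Om x -> `|x| <= M).
Local Notation mOm := (mOm oOm).
Local Notation vipO := (vip mu (Om : set T)).
Local Notation vL2 := (vsqint mu (Om : set T)).

Let PHV := @pre_hilbert_vsqint _ T R mu Om 'I_d mOm.

Lemma H10_sub U U' w : U `<=` U' -> H10 Om U w -> H10 Om U' w.
Proof.
move=> UU' [Hw [phi [tphi cphi]]]; split => //; exists phi; split => // n.
exact: test_fun_sub UU' (tphi n).
Qed.

Lemma H10B U v w : H10 Om U v -> H10 Om U w -> H10 Om U (fun x => v x - w x).
Proof.
move=> Hv Hw; have := H10D oOm bOm Hv (H10Z oOm bOm (-1) Hw).
by congr (H10 Om U _); apply/funext => x; rewrite mulN1r.
Qed.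

(** The condition of [is_potential] near K, isolated so that it can be required of trial functions
    that are not harmonic off K. *)
Definition extends_near (K : set E) (u W : E -> R) := forall eta, test_fun Om eta ->
  (exists N, [/\ open N, K `<=` N & forall x, N x -> eta x = 1]) ->
  H10 Om (Om `\` K) (fun x => W x - eta x * u x).

(** [potential] is a choice, which satisfies [is_potential] once some solution exists. One is
    obtained by subtracting from W the r in H^1_0(Om \ K) whose gradient is the projection of
    [DW]. *)
Lemma is_potential_exists (i0 : 'I_d) K u W DW : H10 Om Om W -> is_weak_grad Om W DW ->
  extends_near K u W -> exists V, is_potential Om K u V.
Proof.
move=> HW wW uW; have sDW : vL2 DW by move=> i; case: (wW i).
have [[sW _] _] := HW.
have [r [P [Hr sr wP oP]]] := H10_projection oOm bOm i0 (@subDsetl _ Om K) sDW.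
have sP : vL2 P by move=> i; case: (wP i).
exists (fun x => W x - r x); split.
- exact: (H10B HW (H10_sub (@subDsetl _ Om K) Hr)).
- move=> eta teta etaK; have := H10B (uW eta teta etaK) Hr.
  by congr (H10 _ _ _); apply/funext => x; rewrite addrAC.
move=> phi Hphi; have [H1phi _] := Hphi; have [_ wphi] := H1_wgrad H1phi.
rewrite (dirichletE oOm bOm (weak_gradB oOm sW sr wW wP) wphi).
exact: (H10_vip_eq0 oOm bOm (prehB PHV sDW sP) Hphi wphi oP).
Qed.

(** W and the chosen potential both match eta u for one common cutoff eta, so their difference is in
    H^1_0(Om \ K), to which the gradient of the potential is orthogonal. *)
Lemma potential_split (i0 : 'I_d) K u W DW : compact K -> K `<=` Om ->
  H10 Om Om W -> is_weak_grad Om W DW -> extends_near K u W ->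
  exists DV DR, [/\ vL2 DV, is_weak_grad Om (potential Om K u) DV, vL2 DR, DW = DV + DR &
    (forall r Dr, H10 Om (Om `\` K) r -> is_weak_grad Om r Dr -> vipO DV Dr = 0) /\
    exists2 r, H10 Om (Om `\` K) r & is_weak_grad Om r DR].
Proof.
move=> cK KOm HW wW uW; have [V0 PV0] := is_potential_exists i0 HW wW uW.
have [HV V2 V3] : is_potential Om K u (potential Om K u) by apply: xgetPex; exists V0.
have [H1V _] := HV; have [H1W _] := HW.
have [sV wV] := H1_wgrad H1V; have [sW _] := H1_wgrad H1W.
have sDW : vL2 DW by move=> i; case: (wW i).
have sDV : vL2 (wgrad Om (potential Om K u)) by move=> i; case: (wV i).
exists (wgrad Om (potential Om K u)), (DW - wgrad Om (potential Om K u)).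
have sDR := prehB PHV sDW sDV; split; [exact: sDV|exact: wV|exact: sDR|by rewrite addrC subrK|].
split.
  move=> r Dr Hr wr; rewrite -(dirichletE oOm bOm wV wr).
  exact: V3.
exists (fun x => W x - potential Om K u x); last exact: (weak_gradB oOm sW sV wW wV).
have [eta [N [teta _ oN KN etaN]]] := cutoff_compact oOm cK KOm.
have etaK : exists N, [/\ open N, K `<=` N & forall x, N x -> eta x = 1] by exists N.
have := H10B (uW eta teta etaK) (V2 eta teta etaK).
by congr (H10 _ _ _); apply/funext => x; rewrite opprB addrA subrK.
Qed.

(* Writing [W = V + r] with [V] the potential and [r] in [H^1_0(Om \ K)], the
   two are orthogonal, so the error is <Dr_a, Dr_b>, and |Dr|^2 <= e by
   testing [r] against [DW]. *)
Lemma Cap_estimate (i0 : 'I_d) K ua ub Wa DWa Wb DWb ea eb : compact K -> K `<=` Om ->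
  0 <= ea -> 0 <= eb ->
  H10 Om Om Wa -> is_weak_grad Om Wa DWa -> extends_near K ua Wa ->
  H10 Om Om Wb -> is_weak_grad Om Wb DWb -> extends_near K ub Wb ->
  (forall phi, test_fun (Om `\` K) phi ->
    vipO DWa (gradf phi) ^+ 2 <= ea * vipO (gradf phi) (gradf phi)) ->
  (forall phi, test_fun (Om `\` K) phi ->
    vipO DWb (gradf phi) ^+ 2 <= eb * vipO (gradf phi) (gradf phi)) ->
  (Cap Om K ua ub - vipO DWa DWb) ^+ 2 <= ea * eb.
Proof.
move=> cK KOm ea0 eb0 HWa wWa ext_a HWb wWb ext_b Ha Hb.
have [DVa [DRa [sVa wVa sRa EWa [oVa [ra Hra wra]]]]] := potential_split i0 cK KOm HWa wWa ext_a.
have [DVb [DRb [sVb wVb sRb EWb [oVb [rb Hrb wrb]]]]] := potential_split i0 cK KOm HWb wWb ext_b.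
have sWa : vL2 DWa by move=> i; case: (wWa i).
have sWb : vL2 DWb by move=> i; case: (wWb i).
have bound (D DV DR : 'I_d -> T -> R^o) r e : vL2 D -> vL2 DV -> vL2 DR -> D = DV + DR -> 0 <= e ->
    H10 Om (Om `\` K) r -> is_weak_grad Om r DR -> vipO DV DR = 0 ->
    (forall phi, test_fun (Om `\` K) phi ->
      vipO D (gradf phi) ^+ 2 <= e * vipO (gradf phi) (gradf phi)) -> vipO DR DR <= e.
  move=> sD sV sR ED e0 Hr wr VR HD.
  (* By orthogonality <D, DR> = |DR|^2, so testing against DR itself gives |DR|^4 <= e |DR|^2. *)
  have := H10_vip_le oOm bOm sD Hr wr HD.
  rewrite {1}ED (preh_addl PHV sV sR sR) VR add0r expr2 => H.
  have : 0 <= vipO DR DR := preh_ge0 PHV sR.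
  rewrite le_eqVlt => /orP[/eqP <-//|R0].
  by move: H; rewrite ler_pM2r.
have Na := bound _ _ _ _ _ sWa sVa sRa EWa ea0 Hra wra (oVa _ _ Hra wra) Ha.
have Nb := bound _ _ _ _ _ sWb sVb sRb EWb eb0 Hrb wrb (oVb _ _ Hrb wrb) Hb.
rewrite /Cap (dirichletE oOm bOm wVa wVb).
have -> : vipO DVa DVb - vipO DWa DWb = - vipO DRa DRb.
  rewrite EWa EWb (preh_addl PHV sVa sRa (prehD PHV sVb sRb)).
  rewrite (preh_addr PHV sVb sRb sVa) (preh_addr PHV sVb sRb sRa).
  rewrite (oVa _ _ Hrb wrb) (preh_sym PHV sRa sVb) (oVb _ _ Hra wra).
  by rewrite addr0 add0r opprD addNKr.
rewrite sqrrN; apply: (le_trans (preh_cs PHV sRa sRb)).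
by apply: ler_pM => //; exact: (preh_ge0 PHV).
Qed.

End capacity.

(** * The scalar truncation *)

Section truncation.
Context {R : realType}.
Implicit Types s : R.

(* A smooth truncation, with bounded derivative [theta]: [tau (n s) / n] vanishes
   for [|s| <= 1 / n], and its derivative tends to [1] for [s != 0]. *)
Definition tau s : R := s * flat 0 (s * s - 1).
Definition theta s : R := flat 0 (s * s - 1) + 2 * (s * s) * flat 1 (s * s - 1).

Lemma is_derive_tau s : is_derive s (1 : R) tau (theta s).
Proof.
have dq : is_derive s (1 : R) (fun t : R => t * t - 1) (2 * s).
  apply: is_derive_eq; rewrite subr0 /GRing.scale/= !mulr1; ring.
have df : is_derive s (1 : R) (fun t : R => flat 0 (t * t - 1)) (flat 1 (s * s - 1) * (2 * s)).
  exact: (@is_derive1_comp R (flat 0) (fun t : R => t * t - 1) s _ _ (is_derive_flat 0 _) dq).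
apply: is_derive_eq; rewrite /theta /GRing.scale/= mulr1; ring.
Qed.

Lemma continuous_flat n : continuous (@flat R n).
Proof.
move=> s; apply: differentiable_continuous; apply/derivable1_diffP.
by have [] := is_derive_flat n s.
Qed.

Lemma continuous_tau : continuous tau.
Proof.
move=> s; apply: differentiable_continuous; apply/derivable1_diffP.
by have [] := is_derive_tau s.
Qed.

Lemma continuous_theta : continuous theta.
Proof.
have cq : continuous (fun t : R => t * t - 1).
  move=> t; apply: (@continuousD _ _ _ (fun t : R => t * t) (fun=> - 1)).
    by apply: (@continuousM _ _ (fun t : R => t) (fun t : R => t)); exact: cvg_id.
  exact: cst_continuous.
have cf n : continuous (fun t : R => flat n (t * t - 1)).
  by move=> t; apply: (continuous_comp (cq t)); exact: continuous_flat.
have cq2 : continuous (fun t : R => 2 * (t * t)).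
  move=> t; apply: (@continuousM _ _ (fun=> 2) (fun t : R => t * t)); first exact: cst_continuous.
  by apply: (@continuousM _ _ (fun t : R => t) (fun t : R => t)); exact: cvg_id.
move=> s; rewrite /continuous_at /theta.
exact: cvgD (cf 0%N s) (cvgM (cq2 s) (cf 1%N s)).
Qed.

Lemma sqr_le1 s : `|s| <= 1 -> s * s - 1 <= 0.
Proof.
move=> s1; rewrite subr_le0 -expr2 -(real_normK (num_real s)).
by rewrite -[leRHS](expr1n _ 2) ler_sqr ?nnegrE.
Qed.

Lemma tau_eq0 s : `|s| <= 1 -> tau s = 0.
Proof. by move=> /sqr_le1 s1; rewrite /tau flat_le0// mulr0. Qed.

Lemma theta_eq0 s : `|s| <= 1 -> theta s = 0.
Proof. by move=> /sqr_le1 s1; rewrite /theta !flat_le0// mulr0 addr0. Qed.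

(** In the variable y = (s^2 - 1)^-1 the derivative is a polynomial times exp(- y): nonnegativity is
    visible, boundedness is [poly_expR_bound], and y -> 0 gives the limit 1. *)
Lemma thetaE s : 1 < s * s ->
  theta s = (1 + 2 * (s * s - 1)^-1 + 2 * (s * s - 1)^-1 ^+ 2) * expR (- (s * s - 1)^-1).
Proof.
rewrite -subr_gt0 => s0; rewrite /theta /flat s0 /= derivC subr0 mulr1 hornerXn hornerC mul1r.
have -> : 2 * (s * s) = 2 * (1 + (s * s - 1)) by congr (2 * _); ring.
move: (s * s - 1) s0 => y y0; move: (expR _) => e; field; exact: lt0r_neq0.
Qed.

Lemma theta_ge0 s : 0 <= theta s.
Proof.
have [s1|s1] := leP (s * s) 1; first by rewrite /theta !flat_le0 ?subr_le0// mulr0 addr0.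
have y0 : 0 <= (s * s - 1)^-1 by rewrite invr_ge0 subr_ge0 ltW.
by rewrite thetaE// mulr_ge0 ?expR_ge0// !addr_ge0 ?mulr_ge0 ?exprn_ge0.
Qed.

Lemma theta_bound : exists2 C, 0 <= C & forall s, theta s <= C.
Proof.
have [C C0 HC] := @poly_expR_bound R (1 + 2 *: 'X + 2 *: 'X^2); exists C => // s.
have [s1|s1] := leP (s * s) 1; first by rewrite /theta !flat_le0 ?subr_le0// mulr0 addr0.
have y0 : 0 <= (s * s - 1)^-1 by rewrite invr_ge0 subr_ge0 ltW.
rewrite thetaE//; apply: le_trans (HC _ y0); rewrite ler_wpM2r ?expR_ge0//.
by rewrite !hornerE; exact: ler_norm.
Qed.

Lemma cvg_theta s : s != 0 -> (fun n : nat => theta (n.+1%:R * s)) @ \oo --> (1 : R).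
Proof.
move=> s0.
have c0 : (fun n : nat => (n.+1%:R * s)^-1) @ \oo --> (0 : R).
  rewrite -[X in _ --> X](mul0r s^-1).
  under eq_fun do rewrite invfM.
  by apply: cvgM; [exact: cvg_harmonic|exact: cvg_cst].
have c1 : (fun n : nat => ((n.+1%:R * s) * (n.+1%:R * s) - 1)^-1) @ \oo --> (0 : R).
  have -> : (fun n : nat => ((n.+1%:R * s) * (n.+1%:R * s) - 1)^-1) =
      (fun n : nat => ((n.+1%:R * s)^-1 * (n.+1%:R * s)^-1) *
      (1 - (n.+1%:R * s)^-1 * (n.+1%:R * s)^-1)^-1).
    apply/funext => n; have x0 : n.+1%:R * s != 0 by rewrite mulf_neq0.
    move: (n.+1%:R * s) x0 => x x0; rewrite -!invfM; congr (_^-1).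
    by rewrite mulrBr mulr1 divff ?mulf_neq0.
  have -> : (0 : R) = (0 * 0) * (1 - 0 * 0)^-1 by rewrite !mul0r.
  apply: cvgM; first exact: cvgM.
  apply: cvgV; first by rewrite mulr0 subr0 oner_neq0.
  by apply: cvgB; [exact: cvg_cst|exact: cvgM].
have fE : \forall n \near \oo, (1 + 2 * ((n.+1%:R * s) * (n.+1%:R * s) - 1)^-1 +
    2 * ((n.+1%:R * s) * (n.+1%:R * s) - 1)^-1 ^+ 2) *
    expR (- ((n.+1%:R * s) * (n.+1%:R * s) - 1)^-1) = theta (n.+1%:R * s).
  have /cvgrPdist_lt/(_ 1 ltr01) := c0.
  apply: filterS => n; rewrite sub0r normrN normfV => Hn; rewrite thetaE//.
  have x0 : n.+1%:R * s != 0 by rewrite mulf_neq0.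
  move: Hn; rewrite invf_lt1 ?normr_gt0// => Hn.
  rewrite -expr2 -(real_normK (num_real _)) -[ltLHS](expr1n _ 2) ltr_sqr ?nnegrE//.
apply: cvg_trans (near_eq_cvg fE) _ => {fE}.
have e1 : (1 + 2 * 0 + 2 * (0 * 0)) * expR (- 0) = 1 :> R by rewrite oppr0 expR0; ring.
move: c1; set y := fun n : nat => _; move=> c1.
have c2 : (fun n => 2 * y n) @ \oo --> 2 * (0 : R) by apply: cvgM => //; exact: cvg_cst.
have c3 : (fun n => 2 * (y n * y n)) @ \oo --> 2 * (0 * 0 : R).
  by apply: cvgM; [exact: cvg_cst|exact: cvgM].
have c4 : (fun n => expR (- y n)) @ \oo --> expR (- 0 : R).
  by apply: continuous_cvg; [exact: continuous_expR|exact: cvgN].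
have := cvgM (cvgD (cvgD (cvg_cst (1 : R)) c2) c3) c4; rewrite e1; exact.
Qed.

End truncation.

(** * Truncations *)

Section C1_compact_support.
Context {R : realType} {d : nat}.
Local Notation E := 'rV[R]_d.
Local Notation T := (caratheodory_type (leb_om R d)).
Local Notation mu := (leb R d).
Local Notation e_ i := (delta_mx 0 i : E).
Implicit Types (f g : E -> R) (U : set E).

(** The class of the trial functions: truncation keeps C^1 regularity, and C^1 with compact support
    is enough for weak gradients and, through mollification, for H^1_0. *)
Definition C1c U g := Ck 1 g /\ exists K, [/\ compact K, K `<=` U & forall x, ~ K x -> g x = 0].

Lemma test_fun_C1c U g : test_fun U g -> C1c U g.
Proof. by move=> [/smoothP sg Kg]; split; [exact: sg|]. Qed.

Lemma C1c_sub U V g : U `<=` V -> C1c U g -> C1c V g.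
Proof.
move=> UV [Cg [K [cK KU gK]]]; split => //; exists K; split => // x /KU.
exact: UV.
Qed.

Lemma C1cD U f g : C1c U f -> C1c U g -> C1c U (fun x => f x + g x).
Proof.
move=> [Cf [K [cK KU fK]]] [Cg [K' [cK' KU' gK']]]; split; first exact: CkD.
exists (K `|` K'); split; first exact: compactU.
  by move=> x [/KU|/KU'].
by move=> x /not_orP[/fK -> /gK' ->]; rewrite addr0.
Qed.

Lemma C1cM U f g : Ck 1 f -> C1c U g -> C1c U (fun x => f x * g x).
Proof.
move=> Cf [Cg [K [cK KU gK]]]; split; first exact: CkM.
by exists K; split => // x /gK ->; rewrite mulr0.
Qed.

Lemma C1c_cst_mul U c g : C1c U g -> C1c U (fun x => c * g x).
Proof. by apply: C1cM; exact: Ck_cst. Qed.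

Lemma C1c_continuous U g : C1c U g -> continuous g.
Proof. by move=> [[]]. Qed.

Lemma C1c_derivable U g x i : C1c U g -> derivable g x (e_ i).
Proof. by move=> [[_ dg _] _]; exact: dg. Qed.

Lemma C1c_continuous_partial U g i : C1c U g -> continuous (partial i g).
Proof. by move=> [[_ _ pg] _]; exact: pg. Qed.

Lemma closed_near_partial0 K g i : closed K -> (forall x, ~ K x -> g x = 0) ->
  forall x, ~ K x -> partial i g x = 0.
Proof.
move=> cK gK x Kx; apply: (partial_near0 i _).2.
have oK : open (~` K) by exact: closed_openC.
by apply: filterS (open_nbhs_nbhs (conj oK Kx)) => y; exact: gK.
Qed.

Lemma C1c_partial_out U g i x : C1c U g -> ~ U x -> partial i g x = 0.
Proof.
move=> [_ [K [cK KU gK]]] Ux.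
by apply: (closed_near_partial0 i (compact_closed _ cK) gK) => // /KU.
Qed.

Lemma C1c_bsupp U g : C1c U g -> exists M, [/\ 0 <= M, bsupp M g & forall i, bsupp M (partial i g)].
Proof.
move=> [_ [K [cK KU gK]]]; have [M M0 KM] := compact_norm_bound cK; exists M.
have out x : M < `|x| -> ~ K x by move=> Mx /KM; rewrite leNgt Mx.
split=> // [x /out|i x /out]; first exact: gK.
exact: (closed_near_partial0 i (compact_closed _ cK) gK).
Qed.

Lemma continuous_bsupp_sqint (D : set T) M g : measurable D -> continuous g -> bsupp M g ->
  sqint mu D g.
Proof.
move=> mD cg sg; have [C _ gC] := continuous_bsupp_bounded cg sg.
exact: (sqint_bsupp mD (continuous_measurable_Rd cg) sg gC).
Qed.

Lemma C1c_sqint (D : set T) U g : measurable D -> C1c U g -> sqint mu D g.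
Proof.
move=> mD Cg; have [M [_ sg _]] := C1c_bsupp Cg.
exact: (continuous_bsupp_sqint mD (C1c_continuous Cg) sg).
Qed.

Lemma C1c_partial_sqint (D : set T) U g i : measurable D -> C1c U g -> sqint mu D (partial i g).
Proof.
move=> mD Cg; have [M [_ _ sg]] := C1c_bsupp Cg.
exact: (continuous_bsupp_sqint mD (C1c_continuous_partial Cg) (sg i)).
Qed.

Lemma C1c_scale U g (c : R) : 0 < c -> C1c U g ->
  C1c (fun x => U (c *: x)) (fun x => g (c *: x)).
Proof.
move=> c0 [Cg [K [cK KU gK]]]; split.
  by have := Ck_affine c 0 Cg; congr (Ck 1 _); apply/funext => x; rewrite addr0.
exists ((fun x => c^-1 *: x) @` K); split.
- apply: continuous_compact => //; apply: continuous_subspaceT => x.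
  exact: scaler_continuous.
- by move=> _ [x Kx <-]; apply: KU; rewrite scalerA divff ?gt_eqF// scale1r.
- move=> x Kx; apply: gK => Kcx; apply: Kx; exists (c *: x) => //.
  by rewrite scalerA mulVf ?gt_eqF// scale1r.
Qed.

Lemma partial_scale g (c : R) x i : derivable g (c *: x) (e_ i) ->
  partial i (fun x => g (c *: x)) x = c * partial i g (c *: x).
Proof.
have gE : (fun x => g (c *: x + 0)) = (fun x => g (c *: x)) by apply/funext => y; rewrite addr0.
move=> dg; have := @derive_affine R d g c 0 x (e_ i).
by rewrite gE addr0 => /(_ dg)[].
Qed.

Section bounded_domain.
Variables (Om : set E) (M : R).
Hypotheses (oOm : open Om) (bOm : forall x, Om x -> `|x| <= M).

Lemma C1c_weak_grad U g : C1c U g -> is_weak_grad Om g (gradf g).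
Proof.
move=> Cg i; split; first exact: (C1c_partial_sqint i (mOm oOm) Cg).
move=> phi tphi; apply: weak_grad_C1 tphi.
- exact: C1c_continuous Cg.
- by move=> x j; exact: C1c_derivable Cg.
- by move=> j; exact: C1c_continuous_partial Cg.
Qed.

Lemma C1c_H1 U g : C1c U g -> H1 Om g.
Proof.
move=> Cg; split; first exact: (C1c_sqint (mOm oOm) Cg).
by exists (gradf g); exact: C1c_weak_grad Cg.
Qed.

Lemma C1c_H10 U g : open U -> U `<=` Om -> C1c U g -> H10 Om U g.
Proof.
move=> oU UOm Cg; have [_ [K [cK KU gK]]] := Cg.
exact: (H10_compact_support oOm bOm cK oU KU UOm (C1c_H1 Cg) gK).
Qed.

End bounded_domain.

Definition C1_at f x := (forall i, derivable f x (e_ i)) /\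
  forall i, {for x, continuous (partial i f)}.

Section truncation.
Variables (U : set E) (g : E -> R).
Hypotheses (oU : open U) (cg : continuous g) (C1g : forall x, U x -> C1_at g x).
Hypothesis gU : forall x, ~ U x -> g x = 0.
Hypothesis g_infty : forall e, 0 < e -> exists N, forall x, N < `|x| -> `|g x| < e.

Definition trunc (n : nat) x : R := n.+1%:R^-1 * tau (n.+1%:R * g x).
(** Off U the function g is merely continuous and [partial] may be meaningless there; the gradient
    is set to 0 by hand. *)
Definition grad_in i x : R := if pselect (U x) then partial i g x else 0.

Let small n x : `|g x| <= n.+1%:R^-1 -> `|n.+1%:R * g x| <= 1.
Proof. by move=> gx; rewrite normrM ger0_norm// mulrC -ler_pdivlMr// mul1r. Qed.

Let small_near n x : ~ U x -> \forall y \near x, `|g y| < n.+1%:R^-1.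
Proof.
move=> Ux; have n0 : (0 : R) < n.+1%:R^-1 by rewrite invr_gt0.
have /cvgrPdist_lt/(_ _ n0) := cg (x := x).
by apply: filterS => y; rewrite (gU Ux) sub0r normrN.
Qed.

(** Inside U this is the chain rule. At a point off U, g is 0, hence below 1 / (n + 1) nearby by
    continuity, so the truncation vanishes in a neighbourhood. *)
Lemma partial_trunc n x i : derivable (trunc n) x (e_ i) /\
  partial i (trunc n) x = theta (n.+1%:R * g x) * grad_in i x.
Proof.
rewrite /grad_in; case: pselect => [Ux|Ux].
  have [/(_ i) dg _] := C1g Ux; apply: derive_from_line.
  pose l (t : R) := g (x + t *: e_ i).
  have dl : is_derive (0 : R) (1 : R) l (partial i g x).
    have := @is_derive_line R E g x (e_ i) 0; rewrite scale0r addr0.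
    by move=> /(_ dg).
  have dnl : is_derive (0 : R) (1 : R) (fun t => n.+1%:R * l t) (n.+1%:R * partial i g x).
    by apply: is_derive_eq.
  have l0 : l 0 = g x by rewrite /l scale0r addr0.
  have dt := @is_derive1_comp R tau (fun t => n.+1%:R * l t) 0 _ _ (is_derive_tau _) dnl.
  apply: is_derive_eq; rewrite l0 /GRing.scale/=.
  have : n.+1%:R != 0 :> R by [].
  by move: (n.+1%:R : R) => N N0; field.
rewrite mulr0; apply: partial_near0; apply: filterS (small_near n Ux) => y gy.
by rewrite /trunc tau_eq0 ?mulr0//; apply: small; exact: ltW.
Qed.

Lemma continuous_partial_trunc n i : continuous (partial i (trunc n)).
Proof.
have cng : continuous (fun x => n.+1%:R * g x).
  exact: (@CkM R d 0 _ _ (Ck_cst 0 _) cg).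
have ct : continuous (fun x => theta (n.+1%:R * g x)).
  by move=> x; apply: (continuous_comp (cng x)); exact: continuous_theta.
have -> : partial i (trunc n) = fun x => theta (n.+1%:R * g x) * grad_in i x.
  by apply/funext => x; case: (partial_trunc n x i).
move=> x; rewrite /continuous_at; have [Ux|Ux] := pselect (U x).
  have E : {near x, (fun y => theta (n.+1%:R * g y) * partial i g y) =1
      (fun y => theta (n.+1%:R * g y) * grad_in i y)}.
    apply: filterS (open_nbhs_nbhs (conj oU Ux)) => y Uy.
    by rewrite /grad_in; case: pselect.
  have -> : theta (n.+1%:R * g x) * grad_in i x = theta (n.+1%:R * g x) * partial i g x.
    by rewrite /grad_in; case: pselect.
  apply: cvg_trans (near_eq_cvg E) _.
  exact: cvgM (ct x) ((C1g Ux).2 i).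
have E : {near x, cst 0 =1 (fun y => theta (n.+1%:R * g y) * grad_in i y)}.
  apply: filterS (small_near n Ux) => y gy.
  by rewrite theta_eq0 ?mul0r//; apply: small; exact: ltW.
have -> : theta (n.+1%:R * g x) * grad_in i x = 0.
  by rewrite /grad_in; case: pselect => // ?; rewrite mulr0.
by apply: cvg_trans (near_eq_cvg E) _; exact: cvg_cst.
Qed.

(** The truncation vanishes where |g| < 1 / (n + 1); the remaining closed set is bounded since g
    tends to 0 at infinity, and inside U since g vanishes off U. *)
Lemma trunc_C1c n : C1c U (trunc n).
Proof.
have n0 : (0 : R) < n.+1%:R^-1 by rewrite invr_gt0.
split.
  split; [|by move=> x i; case: (partial_trunc n x i)|exact: continuous_partial_trunc].
  have cng : continuous (fun x => n.+1%:R * g x) := @CkM R d 0 _ _ (Ck_cst 0 _) cg.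
  have ct : continuous (fun x => tau (n.+1%:R * g x)).
    by move=> x; apply: (continuous_comp (cng x)); exact: continuous_tau.
  exact: (@CkM R d 0 _ _ (Ck_cst 0 _) ct).
have [N HN] := g_infty n0.
exists [set x | n.+1%:R^-1 <= `|g x|]; split.
- apply: (subclosed_compact _ (@compact_norm_le R d 0 N)).
    apply: (@closed_comp _ _ (fun x => `|g x|) [set y | n.+1%:R^-1 <= y]); last exact: closed_ge.
    by move=> x _; apply: (continuous_comp (cg (x := x))); exact: norm_continuous.
  by move=> x /= gx; rewrite subr0 leNgt; apply/negP => /HN; rewrite ltNge gx.
- move=> x /= gx; apply: contrapT => /gU gx0.
  by move: gx; rewrite gx0 normr0 leNgt n0.
- move=> x /= /negP; rewrite -ltNge => gx.
  by rewrite /trunc tau_eq0 ?mulr0//; apply: small; exact: ltW.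
Qed.

Lemma measurable_grad_in i : measurable_fun (setT : set T) (grad_in i).
Proof.
have mU : measurable (U : set T) := open_measurable_Rd oU.
have mUp : measurable_fun (U : set T) (partial i g).
  by apply: measurable_open_continuous => // x Ux; case: (C1g Ux).
have -> : grad_in i = (partial i g \_ U).
  apply/funext => x; rewrite /grad_in /patch; case: pselect => Ux.
    by rewrite mem_set.
  by rewrite memNset.
exact/(measurable_restrictT _ mU).
Qed.

End truncation.

End C1_compact_support.

(** * Null sets *)

Section euclidean_norm.
Context {R : realType} {d : nat}.
Implicit Types x y : 'rV[R]_d.

Lemma ler_norm_enorm x : `|x| <= enorm x.
Proof.
apply: ler_norm_coord; first exact: sqrtr_ge0.
move=> i; rewrite -sqrtr_sqr /enorm ler_wsqrtr// /dot (bigD1 i)//= -expr2 lerDl.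
by apply: sumr_ge0 => j _; rewrite -expr2 sqr_ge0.
Qed.

Lemma ler_enorm x : enorm x <= d%:R * `|x|.
Proof.
have d0 : 0 <= d%:R * `|x| by rewrite mulr_ge0.
rewrite -[leRHS](ger0_norm d0) -sqrtr_sqr /enorm ler_wsqrtr// /dot.
apply: (@le_trans _ _ (\sum_(i < d) `|x| ^+ 2)).
  apply: ler_sum => i _; rewrite -expr2 -(real_normK (num_real (x 0 i))).
  by rewrite ler_sqr ?nnegrE//; exact: ler_coord_norm.
rewrite sumr_const card_ord -[_ *+ d]mulr_natl exprMn ler_wpM2r ?sqr_ge0//.
by rewrite -natrX ler_nat; case: (d) => // n; rewrite expnS leq_pmulr.
Qed.

End euclidean_norm.

Section null_sets.
Context {R : realType} {d : nat}.
Local Notation E := 'rV[R]_d.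
Local Notation T := (caratheodory_type (leb_om R d)).
Local Notation mu := (leb R d).
Local Notation e_ i := (delta_mx 0 i : E).

(* Infinitely many small translates of [A] in the direction [e_i] are pairwise
   disjoint and stay in a bounded set. *)
Lemma leb_thin (A : set E) (i : 'I_d) (M r : R) : measurable (A : set T) ->
  (forall x, A x -> `|x| <= M) -> 0 < r ->
  (forall x t, A x -> t != 0 -> `|t| < r -> ~ A (x + t *: e_ i)) -> mu A = 0%E.
Proof.
move=> mA AM r0 thin.
(* Distinct shifts in ]0, r / 2], so that any two of them differ by less than r. *)
pose s (j : nat) : R := r / j.+1%:R / 2.
have s0 j : 0 < s j by rewrite !divr_gt0.
have sr j : s j <= r / 2.
  by rewrite ler_pM2r// ler_pdivrMr// ler_peMr ?ler1n// ltW.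
pose F (j : nat) : set T := (fun x : E => 1 *: x + - (s j *: e_ i)) @^-1` A.
have mF j : measurable (F j).
  by have := @measurable_affine R d 1 (- (s j *: e_ i)) ltr01 measurableT A mA; rewrite setTI.
have FA j : mu (F j) = mu A.
  by rewrite [LHS](leb_outer_affine _ _ ltr01) expr1n invr1 mul1e.
have tF : trivIset setT F.
  apply/trivIsetP => j k _ _ jk; apply/seteqP; split => // x []; rewrite /F /= !scale1r => Fj Fk.
  apply: (thin _ (s j - s k) Fj); last first.
  - by rewrite scalerBl addrA subrK.
  - have := s0 j; have := s0 k; have := sr j; have := sr k; rewrite ltr_norml.
    by move: (s j) (s k) r0 => a b r0 ????; apply/andP; split; lra.
  rewrite subr_eq0 /s; apply: contra_neq jk.
  move=> /(mulIf (invr_neq0 (lt0r_neq0 (@ltr0n R 2))))/(mulfI (lt0r_neq0 r0))/invr_inj/eqP.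
  by rewrite eqr_nat => /eqP[].
have Foo : (mu (\bigcup_j F j) < +oo)%E.
  apply: (@leb_bounded R d _ (M + r)) => x [j _]; rewrite /F /= scale1r => /AM xM.
  have := ler_normD (x - s j *: e_ i) (s j *: e_ i); rewrite subrK => /le_trans; apply.
  apply: lerD => //; apply: (le_trans (norm_delta_mx _ _)).
  by rewrite gtr0_norm//; have := sr j; move: (s j) r0 => a; lra.
apply/eqP; rewrite eq_le measure_ge0 andbT leNgt; apply/negP => A0.
have Aoo : mu A \is a fin_num.
  by rewrite fin_numElt (lt_le_trans _ (measure_ge0 _ _)) ?ltNyr//=; exact: leb_bounded AM.
have a0 : 0 < fine (mu A) by rewrite fine_gt0// A0 ltey_eq Aoo.
have Fin : mu (\bigcup_j F j) \is a fin_num.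
  by rewrite fin_numElt (lt_le_trans _ (measure_ge0 _ _)) ?ltNyr.
have bound n : n%:R * fine (mu A) <= fine (mu (\bigcup_j F j)).
  rewrite -lee_fin EFinM !fineK//.
  have -> : (n%:R%:E * mu A = mu (\big[setU/set0]_(j < n) F j))%E.
    rewrite measure_bigsetU// (eq_bigr (fun=> mu A)); last by move=> j _; exact: FA.
    by rewrite mule_natl [RHS]sumr_const card_ord.
  apply: le_outer_measure; rewrite -bigcup_mkord.
  by apply: bigcup_sub => j _; exact: bigcup_sup.
pose N := (Num.truncn (fine (mu (\bigcup_j F j)) / fine (mu A))).+1.
have := bound N; rewrite -ler_pdivlMr// leNgt => /negP; apply.
exact: truncnS_gt.
Qed.

(** Each point of A lies in a rational ball contained in its given neighbourhood, and these balls
    are countably many. *)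
Lemma leb_null_local (A : set E) :
  (forall x, A x -> exists2 r : R, 0 < r & mu (A `&` [set y : E | `|y - x| < r]) = 0%E) ->
  mu A = 0%E.
Proof.
move=> H.
pose B (p : 'rV[rat]_d * nat) := [set y : E | `|y - map_mx ratr p.1| < p.2.+1%:R^-1].
pose F (k : nat) : set E := if @unpickle ('rV[rat]_d * nat)%type k is Some p then
  (if `[< mu (A `&` B p) = 0%E >] then A `&` B p else set0) else set0.
have F0 k : mu (F k) = 0%E.
  rewrite /F; case: unpickle => [p|]; last exact: measure0.
  by case: asboolP => // _; exact: measure0.
apply/eqP; rewrite eq_le measure_ge0 andbT.
apply: (@le_trans _ _ (mu (\bigcup_k F k))).
  apply: le_outer_measure => x Ax; have [r r0 Hr] := H x Ax.
  have [n nr] : exists n : nat, n.+1%:R^-1 < r / 2.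
    have r2 : 0 < r / 2 by rewrite divr_gt0.
    by have [n] := ltr_add_invr r2; rewrite add0r; exists n.
  have [q xq] := @dense_rat_row R d x n.+1%:R^-1 (ltac:(by [])).
  have Bx : B (q, n) x by rewrite /B /= distrC.
  exists (pickle (q, n)) => //; rewrite /F pickleK; case: asboolP => [_|[]]; first by split.
  apply/eqP; rewrite eq_le measure_ge0 andbT -Hr; apply: le_outer_measure => y [Ay].
  rewrite /B /= => yq; split=> //=.
  have := ler_normD (y - map_mx ratr q) (map_mx ratr q - x); rewrite addrA subrK.
  by move=> /le_lt_trans; apply; rewrite (splitr r) ltrD// (lt_trans _ nr).
apply: (le_trans (outer_measure_sigma_subadditive (leb_om R d) F)).
by rewrite eseries0// => k _ _; exact: F0.
Qed.

Lemma leb_locally_thin (A : set E) : measurable (A : set T) ->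
  (forall x, A x -> exists i : 'I_d, exists2 r : R, 0 < r & forall y t, A y -> `|y - x| < r ->
    t != 0 -> `|y + t *: e_ i - x| < r -> ~ A (y + t *: e_ i)) -> mu A = 0%E.
Proof.
move=> mA H; apply: leb_null_local => x /H[i [r r0 thin]]; exists r => //.
apply: (@leb_thin _ i (`|x| + r) r) => //.
- exact: (measurableI _ _ mA (measurable_norm_ball x r)).
- move=> y [_ /= yx]; rewrite -[y](subrK x) (le_trans (ler_normD _ _))// addrC lerD//.
  exact: ltW.
- by move=> y t [Ay yx] t0 _ [Ayt ytx]; exact: (thin y t Ay yx t0 ytx).
Qed.

(** Near a zero where d_i g <> 0, g is strictly monotone along e_i, so the set meets each line in
    that direction at most once: it is locally thin. *)
Lemma leb_level_set (U : set E) (g : E -> R) (i : 'I_d) : open U -> continuous g ->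
  (forall x, U x -> C1_at g x) -> mu [set x | [/\ U x, g x = 0 & partial i g x != 0]] = 0%E.
Proof.
move=> oU cg C1g; apply: leb_locally_thin.
  have mU : measurable (U : set T) := open_measurable_Rd oU.
  have mp : measurable_fun (U : set T) (partial i g).
    by apply: measurable_open_continuous => // x Ux; exact: (C1g x Ux).2.
  have -> : [set x | [/\ U x, g x = 0 & partial i g x != 0]] =
      (U `&` (partial i g) @^-1` (~` [set 0])) `&` g @^-1` [set 0].
    apply/seteqP; split => x.
      by move=> [Ux gx /eqP px].
    by move=> [[Ux /eqP px] gx].
  apply: measurableI; first by apply: mp => //; exact: measurableC.
  rewrite -[X in measurable X]setTI.
  by apply: (continuous_measurable_Rd (D := setT) cg).
move=> x [Ux gx px]; exists i.
set c := partial i g x in px.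
have c0 : 0 < `|c| / 2 by rewrite divr_gt0// normr_gt0.
have := (C1g x Ux).2 i; move=> /cvgrPdist_lt/(_ _ c0) nearx.
have : \forall y \near x, U y /\ `|c - partial i g y| < `|c| / 2.
  by near=> y; split; near: y => //; exact: open_nbhs_nbhs.
move=> /nbhs_normP[r /= r0 Hr]; exists r => // y t [Uy gy _] yx t0 ytx [_ gyt _].
(* A cube is convex: the segment stays in the neighbourhood where d_i g is close to c. *)
have cvx s : Num.min 0 t <= s <= Num.max 0 t -> `|x - (y + s *: e_ i)| < r.
  move=> st; rewrite distrC; apply: ltr_norm_coord => // j.
  have := le_lt_trans (ler_coord_norm _ j) yx; have := le_lt_trans (ler_coord_norm _ j) ytx.
  rewrite !mxE eqxx/= !ltr_norml; move: (y 0 j) (x 0 j) st => a b.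
  case: (j == i); rewrite /= ?mulr1 ?mulr0 => st /andP[h1 h2] /andP[h3 h4]; apply/andP; last by split; lra.
  by move: st; case: (leP 0 t) => ? /andP[]; split; lra.
(* The i-th derivative of h is below |c| / 2 in absolute value near x, so two zeros of g at distance
   |t| along e_i would give |c t| <= |c t| / 2. *)
pose h (z : E) := g z - c * z 0 i.
have dh z : `|x - z| < r -> derivable h z (e_ i) /\ partial i h z = partial i g z - c.
  move=> /Hr[Uz _]; have [/(_ i) dg _] := C1g z Uz.
  have [dz pz] := partial_coord i i z.
  have dc : derivable (fun y : E => - c * y 0 i) z (e_ i).
    exact: (derivableM (derivable_cst _ _ _) dz).
  have -> : h = fun y => g y + - c * y 0 i by apply/funext => w; rewrite mulNr.
  split; first exact: derivableD.
  by rewrite partialD// partialZ// pz eqxx mulr1.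
have : `|h (y + t *: e_ i) - h y| <= `|c| / 2 * `|t|.
  apply: mvt_bound => s /cvx sr; have [dhs phs] := dh _ sr; first exact: dhs.
  rewrite -/(partial i h _) phs distrC ltW//.
  by have [_] := Hr _ sr.
rewrite /h gyt gy !mxE !eqxx/= mulr1.
have -> : 0 - c * (y 0 i + t) - (0 - c * y 0 i) = - (c * t) by ring.
rewrite normrN normrM.
have t1 : 0 < `|t| by rewrite normr_gt0.
rewrite ler_pM2r// ler_pdivlMr// => c2.
by have : 0 < `|c| by [rewrite normr_gt0]; move: c2; lra.
Unshelve. all: by end_near. Qed.

End null_sets.

(** * The boundary of a Schauder domain is null *)

Section null_boundary.
Context {R : realType}.

(** Hoelder derivatives are bounded near the centre, so g is Lipschitz there. Dividing the radius by
    n + 1 fits a sup-norm ball into the Euclidean one. *)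
Lemma C1alpha_on_continuous (n : nat) (al r : R) (c : 'rV[R]_n) (g : 'rV[R]_n -> R) :
  0 < al -> 0 < r -> C1alpha_on al (eball c r) g ->
  exists2 r' : R, 0 < r' & forall x, `|x - c| < r' -> {for x, continuous g}.
Proof.
move=> al0 r0 Cg; pose r' := r / n.+1%:R; have r'0 : 0 < r' by rewrite divr_gt0.
have ball_r x : `|x - c| < r' -> eball c r x.
  move=> xc; rewrite /eball /=; apply: (le_lt_trans (ler_enorm _)).
  apply: (@le_lt_trans _ _ (n.+1%:R * `|x - c|)); first by rewrite ler_wpM2r// ler_nat.
  by rewrite mulrC -ltr_pdivlMr.
exists r' => //; apply: partial_bounded_continuous => [x i xr|i].
  exact: (Cg i).1 (ball_r x xr).
have [_ [C HC]] := Cg i; exists (`|partial i g c| + `|C| * r `^ al) => x xr.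
have cb : eball c r c by apply: ball_r; rewrite subrr normr0.
rewrite -lerBlDl; apply: (le_trans (lerB_dist _ _)).
apply: (le_trans (HC _ _ (ball_r _ xr) cb)).
apply: (@le_trans _ _ (`|C| * enorm (x - c) `^ al)).
  by rewrite ler_wpM2r ?powR_ge0// ler_norm.
rewrite ler_wpM2l// ge0_ler_powR ?nnegrE ?sqrtr_ge0 ?ltW//.
exact: ball_r xr.
Qed.

Context {d : nat}.
Local Notation E := 'rV[R]_d.
Local Notation mu := (leb R d).
Local Notation e_ i := (delta_mx 0 i : E).

Lemma continuous_col' (i : 'I_d) : continuous (fun x : E => col' i x).
Proof.
move=> x; apply/(@cvgrPdist_lt _ _ _ (nbhs (x : E))) => e e0; apply/nbhs_ballP; exists e => //= y; rewrite -ball_normE /ball_/= => yx.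
by apply: ltr_norm_coord => // j; rewrite !mxE; have := le_lt_trans (ler_coord_norm _ (lift i j)) yx; rewrite !mxE.
Qed.

Lemma bdry_closed (O : set E) : closed (bdry O).
Proof. by apply: closedI; [exact: closed_closure|exact/open_closedC/open_interior]. Qed.

(** Locally the boundary lies in a graph over the coordinates other than the i-th, and a graph meets
    a line parallel to e_i at most once. *)
Lemma leb_bdry (al : R) (O : set E) : 0 < al -> schauder al O -> mu (bdry O) = 0%E.
Proof.
move=> al0 sO; apply: leb_locally_thin; first exact: closed_measurable_Rd (@bdry_closed O).
move=> p /sO[i [s [r [g [r0 Cg Hg]]]]]; exists i.
have [r' r'0 cg] := C1alpha_on_continuous al0 r0 Cg.
pose h (x : E) := (-1) ^+ s * x 0 i - g (col' i x).
pose rho := Num.min r' (r / d.+1%:R); have rho0 : 0 < rho by rewrite lt_min r'0 divr_gt0.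
have ball_r x : `|x - p| < rho -> eball p r x.
  rewrite lt_min => /andP[_ xp]; rewrite /eball /=; apply: (le_lt_trans (ler_enorm _)).
  apply: (@le_lt_trans _ _ (d.+1%:R * `|x - p|)); first by rewrite ler_wpM2r// ler_nat.
  by rewrite mulrC -ltr_pdivlMr.
have ch x : `|x - p| < rho -> {for x, continuous h}.
  rewrite lt_min => /andP[xp _].
  have cg' : {for x, continuous (fun y => g (col' i y))}.
    apply: continuous_comp; first exact: continuous_col'.
    apply: cg; apply: ltr_norm_coord => // j; rewrite !mxE.
    by have := le_lt_trans (ler_coord_norm _ (lift i j)) xp; rewrite !mxE.
  have cx : {for x, continuous (fun y : E => (-1) ^+ s * y 0 i)}.
    by move: (x); exact: (@CkM R d 0 _ _ (Ck_cst 0 _) (@coord_continuous R 1 d 0 i)).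
  exact: continuousB cx cg'.
have oB : open [set x : E | `|x - p| < rho].
  apply: (@open_comp _ _ (fun x : E => `|x - p|) [set y | y < rho]); last exact: open_lt.
  move=> x _; apply: (@continuous_comp _ _ _ (fun x : E => x - p)); last exact: norm_continuous.
  by apply: continuousB; [exact: cvg_id|exact: cst_continuous].
(* The sign of h decides membership in O: h < 0 would make x interior, h > 0 would put it outside
   the closure. *)
have h0 x : bdry O x -> `|x - p| < rho -> h x = 0.
  move=> [clx intx] xp; apply/eqP/negP => /negP hx.
  have nB := open_nbhs_nbhs (conj oB xp : open_nbhs _ _).
  have [hx0|hx0] := ltP (h x) 0.
    apply: intx; have := ch x xp; move=> /cvgr_lt/(_ _ hx0) near0.
    apply: filterS2 nB near0 => y yp hy; apply/(Hg y (ball_r y yp)).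
    by rewrite -subr_lt0.
  have {}hx0 : 0 < h x by rewrite lt_def hx.
  have := ch x xp; move=> /cvgr_gt/(_ _ hx0) near0.
  have [y [Oy [/= yp hy]]] := clx _ (filterI nB near0).
  have /(Hg y (ball_r y yp)) := Oy.
  by rewrite -subr_lt0 ltNge (ltW hy).
exists rho => // y t By yp t0 ytp Byt.
have := h0 _ Byt ytp; have := h0 _ By yp; rewrite /h.
have -> : col' i (y + t *: e_ i) = col' i y.
  by apply/rowP => j; rewrite !mxE eqxx/= eq_sym (negbTE (neq_lift i j)) mulr0 addr0.
rewrite !mxE !eqxx/= mulr1 mulrDr => h1 h2.
have : (-1) ^+ s * t = 0 by move: h1 h2; lra.
by move/eqP; rewrite mulf_eq0 (negbTE t0) orbF signr_eq0.
Qed.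

End null_boundary.

(** * The exterior problem *)

Section local_C1.
Context {R : realType} {d : nat}.
Local Notation E := 'rV[R]_d.
Local Notation T := (caratheodory_type (leb_om R d)).
Local Notation mu := (leb R d).
Local Notation e_ i := (delta_mx 0 i : E).

(** A set of outer measure 0 satisfies the Caratheodory criterion, so no separate measurability
    proof is required for exceptional sets. *)
Lemma leb_ae (P : E -> Prop) : mu [set x | ~ P x] = 0%E -> {ae mu, forall x, P x}.
Proof.
move=> P0; exists [set x | ~ P x]; split => //.
apply: le_caratheodory_measurable => X.
have -> : leb_om R d (X `&` [set x | ~ P x]) = 0%E.
  apply/eqP; rewrite eq_le outer_measure_ge0 andbT -P0.
  exact: le_outer_measure (@subIsetr _ _ _).
by rewrite add0e; exact: le_outer_measure (@subIsetl _ _ _).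
Qed.

(** Partial derivatives continuous at x are bounded near x, and bounded partial derivatives make a
    function Lipschitz. *)
Lemma C1_at_continuous (F : E -> R) x :
  (\forall y \near x, forall j, derivable F y (e_ j)) ->
  (forall j, {for x, continuous (partial j F)}) -> {for x, continuous F}.
Proof.
move=> dF cF.
have bF : \forall y \near x, forall j, `|partial j F y| < `|partial j F x| + 1.
  apply: (@filter_forall _ _ _ (nbhs (x : E)) _) => j.
  apply: (@filterS _ (nbhs (x : E)) _ _ _ _ (proj1 (@cvgrPdist_lt _ _ _ (nbhs (x : E)) _ _ _) (cF j) _ ltr01)).
  move=> y Fy; rewrite -ltrBlDl; apply: le_lt_trans Fy.
  by rewrite distrC; exact: lerB_dist.
have : \forall y \near x, (forall j, derivable F y (e_ j)) /\
  (forall j, `|partial j F y| < `|partial j F x| + 1) by exact: filterI.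
move=> /nbhs_normP[r /= r0 Hr].
apply: (@partial_bounded_continuous R d F x r) => [y i|i|]; last by rewrite subrr normr0.
  by rewrite distrC => /Hr[dy _]; exact: dy.
by exists (`|partial i F x| + 1) => y; rewrite distrC => /Hr[_ /(_ i)/ltW].
Qed.

(** p may be discontinuous off U: near a point outside K the product is identically 0. *)
Lemma continuousM_supp (U K : set E) (p q : E -> R) : open U -> closed K -> K `<=` U ->
  (forall x, U x -> {for x, continuous p}) -> continuous q -> (forall x, ~ K x -> q x = 0) ->
  continuous (fun x => p x * q x).
Proof.
move=> oU cK KU cp cq qK x; have [Kx|Kx] := pselect (K x).
  exact: cvgM (cp x (KU _ Kx)) (cq x).
have oK : open (~` K) by exact: closed_openC.
have pq0 : {near x, cst 0 =1 (fun y => p y * q y)}.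
  by apply: filterS (open_nbhs_nbhs (conj oK Kx)) => y Ky; rewrite (qK y Ky) mulr0.
rewrite /continuous_at qK// mulr0; apply: cvg_trans (near_eq_cvg pq0) _.
exact: cvg_cst.
Qed.

Lemma bsupp_mulr M (p q : E -> R) : bsupp M q -> bsupp M (fun x => p x * q x).
Proof. by move=> sq x /sq ->; rewrite mulr0. Qed.

Lemma continuous_bsupp_integrable (M : R) (g : E -> R) : continuous g -> bsupp M g ->
  mu.-integrable (setT : set T) (EFin \o g).
Proof.
move=> cg sg; have [C _ gC] := continuous_bsupp_bounded cg sg.
by apply: integrable_bsupp sg gC; exact: continuous_measurable_Rd.
Qed.

Lemma near_eq_C1_at (f g : E -> R) x : (\forall y \near x, f y = g y) -> C1_at f x -> C1_at g x.
Proof.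
move=> fg [df cf]; split=> [i|i]; first exact: near_eq_derivable_partial fg (df i).
have pfg : \forall y \near x, partial i f y = partial i g y.
  have /nbhs_interior := fg; apply: filterS => y fgy; exact: near_eq_partial.
have E0 : partial i f x = partial i g x by exact: near_eq_partial fg.
have := cvg_trans (near_eq_cvg pfg) (cf i); rewrite E0; exact.
Qed.

Lemma C1_at_sub_smooth (U : set E) (f g : E -> R) : open U -> (forall x, U x -> C1_at f x) ->
  smooth g -> forall x, U x -> C1_at (fun x => f x - g x) x.
Proof.
move=> oU Cf sg x Ux.
have nU : \forall y \near x, U y by exact: open_nbhs_nbhs.
have -> : (fun x => f x - g x) = (fun x => f x + -1 * g x) by apply/funext => y; rewrite mulN1r.
have sng : smooth (fun y => -1 * g y) := smoothM (smooth_cst (-1)) sg.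
have dg y i : derivable (fun y => -1 * g y) y (e_ i) := smooth_derivable sng.
split=> [i|i]; first exact: derivableD ((Cf x Ux).1 i) (dg x i).
have pE0 y : U y -> partial i f y + partial i (fun y => -1 * g y) y = partial i (fun y => f y + -1 * g y) y.
  by move=> Uy; rewrite (partialD ((Cf y Uy).1 i) (dg y i)).
have pE : {near x, (fun y => partial i f y + partial i (fun y => -1 * g y) y) =1
    partial i (fun y => f y + -1 * g y)} by apply: filterS nU => y; exact: pE0.
have cg : continuous (partial i (fun y => -1 * g y)) := smooth_continuous (smooth_partial i sng).
have := cvg_trans (near_eq_cvg pE) (cvgD ((Cf x Ux).2 i) (cg x)); rewrite (pE0 x Ux); exact.
Qed.

Lemma C1c_mul (U : set E) (g psi : E -> R) : open U -> (forall x, U x -> C1_at g x) ->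
  C1c U psi -> C1c U (fun x => g x * psi x) /\
    forall i x, partial i (fun x => g x * psi x) x = g x * partial i psi x + partial i g x * psi x.
Proof.
move=> oU Cg Cpsi; have [_ [K [cK KU psiK]]] := Cpsi.
have clK := compact_closed (@norm_hausdorff _ _) cK.
have oK : open (~` K) by exact: closed_openC.
have pK i := closed_near_partial0 i clK psiK.
have cg x : U x -> {for x, continuous g}.
  move=> Ux; apply: C1_at_continuous; last by case: (Cg x Ux).
  by apply: filterS (open_nbhs_nbhs (conj oU Ux)) => y /Cg[].
have D i x : derivable (fun x => g x * psi x) x (e_ i) /\
    partial i (fun x => g x * psi x) x = g x * partial i psi x + partial i g x * psi x.
  have [Kx|Kx] := pselect (K x).
    have [/(_ i) dg _] := Cg _ (KU _ Kx).
    have dpsi : derivable psi x (e_ i) := C1c_derivable Cpsi.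
    by split; [exact: (derivableM dg dpsi)|rewrite (partialM dg dpsi) [psi x * _]mulrC].
  rewrite (pK i x Kx) psiK// !mulr0 addr0; apply: partial_near0.
  by apply: filterS (open_nbhs_nbhs (conj oK Kx)) => y Ky; rewrite psiK// mulr0.
split; last by move=> i x; case: (D i x).
split; last by exists K; split => // x Kx; rewrite psiK// mulr0.
split; [exact: continuousM_supp oU clK KU cg (C1c_continuous Cpsi) psiK|by move=> x i; case: (D i x)|].
move=> i; have -> : partial i (fun x => g x * psi x) =
    fun x => g x * partial i psi x + partial i g x * psi x.
  by apply/funext => x; case: (D i x).
have c1 := continuousM_supp oU clK KU cg (C1c_continuous_partial (i:=i) Cpsi) (pK i).
have c2 := continuousM_supp oU clK KU (fun x Ux => (Cg x Ux).2 i) (C1c_continuous Cpsi) psiK.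
exact: (@CkD R d 0 _ _ c1 c2).
Qed.

End local_C1.

Section exterior_problem.
Context {R : realType} {d : nat}.
Local Notation E := 'rV[R]_d.
Local Notation T := (caratheodory_type (leb_om R d)).
Local Notation mu := (leb R d).
Local Notation e_ i := (delta_mx 0 i : E).
Local Notation IntT f := (\int[mu]_x f x).
Local Notation L2T := (sqint mu (setT : set T)).
Variables (om : set E) (f zh h : E -> R).
Hypotheses (oom : open om) (cf : {within ~` om, continuous f}).
Hypothesis harm_f : harmonic_on (~` closure om) f.
Hypothesis f_bdry : forall t, bdry om t -> f t = h t.
Hypothesis f_infty : forall e : R, 0 < e -> exists M : R, forall t, M < enorm t -> `|f t| < e.
Hypothesis zh_test : test_fun setT zh.
Hypothesis zhE : forall t, bdry om t -> zh t = h t.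

Local Notation ext := (~` closure om).

Let oext : open ext. Proof. by apply: closed_openC; exact: closed_closure. Qed.

(* The excess of [f] over the smooth extension [zh] of its boundary datum,
   extended by [0]: continuous, C^1 in [ext] and vanishing at infinity. *)
Definition excess x : R := if pselect (closure om x) then 0 else f x - zh x.

Let excessE x : ext x -> excess x = f x - zh x.
Proof. by rewrite /excess; case: pselect. Qed.

Let excess0 x : ~ ext x -> excess x = 0.
Proof. by rewrite /excess; case: pselect. Qed.

Let near_ext x : ext x -> \forall y \near x, ext y.
Proof. by move=> ex; exact: open_nbhs_nbhs (conj oext ex). Qed.

(** [harmonic_on] speaks of continuity for the second derivatives only; that of the first ones
    follows by [C1_at_continuous]. *)
Lemma C1_at_ext x : ext x -> C1_at f x.
Proof.
move=> ex; have [df _] := harm_f ex; split; first exact: df.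
move=> i; apply: C1_at_continuous.
  by apply: filterS (near_ext ex) => y ey j; have [_ [/(_ i j)[]]] := harm_f ey.
by move=> j; have [_ [/(_ i j)[]]] := harm_f ex.
Qed.

Lemma C1_at_excess x : ext x -> C1_at excess x.
Proof.
move=> ex; apply: (@near_eq_C1_at _ _ (fun y => f y - zh y)).
  by apply: filterS (near_ext ex) => y /excessE ->.
by apply: C1_at_sub_smooth C1_at_ext _ _ ex => //; case: zh_test.
Qed.

(** At a boundary point, f from outside [om] and [zh] have the common limit [h x], so their
    difference tends to 0, the value given on the closure. *)
Lemma excess_continuous : continuous excess.
Proof.
have czh : continuous zh by apply: smooth_continuous; case: zh_test.
move=> x; have [ex|ex] := pselect (ext x).
  apply: C1_at_continuous; last by case: (C1_at_excess ex).
  by apply: filterS (near_ext ex) => y /C1_at_excess[].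
apply/(@cvgrPdist_lt _ _ _ (nbhs (x : E))) => e e0; rewrite excess0//.
have [ox|nox] := pselect (om x).
  apply: filterS (open_nbhs_nbhs (conj oom ox)) => y oy.
  by rewrite excess0 ?subrr ?normr0// => ey; apply: ey; exact: subset_closure.
have bx : bdry om x.
  split; first by apply: contrapT.
  by move=> /interior_subset.
have e2 : 0 < e / 2 by rewrite divr_gt0.
have := (proj1 (subspace_continuousP _ _) cf) x nox.
move=> /(@cvgrPdist_lt _ _ _ (within (~` om) (nbhs (x : E))))/(_ _ e2).
move=> nf0.
have nf : \forall y \near x, (~` om) y -> `|f x - f y| < e / 2 by exact: nf0.
rewrite (f_bdry bx) in nf.
have := czh x; move=> /(@cvgrPdist_lt _ _ _ (nbhs (x : E)))/(_ _ e2) nz.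
apply: filterS (filterI nf nz) => y [fy zy].
have [ey|ey] := pselect (ext y); last by rewrite excess0// subrr normr0.
have noy : ~ om y by move=> oy; apply: ey; exact: subset_closure.
rewrite excessE// sub0r normrN.
have -> : f y - zh y = (zh x - zh y) - (h x - f y) by rewrite (zhE bx); ring.
apply: (le_lt_trans (ler_normB _ _)); rewrite [ltRHS]splitr ltrD//.
exact: fy.
Qed.

Lemma excess_infty (e : R) : 0 < e -> exists N, forall x, N < `|x| -> `|excess x| < e.
Proof.
move=> e0; have [M HM] := f_infty e0; have [N _ zN] := test_fun_bsupp zh_test.
exists (Num.max M N) => x; rewrite gt_max => /andP[Mx Nx].
have [ex|ex] := pselect (ext x); last by rewrite excess0// normr0.
by rewrite excessE// zN// subr0; apply: HM; exact: lt_le_trans Mx (ler_norm_enorm x).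
Qed.

Definition dexcess i : E -> R := grad_in ext excess i.
Definition texcess n : E -> R := trunc excess n.

Lemma texcess_C1c n : C1c ext (texcess n).
Proof.
exact: (trunc_C1c oext excess_continuous C1_at_excess excess0 excess_infty n).
Qed.

Lemma partial_texcess n i x : partial i (texcess n) x = theta (n.+1%:R * excess x) * dexcess i x.
Proof.
by have [] := partial_trunc excess_continuous C1_at_excess excess0 n x i.
Qed.

Lemma dexcessE i x : ext x -> dexcess i x = partial i f x - partial i zh x.
Proof.
move=> ex; rewrite /dexcess /grad_in; case: pselect => // ?.
have szh : smooth zh by case: zh_test.
rewrite (@near_eq_partial _ _ excess (fun y => f y + -1 * zh y)); last first.
  by apply: filterS (near_ext ex) => y /excessE ->; rewrite mulN1r.
have dz : derivable (fun y => -1 * zh y) x (e_ i).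
  exact: smooth_derivable (smoothM (smooth_cst (-1)) szh).
have [/(_ i) df _] := C1_at_ext ex.
by rewrite (partialD df dz) (partialZ _ (smooth_derivable szh)) mulN1r.
Qed.

Lemma dexcess_out i x : ~ ext x -> dexcess i x = 0.
Proof. by move=> ex; rewrite /dexcess /grad_in; case: pselect. Qed.

(** Green's formula without boundary term: psi has compact support in the exterior, so d_i (d_i f
    psi) has integral 0, and summing over i leaves the Laplacian of f against psi. *)
Lemma ext_orthogonal psi : C1c ext psi ->
  \sum_i IntT (fun x : T => partial i f x * partial i psi x) = 0.
Proof.
move=> Cpsi; have [_ [K [cK Kext psiK]]] := Cpsi.
have clK := compact_closed (@norm_hausdorff _ _) cK.
have [M [M0 spsi sdpsi]] := C1c_bsupp Cpsi.
have pK i := closed_near_partial0 i clK psiK.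
have C1pf i x : ext x -> C1_at (partial i f) x.
  by move=> /harm_f[_ [Hf _]]; split=> j; case: (Hf i j).
have cpf i x : ext x -> {for x, continuous (partial i f)} by move=> /C1_at_ext[].
have c1 i := continuousM_supp oext clK Kext (cpf i) (C1c_continuous_partial (i:=i) Cpsi) (pK i).
have c2 i := continuousM_supp oext clK Kext (fun x ex => (C1pf i x ex).2 i) (C1c_continuous Cpsi) psiK.
have I1 i := continuous_bsupp_integrable (c1 i) (bsupp_mulr _ (sdpsi i)).
have I2 i := continuous_bsupp_integrable (c2 i) (bsupp_mulr (partial i (partial i f)) spsi).
have H i : IntT (fun x : T => partial i f x * partial i psi x) =
    - IntT (fun x : T => partial i (partial i f) x * psi x).
  have [Cf pf] := C1c_mul oext (C1pf i) Cpsi.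
  have s0 : bsupp M (fun x => partial i f x * psi x) := bsupp_mulr _ spsi.
  have [M' [_ _ sM']] := C1c_bsupp Cf.
  have [C _ HC] := continuous_bsupp_bounded (C1c_continuous_partial (i:=i) Cf) (sM' i).
  have [_] := Rintegral_partial_eq0 (continuous_measurable_Rd (C1c_continuous Cf)) s0
    (fun x => C1c_derivable Cf) HC (continuous_bsupp_integrable (C1c_continuous Cf) s0).
  have -> : partial i (fun x => partial i f x * psi x) =
      fun x => partial i f x * partial i psi x + partial i (partial i f) x * psi x.
    by apply/funext => x; exact: pf.
  by rewrite /volint (RintegralD measurableT (I1 i) (I2 i)) => /eqP; rewrite addr_eq0 => /eqP.
rewrite (eq_bigr _ (fun i _ => H i)) sumrN -(Rintegral_sumr measurableT _ I2).
apply/eqP; rewrite oppr_eq0; apply/eqP.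
transitivity (IntT (fun _ : T => 0 : R)); last by rewrite /Rintegral integral0.
apply: eq_Rintegral => x _.
rewrite -mulr_suml; have [Kx|Kx] := pselect (K x); last by rewrite psiK// mulr0.
by have [_ [_ ->]] := harm_f (Kext _ Kx); rewrite mul0r.
Qed.

(** At a zero of [excess] the factor [theta] stays 0, so the truncated gradients have the right
    limit there only if [dexcess] vanishes. *)
Lemma dexcess_eq0_ae i : {ae mu, forall x, excess x = 0 -> dexcess i x = 0}.
Proof.
apply: leb_ae; apply/eqP; rewrite eq_le outer_measure_ge0 andbT.
rewrite -(leb_level_set i oext excess_continuous C1_at_excess); apply: le_outer_measure.
move=> x /not_implyP[x0]; rewrite /dexcess /grad_in; case: pselect => // ex /eqP px.
by split.
Qed.

Lemma measurable_dexcess i : measurable_fun (setT : set T) (dexcess i).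
Proof. exact: measurable_grad_in oext C1_at_excess i. Qed.

Lemma sqint_dzh i : L2T (partial i zh).
Proof. exact: (test_fun_sqint measurableT (test_fun_partial i zh_test)). Qed.

Let theta_e n x : R := theta (n.+1%:R * excess x).

Let ctheta_e n : continuous (theta_e n).
Proof.
have c1 : continuous (fun x => n.+1%:R * excess x) := @CkM R d 0 _ _ (Ck_cst 0 _) excess_continuous.
by move=> x; apply: (continuous_comp (c1 x)); exact: continuous_theta.
Qed.

Let cvg_theta_e i : {ae mu, forall x, setT x ->
  (fun n => theta_e n x * dexcess i x) @ \oo --> dexcess i x}.
Proof.
apply: (@filterS _ _ (ae_filter_ringOfSetsType mu) _ _ _ (dexcess_eq0_ae i)) => x d0 _.
have [/d0 ->|x0] := eqVneq (excess x) 0.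
  by under eq_fun do rewrite mulr0; exact: cvg_cst.
rewrite -[X in _ --> X]mul1r; apply: cvgM; last exact: cvg_cst.
exact: cvg_theta.
Qed.

(* Testing [ext_orthogonal] with the truncations [texcess n] bounds the integral
   of [theta_e n * |dexcess|^2] by that of [theta_e n * |grad zh|^2]. *)
Lemma sqint_dexcess i : L2T (dexcess i).
Proof.
have md j := measurable_dexcess j.
have [C C0 HC] := @theta_bound R.
pose F n j (x : T) : R := theta_e n x * dexcess j x * dexcess j x.
have mt n : measurable_fun (setT : set T) (theta_e n) := continuous_measurable_Rd (@ctheta_e n).
have mF n j : measurable_fun (setT : set T) (F n j).
  exact: measurable_funM (measurable_funM (mt n) (md j)) (md j).
have cz j : continuous (partial j zh).
  by apply: smooth_continuous; apply: smooth_partial; case: zh_test.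
have FE n j x : F n j x = dexcess j x * partial j (texcess n) x.
  by rewrite partial_texcess /F mulrC.
have cd j x : ext x -> {for x, continuous (dexcess j)}.
  move=> ex; have [_ /(_ j) pc] := C1_at_excess ex.
  have E0 y : ext y -> partial j excess y = dexcess j y.
    by move=> ey; rewrite /dexcess /grad_in; case: pselect.
  have En : {near x, partial j excess =1 dexcess j}.
    by apply: filterS (near_ext ex) => y; exact: E0.
  by have := cvg_trans (near_eq_cvg En) pc; rewrite (E0 x ex); exact.
have IF n j : mu.-integrable setT (EFin \o F n j).
  have -> : F n j = (fun x => dexcess j x * partial j (texcess n) x).
    by apply/funext => x; exact: FE.
  have Cn := texcess_C1c n; have [_ [K [cK Kext gK]]] := Cn.
  have clK := compact_closed (@norm_hausdorff _ _) cK.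
  have [M [_ _ sM]] := C1c_bsupp Cn.
  apply: (continuous_bsupp_integrable _ (bsupp_mulr _ (sM j))).
  exact: (continuousM_supp oext clK Kext (cd j) (C1c_continuous_partial (i:=j) Cn)
    (closed_near_partial0 j clK gK)).
have Iz j := integrable_mul_sqint measurableT (sqint_dzh j) (sqint_dzh j).
have Ip n j : mu.-integrable setT (EFin \o (fun x : T => partial j f x * partial j (texcess n) x)).
  have Cn := texcess_C1c n; have [_ [K [cK Kext gK]]] := Cn.
  have clK := compact_closed (@norm_hausdorff _ _) cK.
  have [M [_ _ sM]] := C1c_bsupp Cn.
  apply: (continuous_bsupp_integrable _ (bsupp_mulr _ (sM j))).
  apply: (continuousM_supp oext clK Kext _ (C1c_continuous_partial (i:=j) Cn)
    (closed_near_partial0 j clK gK)).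
  by move=> x /C1_at_ext[_]; exact.
(* Twice the orthogonality relation is subtracted. With a = [dexcess], z = d_j zh and t the value of
   [theta], the integrand becomes t a^2 - 2 t a (a + z), which is at most t z^2 because t (a + z)^2
   >= 0. *)
have bound n : \sum_j IntT (F n j) <= C * \sum_j IntT (fun x : T => partial j zh x * partial j zh x).
  have O := ext_orthogonal (texcess_C1c n).
  have -> : \sum_j IntT (F n j) = \sum_j IntT (F n j) -
      2 * \sum_j IntT (fun x : T => partial j f x * partial j (texcess n) x).
    by rewrite O mulr0 subr0.
  rewrite !mulr_sumr -sumrB; apply: ler_sum => j _.
  have I2 := integrable_mulr measurableT 2 (Ip n j).
  rewrite -(RintegralZl 2 measurableT (Ip n j)) -(RintegralZl C measurableT (Iz j)).
  rewrite -(RintegralB measurableT (IF n j) I2).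
  apply: (le_Rintegral measurableT (integrable_subr measurableT (IF n j) I2)
    (integrable_mulr measurableT C (Iz j))) => x _.
  rewrite FE partial_texcess.
  have zz : 0 <= partial j zh x * partial j zh x by rewrite -expr2 sqr_ge0.
  have [ex|/(@dexcess_out j) ->] := pselect (ext x); last first.
    by rewrite !mulr0 subr0 mulr_ge0.
  have -> : partial j f x = dexcess j x + partial j zh x by rewrite dexcessE// subrK.
  have t0 := theta_ge0 (n.+1%:R * excess x); have tC := HC (n.+1%:R * excess x).
  move: (theta _) (dexcess j x) (partial j zh x) t0 tC zz => t a z t0 tC zz.
  apply: (@le_trans _ _ (t * (z * z))); last exact: ler_wpM2r.
  have : 0 <= t * (a + z) ^+ 2 by rewrite mulr_ge0// sqr_ge0.
  by rewrite expr2; lra.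
split; first exact: md.
pose c := C * \sum_j IntT (fun x : T => partial j zh x * partial j zh x).
apply: (@le_lt_trans _ _ c%:E); last exact: ltry.
apply: (@fatou_bound _ T R mu setT measurableT (fun n => F n i) (fun x => dexcess i x ^+ 2) c 0).
- by move=> n; exact: mF.
- exact: measurable_funX (md i).
- by move=> n x _; rewrite /F -mulrA mulr_ge0 ?theta_ge0// -expr2 sqr_ge0.
- apply: (@filterS _ _ (ae_filter_ringOfSetsType mu) _ _ _ (cvg_theta_e i)) => x cx _.
  by rewrite expr2; apply: cvgM; [exact: cx|exact: cvg_cst].
- move=> n _; rewrite -(fineK (integrable_fin_num measurableT (IF n i))) lee_fin.
  apply: le_trans (bound n); rewrite [leRHS](bigD1 i)//= lerDl; apply: sumr_ge0 => j _.
  by apply: Rintegral_ge0 => x _; rewrite /F -mulrA mulr_ge0 ?theta_ge0// -expr2 sqr_ge0.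
Qed.

(** Dominated convergence: [sqint_dexcess] provides the integrable bound (C + 1)^2 times the square
    of [dexcess]. *)
Lemma cvg_dtexcess i :
  (fun n => IntT (fun x : T => (partial i (texcess n) x - dexcess i x) *
    (partial i (texcess n) x - dexcess i x))) @ \oo --> 0.
Proof.
have [C C0 HC] := @theta_bound R; have sd := sqint_dexcess i.
have md := measurable_dexcess i.
have mt n : measurable_fun (setT : set T) (theta_e n) := continuous_measurable_Rd (@ctheta_e n).
pose F n (x : T) : R := (theta_e n x * dexcess i x - dexcess i x) * (theta_e n x * dexcess i x - dexcess i x).
have -> : (fun n => IntT (fun x : T => (partial i (texcess n) x - dexcess i x) *
    (partial i (texcess n) x - dexcess i x))) = (fun n => IntT (F n)).
  by apply/funext => n; apply: eq_Rintegral => x _; rewrite partial_texcess.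
have -> : 0 = IntT (fun _ : T => 0 : R) by rewrite /Rintegral integral0.
have mB n : measurable_fun (setT : set T) (fun x : T => theta_e n x * dexcess i x - dexcess i x).
  exact: measurable_funB (measurable_funM (mt n) md) md.
have Ig := integrable_mulr measurableT ((C + 1) * (C + 1)) (integrable_mul_sqint measurableT sd sd).
have mF n : measurable_fun (setT : set T) (F n) := measurable_funM (mB n) (mB n).
have ae0 : {ae mu, forall x, setT x -> F ^~ x @ \oo --> (0 : R)}.
  apply: (@filterS _ _ (ae_filter_ringOfSetsType mu) _ _ _ (cvg_theta_e i)) => x cx _.
  have l : (fun n => theta_e n x * dexcess i x - dexcess i x) @ \oo --> (0 : R).
    by rewrite -(subrr (dexcess i x)); apply: cvgB; [exact: cx|exact: cvg_cst].
  by rewrite -(mulr0 (0 : R)); exact: cvgM.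
have [] := @Rintegral_dominated _ T R mu setT measurableT F (fun=> 0) _ mF
  (measurable_cst _) Ig ae0 _; last by [].
move=> n x _; rewrite /F.
have t0 : 0 <= theta_e n x := theta_ge0 _; have tC : theta_e n x <= C := HC _.
have -> : theta_e n x * dexcess i x - dexcess i x = (theta_e n x - 1) * dexcess i x by ring.
have dd : 0 <= dexcess i x * dexcess i x by rewrite -expr2 sqr_ge0.
rewrite mulrACA normrM (ger0_norm dd) ler_wpM2r// ger0_norm -?expr2 ?sqr_ge0//.
by move: (theta_e n x) t0 tC => t t0 tC; rewrite !expr2; nra.
Qed.

End exterior_problem.

(** * Analytic functions *)

Section termwise_differentiation.
Context {R : realType} {d : nat}.
Local Notation E := 'rV[R]_d.
Local Notation e_ i := (delta_mx 0 i : E).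

(** A summable majorant of the derivatives controls, by the mean value inequality, the difference
    quotients of the tail uniformly in the increment; what remains is a finite sum. *)
Lemma termwise_derive (P : nat -> E -> R) (K : nat -> R) (u : E -> R) (s : R) (i : 'I_d) :
  (forall m x, derivable (P m) x (e_ i)) ->
  (forall m x, `|x| < s -> `|partial i (P m) x| <= K m) ->
  cvgn (series K) -> (forall x, `|x| < s -> series (fun m => P m x) @ \oo --> u x) ->
  forall x, `|x| < s -> derivable u x (e_ i) /\
    series (fun m => partial i (P m) x) @ \oo --> partial i u x.
Proof.
move=> dP PK cK Pu x xs.
have K0 m : 0 <= K m by exact: le_trans (PK m x xs).
have cD : cvgn (series (fun m => partial i (P m) x)).
  apply: normed_cvg; apply: (series_le_cvg _ K0 _ cK) => m; first exact: normr_ge0.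
  exact: PK.
pose S n := fun y => \sum_(0 <= m < n) P m y.
have dS n y : derivable (S n) y (e_ i) /\ partial i (S n) y = \sum_(0 <= m < n) partial i (P m) y.
  have S0 : S 0%N = fun=> 0 by apply/funext => z; rewrite /S big_geq.
  have SS k : S k.+1 = fun z => S k z + P k z.
    by apply/funext => z; rewrite /S (big_nat_recr _ _ _ (leq0n k)).
  elim: n => [|n [dn pn]].
    by rewrite S0; split; [exact: derivable_cst|rewrite partial_cst big_geq].
  rewrite SS (big_nat_recr _ _ _ (leq0n n)) /= -pn; split; first exact: derivableD dn (dP n y).
  exact: partialD dn (dP n y).
pose D := limn (series (fun m => partial i (P m) x)).
suff H : (fun t : R => t^-1 *: (u (t *: e_ i + x) - u x)) @ 0^' --> D.
  have dD : 'D_(e_ i) u x = D by apply/cvg_lim => //; exact: norm_hausdorff.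
  split; first by apply/cvg_ex; exists D.
  by rewrite /partial dD; exact: cD.
apply/cvgrPdist_le => e e0.
(* One third each for the tail of the differentiated series, the finite sum, and the tail of the
   difference quotient. *)
have e3 : 0 < e / 3 by rewrite divr_gt0.
have [n [tailn Dn]] : exists n, (forall k, (n <= k)%N -> \sum_(n <= m < k) K m <= e / 3) /\
    `|D - partial i (S n) x| <= e / 3.
  have /cvgrPdist_le/(_ _ e3)[N1 _ H1] := cD.
  have e6 : 0 < e / 3 / 2 by rewrite divr_gt0.
  have /cvgrPdist_le/(_ _ e6)[N2 _ H2] := cK.
  pose n := maxn N1 N2; exists n; split; last first.
    by have := H1 n (leq_maxl _ _); rewrite (dS n x).2.
  move=> k nk; have := H2 n (leq_maxr _ _); have := H2 k (leq_trans (leq_maxr _ _) nk).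
  rewrite /series/= (big_cat_nat _ nk)//=.
  move: (\sum_(0 <= m < n) K m) (\sum_(n <= m < k) K m) (limn _) => a b l.
  by rewrite !ler_norml => /andP[h1 h2] /andP[h3 h4]; move: h1 h2 h3 h4; lra.
have nears : \forall t \near (0 : R), `|x| + `|t| < s.
  have := @norm_continuous R R^o (0 : R); move=> /cvgrPdist_lt/(_ (s - `|x|)).
  rewrite subr_gt0 => /(_ xs); apply: filterS => t.
  by rewrite /= normr0 sub0r normrN normr_id -ltrBrDl.
have tail (t : R) : `|x| + `|t| < s ->
    `|(u (t *: e_ i + x) - u x) - (S n (t *: e_ i + x) - S n x)| <= e / 3 * `|t|.
  move=> xts.
  have xt : `|t *: e_ i + x| < s.
    by apply: le_lt_trans xts; rewrite addrC (le_trans (ler_normD _ _))// lerD// norm_delta_mx.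
  have l1 : (fun k => (S k (t *: e_ i + x) - S k x) - (S n (t *: e_ i + x) - S n x)) @ \oo -->
      (u (t *: e_ i + x) - u x) - (S n (t *: e_ i + x) - S n x).
    by apply: cvgB; [apply: cvgB; [exact: Pu|exact: Pu]|exact: cvg_cst].
  have l2 : (fun k => `|(S k (t *: e_ i + x) - S k x) - (S n (t *: e_ i + x) - S n x)|) @ \oo -->
      `|(u (t *: e_ i + x) - u x) - (S n (t *: e_ i + x) - S n x)|.
    exact: cvg_norm l1.
  rewrite -(cvg_lim (@norm_hausdorff _ _) l2).
  apply: limr_le; first by apply/cvg_ex; eexists; exact: l2.
  exists n => // k /= nk.
  pose f y := \sum_(n <= m < k) P m y.
  have SE y : S k y - S n y = f y.
    by rewrite /S (big_cat_nat _ nk)//= addrAC subrr add0r.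
  have -> : S k (t *: e_ i + x) - S k x - (S n (t *: e_ i + x) - S n x) =
      f (x + t *: e_ i) - f x by rewrite -!SE [x + _]addrC; ring.
  have df y : derivable f y (e_ i) /\ partial i f y = \sum_(n <= m < k) partial i (P m) y.
    have -> : f = fun y => S k y + -1 * S n y by apply/funext => z; rewrite mulN1r SE.
    have dZ : derivable (fun y => -1 * S n y) y (e_ i).
      exact: (derivableM (derivable_cst _ _ _) (dS n y).1).
    split; first exact: derivableD (dS k y).1 dZ.
    rewrite (partialD (dS k y).1 dZ) (partialZ _ (dS n y).1) (dS k y).2 (dS n y).2.
    by rewrite (big_cat_nat _ nk)//= mulN1r addrAC subrr add0r.
  apply: mvt_bound => r rt; first exact: (df _).1.
  rewrite -/(partial i f _) (df _).2; apply: le_trans (tailn k nk).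
  apply: (le_trans (ler_norm_sum _ _ _)); apply: ler_sum => m _; apply: PK.
  apply: le_lt_trans xts; rewrite (le_trans (ler_normD _ _))// lerD//.
  apply: (le_trans (norm_delta_mx _ _)).
  by move: rt; rewrite ler_norml; case: (leP 0 t) => t0 /andP[r1 r2];
    rewrite ?(ger0_norm t0) ?(ltr0_norm t0); apply/andP; split; lra.
have /cvgrPdist_le/(_ _ e3) dSn : (fun t : R => t^-1 *: (S n (t *: e_ i + x) - S n x)) @ 0^' -->
    partial i (S n) x by exact: (dS n x).1.
have nears' : \forall t \near (0 : R)^', `|x| + `|t| < s by exact: nbhs_dnbhs.
have n0 : \forall t \near (0 : R)^', t != 0 by exact: nbhs_dnbhs_neq.
apply: filterS3 dSn nears' n0 => t Ht xts t0.
have := tail t xts; move: Ht.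
move: (u _ - u x) (S n (t *: e_ i + x) - S n x) => U V.
have t1 : 0 < `|t| by rewrite normr_gt0.
move=> Ht HT.
have HT' : `|t^-1 *: (U - V)| <= e / 3.
  by rewrite normrM normfV mulrC ler_pdivrMr.
have -> : D - t^-1 *: U = (D - partial i (S n) x) + (partial i (S n) x - t^-1 *: V) - t^-1 *: (U - V).
  by rewrite scalerBr; ring.
apply: (le_trans (ler_normB _ _)); apply: (le_trans (lerD (ler_normD _ _) HT')).
by move: Dn Ht; lra.
Qed.

End termwise_differentiation.

Section multi_indices.
Context {R : realType} {d : nat}.
Local Notation E := 'rV[R]_d.
Local Notation e_ i := (delta_mx 0 i : E).
Implicit Types (b c : mindex d).

Definition madd b c : mindex d := [ffun j => (b j + c j)%N].
Definition munit (i : 'I_d) : mindex d := [ffun j => (j == i) : nat].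
Definition msub1 (i : 'I_d) b : mindex d := [ffun j => (b j - (j == i))%N].

Lemma mem_midx k b : (b \in midx k) = (mdeg b == k).
Proof.
apply/mapP/eqP => [[c]|bk].
  rewrite mem_filter => /andP[/eqP ck _] ->; rewrite -[RHS]ck /mdeg.
  by apply: eq_bigr => i _; rewrite ffunE.
have bi i : (b i < k.+1)%N by rewrite ltnS -bk /mdeg (bigD1 i)//= leq_addr.
exists [ffun i => Ordinal (bi i)]; last by apply/ffunP => i; rewrite !ffunE.
rewrite mem_filter mem_enum andbT -[X in _ == X]bk; apply/eqP; apply: eq_bigr => i _.
by rewrite ffunE.
Qed.

Lemma midx_uniq k : uniq (midx k : seq (mindex d)).
Proof.
rewrite /midx map_inj_uniq => [|b c /ffunP bc]; first by apply: filter_uniq; exact: enum_uniq.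
by apply/ffunP => i; apply: val_inj; have := bc i; rewrite !ffunE.
Qed.

Lemma size_midx k : (size (midx k : seq (mindex d)) <= k.+1 ^ d)%N.
Proof.
rewrite /midx size_map size_filter; apply: leq_trans (count_size _ _) _.
by rewrite -cardE card_ffun !card_ord.
Qed.

Lemma mdeg_madd b c : mdeg (madd b c) = (mdeg b + mdeg c)%N.
Proof. by rewrite /mdeg -big_split; apply: eq_bigr => i _; rewrite ffunE. Qed.

Lemma mdeg_munit i : mdeg (munit i) = 1%N.
Proof.
rewrite /mdeg (bigD1 i)//= ffunE eqxx big1 ?addn0// => j /negbTE ji.
by rewrite ffunE ji.
Qed.

Lemma madd_munit_gt0 i c : madd c (munit i) i != 0%N.
Proof. by rewrite !ffunE eqxx addn1. Qed.

Lemma madd_munitK i : cancel (madd^~ (munit i)) (msub1 i).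
Proof. by move=> c; apply/ffunP => j; rewrite !ffunE addnK. Qed.

Lemma msub1K i b : b i != 0%N -> madd (msub1 i b) (munit i) = b.
Proof.
move=> bi; apply/ffunP => j; rewrite !ffunE subnK//.
by case: eqP => // ->; rewrite lt0n.
Qed.

Lemma mfact_madd_munit i c : mfact (madd c (munit i)) = ((c i).+1 * mfact c)%N.
Proof.
rewrite /mfact (bigD1 i)//= [in RHS](bigD1 i)//= !ffunE eqxx addn1 factS -mulnA.
congr (_ * (_ * _))%N; apply: eq_bigr => j /negbTE ji.
by rewrite !ffunE ji addn0.
Qed.

Lemma mfact_gt0 b : (0 < mfact b)%N.
Proof. by rewrite /mfact prodn_gt0// => i; exact: fact_gt0. Qed.

Lemma partial_mpow b (x : E) i : derivable (mpow^~ b) x (e_ i) /\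
  partial i (mpow^~ b) x = (b i)%:R * mpow x (msub1 i b).
Proof.
apply: derive_from_line.
pose q := \prod_(j < d | j != i) x 0 j ^+ b j.
have -> : (fun t : R => mpow (x + t *: e_ i) b) = (fun t : R => (x 0 i + t) ^+ b i * q).
  apply/funext => t; rewrite /mpow (bigD1 i)//= !mxE !eqxx/= mulr1; congr (_ * _).
  by apply: eq_bigr => j /negbTE ji; rewrite !mxE eqxx/= ji mulr0 addr0.
have -> : (b i)%:R * mpow x (msub1 i b) = q * ((b i)%:R * (x 0 i + 0) ^+ (b i).-1).
  rewrite /mpow [in LHS](bigD1 i)//= ffunE eqxx subn1 addr0.
  rewrite (eq_bigr (fun j => x 0 j ^+ b j)); last by move=> j /negbTE ji; rewrite ffunE ji subn0.
  by rewrite -/q; ring.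
have H : is_derive (0 : R) (1 : R) (fun t : R => x 0 i + t) 1.
  by apply: is_derive_eq; rewrite mulr1 add0r.
have H2 n : is_derive (0 : R) (1 : R) (fun t : R => (x 0 i + t) ^+ n) (n%:R * (x 0 i + 0) ^+ n.-1).
  elim: n => [|n IHn]; first by rewrite mul0r; exact: is_derive_cst.
  have -> : (fun t : R => (x 0 i + t) ^+ n.+1) = (fun t : R => x 0 i + t) * (fun t : R => (x 0 i + t) ^+ n).
    by apply/funext => t; rewrite exprS.
  apply: is_derive_eq; rewrite /GRing.scale/= mulr1 addr0.
  case: n {IHn} => [|n] /=; first by rewrite !expr0 mul0r mulr0 add0r mulr1.
  by rewrite mulrCA -exprS -[in RHS]natr1 mulrDl mul1r.
have -> : (fun t : R => (x 0 i + t) ^+ b i * q) = q *: (fun t : R => (x 0 i + t) ^+ b i).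
  by apply/funext => t; rewrite mulrC.
by have := H2 (b i); exact: is_deriveZ.
Qed.

End multi_indices.

Section expansions.
Context {R : realType} {d : nat}.
Local Notation E := 'rV[R]_d.
Local Notation e_ i := (delta_mx 0 i : E).
Implicit Types (A B : mindex d -> R) (u v : E -> R) (rho C : R).

Definition term A (m : nat) (h : E) : R := \sum_(b <- midx m) A b / (mfact b)%:R * mpow h b.

(* Exponential coefficients turn a partial derivative into a mere shift. *)
Definition shift (i : 'I_d) A : mindex d -> R := fun c => A (madd c (munit i)).

(** Cauchy's estimates at radius rho for the Taylor coefficients A b / b!. *)
Definition coef_bound A rho C := forall b, `|A b| / (mfact b)%:R * rho ^+ mdeg b <= C.

(** A b stands for D^b u(0). The coefficient bound is recorded beside convergence because it passes
    explicitly to derivatives and supplies the majorant for termwise differentiation. *)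
Definition expansion u A rho := [/\ 0 < rho, exists C, coef_bound A rho C &
  forall h, `|h| < rho -> series (fun m => term A m h) @ \oo --> u h].

Lemma coef_bound_ge0 A rho C : 0 <= rho -> coef_bound A rho C -> 0 <= C.
Proof.
move=> rho0 bA; apply: le_trans (bA [ffun=> 0%N]).
by rewrite mulr_ge0 ?divr_ge0 ?exprn_ge0.
Qed.

Lemma norm_mpow_le (h : E) (b : mindex d) : `|mpow h b| <= `|h| ^+ mdeg b.
Proof.
rewrite /mpow /mdeg normr_prod -prodrXr; apply: ler_prod => i _.
by rewrite normr_ge0 normrX lerXn2r ?nnegrE// ler_coord_norm.
Qed.

(** A monomial of degree m is at most |h|^m, and there are at most (m + 1)^d <= 2^(d m) of them,
    whence the ratio 2^d |h| / rho. *)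
Lemma term_bound A rho C m h : 0 < rho -> coef_bound A rho C ->
  `|term A m h| <= C * (2 ^+ d * `|h| / rho) ^+ m.
Proof.
move=> rho0 bA; have C0 := coef_bound_ge0 (ltW rho0) bA.
have q0 : 0 <= `|h| / rho by rewrite divr_ge0// ltW.
apply: (@le_trans _ _ (\sum_(b <- midx m : seq (mindex d)) C * (`|h| / rho) ^+ m)).
  apply: (le_trans (ler_norm_sum _ _ _)); rewrite big_seq [leRHS]big_seq.
  apply: ler_sum => b; rewrite mem_midx => /eqP bm.
  have b0 : 0 < (mfact b)%:R :> R by rewrite ltr0n mfact_gt0.
  rewrite normrM normrM normfV (gtr0_norm b0).
  apply: (@le_trans _ _ (`|A b| / (mfact b)%:R * `|h| ^+ m)).
    by rewrite ler_wpM2l ?divr_ge0 ?(ltW b0)// -bm norm_mpow_le.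
  have -> : `|h| ^+ m = rho ^+ m * (`|h| / rho) ^+ m.
    by rewrite -exprMn mulrCA divff ?gt_eqF// mulr1.
  by rewrite mulrA ler_wpM2r ?exprn_ge0// -{1}bm; exact: bA.
rewrite big_const_seq count_predT iter_addr_0 -[leLHS]mulr_natr.
have -> : C * (2 ^+ d * `|h| / rho) ^+ m = C * (`|h| / rho) ^+ m * (2 ^+ d) ^+ m.
  by rewrite -[2 ^+ d * _ / _]mulrA exprMn [_ ^+ m * _]mulrC mulrA.
apply: ler_wpM2l; first by rewrite mulr_ge0// exprn_ge0.
rewrite -!natrX ler_nat; apply: (leq_trans (size_midx m)).
rewrite -expnM mulnC expnM; case: (d) => [|n]; first by rewrite !expn0.
by rewrite leq_exp2r// ltn_expl.
Qed.

Lemma derive_term A m i (h : E) : derivable (term A m) h (e_ i) /\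
  partial i (term A m) h =
    \sum_(b <- midx m) A b / (mfact b)%:R * ((b i)%:R * mpow h (msub1 i b)).
Proof.
rewrite /term; elim: (midx m) => [|b s [ds ps]].
  have -> : (fun h : E => \sum_(b <- [::]) A b / (mfact b)%:R * mpow h b) = fun=> 0.
    by apply/funext => y; rewrite big_nil.
  by rewrite big_nil; split; [exact: derivable_cst|exact: partial_cst].
have -> : (fun h : E => \sum_(b <- b :: s) A b / (mfact b)%:R * mpow h b) =
    fun h => A b / (mfact b)%:R * mpow h b + \sum_(b <- s) A b / (mfact b)%:R * mpow h b.
  by apply/funext => y; rewrite big_cons.
have [db pb] := partial_mpow b h i.
have dZ : derivable (fun y : E => A b / (mfact b)%:R * mpow y b) h (e_ i).
  exact: (derivableM (derivable_cst _ _ _) db).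
split; first exact: derivableD dZ ds.
by rewrite big_cons -ps (partialD dZ ds) (partialZ _ db) pb.
Qed.

(** Reindexing by b = c + e_i: the factor b_i = c_i + 1 cancels against b! = (c_i + 1) c!, and the
    terms with b_i = 0 drop out. *)
Lemma partial_term A m i (h : E) : partial i (term A m.+1) h = term (shift i A) m h.
Proof.
rewrite (derive_term A m.+1 i h).2 (bigID (fun b : mindex d => b i == 0%N))/= big1 ?add0r; last first.
  by move=> b /eqP ->; rewrite mul0r mulr0.
rewrite -big_filter; have P : perm_eq [seq b : mindex d <- midx m.+1 | b i != 0%N]
    [seq madd c (munit i) | c <- midx m].
  apply: uniq_perm; first by rewrite filter_uniq// midx_uniq.
    by rewrite map_inj_uniq ?midx_uniq//; exact: can_inj (madd_munitK i).
  move=> b; rewrite mem_filter; apply/andP/mapP => [[bi]|[c]].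
    rewrite mem_midx => /eqP bm; exists (msub1 i b); last by rewrite msub1K.
    have := mdeg_madd (msub1 i b) (munit i); rewrite msub1K// mdeg_munit bm addn1 => -[->].
    by rewrite mem_midx.
  rewrite mem_midx => /eqP cm ->; rewrite madd_munit_gt0 mem_midx mdeg_madd mdeg_munit cm.
  by rewrite addn1.
rewrite (perm_big _ P)/= big_map /term; apply: eq_bigr => c _.
rewrite madd_munitK mfact_madd_munit natrM /shift.
have -> : madd c (munit i) i = (c i).+1 by rewrite !ffunE eqxx addn1.
have c0 : (c i).+1%:R != 0 :> R by [].
have f0 : (mfact c)%:R != 0 :> R by rewrite pnatr_eq0 -lt0n mfact_gt0.
by move: ((c i).+1%:R : R) ((mfact c)%:R : R) c0 f0 => p q p0 q0; field; rewrite p0 q0.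
Qed.

Lemma partial_term0 A i (h : E) : partial i (term A 0) h = 0.
Proof.
rewrite (derive_term A 0 i h).2 big_seq big1// => b; rewrite mem_midx /mdeg => /eqP b0.
have : (b i <= 0)%N by rewrite -b0 (bigD1 i)//= leq_addr.
by rewrite leqn0 => /eqP ->; rewrite mul0r mulr0.
Qed.

(* There are at most [2 ^ (d m)] multi-indices of degree [m], whence the loss of
   radius at each differentiation. *)
Definition shrink : R := 2 ^+ d.+2.

Lemma shrink_gt0 : 0 < shrink. Proof. exact: exprn_gt0. Qed.

Lemma shrinkE : shrink = 2 * (2 * 2 ^+ d).
Proof. by rewrite /shrink !exprS. Qed.

Lemma shrink_ge1 : 1 <= shrink.
Proof. by rewrite /shrink exprn_ege1// ler1n. Qed.

(** The factor c_i + 1 lost from the factorial is at most 2^|c|, which halving the radius pays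
    for. *)
Lemma coef_bound_shift A rho C i : 0 < rho -> coef_bound A rho C ->
  coef_bound (shift i A) (rho / 2) (C / rho).
Proof.
move=> rho0 bA c; rewrite /shift ler_pdivlMr//.
apply: le_trans (bA (madd c (munit i))).
rewrite mfact_madd_munit mdeg_madd mdeg_munit addn1 natrM.
rewrite exprMn exprVn exprSr.
have c1 : (c i).+1%:R <= 2 ^+ mdeg c :> R.
  rewrite -natrX ler_nat; apply: leq_trans (ltn_expl (mdeg c) (ltnSn 1)).
  by rewrite ltnS /mdeg (bigD1 i)//= leq_addr.
have p0 : 0 < (c i).+1%:R :> R by [].
have f0 : 0 < (mfact c)%:R :> R by rewrite ltr0n mfact_gt0.
have w0 : 0 < 2 ^+ mdeg c :> R by rewrite exprn_gt0.
have r0 : 0 <= rho ^+ mdeg c by rewrite exprn_ge0// ltW.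
have a0 := normr_ge0 (A (madd c (munit i))).
move: (2 ^+ mdeg c) ((c i).+1%:R : R) ((mfact c)%:R : R) (rho ^+ mdeg c)
  (`|A (madd c (munit i))|) c1 p0 f0 w0 r0 a0 => w p f r a c1 p0 f0 w0 r0 a0.
have -> : a / f * (r * w^-1) * rho = a * r * rho / f * w^-1 by field; rewrite !gt_eqF.
have -> : a / (p * f) * (r * rho) = a * r * rho / f * p^-1 by field; rewrite !gt_eqF.
rewrite ler_wpM2l ?lef_pV2//; apply: divr_ge0; last exact: ltW.
by apply: mulr_ge0; [exact: mulr_ge0|exact: ltW].
Qed.

Lemma coef_bound_le A rho rho' C : 0 <= rho' <= rho -> coef_bound A rho C -> coef_bound A rho' C.
Proof.
move=> /andP[r0 rr] bA b; apply: le_trans (bA b).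
by rewrite ler_wpM2l ?divr_ge0// lerXn2r ?nnegrE// (le_trans r0).
Qed.

Lemma expansion_partial u A rho i : expansion u A rho ->
  (forall h, `|h| < rho / shrink -> derivable u h (e_ i)) /\
  expansion (partial i u) (shift i A) (rho / shrink).
Proof.
move=> [rho0 [C bA] cu].
have bS := coef_bound_shift i rho0 bA.
have rho2 : 0 < rho / 2 by rewrite divr_gt0.
have s0 : 0 < rho / shrink by rewrite divr_gt0 ?shrink_gt0.
have srho : rho / shrink <= rho by rewrite ler_pdivrMr ?shrink_gt0// ler_peMr ?(ltW rho0) ?shrink_ge1.
(* For |x| < rho / [shrink] the ratio 2^d |x| / (rho / 2) is at most 1/2; the factor 2 compensates
   for the shift of index, the term of degree 0 having derivative 0. *)
pose K := geometric (2 * (C / rho)) (2^-1 : R).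
have Cr0 : 0 <= C / rho := coef_bound_ge0 (ltW rho2) bS.
have PK m (x : E) : `|x| < rho / shrink -> `|partial i (term A m) x| <= K m.
  move=> xs; case: m => [|m].
    by rewrite partial_term0 normr0 /K /geometric/= expr0 mulr1 mulr_ge0.
  rewrite partial_term; apply: (le_trans (term_bound m x rho2 bS)).
  rewrite /K /geometric/=.
  have -> : 2 * (C / rho) * 2^-1 ^+ m.+1 = C / rho * 2^-1 ^+ m.
    by rewrite exprS; move: (2^-1 ^+ m) (C / rho) => y z; field.
  have q0 : 0 <= 2 ^+ d * `|x| / (rho / 2).
    by apply: divr_ge0; [apply: mulr_ge0 => //; exact: exprn_ge0|exact: ltW].
  apply: ler_wpM2l => //; apply: lerXn2r; rewrite ?nnegrE//.
  rewrite ler_pdivrMr//.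
  move: (ltW xs); rewrite ler_pdivlMr ?shrink_gt0// shrinkE.
  by move: (2 ^+ d) => w; lra.
have cK : cvgn (series K) by apply: is_cvg_geometric_series; rewrite ger0_norm ?invf_lt1// ltr1n.
have H := termwise_derive (fun m x => (derive_term A m i x).1) PK cK
  (fun x xs => cu x (lt_le_trans xs srho)).
split=> [h hs|]; first exact: (H h hs).1.
split=> // [|h hs].
  exists (C / rho); apply: coef_bound_le bS; rewrite ltW//=.
  by rewrite ler_pM2l// lef_pV2 ?posrE ?shrink_gt0// shrinkE; have := @exprn_ege1 R d 2; rewrite ler1n => /(_ isT); lra.
have [_ Hs] := H h hs.
have E0 : (fun n => series (fun m => partial i (term A m) h) n.+1) =
    series (fun m => term (shift i A) m h).
  apply/funext => n; rewrite /series/= big_nat_recl//= partial_term0 add0r.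
  by apply: eq_bigr => m _; exact: partial_term.
by rewrite -cvg_shiftS in Hs; rewrite -E0.
Qed.

(** Terms of degree below j are absent, and |h|^j factors out of the others, which still form a
    geometric series of ratio 1/2. *)
Lemma expansion_vanish u A rho j : expansion u A rho -> (forall b, (mdeg b < j)%N -> A b = 0) ->
  exists2 K, 0 <= K & forall h, `|h| < rho / shrink -> `|u h| <= K * `|h| ^+ j.
Proof.
move=> [rho0 [C bA] cu] A0.
have C0 := coef_bound_ge0 (ltW rho0) bA.
have srho : rho / shrink <= rho by rewrite ler_pdivrMr ?shrink_gt0// ler_peMr ?(ltW rho0) ?shrink_ge1.
pose K0 := C * (2 ^+ d / rho) ^+ j * 2 ^+ j.
have K00 : 0 <= K0 by rewrite !mulr_ge0 ?exprn_ge0 ?divr_ge0 ?exprn_ge0// ltW.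
exists (K0 * 2) => [|h hs]; first by rewrite mulr_ge0.
have tb m : `|term A m h| <= K0 * `|h| ^+ j * 2^-1 ^+ m.
  have [mj|jm] := ltnP m j.
    have -> : term A m h = 0.
      rewrite /term big_seq big1// => b; rewrite mem_midx => /eqP bm.
      by rewrite A0 ?bm// !mul0r.
    by rewrite normr0; apply: mulr_ge0; [apply: mulr_ge0 => //; exact: exprn_ge0|exact: exprn_ge0].
  apply: (le_trans (term_bound m h rho0 bA)).
  rewrite -(subnK jm) addnC !exprD mulrA.
  have -> : C * (2 ^+ d * `|h| / rho) ^+ j = C * (2 ^+ d / rho) ^+ j * `|h| ^+ j.
    by rewrite -[RHS]mulrA -exprMn; congr (_ * _ ^+ _); rewrite mulrAC.
  have -> : K0 * `|h| ^+ j * (2^-1 ^+ j * 2^-1 ^+ (m - j)) =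
      C * (2 ^+ d / rho) ^+ j * `|h| ^+ j * 2^-1 ^+ (m - j).
    rewrite /K0 exprVn; have : 2 ^+ j != 0 :> R by rewrite expf_neq0.
    by move: (2 ^+ j : R) (2^-1 ^+ (m - j)) ((_ / rho) ^+ j) => w y z w0; field.
  apply: ler_wpM2l.
    by rewrite !mulr_ge0 ?exprn_ge0 ?divr_ge0 ?exprn_ge0// ltW.
  have q0 : 0 <= 2 ^+ d * `|h| / rho.
    by apply: divr_ge0; [apply: mulr_ge0 => //; exact: exprn_ge0|exact: ltW].
  apply: lerXn2r; rewrite ?nnegrE//.
  rewrite ler_pdivrMr//; move: (ltW hs); rewrite ler_pdivlMr ?shrink_gt0// shrinkE.
  have : 0 <= `|h| * 2 ^+ d by rewrite mulr_ge0// exprn_ge0.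
  by move: (2 ^+ d) => w; lra.
have c := cu h (lt_le_trans hs srho).
have cn : (fun n => `|series (fun m => term A m h) n|) @ \oo --> `|u h|.
  exact: cvg_norm c.
rewrite -(cvg_lim (@norm_hausdorff _ _) cn); apply: limr_le.
  by apply/cvg_ex; exists `|u h|.
apply: nearW => n; rewrite /series/=.
have geo : \sum_(0 <= m < n) (2^-1 : R) ^+ m = 2 - 2 * 2^-1 ^+ n.
  elim: n => [|n IHn]; first by rewrite big_geq// expr0 mulr1 subrr.
  rewrite big_nat_recr//= IHn exprS; move: (2^-1 ^+ n) => y; lra.
apply: (le_trans (ler_norm_sum _ _ _)); apply: (le_trans (ler_sum _ (fun m _ => tb m))).
rewrite -mulr_sumr geo -mulrA [2 * _]mulrC mulrA.
rewrite [leRHS]mulrAC; apply: ler_wpM2l; first by rewrite mulr_ge0// exprn_ge0.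
by rewrite lerBlDr lerDl mulr_ge0// exprn_ge0.
Qed.

Lemma midx0 : perm_eq (midx 0) [:: [ffun=> 0%N] : mindex d].
Proof.
apply: uniq_perm; [exact: midx_uniq|by []|] => b; rewrite mem_midx inE.
apply/eqP/eqP => [b0|->]; last by rewrite /mdeg big1// => i _; rewrite ffunE.
apply/ffunP => i; rewrite ffunE; apply/eqP; rewrite -leqn0 -b0 /mdeg (bigD1 i)//=.
exact: leq_addr.
Qed.

Lemma expansion_at0 u A rho : expansion u A rho -> u 0 = A [ffun=> 0%N].
Proof.
move=> [rho0 [C bA] cu]; have := cu 0; rewrite normr0 => /(_ rho0) c.
have t0 m : term A m.+1 0 = 0.
  apply/eqP; rewrite -normr_le0; apply: le_trans (term_bound m.+1 0 rho0 bA) _.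
  by rewrite normr0 mulr0 mul0r expr0n mulr0.
have E0 n : series (fun m => term A m 0) n.+1 = A [ffun=> 0%N].
  rewrite /series/= big_nat_recl//= big1 ?addr0; last by move=> m _; exact: t0.
  rewrite /term (perm_big _ midx0)/= big_seq1 /mfact /mpow !big1 ?divr1 ?mulr1//.
    by move=> i _; rewrite ffunE.
  by move=> i _; rewrite ffunE.
have c1 : (fun n => series (fun m => term A m 0) n.+1) @ \oo --> u 0.
  by rewrite -cvg_shiftS in c.
have c2 : (fun n => series (fun m => term A m 0) n.+1) @ \oo --> A [ffun=> 0%N].
  by under eq_fun do rewrite E0; exact: cvg_cst.
exact: (cvg_unique (@norm_hausdorff _ _) c1 c2).
Qed.

End expansions.

Section taylor.
Context {R : realType} {d : nat}.
Local Notation E := 'rV[R]_d.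
Local Notation e_ i := (delta_mx 0 i : E).
Implicit Types (A B : mindex d -> R) (u v : E -> R) (rho C : R).
Local Notation shrink := (@shrink R d).

Lemma expansion_iter_partial u A rho i n : expansion u A rho ->
  exists rho', expansion (iter n (partial i) u)
    (fun c => A [ffun j => (c j + n * (j == i))%N]) rho'.
Proof.
move=> uA; elim: n => [|n [rho' IHn]].
  exists rho; have -> // : (fun c : mindex d => A [ffun j => (c j + 0 * (j == i))%N]) = A.
  by apply/funext => c; congr A; apply/ffunP => j; rewrite ffunE mul0n addn0.
have [_ H] := expansion_partial i IHn; exists (rho' / shrink).
move: H; congr (expansion _ _ _); apply/funext => c; rewrite /shift; congr A.
by apply/ffunP => j; rewrite !ffunE -addnA mulSn.
Qed.

(** Each d_i shifts the coefficients by one unit, so D^b shifts them by b, and evaluation at 0 reads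
    off A b. *)
Lemma expansion_mderiv u A rho b : expansion u A rho -> mderiv b u 0 = A b.
Proof.
move=> uA.
have [rho' H] : exists rho', expansion (foldr (fun i g => iter (b i) (partial i) g) u (enum 'I_d))
    (fun c => A [ffun j => (c j + \sum_(l <- enum 'I_d) b l * (j == l))%N]) rho'.
  elim: (enum 'I_d) => [|i s [r IHs]].
    exists rho; move: uA; congr (expansion _ _ _); apply/funext => c; congr A.
    by apply/ffunP => j; rewrite ffunE big_nil addn0.
  have [r' H] := expansion_iter_partial i (b i) IHs; exists r'.
  move: H; congr (expansion _ _ _); apply/funext => c; congr A.
  by apply/ffunP => j; rewrite !ffunE big_cons addnA.
rewrite /mderiv (expansion_at0 H); congr A; apply/ffunP => j; rewrite !ffunE add0n.
rewrite big_enum (bigD1 j)//= eqxx muln1 big1 ?addn0// => l /negbTE lj.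
by rewrite eq_sym lj muln0.
Qed.

Lemma expansionB u v A B rho : expansion u A rho -> expansion v B rho ->
  expansion (fun x => u x - v x) (fun b => A b - B b) rho.
Proof.
move=> [rho0 [C bA] cu] [_ [C' bB] cv]; split => // [|h hr].
  exists (C + C') => b; apply: le_trans (lerD (bA b) (bB b)).
  rewrite -!mulrDl; apply: ler_wpM2r; first by rewrite exprn_ge0// ltW.
  by apply: ler_wpM2r => //; exact: ler_normB.
have -> : series (fun m => term (fun b => A b - B b) m h) =
    (fun n => series (fun m => term A m h) n - series (fun m => term B m h) n).
  apply/funext => n; rewrite /series/= -sumrB; apply: eq_bigr => m _.
  by rewrite /term -sumrB; apply: eq_bigr => b _; rewrite !mulrBl.
exact: cvgB (cu h hr) (cv h hr).
Qed.

Definition homog A k : mindex d -> R := fun b => if mdeg b == k then A b else 0.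

Lemma term_homog A k m (h : E) : term (homog A k) m h = if m == k then term A k h else 0.
Proof.
rewrite /term; case: eqP => [->|mk].
  by rewrite big_seq [RHS]big_seq; apply: eq_bigr => b; rewrite /homog mem_midx => ->.
rewrite big_seq big1// => b; rewrite mem_midx => /eqP bm.
by rewrite /homog bm; case: eqP => // _; rewrite !mul0r.
Qed.

Lemma expansion_homog u A rho k : expansion u A rho -> expansion (term A k) (homog A k) rho.
Proof.
move=> [rho0 [C bA] _]; split => // [|h _].
  exists C => b; rewrite /homog; case: ifP => // _.
  by rewrite normr0 !mul0r (coef_bound_ge0 (ltW rho0) bA).
apply: cvg_near_cst; exists k.+1 => // n /= kn; rewrite /series/=.
rewrite (bigD1_seq k)/= ?mem_index_iota ?iota_uniq// term_homog eqxx big1 ?addr0//.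
by move=> m /negbTE mk; rewrite term_homog mk.
Qed.

Lemma expansion_continuous u A rho h : expansion u A rho -> `|h| < rho / shrink / shrink ->
  {for h, continuous u}.
Proof.
move=> uA hr; have [rho0 _ _] := uA.
have s0 := @shrink_gt0 R d.
have r1 : rho / shrink / shrink <= rho / shrink.
  by rewrite ler_pdivrMr// ler_peMr ?shrink_ge1// divr_ge0// ltW.
apply: (@partial_bounded_continuous R d u 0 (rho / shrink / shrink)) => [x i|i|]; last by rewrite subr0.
  by rewrite subr0 => xr; have [dui _] := expansion_partial i uA; apply: dui; exact: lt_le_trans xr r1.
have [_ ui] := expansion_partial i uA.
have [//|K _ HK] := @expansion_vanish R d _ _ _ 0 ui.
by exists K => z; rewrite subr0 => /HK; rewrite expr0 mulr1.
Qed.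

(** Absolute convergence at the diagonal point (rho, ..., rho) bounds every |a b| rho^|b|, which is
    the coefficient bound for A b = a b b!. *)
Lemma analytic_expansion u : analytic_at u 0 -> exists A rho, expansion u A rho.
Proof.
(* This radius keeps the closed sup-norm ball inside the Euclidean ball of radius r. *)
move=> [a [r [r0 H]]]; pose rho := r / (2 * d.+1%:R).
have rho0 : 0 < rho by rewrite divr_gt0// mulr_gt0.
have enr (h : E) : `|h| <= rho -> enorm h < r.
  move=> hr; apply: (le_lt_trans (ler_enorm h)).
  apply: (@le_lt_trans _ _ (d.+1%:R * rho)); first by rewrite ler_pM// ler_nat.
  rewrite /rho; have : 0 < d.+1%:R :> R by [].
  move: (d.+1%:R : R) => D D0.
  have -> : D * (r / (2 * D)) = r / 2 by field; rewrite gt_eqF.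
  by rewrite ltr_pdivrMr// ltr_pMr// ltr1n.
pose A b := a b * (mfact b)%:R.
have tE m (h : E) : term A m h = \sum_(b <- midx m) a b * mpow h b.
  apply: eq_bigr => b _; rewrite /A mulfK// pnatr_eq0 -lt0n; exact: mfact_gt0.
exists A, rho; split => //; last first.
  move=> h hr; have [_] := H h (enr h (ltW hr)); rewrite add0r.
  have -> : (fun m => term A m h) = (fun m => \sum_(b <- midx m) a b * mpow h b) by apply/funext => m.
  exact.
have hc : `|const_mx rho : E| <= rho.
  by apply: ler_norm_coord => [|i]; [exact: ltW|rewrite mxE ger0_norm// ltW].
have [/cvg_series_bounded [C [_ HC]] _] := H (const_mx rho) (enr _ hc).
exists (`|C| + 1) => b.
have f0 : 0 < (mfact b)%:R :> R by rewrite ltr0n mfact_gt0.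
rewrite /A normrM (gtr0_norm f0) mulfK ?gt_eqF//.
have mr : `|mpow (const_mx rho : E) b| = rho ^+ mdeg b.
  rewrite /mpow (eq_bigr (fun i => rho ^+ b i)); last by move=> i _; rewrite mxE.
  by rewrite prodrXr ger0_norm// exprn_ge0// ltW.
have C1 : C < `|C| + 1 by rewrite (le_lt_trans (ler_norm C))// ltrDl.
have := HC _ C1 (mdeg b) I => /=; rewrite ger0_norm; last by apply: sumr_ge0.
apply: le_trans; rewrite (bigD1_seq b)/= ?midx_uniq ?mem_midx//.
rewrite normrM mr lerDl; exact: sumr_ge0.
Qed.

Lemma usharp_term u A rho k : expansion u A rho -> usharp u k = term A k.
Proof.
move=> uA; apply/funext => t; apply: eq_bigr => b _.
by rewrite (expansion_mderiv b uA).
Qed.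

Lemma smooth_usharp u k : smooth (usharp u k : E -> R).
Proof.
apply/smoothP => n; apply: Ck_sum => b; apply: CkM; first exact: Ck_cst.
apply: Ck_prod => i; elim: (b i) => [|m IHm].
  by under eq_fun do rewrite expr0; exact: Ck_cst.
under eq_fun do rewrite exprS; apply: CkM => //.
by have /smoothP := @smooth_coord R d i.
Qed.

(** u minus its homogeneous part of degree k has coefficients vanishing below degree k + 1, and its
    first derivatives below degree k; [expansion_vanish] turns this into the two bounds. *)
Lemma analytic_taylor u k : analytic_at u 0 ->
  (forall b : mindex d, (mdeg b < k)%N -> mderiv b u 0 = 0) ->
  exists rho, exists K, [/\ 0 < rho, 0 <= K, forall x, `|x| < rho -> C1_at u x,
    forall x, `|x| < rho -> `|u x - usharp u k x| <= K * `|x| ^+ k.+1 &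
    forall x i, `|x| < rho -> `|partial i u x - partial i (usharp u k) x| <= K * `|x| ^+ k].
Proof.
move=> /analytic_expansion[A [rho uA]] u0.
have [rho0 _ _] := uA.
have Ab b : (mdeg b < k)%N -> A b = 0 by move=> bk; rewrite -(expansion_mderiv b uA) u0.
rewrite (usharp_term k uA).
have wA := expansionB uA (expansion_homog k uA).
have B0 b : (mdeg b < k.+1)%N -> A b - homog A k b = 0.
  rewrite ltnS leq_eqVlt /homog => /orP[->|bk]; first by rewrite subrr.
  by rewrite Ab// (ltn_eqF bk) subr0.
have s0 := @shrink_gt0 R d; have s1 := @shrink_ge1 R d.
have le_sh r : 0 < r -> r / shrink <= r by move=> r0; rewrite ler_pdivrMr// ler_peMr// ltW.
have r1 : 0 < rho / shrink by rewrite divr_gt0.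
have r2 : 0 < rho / shrink / shrink by rewrite divr_gt0.
have r3 : 0 < rho / shrink / shrink / shrink by rewrite divr_gt0.
have [K1 K10 HK1] := expansion_vanish wA B0.
have /choice[K2 HK2] i : exists K, 0 <= K /\ forall h, `|h| < rho / shrink / shrink ->
    `|partial i (fun x => u x - term A k x) h| <= K * `|h| ^+ k.
  have [_ wi] := expansion_partial i wA.
  have [|K K0 HK] := @expansion_vanish R d _ _ _ k wi; last by exists K.
  by move=> b bk; rewrite /shift B0// mdeg_madd mdeg_munit addn1.
have d0 i x : `|x| < rho / shrink -> derivable u x (e_ i) by move=> xr; apply: (expansion_partial i uA).1.
(* One shrinking to differentiate u, two more for the continuity of the derivative. *)
exists (rho / shrink / shrink / shrink), (K1 + \sum_i K2 i); split => //.
- by rewrite addr_ge0// sumr_ge0// => i _; case: (HK2 i).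
- move=> x xr; split => i.
    by apply: d0; apply: (lt_le_trans xr); apply: (le_trans (le_sh _ r2)); exact: le_sh.
  by apply: (expansion_continuous (expansion_partial i uA).2).
- move=> x xr; apply: le_trans (HK1 x _) _.
    by apply: (lt_le_trans xr); apply: (le_trans (le_sh _ r2)); exact: le_sh.
  rewrite ler_wpM2r ?exprn_ge0// lerDl sumr_ge0// => i _; by case: (HK2 i).
- move=> x i xr; have x2 : `|x| < rho / shrink / shrink by exact: lt_le_trans xr (le_sh _ r2).
  have x1 : `|x| < rho / shrink by exact: lt_le_trans x2 (le_sh _ r1).
  have dt := (derive_term A k i x).1.
  have dZ : derivable (fun y => -1 * term A k y) x (e_ i).
    exact: (derivableM (derivable_cst _ _ _) dt).
  have -> : partial i u x - partial i (term A k) x = partial i (fun x => u x - term A k x) x.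
    have -> : (fun x => u x - term A k x) = (fun x => u x + -1 * term A k x).
      by apply/funext => y; rewrite mulN1r.
    by rewrite (partialD (d0 i x x1) dZ) (partialZ _ dt) mulN1r.
  apply: (le_trans ((HK2 i).2 x x2)); rewrite ler_wpM2r ?exprn_ge0//.
  rewrite (bigD1 i)//= [K2 i + _]addrC addrA lerDr addr_ge0// sumr_ge0// => j _.
  by case: (HK2 j).
Qed.

End taylor.

(** * Leading coefficient of a power series *)

Section leading_coefficient.
Context {R : realType}.
Variables (c : nat -> R) (r : R).
Hypotheses (r0 : 0 < r) (cc : forall e : R, `|e| < r -> cvgn (series (fun n => `|c n * e ^+ n|))).
Local Notation S e := (limn (series (fun n => c n * e ^+ n))).

Let cvgS (e : R) : `|e| < r -> cvgn (series (fun n => c n * e ^+ n)).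
Proof. by move=> /cc; exact: normed_cvg. Qed.

(** Comparison with the absolutely convergent series at r1 = r / 2: a term of degree m > n is at
    most |c m| r1^m (e / r1)^(n+1). *)
Lemma power_series_leading n : (forall m, (m < n)%N -> c m = 0) ->
  exists2 K, 0 <= K & forall e, 0 < e < r / 2 -> `|S e / e ^+ n - c n| <= K * e.
Proof.
move=> c0; pose r1 := r / 2; have r10 : 0 < r1 by rewrite divr_gt0.
have r1r : `|r1| < r by rewrite gtr0_norm// ltr_pdivrMr// ltr_pMr// ltr1n.
pose M := limn (series (fun n => `|c n * r1 ^+ n|)).
have nd : nondecreasing_seq (series (fun n => `|c n * r1 ^+ n|)).
  by apply/nondecreasing_seqP => k; rewrite /series/= big_nat_recr//= lerDl.
have leM k : \sum_(0 <= m < k) `|c m * r1 ^+ m| <= M by exact: nondecreasing_cvgn_le nd (cc r1r) k.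
have M0 : 0 <= M by have := leM 0%N; rewrite big_geq.
exists (M / r1 ^+ n.+1) => [|e /andP[e0 er]]; first by rewrite divr_ge0// exprn_ge0// ltW.
have er' : `|e| < r by rewrite (gtr0_norm e0); apply: (lt_trans er); rewrite -[r / 2](gtr0_norm r10).
have en0 : 0 < e ^+ n by rewrite exprn_gt0.
have q0 : 0 <= e / r1 by rewrite divr_ge0// ltW.
have q1 : e / r1 <= 1 by rewrite ler_pdivrMr// mul1r ltW.
have part k : (n < k)%N ->
    `|\sum_(0 <= m < k) c m * e ^+ m - c n * e ^+ n| <= M * (e / r1) ^+ n.+1.
  move=> nk; rewrite (big_cat_nat _ (ltnW nk))//= big_nat big1 ?add0r; last first.
    by move=> m /andP[_ mn]; rewrite c0// mul0r.
  rewrite big_ltn// addrAC subrr add0r.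
  apply: (le_trans (ler_norm_sum _ _ _)).
  apply: (@le_trans _ _ (\sum_(n.+1 <= m < k) `|c m * r1 ^+ m| * (e / r1) ^+ n.+1)).
    rewrite big_nat [leRHS]big_nat; apply: ler_sum => m /andP[nm _].
    have -> : c m * e ^+ m = c m * r1 ^+ m * (e / r1) ^+ m.
      by rewrite -mulrA -exprMn mulrCA divff ?mulr1// gt_eqF.
    rewrite normrM ler_wpM2l// ger0_norm ?exprn_ge0//.
    by rewrite -(subnK nm) exprD ler_piMl ?exprn_ge0// exprn_ile1.
  rewrite -mulr_suml ler_wpM2r ?exprn_ge0//; apply: le_trans (leM k).
  by rewrite [leRHS](big_cat_nat _ nk)//= lerDr sumr_ge0.
have : `|S e - c n * e ^+ n| <= M * (e / r1) ^+ n.+1.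
  have l : (fun k => `|series (fun m => c m * e ^+ m) k - c n * e ^+ n|) @ \oo --> `|S e - c n * e ^+ n|.
    by apply: cvg_norm; apply: cvgB; [exact: cvgS|exact: cvg_cst].
  rewrite -(cvg_lim (@norm_hausdorff _ _) l); apply: limr_le.
    by apply/cvg_ex; eexists; exact: l.
  by exists n.+1 => // k /= nk; exact: part.
have -> : S e / e ^+ n - c n = (S e - c n * e ^+ n) / e ^+ n.
  by rewrite mulrBl mulfK// gt_eqF.
rewrite normrM normfV (gtr0_norm en0) ler_pdivrMr// => /le_trans; apply.
have : r1 ^+ n.+1 != 0 by rewrite expf_neq0// gt_eqF.
rewrite [(e / r1) ^+ _]expr_div_n [e ^+ n.+1]exprS; move: (r1 ^+ n.+1) (e ^+ n) => p q p0.
by have -> : M * (e * q / p) = M / p * e * q by field.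
Qed.

Variables (N : nat) (L : R).
Hypothesis SL : forall e, 0 < e -> exists2 dl, 0 < dl & forall x, 0 < x < dl ->
  `|S x / x ^+ N - L| <= e.

Lemma small_eq0 (a K dl : R) : 0 < dl -> (forall x, 0 < x < dl -> `|a| <= K * x) -> a = 0.
Proof.
move=> dl0 H; apply/eqP; rewrite -normr_le0; apply/ler_addgt0Pr => e e0; rewrite add0r.
pose x := Num.min (dl / 2) (e / (`|K| + 1)).
have K0 : 0 < `|K| + 1 by rewrite ltr_wpDl.
have x0 : 0 < x by rewrite lt_min !divr_gt0.
have xd : x < dl by rewrite gt_min; apply/orP; left; rewrite ltr_pdivrMr// ltr_pMr// ltr1n.
apply: (le_trans (H x _)); first by rewrite x0.
apply: (@le_trans _ _ ((`|K| + 1) * x)).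
  by rewrite ler_wpM2r ?(ltW x0)// (le_trans (ler_norm _))// lerDl.
by rewrite mulrC -ler_pdivlMr// ge_min lexx orbT.
Qed.

(** By strong induction: once the coefficients below n vanish, c n is the limit of S x / x^n, which
    is S x / x^N, bounded, times x^(N - n), which tends to 0. *)
Lemma power_series_low n : (n < N)%N -> c n = 0.
Proof.
elim/ltn_ind: n => n IHn nN.
have [K K0 HK] := power_series_leading (fun m mn => IHn m mn (ltn_trans mn nN)).
have [dl dl0 Hdl] := SL ltr01.
apply: (@small_eq0 _ (K + (`|L| + 1)) (Num.min dl (Num.min (r / 2) 1))).
  by rewrite !lt_min dl0 divr_gt0// ltr01.
move=> x /andP[x0]; rewrite !lt_min => /andP[xdl /andP[xr x1]].
have {}HK : `|S x / x ^+ n - c n| <= K * x by apply: HK; rewrite x0.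
have {}Hdl : `|S x / x ^+ N - L| <= 1 by apply: Hdl; rewrite x0.
have E : S x / x ^+ n = S x / x ^+ N * x ^+ (N - n).
  rewrite -{1}(subnK (ltnW nN)) exprD; have : x ^+ n != 0 by rewrite expf_neq0// gt_eqF.
  have : x ^+ (N - n) != 0 by rewrite expf_neq0// gt_eqF.
  by move: (x ^+ n) (x ^+ (N - n)) => p q p0 q0; field; rewrite p0 q0.
have Sn : `|S x / x ^+ n| <= (`|L| + 1) * x.
  rewrite E normrM; apply: ler_pM => //.
    by have := ler_normD (S x / x ^+ N - L) L; rewrite subrK => /le_trans; apply; rewrite addrC lerD2l.
  rewrite ger0_norm ?exprn_ge0 ?(ltW x0)//.
  have : (0 < N - n)%N by rewrite subn_gt0.
  case: (N - n)%N => // k _; rewrite exprS ler_piMr ?(ltW x0)//.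
  by rewrite exprn_ile1 ?(ltW x0)// ltW.
have -> : c n = S x / x ^+ n - (S x / x ^+ n - c n) by rewrite subKr.
apply: (le_trans (ler_normB _ _)); rewrite mulrDl addrC.
exact: lerD.
Qed.

Lemma power_series_coef : c N = L.
Proof.
have [K K0 HK] := power_series_leading power_series_low.
apply/eqP; rewrite -subr_eq0 -normr_le0; apply/ler_addgt0Pr => e e0; rewrite add0r.
have e2 : 0 < e / 2 by rewrite divr_gt0.
have [dl dl0 Hdl] := SL e2.
pose x := Num.min (dl / 2) (Num.min (r / 2 / 2) (e / 2 / (K + 1))).
have K1 : 0 < K + 1 by rewrite ltr_wpDl.
have half (a : R) : 0 < a -> a / 2 < a by move=> a0; rewrite ltr_pdivrMr// ltr_pMr// ltr1n.
have r2 : 0 < r / 2 by rewrite divr_gt0.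
have x0 : 0 < x by rewrite !lt_min !divr_gt0.
have xd : x < dl by rewrite gt_min half.
have xr : x < r / 2 by rewrite !gt_min half ?orbT//.
have xe : K * x <= e / 2.
  apply: (@le_trans _ _ ((K + 1) * x)); first by rewrite ler_wpM2r ?(ltW x0)// lerDl.
  by rewrite mulrC -ler_pdivlMr// !ge_min lexx !orbT.
have {}HK : `|S x / x ^+ N - c N| <= K * x by apply: HK; rewrite x0.
have {}Hdl : `|S x / x ^+ N - L| <= e / 2 by apply: Hdl; rewrite x0.
have -> : c N - L = (S x / x ^+ N - L) - (S x / x ^+ N - c N) by ring.
apply: (le_trans (ler_normB _ _)); rewrite [leRHS]splitr; apply: lerD => //.
exact: le_trans HK xe.
Qed.

Lemma power_series_split e : `|e| < r ->
  S e = e ^+ N * L + limn (fun m => \sum_(N.+1 <= n < m) e ^+ n * c n).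
Proof.
move=> er.
have l : (fun m => \sum_(N.+1 <= n < m) e ^+ n * c n) @ \oo --> S e - e ^+ N * L.
  have l1 : (fun m => series (fun n => c n * e ^+ n) m - e ^+ N * L) @ \oo --> S e - e ^+ N * L.
    by apply: cvgB; [exact: cvgS|exact: cvg_cst].
  apply: cvg_trans l1; apply: near_eq_cvg; exists N.+1 => // m /= Nm; rewrite /series/=.
  rewrite (big_cat_nat _ (ltnW Nm))//= big_nat big1 ?add0r; last first.
    by move=> k /andP[_ kN]; rewrite power_series_low// mul0r.
  rewrite big_ltn// power_series_coef [L * _]mulrC addrAC subrr add0r.
  by apply: eq_bigr => k _; rewrite mulrC.
by rewrite (cvg_lim (@norm_hausdorff _ _) l) addrC subrK.
Qed.

End leading_coefficient.

(** * Trial functions and the asymptotics of the capacity *)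

Section products.
Context {R : realType} {d : nat}.
Local Notation E := 'rV[R]_d.

Lemma C1c_bounded (U : set E) (g : E -> R) : C1c U g ->
  exists2 B, 0 < B & C1c (U `&` [set x | `|x| < B]) g.
Proof.
move=> [Cg [K [cK KU gK]]]; have [B B0 KB] := compact_norm_bound cK.
exists (B + 1); first by rewrite ltr_wpDl.
split => //; exists K; split => // x Kx; split; first exact: KU.
by rewrite /= (le_lt_trans (KB x Kx))// ltrDl.
Qed.

Lemma usharp_scale (u : E -> R) k (c : R) t : usharp u k (c *: t) = c ^+ k * usharp u k t.
Proof.
rewrite /usharp mulr_sumr big_seq [RHS]big_seq; apply: eq_bigr => b.
rewrite mem_midx => /eqP bk; rewrite mulrCA; congr (_ * _).
rewrite /mpow -bk /mdeg -prodrXr -big_split/=; apply: eq_bigr => i _.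
by rewrite mxE exprMn.
Qed.

End products.

Section trial_functions.
Context {R : realType} {d : nat}.
Local Notation E := 'rV[R]_d.
Local Notation T := (caratheodory_type (leb_om R d)).
Local Notation mu := (leb R d).
Local Notation e_ i := (delta_mx 0 i : E).
Local Notation IntT f := (\int[mu]_x f x).
Local Notation L2T := (sqint mu (setT : set T)).
Local Notation vipT := (vip mu (setT : set T)).
Variables (Om : set E) (M : R).
Hypotheses (oOm : open Om) (bOm : forall x, Om x -> `|x| <= M) (Om0 : Om 0).
Variables (om : set E) (Mo : R).
Hypotheses (oom : open om) (Mo0 : 0 <= Mo) (bom : forall x, closure om x -> `|x| <= Mo).
Variables (u f : E -> R) (k : nat).
Hypotheses (H1u : H1 Om u) (an_u : analytic_at u 0).
Hypothesis u_low : forall b : mindex d, (mdeg b < k)%N -> mderiv b u 0 = 0.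
Hypotheses (cf : {within ~` om, continuous f}) (harm_f : harmonic_on (~` closure om) f).
Hypothesis f_bdry : forall t, bdry om t -> f t = usharp u k t.
Hypothesis f_infty : forall e : R, 0 < e -> exists N : R, forall t, N < enorm t -> `|f t| < e.

Local Notation ext := (~` closure om).
(** Margins of width 1 around the cube |t| <= [Mo] that contains the closure of [om]: [zeta] is 1
    near this closure and 0 for |t| >= [r2]. *)
Let r1 : R := Mo + 1.
Let r2 : R := Mo + 2.
Let r1r2 : r1 < r2. Proof. by rewrite /r1 /r2; lra. Qed.
Let r20 : 0 < r2. Proof. by rewrite /r2 ltr_wpDl. Qed.
Let zeta : E -> R := cutoff r1 r2.
Let h : E -> R := usharp u k.
Let zh : E -> R := fun t => zeta t * h t.
Let v : E -> R := fun x => u x - h x.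

Let sh : smooth h. Proof. exact: smooth_usharp. Qed.

Let zeta_test : test_fun [set x : E | `|x| < r2 + 1] zeta.
Proof.
have := @test_cutoff R d [set x : E | `|x| < r2 + 1] 0 r1 r2 r20 r1r2.
have -> : (fun x => cutoff r1 r2 (x - 0)) = zeta by apply/funext => x; rewrite subr0.
by apply=> x; rewrite subr0 => xr /=; rewrite (le_lt_trans xr)// ltrDl.
Qed.

Let zh_test : test_fun setT zh.
Proof.
have -> : zh = fun t => h t * zeta t by apply/funext => t; rewrite mulrC.
exact: test_funM sh (test_fun_sub (@subsetT _ _) zeta_test).
Qed.

Let zeta1 t : `|t| <= r1 -> zeta t = 1. Proof. exact: cutoff_eq1. Qed.
Let zeta0 t : r2 <= `|t| -> zeta t = 0. Proof. exact: cutoff_eq0. Qed.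

Let zhE t : bdry om t -> zh t = h t.
Proof.
move=> [ct _]; rewrite /zh zeta1 ?mul1r//; apply: (le_trans (bom ct)).
by rewrite /r1; lra.
Qed.

Let tex n := texcess om f zh n.
Let dex i := dexcess om f zh i.
Let tex_C1c n : C1c ext (tex n) :=
  texcess_C1c oom cf harm_f f_bdry f_infty zh_test zhE n.

(** The limit of the rescaled gradients: by [Y_ext] and [Y_int] it is the gradient of f off the
    closure of [om] and of u_# on it. Written as this sum, it is visibly in L^2. *)
Let Y : 'I_d -> T -> R^o := fun i x => partial i zh x + dex i x.

Let sqint_dzh i : L2T (partial i zh) := test_fun_sqint measurableT (test_fun_partial i zh_test).
Let sqint_dex i : L2T (dex i) :=
  sqint_dexcess oom cf harm_f f_bdry f_infty zh_test zhE i.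

Let vL2Y : vsqint mu setT Y.
Proof. by move=> i; exact: (sqintD measurableT (sqint_dzh i) (sqint_dex i)). Qed.

Let Y_ext i x : ext x -> Y i x = partial i f x.
Proof. by move=> ex; rewrite /Y /dex (dexcessE harm_f zh_test i ex) addrC subrK. Qed.

Let Y_int i x : ~ ext x -> Y i x = partial i h x.
Proof.
move=> ex; rewrite /Y /dex dexcess_out// addr0; apply: near_eq_partial.
have cx : closure om x by apply: contrapT.
have oB : open [set y : E | `|y| < r1] by exact: open_norm_lt.
have Bx : [set y : E | `|y| < r1] x by rewrite /= (le_lt_trans (bom cx))// /r1 ltrDl.
by apply: filterS (open_nbhs_nbhs (conj oB Bx)) => y /ltW yr; rewrite /zh zeta1// mul1r.
Qed.

(** In the exterior Y is the gradient of a harmonic function; elsewhere the gradient of psi is 0. *)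
Let Y_orth psi : C1c ext psi -> vipT Y (gradf psi) = 0.
Proof.
move=> Cpsi; rewrite /vip -[RHS](ext_orthogonal harm_f Cpsi); apply: eq_bigr => i _.
apply: eq_Rintegral => x _; have [ex|ex] := pselect (ext x); first by rewrite Y_ext.
by rewrite /gradf (C1c_partial_out i Cpsi ex) !mulr0.
Qed.

Definition scaled (e : R) : set E := [set e *: t | t in closure om].

Let scaledP e x : 0 < e -> scaled e x <-> closure om (e^-1 *: x).
Proof.
move=> e0; split=> [[t ct <-]|cx]; first by rewrite scalerA mulVf ?gt_eqF// scale1r.
by exists (e^-1 *: x) => //; rewrite scalerA divff ?gt_eqF// scale1r.
Qed.

Let closed_scaled e : 0 < e -> closed (scaled e).
Proof.
move=> e0; have -> : scaled e = (fun x : E => e^-1 *: x) @^-1` closure om.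
  by apply/seteqP; split => x /(scaledP x e0).
apply: closed_comp; last exact: closed_closure.
by move=> x _; exact: scaler_continuous.
Qed.

Let normV (e : R) (x : E) : 0 < e -> `|e^-1 *: x| = `|x| / e.
Proof. by move=> e0; rewrite normrZ gtr0_norm ?invr_gt0// mulrC. Qed.

Let zeta_e (e : R) : E -> R := fun x => zeta (e^-1 *: x).

Let zeta_e_C1c e rho : 0 < e -> e * (r2 + 1) < rho -> C1c [set x : E | `|x| < rho] (zeta_e e).
Proof.
move=> e0 er; have ei : 0 < e^-1 by rewrite invr_gt0.
apply: C1c_sub (C1c_scale ei (test_fun_C1c zeta_test)) => x /=.
rewrite normV// ltr_pdivrMr// => /lt_trans; apply.
by rewrite mulrC.
Qed.

(* [zeta u] is only controlled near the origin, where it agrees with [h] up to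
   the remainder [v]; the latter contributes O(e) to the rescaled gradient. *)
Let remainder_small : exists rho, exists K, [/\ 0 < rho, 0 <= K, forall x, `|x| < rho -> Om x,
  forall x, `|x| < rho -> C1_at u x &
  forall e, 0 < e -> e < 1 -> e * (r2 + 1) < rho ->
    C1c [set x : E | `|x| < rho] (fun x => v x * zeta_e e x) /\
    forall i t, `|e^-1 ^+ k * partial i (fun t => v (e *: t) * zeta_e e (e *: t)) t| <=
      (if `|t| <= r2 then K * e else 0)].
Proof.
have [rho1 [K [rho10 K0 C1u Kv Kdv]]] := analytic_taylor an_u u_low.
have [rho2 rho20 ball_Om] := open_ballP oOm Om0.
pose rho := Num.min rho1 rho2.
have rho0 : 0 < rho by rewrite lt_min rho10.
have rhoOm x : `|x| < rho -> Om x.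
  by rewrite lt_min => /andP[_ xr]; apply: ball_Om; rewrite subr0.
have rhoC x : `|x| < rho -> C1_at u x by rewrite lt_min => /andP[xr _]; exact: C1u.
have [M1 M10 HM1] : exists2 M1, 0 <= M1 & forall i t, `|partial i zeta t| <= M1.
  have /choice[C HC] i : exists C, forall t, `|partial i zeta t| <= C.
    by have [C _ HC] := test_fun_bounded (test_fun_partial i zeta_test); exists C.
  exists (\sum_i `|C i|) => [|i t]; first exact: sumr_ge0.
  by rewrite (le_trans (HC i t))// (le_trans (ler_norm _))// (bigD1 i)//= lerDl sumr_ge0.
have z1 t : `|zeta t| <= 1 by rewrite ger0_norm; [exact: cutoff_le1|exact: cutoff_ge0].
(* The bounds K |x|^(k+1) on v and K |x|^k on its derivatives are used at |x| <= e r2. After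
   division by e^k the derivative of the cutoff contributes the first term and that of v the second,
   both of order e. *)
exists rho, (K * r2 ^+ k.+1 * M1 + K * r2 ^+ k); split => //.
  by rewrite addr_ge0// !mulr_ge0// exprn_ge0// ltW.
move=> e e0 e1 er.
have oB : open [set x : E | `|x| < rho] by exact: open_norm_lt.
have Cv x : [set x : E | `|x| < rho] x -> C1_at v x.
  exact: (C1_at_sub_smooth oB rhoC sh).
have [CQ pQ] := C1c_mul oB Cv (zeta_e_C1c e0 er).
split => // i t.
have dQ : derivable (fun x => v x * zeta_e e x) (e *: t) (e_ i) := C1c_derivable CQ.
rewrite (partial_scale dQ) pQ.
have dz : derivable zeta (e^-1 *: (e *: t)) (e_ i).
  by apply: smooth_derivable; case: zeta_test.
rewrite /zeta_e (partial_scale dz) scalerA mulVf ?gt_eqF// scale1r.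
case: ifPn => [tr|]; last first.
  rewrite -ltNge => tr; rewrite zeta0 ?(ltW tr)// mulr0 addr0.
  have oN : open [set y : E | r2 < `|y|].
    apply: (@open_comp _ _ (fun y : E => `|y|) [set y | r2 < y]); last exact: open_gt.
    by move=> y _; exact: norm_continuous.
  rewrite (partial_near0 i _).2 ?mulr0 ?normr0//.
  by apply: filterS (open_nbhs_nbhs (conj oN tr)) => y /ltW; exact: zeta0.
have et : `|e *: t| = e * `|t| by rewrite normrZ gtr0_norm.
have etr : e * `|t| <= e * r2 by rewrite ler_pM2l.
have xr : `|e *: t| < rho.
  by rewrite et (le_lt_trans _ er)// ler_pM2l// (le_trans tr)// lerDl.
have xr1 : `|e *: t| < rho1 by move: xr; rewrite lt_min => /andP[].
have B1 : `|v (e *: t)| <= K * (e * r2) ^+ k.+1.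
  apply: (le_trans (Kv _ xr1)); rewrite ler_wpM2l// lerXn2r ?nnegrE// ?et//.
  by rewrite mulr_ge0// ltW.
have B2 : `|partial i v (e *: t)| <= K * (e * r2) ^+ k.
  have -> : partial i v (e *: t) = partial i u (e *: t) - partial i h (e *: t).
    have -> : v = fun x => u x + -1 * h x by apply/funext => y; rewrite /v mulN1r.
    have dh : derivable h (e *: t) (e_ i) := smooth_derivable sh.
    have dnh : derivable (fun y => -1 * h y) (e *: t) (e_ i) := smooth_derivable (smoothM (smooth_cst (-1)) sh).
    by rewrite (partialD ((C1u _ xr1).1 i) dnh) (partialZ _ dh) mulN1r.
  apply: (le_trans (Kdv _ i xr1)); rewrite ler_wpM2l// lerXn2r ?nnegrE// ?et//.
  by rewrite mulr_ge0// ltW.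
rewrite [e^-1 ^+ k * _]mulrA normrM.
have -> : `|e^-1 ^+ k * e| = e^-1 ^+ k * e.
  by rewrite ger0_norm// mulr_ge0 ?exprn_ge0 ?invr_ge0// ltW.
have en : e ^+ k != 0 by rewrite expf_neq0// gt_eqF.
apply: (@le_trans _ _ (e^-1 ^+ k * e * (K * (e * r2) ^+ k.+1 * (e^-1 * M1) + K * (e * r2) ^+ k))).
  rewrite ler_wpM2l ?mulr_ge0 ?exprn_ge0 ?invr_ge0 ?(ltW e0)//.
  apply: (le_trans (ler_normD _ _)); apply: lerD.
    rewrite normrM; apply: ler_pM => //; rewrite normrM gtr0_norm ?invr_gt0//.
    by rewrite ler_wpM2l ?invr_ge0 ?(ltW e0).
  by rewrite normrM -[leRHS]mulr1; apply: ler_pM.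
have e0' : e != 0 by rewrite gt_eqF.
rewrite exprVn !exprMn [e ^+ k.+1]exprS.
by move: (e ^+ k) (r2 ^+ k) (r2 ^+ k.+1) en => p q q' p0; rewrite le_eqVlt; apply/orP; left; apply/eqP; field; rewrite e0' p0.
Qed.

(** Stated in rescaled form: w lives on the scale of [om], and e^k w(x / e) on that of [Om]. The
    field does not depend on e; its orthogonality and the closeness of grad w to it are what the
    capacity estimate consumes. *)
Lemma trial_functions : exists Y : 'I_d -> T -> R^o, [/\ vsqint mu (setT : set T) Y,
    forall i x, ext x -> Y i x = partial i f x,
    forall i x, ~ ext x -> Y i x = partial i (usharp u k) x,
    forall psi, C1c ext psi -> vipT Y (gradf psi) = 0 &
    forall dl, 0 < dl -> exists2 e0, 0 < e0 & forall e, 0 < e < e0 -> exists w,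
      [/\ C1c setT w, C1c Om (fun x => e ^+ k * w (e^-1 *: x)),
        extends_near Om (scaled e) u (fun x => e ^+ k * w (e^-1 *: x)) &
        vipT (gradf w - Y) (gradf w - Y) <= dl]].
Proof.
exists Y; split; [exact: vL2Y|exact: Y_ext|exact: Y_int|exact: Y_orth|] => dl dl0.
have [rho [K [rho0 K0 rhoOm rhoC Hrho]]] := remainder_small.
pose tn n i : T -> R := fun x => partial i (tex n) x - dex i x.
have stn n i : L2T (tn n i).
  exact: (sqintB measurableT (C1c_partial_sqint i measurableT (tex_C1c n)) (sqint_dex i)).
have [n Hn] : exists n, \sum_i IntT (fun x : T => tn n i x * tn n i x) <= dl / 4.
  have c : (fun n => \sum_i IntT (fun x : T => tn n i x * tn n i x)) @ \oo --> \sum_(i < d) (0 : R).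
    by apply: cvg_sumr => i; exact: (cvg_dtexcess oom cf harm_f f_bdry f_infty zh_test zhE i).
  have dl4 : 0 < dl / 4 by rewrite divr_gt0.
  rewrite big1 in c => //; have /cvgrPdist_lt/(_ _ dl4)[N _ HN] := c.
  exists N; have := HN N (leqnn N); rewrite /= sub0r normrN => /ltW.
  exact: le_trans (ler_norm _).
have [B B0 CB] := C1c_bounded (tex_C1c n).
pose Bl : set T := [set x : E | `|x| <= r2].
have mBl : measurable Bl := measurable_norm_le r2.
pose vol : R := fine (mu Bl).
have vol0 : 0 <= vol by rewrite fine_ge0.
pose Z := d%:R * (K ^+ 2 * vol) + 1.
have Z0 : 0 < Z by rewrite ltr_wpDl// !mulr_ge0// sqr_ge0.
have r21 : 0 < r2 + 1 by rewrite addr_gt0.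
(* Four constraints on e: below 1; supports of the cutoff and of the truncated part inside the ball
   of radius rho; remainder at most dl / 4. *)
exists (Num.min (Num.min 1 (rho / (r2 + 1))) (Num.min (rho / B) (dl / 4 / Z))).
  by rewrite !lt_min ltr01 !divr_gt0.
move=> e /andP[e0]; rewrite !lt_min => /andP[/andP[e1 er] /andP[eB eZ]].
rewrite ltr_pdivlMr// in er; rewrite ltr_pdivlMr// in eB; rewrite ltr_pdivlMr// in eZ.
have [CQ HQ] := Hrho e e0 e1 er.
have ei0 : 0 < e^-1 by rewrite invr_gt0.
have ek : e ^+ k != 0 by rewrite expf_neq0// gt_eqF.
pose q t := v (e *: t) * zeta_e e (e *: t).
have Cq : C1c setT q := C1c_sub (@subsetT _ _) (C1c_scale e0 CQ).
have Ct : C1c setT (tex n) := C1c_sub (@subsetT _ _) (tex_C1c n).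
have Czh : C1c setT zh := test_fun_C1c zh_test.
have Cqe : C1c setT (fun t => e^-1 ^+ k * q t) := C1c_cst_mul (e^-1 ^+ k) Cq.
have Cqt := C1cD Cqe Ct.
(* The cut-off u_#, the rescaled remainder u - u_#, and the truncated excess. *)
pose w t := zh t + (e^-1 ^+ k * q t + tex n t).
have Cw : C1c setT w := C1cD Czh Cqt.
have oB : open [set x : E | `|x| < rho] by exact: open_norm_lt.
have Cz := zeta_e_C1c e0 er.
have [CU _] := C1c_mul oB rhoC Cz.
have CT : C1c (fun x => (ext `&` [set x | `|x| < B]) (e^-1 *: x)) (fun x => tex n (e^-1 *: x)).
  exact: C1c_scale ei0 CB.
have CT' : C1c (Om `\` scaled e) (fun x => e ^+ k * tex n (e^-1 *: x)).
  apply: C1c_cst_mul; apply: C1c_sub CT => x [ex]; rewrite /= normV// ltr_pdivrMr// => xB.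
  split; last by move=> /(scaledP x e0).
  by apply: rhoOm; apply: (lt_trans xB); rewrite mulrC.
(* Homogeneity turns e^k zh(x / e) into zeta(x / e) u_#(x), which recombines with the remainder into
   zeta(x / e) u(x). *)
have WE : (fun x => e ^+ k * w (e^-1 *: x)) = (fun x => u x * zeta_e e x + e ^+ k * tex n (e^-1 *: x)).
  apply/funext => x; rewrite /w /q /zh /h usharp_scale scalerA divff ?gt_eqF// scale1r -/h.
  rewrite !mulrDr addrA; congr (_ + _); rewrite /v /zeta_e exprVn.
  by move: (e ^+ k) ek => p p0; field.
have oOmK : open (Om `\` scaled e).
  by apply: openI => //; apply: closed_openC; exact: closed_scaled.
exists w; split; [exact: Cw| | |].
- rewrite WE; apply: C1cD; first exact: C1c_sub rhoOm CU.
  exact: C1c_sub (@subDsetl _ _ _) CT'.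
(* The difference with eta u is (zeta(x / e) - eta) u plus the truncated part. The former is an H^1
   function of compact support off the scaled set, since both cutoffs are 1 near that set. *)
- rewrite WE => eta teta [N [oN KN etaN]].
  have H2 := C1c_H10 oOm bOm oOmK (@subDsetl _ Om (scaled e)) CT'.
  have seta : smooth eta by case: teta.
  have szeta : smooth (zeta_e e).
    have [sz _] := zeta_test; have := smooth_affine e^-1 0 sz.
    by congr (smooth _); apply/funext => x; rewrite addr0.
  have sg : smooth (fun x => zeta_e e x + -1 * eta x).
    exact: smoothD szeta (smoothM (smooth_cst (-1)) seta).
  have [su wu] := H1_wgrad H1u.
  have Hg : H1 Om (fun x => (zeta_e e x + -1 * eta x) * u x).
    split; first exact: (smoothM_sqint oOm bOm sg su).
    by eexists; exact: (weak_gradM oOm bOm sg su wu).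
  have [_ [Ke [cKe KeOm etaKe]]] := teta.
  pose N' := [set x : E | `|x| < e * r1].
  pose C := (Ke `|` [set x : E | `|x - 0| <= e * r2]) `&` ~` (N `&` N').
  have oN' : open N' by exact: open_norm_lt.
  have cC : compact C.
    apply: (@subclosed_compact _ C (Ke `|` [set x : E | `|x - 0| <= e * r2])).
    - apply: closedI; last by apply: open_closedC; exact: openI.
      by apply: closedU; apply: compact_closed => //; exact: compact_norm_le.
    - by apply: compactU => //; exact: compact_norm_le.
    - by move=> x [].
  have COm : C `<=` Om `\` scaled e.
    move=> x [Kx Nx]; split.
      case: Kx => [/KeOm//|/=]; rewrite subr0 => xr; apply: rhoOm; apply: (le_lt_trans xr).
      by apply: lt_trans er; rewrite ltr_pM2l// ltrDl.
    move=> sx; apply: Nx; split; first exact: KN.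
    have /bom := (scaledP x e0).1 sx; rewrite normV// ler_pdivrMr// /N' /= => xM.
    by apply: (le_lt_trans xM); rewrite mulrC ltr_pM2l// /r1 ltrDl.
  have gC x : ~ C x -> (zeta_e e x + -1 * eta x) * u x = 0.
    move=> nC; have [[Nx N'x]|nN] := pselect ((N `&` N') x).
      rewrite etaN// /zeta_e zeta1 ?mulr1 ?subrr ?mul0r//.
      by rewrite normV// ler_pdivrMr// mulrC ltW.
    have nK : ~ (Ke `|` [set x : E | `|x - 0| <= e * r2]) x by move=> Kx; apply: nC.
    have /not_orP[nKe /negP] := nK; rewrite subr0 -ltNge => xr.
    rewrite etaKe// /zeta_e zeta0 ?mulr0 ?addr0 ?mul0r//.
    by rewrite normV// ler_pdivlMr// mulrC ltW.
  have Hg0 := H10_compact_support oOm bOm cC oOmK COm (@subDsetl _ Om (scaled e)) Hg gC.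
  have := H10D oOm bOm Hg0 H2; congr (H10 _ _ _); apply/funext => x.
  by rewrite mulN1r mulrBl addrAC [zeta_e e x * _]mulrC.
- pose p i : T -> R := fun t => e^-1 ^+ k * partial i q t.
have wY i (x : T) : (gradf w - Y) i x = p i x + tn n i x.
  rewrite [LHS](_ : _ = partial i w x - Y i x)//.
  have d1 : derivable zh x (e_ i) := C1c_derivable Czh.
  have d2 : derivable (fun t => e^-1 ^+ k * q t) x (e_ i) := C1c_derivable Cqe.
  have d3 : derivable (tex n) x (e_ i) := C1c_derivable Ct.
  have d4 : derivable (fun t => e^-1 ^+ k * q t + tex n t) x (e_ i) := C1c_derivable Cqt.
  have d5 : derivable q x (e_ i) := C1c_derivable Cq.
  rewrite /w (partialD d1 d4) (partialD d2 d3) (partialZ _ d5) /p /tn /Y.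
  by move: (partial i zh x) (_ * _) (partial i (tex n) x) (dex i x) => a b c d'; ring.
have sp i : L2T (p i).
  exact: (sqintZ measurableT _ (C1c_partial_sqint i measurableT Cq)).
have Ip i : IntT (fun x : T => p i x * p i x) <= K ^+ 2 * vol * e.
  pose g : T -> R := (fun=> (K * e) ^+ 2) \_ Bl.
  have Ig : mu.-integrable setT (EFin \o g).
    rewrite /g -restrict_EFin; apply/(integrable_mkcond _ mBl).
    by apply: integrable_cst_fin => //; exact: leb_norm_le.
  apply: (@le_trans _ _ (IntT g)).
    apply: (le_Rintegral measurableT (integrable_mul_sqint measurableT (sp i) (sp i)) Ig) => x _.
    have := HQ i x; rewrite -/(q) /g /patch -[_ * partial i _ _]/(p i x).
    have -> : (x \in Bl) = (`|x : E| <= r2).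
      by apply/idP/idP => [/set_mem//|xr]; exact: mem_set.
    case: ifP => _ H.
      rewrite -expr2 -(real_normK (num_real (p i x))) lerXn2r ?nnegrE//.
      by rewrite mulr_ge0// ltW.
    have /eqP -> : p i x == 0 by rewrite -normr_eq0 eq_le H normr_ge0.
    by rewrite mulr0.
  rewrite /g -Rintegral_mkcond (Rintegral_cst _ mBl) -/vol exprMn mulrAC.
  rewrite ler_wpM2l ?mulr_ge0 ?sqr_ge0// expr2 ler_piMr ?(ltW e0)//.
  exact: ltW.
(* By (a + b)^2 <= 2 a^2 + 2 b^2, where the remainder part and the truncation part are each at most
   dl / 4 once summed over i. *)
apply: (@le_trans _ _ (\sum_i (2 * (K ^+ 2 * vol * e) + 2 * IntT (fun x : T => tn n i x * tn n i x)))).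
  apply: ler_sum => i _.
  have I1 := integrable_mul_sqint measurableT (sp i) (sp i).
  have I2 := integrable_mul_sqint measurableT (stn n i) (stn n i).
  have J1 := integrable_mulr measurableT 2 I1.
  have J2 := integrable_mulr measurableT 2 I2.
  apply: (@le_trans _ _ (2 * IntT (fun x : T => p i x * p i x) + 2 * IntT (fun x : T => tn n i x * tn n i x))).
    rewrite -(RintegralZl 2 measurableT I1) -(RintegralZl 2 measurableT I2) -(RintegralD measurableT J1 J2).
    have s3 := sqintD measurableT (sp i) (stn n i).
    have I3 := integrable_mul_sqint measurableT s3 s3.
    have -> : IntT (fun x : T => (gradf w - Y) i x * (gradf w - Y) i x) =
        IntT (fun x : T => (p i x + tn n i x) * (p i x + tn n i x)).
      by apply: eq_Rintegral => x _; rewrite wY.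
    apply: (le_Rintegral measurableT I3 (integrable_addr measurableT J1 J2)) => x _.
    move: (p i x) (tn n i x) => a b; have := sqr_ge0 (a - b); rewrite expr2; lra.
  by rewrite lerD2r ler_pM2l// Ip.
have E2 : K ^+ 2 * vol * e * d%:R <= dl / 4.
  apply: le_trans (ltW eZ); rewrite /Z mulrDr mulr1.
  have -> : K ^+ 2 * vol * e * d%:R = e * (d%:R * (K ^+ 2 * vol)) by ring.
  by rewrite lerDl ltW.
rewrite big_split/= sumr_const card_ord -[_ *+ d]mulr_natr -mulr_sumr -[2 * _ * d%:R]mulrA.
by move: Hn E2; move: (\sum_i _) (K ^+ 2 * vol * e * d%:R) => S y H1 H2; lra.
Qed.

End trial_functions.

(** * Asymptotics of the capacity *)

Section capacity_asymptotics.
Context {R : realType} {d : nat}.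
Local Notation E := 'rV[R]_d.
Local Notation T := (caratheodory_type (leb_om R d)).
Local Notation mu := (leb R d).
Local Notation IntT f := (\int[mu]_x f x).
Local Notation vipT := (vip mu (setT : set T)).

Lemma ler_norm_sqr (x y : R) : 0 <= y -> x ^+ 2 <= y ^+ 2 -> `|x| <= y.
Proof.
by move=> y0; rewrite -(real_normK (num_real x)) ler_pXn2r ?nnegrE.
Qed.

(** Lets y + 1 stand for the square root of y in Cauchy-Schwarz bounds. *)
Lemma ler_sqr_addr1 (y : R) : 0 <= y -> y <= (y + 1) ^+ 2.
Proof. by move=> y0; rewrite expr2; nra. Qed.

(** e^-2 from the two gradients, times e^d from the change of variables. *)
Lemma vip_scale (U U' : set E) (p q : E -> R) (e : R) : (2 <= d)%N -> 0 < e -> C1c U p -> C1c U' q ->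
  vipT (gradf (fun x => p (e^-1 *: x))) (gradf (fun x => q (e^-1 *: x))) =
    e ^+ (d - 2) * vipT (gradf p) (gradf q).
Proof.
move=> d2 e0 Cp Cq; have ei0 : 0 < e^-1 by rewrite invr_gt0.
rewrite /vip mulr_sumr; apply: eq_bigr => i _.
have sp := C1c_partial_sqint i measurableT Cp; have sq := C1c_partial_sqint i measurableT Cq.
have Ipq := integrable_mul_sqint measurableT sp sq.
have IF := integrable_mulr measurableT (e^-1 * e^-1) Ipq.
have -> : IntT (fun x : T => gradf (fun x => p (e^-1 *: x)) i x * gradf (fun x => q (e^-1 *: x)) i x) =
    IntT (fun x : T => (fun y : T => (e^-1 * e^-1) * (partial i p y * partial i q y)) (e^-1 *: (x : E) + 0)).
  apply: eq_Rintegral => x _; rewrite /gradf addr0.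
  rewrite (partial_scale (C1c_derivable Cp)) (partial_scale (C1c_derivable Cq)).
  by rewrite mulrACA.
rewrite (Rintegral_affine 0 ei0 IF) (RintegralZl _ measurableT Ipq) mulrA; congr (_ * _).
have -> : e^-1 ^- d = e ^+ (d - 2) * e ^+ 2 by rewrite exprVn invrK -exprD subnK.
by move: (e ^+ (d - 2)) => z; rewrite expr2; field; rewrite gt_eqF.
Qed.

Lemma vip_restrict (Om : set E) (G : 'I_d -> T -> R^o) (q : E -> R) : C1c Om q ->
  vip mu (Om : set T) G (gradf q) = vipT G (gradf q).
Proof.
move=> Cq; apply: eq_bigr => i _; apply/esym/Rintegral_supp => x Ox.
by rewrite /gradf (C1c_partial_out i Cq Ox) mulr0.
Qed.

Lemma vip_gradfZl (U : set E) (c : R) (p : E -> R) (H : 'I_d -> T -> R^o) : C1c U p ->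
  vsqint mu (setT : set T) H -> vipT (gradf (fun x => c * p x)) H = c * vipT (gradf p) H.
Proof.
move=> Cp sH; have PHV := @pre_hilbert_vsqint _ T R mu setT 'I_d measurableT.
rewrite -(preh_scalel PHV _ (fun i => C1c_partial_sqint i measurableT Cp) sH).
congr (vip _ _ _ _); apply/funext => i; apply/funext => x.
exact: (partialZ c (C1c_derivable Cp)).
Qed.

Variables (Om om : set E) (M : R).
Hypotheses (oOm : open Om) (bOm : forall x, Om x -> `|x| <= M).
Hypothesis com : compact (closure om).
Hypothesis d2 : (2 <= d)%N.

Let PHT := @pre_hilbert_vsqint _ T R mu setT 'I_d measurableT.
Local Notation vL2T := (vsqint mu (setT : set T)).

Let C1c_vL2 U p : C1c U p -> vL2T (gradf p).
Proof. by move=> Cp i; exact: (C1c_partial_sqint i measurableT Cp). Qed.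

Definition trial_approx u k (Y : 'I_d -> T -> R^o) := forall dl, 0 < dl ->
  exists2 e0, 0 < e0 & forall e, 0 < e < e0 -> exists w,
    [/\ C1c setT w, C1c Om (fun x => e ^+ k * w (e^-1 *: x)),
      extends_near Om (scaled om e) u (fun x => e ^+ k * w (e^-1 *: x)) &
      vipT (gradf w - Y) (gradf w - Y) <= dl].

(** Rescaled, phi is supported off the closure of [om], where its gradient is orthogonal to Y; so
    grad w may be replaced by grad w - Y, and Cauchy-Schwarz brings in dl. The residual has the
    scaling of the energy, times a small factor. *)
Lemma trial_residual k (Y : 'I_d -> T -> R^o) w e dl : 0 < e -> vL2T Y ->
  (forall psi, C1c (~` closure om) psi -> vipT Y (gradf psi) = 0) ->
  C1c setT w -> vipT (gradf w - Y) (gradf w - Y) <= dl ->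
  forall phi, test_fun (Om `\` scaled om e) phi ->
    vip mu (Om : set T) (gradf (fun x => e ^+ k * w (e^-1 *: x))) (gradf phi) ^+ 2 <=
    (e ^+ k) ^+ 2 * e ^+ (d - 2) * dl * vip mu (Om : set T) (gradf phi) (gradf phi).
Proof.
move=> e0 sY oY Cw wY phi tphi.
have Cphi := C1c_sub (@subDsetl _ Om (scaled om e)) (test_fun_C1c tphi).
have ei0 : 0 < e^-1 by rewrite invr_gt0.
pose psi (t : E) := phi (e *: t).
have Cpsi : C1c (~` closure om) psi.
  by apply: C1c_sub (C1c_scale e0 (test_fun_C1c tphi)) => t [_ nK] ct; apply: nK; exists t.
have phiE : phi = fun x => psi (e^-1 *: x).
  by apply/funext => x; rewrite /psi scalerA divff ?gt_eqF// scale1r.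
have Cws := C1c_scale ei0 Cw; have Cps := C1c_scale ei0 Cpsi.
rewrite !(vip_restrict _ Cphi) phiE (vip_gradfZl _ Cws (C1c_vL2 Cps)).
rewrite (vip_scale d2 e0 Cw Cpsi) (vip_scale d2 e0 Cpsi Cpsi).
have sw := C1c_vL2 Cw; have sp := C1c_vL2 Cpsi.
have -> : vipT (gradf w) (gradf psi) = vipT (gradf w - Y) (gradf psi).
  by rewrite (preh_subl PHT sw sY sp) oY// subr0.
have cs := preh_cs PHT (prehB PHT sw sY) sp.
have n0 := preh_ge0 PHT sp.
move: (vipT (gradf w - Y) (gradf psi)) (vipT (gradf psi) (gradf psi)) cs n0 => a n cs n0.
have ed : 0 <= e ^+ (d - 2) by rewrite exprn_ge0// ltW.
have ek : 0 <= (e ^+ k) ^+ 2 by rewrite sqr_ge0.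
have -> : (e ^+ k * (e ^+ (d - 2) * a)) ^+ 2 = ((e ^+ k) ^+ 2 * e ^+ (d - 2)) * e ^+ (d - 2) * a ^+ 2.
  by rewrite !exprMn [_ ^+ 2 in X in _ * X]expr2; ring.
have -> : (e ^+ k) ^+ 2 * e ^+ (d - 2) * dl * (e ^+ (d - 2) * n) =
    ((e ^+ k) ^+ 2 * e ^+ (d - 2)) * e ^+ (d - 2) * (dl * n) by ring.
apply: ler_wpM2l; first by apply: mulr_ge0 => //; exact: mulr_ge0.
by apply: (le_trans cs); rewrite ler_wpM2r.
Qed.

Lemma Cap_asymptotics ua ub ka kb (Ya Yb : 'I_d -> T -> R^o) (e1 : R) : 0 < e1 ->
  (forall e, 0 < e < e1 -> scaled om e `<=` Om) ->
  vL2T Ya -> vL2T Yb ->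
  (forall psi, C1c (~` closure om) psi -> vipT Ya (gradf psi) = 0) ->
  (forall psi, C1c (~` closure om) psi -> vipT Yb (gradf psi) = 0) ->
  trial_approx ua ka Ya -> trial_approx ub kb Yb ->
  forall eta, 0 < eta -> exists2 dl, 0 < dl & forall e, 0 < e < dl ->
    `|Cap Om (scaled om e) ua ub / e ^+ (ka + kb + (d - 2)) - vipT Ya Yb| <= eta.
Proof.
move=> e10 KOm sYa sYb oYa oYb tYa tYb eta eta0.
have i0 : 'I_d := Ordinal d2.
pose Ba := vipT Ya Ya + 1; pose Bb := vipT Yb Yb + 1.
have ya0 : 0 <= vipT Ya Ya := preh_ge0 PHT sYa.
have yb0 : 0 <= vipT Yb Yb := preh_ge0 PHT sYb.
have Ba0 : 0 <= Ba by rewrite addr_ge0.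
have Bb0 : 0 <= Bb by rewrite addr_ge0.
have C0 : 0 < Ba + Bb + 2 by rewrite ltr_wpDl// addr_ge0.
(* The final error is s + s Bb + Ba s + s^2, at most s (Ba + Bb + 2) when s <= 1. *)
pose s := Num.min 1 (eta / (Ba + Bb + 2)).
have s0 : 0 < s by rewrite lt_min ltr01 divr_gt0.
have s1 : s <= 1 by rewrite ge_min lexx.
have sC : s * (Ba + Bb + 2) <= eta by rewrite -ler_pdivlMr// ge_min lexx orbT.
have s20 : 0 < s ^+ 2 by rewrite exprn_gt0.
have [ea ea0 Ha] := tYa _ s20; have [eb eb0 Hb] := tYb _ s20.
exists (Num.min e1 (Num.min ea eb)) => [|e /andP[e0]]; first by rewrite !lt_min e10 ea0.
rewrite !lt_min => /andP[ee1 /andP[eea eeb]].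
have [wa [Cwa CWa Xa Na]] : exists w, [/\ C1c setT w, C1c Om (fun x => e ^+ ka * w (e^-1 *: x)),
    extends_near Om (scaled om e) ua (fun x => e ^+ ka * w (e^-1 *: x)) &
    vipT (gradf w - Ya) (gradf w - Ya) <= s ^+ 2] by apply: Ha; rewrite e0.
have [wb [Cwb CWb Xb Nb]] : exists w, [/\ C1c setT w, C1c Om (fun x => e ^+ kb * w (e^-1 *: x)),
    extends_near Om (scaled om e) ub (fun x => e ^+ kb * w (e^-1 *: x)) &
    vipT (gradf w - Yb) (gradf w - Yb) <= s ^+ 2] by apply: Hb; rewrite e0.
have cK : compact (scaled om e).
  by apply: continuous_compact com; apply: continuous_subspaceT => x; exact: scaler_continuous.
have KO : scaled om e `<=` Om by apply: KOm; rewrite e0.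
have ei0 : 0 < e^-1 by rewrite invr_gt0.
have swa := C1c_vL2 Cwa; have swb := C1c_vL2 Cwb.
have pos (k : nat) : 0 <= (e ^+ k) ^+ 2 * e ^+ (d - 2) * s ^+ 2.
  apply: mulr_ge0; last exact: sqr_ge0.
  by apply: mulr_ge0; [exact: sqr_ge0|rewrite exprn_ge0// ltW].
have := Cap_estimate oOm bOm i0 cK KO (pos ka) (pos kb)
  (C1c_H10 oOm bOm oOm (@subset_refl _ Om) CWa) (C1c_weak_grad oOm CWa) Xa
  (C1c_H10 oOm bOm oOm (@subset_refl _ Om) CWb) (C1c_weak_grad oOm CWb) Xb
  (trial_residual ka e0 sYa oYa Cwa Na) (trial_residual kb e0 sYb oYb Cwb Nb).
rewrite (vip_restrict _ CWb).
have Cwas := C1c_scale ei0 Cwa; have Cwbs := C1c_scale ei0 Cwb.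
rewrite (vip_gradfZl _ Cwas (C1c_vL2 CWb)).
rewrite (preh_sym PHT (C1c_vL2 Cwas) (C1c_vL2 CWb)) (vip_gradfZl _ Cwbs (C1c_vL2 Cwas)).
rewrite (vip_scale d2 e0 Cwb Cwa) (preh_sym PHT swb swa).
set D := vipT (gradf wa) (gradf wb); set cap := Cap _ _ _ _.
set N := (ka + kb + (d - 2))%N; have en0 : 0 < e ^+ N by rewrite exprn_gt0.
have -> : e ^+ ka * (e ^+ kb * (e ^+ (d - 2) * D)) = e ^+ N * D by rewrite /N !exprD; ring.
(* The product of the two residual bounds is a perfect square, so the error itself is at most e^N
   s^2. *)
have -> : (e ^+ ka) ^+ 2 * e ^+ (d - 2) * s ^+ 2 * ((e ^+ kb) ^+ 2 * e ^+ (d - 2) * s ^+ 2) =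
    (e ^+ N * s ^+ 2) ^+ 2 by rewrite /N !exprD; ring.
have es0 : 0 <= e ^+ N * s ^+ 2 by rewrite mulr_ge0// ltW.
move=> /(ler_norm_sqr es0) Hcap.
have H1 : `|cap / e ^+ N - D| <= s.
  have -> : cap / e ^+ N - D = (cap - e ^+ N * D) / e ^+ N.
    by rewrite mulrBl mulrAC divff ?mul1r// gt_eqF.
  rewrite normrM normfV (gtr0_norm en0) ler_pdivrMr//; apply: (le_trans Hcap).
  by rewrite [leRHS]mulrC ler_wpM2l ?(ltW en0)// expr2 ler_piMr// ltW.
pose da := gradf wa - Ya; pose db := gradf wb - Yb.
have sda : vL2T da := prehB PHT swa sYa.
have sdb : vL2T db := prehB PHT swb sYb.
(* Bilinear expansion of <Ya + da, Yb + db> - <Ya, Yb>. *)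
have DE : D - vipT Ya Yb = vipT da Yb + vipT Ya db + vipT da db.
  rewrite (preh_subl PHT swa sYa sYb) (preh_subr PHT swb sYb sYa) (preh_subr PHT swb sYb sda).
  rewrite (preh_subl PHT swa sYa swb) (preh_subl PHT swa sYa sYb) -/D.
  by ring.
have h1 : `|vipT da Yb| <= s * Bb.
  apply: ler_norm_sqr; first by rewrite mulr_ge0// ltW.
  apply: (le_trans (preh_cs PHT sda sYb)); rewrite exprMn; apply: ler_pM => //.
  - exact: (preh_ge0 PHT sda).
  - exact: ler_sqr_addr1.
have h2 : `|vipT Ya db| <= Ba * s.
  apply: ler_norm_sqr; first by rewrite mulr_ge0// ltW.
  apply: (le_trans (preh_cs PHT sYa sdb)); rewrite exprMn; apply: ler_pM => //.
  - exact: (preh_ge0 PHT sdb).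
  - exact: ler_sqr_addr1.
have h3 : `|vipT da db| <= s * s.
  apply: ler_norm_sqr; first by rewrite mulr_ge0// ltW.
  apply: (le_trans (preh_cs PHT sda sdb)); rewrite exprMn; apply: ler_pM => //.
  - exact: (preh_ge0 PHT sda).
  - exact: (preh_ge0 PHT sdb).
apply: le_trans sC.
have -> : cap / e ^+ N - vipT Ya Yb = (cap / e ^+ N - D) + (D - vipT Ya Yb) by ring.
rewrite DE; apply: (le_trans (ler_normD _ _)).
have h4 : `|vipT da Yb + vipT Ya db + vipT da db| <= s * Bb + Ba * s + s * s.
  apply: (le_trans (ler_normD _ _)); apply: lerD => //.
  by apply: (le_trans (ler_normD _ _)); exact: lerD.
apply: (le_trans (lerD H1 h4)).
have ss : s * s <= s by rewrite ler_piMr// ltW.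
have -> : s * (Ba + Bb + 2) = s + (s * Bb + Ba * s) + s by ring.
by rewrite addrA lerD2l.
Qed.

End capacity_asymptotics.

(** * The leading coefficient as a sum of two integrals *)

Section leading_integral.
Context {R : realType} {d : nat}.
Local Notation E := 'rV[R]_d.
Local Notation T := (caratheodory_type (leb_om R d)).
Local Notation mu := (leb R d).

(** The inner expression of the fields holds on the whole closure of [om]; as the boundary is null,
    the inner integral may be taken over [om]. *)
Lemma vip_split (om : set E) (Ya Yb : 'I_d -> T -> R^o) (fa fb ga gb : E -> R) :
  open om -> mu (bdry om) = 0%E ->
  vsqint mu (setT : set T) Ya -> vsqint mu (setT : set T) Yb ->
  (forall i x, (~` closure om) x -> Ya i x = partial i fa x) ->
  (forall i x, (~` closure om) x -> Yb i x = partial i fb x) ->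
  (forall i x, ~ (~` closure om) x -> Ya i x = partial i ga x) ->
  (forall i x, ~ (~` closure om) x -> Yb i x = partial i gb x) ->
  vip mu (setT : set T) Ya Yb =
    volint (~` closure om) (fun t => dot (grad fa t) (grad fb t)) +
    volint om (fun t => dot (grad ga t) (grad gb t)).
Proof.
move=> oom mb sYa sYb ea eb ia ib.
have Ii i := integrable_mul_sqint measurableT (sYa i) (sYb i).
pose F (x : T) := \sum_i Ya i x * Yb i x.
have IF : mu.-integrable setT (EFin \o F) := integrable_sumr measurableT (index_enum 'I_d) Ii.
have -> : vip mu (setT : set T) Ya Yb = \int[mu]_x F x.
  by rewrite /vip /F (Rintegral_sumr measurableT _ Ii).
have mom : measurable (om : set T) := open_measurable_Rd oom.
have mcl : measurable (closure om : set T) := closed_measurable_Rd (@closed_closure _ om).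
have mext : measurable (~` closure om : set T) := measurableC mcl.
have mbd : measurable (bdry om : set T) := closed_measurable_Rd (@bdry_closed R d om).
have clE : closure om = om `|` bdry om.
  apply/seteqP; split => x.
    move=> cx; have [ox|nox] := pselect (om x); [by left|right; split => //].
    by move=> /interior_subset.
  by case=> [|[]//]; exact: subset_closure.
have IS (D : set T) : measurable D -> mu.-integrable D (EFin \o F).
  by move=> mD; exact: (integrableS measurableT mD (@subsetT _ D) IF).
have TE : (setT : set T) = ~` closure om `|` closure om by rewrite setUC setUv.
have dj1 : [disjoint ~` closure om & (closure om : set T)].
  by apply/disj_setPS => x [].
have dj2 : [disjoint (om : set T) & (bdry om : set T)].
  apply/disj_setPS => x [ox [_ nx]]; apply: nx.
  by have := oom; rewrite openE => /(_ _ ox).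
have -> : \int[mu]_x F x = \int[mu]_(x in ~` closure om) F x + \int[mu]_(x in closure om) F x.
  have IT : mu.-integrable (~` closure om `|` closure om) (EFin \o F) by rewrite -TE.
  by rewrite [in LHS]TE (Rintegral_setU mext mcl IT dj1).
have -> : \int[mu]_(x in closure om) F x = \int[mu]_(x in om) F x + \int[mu]_(x in bdry om) F x.
  have IT : mu.-integrable (om `|` bdry om) (EFin \o F).
    by apply: IS; exact: measurableU.
  by rewrite clE (Rintegral_setU mom mbd IT dj2).
have -> : \int[mu]_(x in bdry om) F x = 0.
  have mF : measurable_fun (bdry om : set T) (EFin \o F) := measurable_int mu (IS _ mbd).
  by rewrite /Rintegral (null_set_integral mbd mF mb).
rewrite addr0; congr (_ + _); apply: eq_Rintegral => x /set_mem Hx.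
  by apply: eq_bigr => i _; rewrite (ea i x Hx) (eb i x Hx) !mxE.
have nx : ~ (~` closure om) x by move=> nx; apply: nx; exact: subset_closure.
by apply: eq_bigr => i _; rewrite (ia i x nx) (ib i x nx) !mxE.
Qed.

End leading_integral.

Theorem theorem6p1 (R : realType) (d : nat) (al : R) (Om om : set 'rV[R]_d)
    (ua ub : 'rV[R]_d -> R) (ka kb : nat) (fa fb : 'rV[R]_d -> R)
    (rho_o rho_i th_o th_i : nat -> 'rV[R]_d -> R) (eps_c : R) :
  (3 <= d)%N ->
  0 < al < 1 ->
  admissible_domain al Om -> admissible_domain al om ->
  admissible_fun Om ua -> admissible_fun Om ub ->
  ~ (\forall x \near (0 : 'rV[R]_d), ua x = 0) ->
  ~ (\forall x \near (0 : 'rV[R]_d), ub x = 0) ->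
  vanishing_order ua ka -> vanishing_order ub kb ->
  ext_dirichlet_sol al om (usharp ua ka) fa ->
  ext_dirichlet_sol al om (usharp ub kb) fb ->
  rho_system Om om al rho_o rho_i ->
  theta_system Om om ua rho_i al th_o th_i ->
  let c := cn Om om ua ub rho_o rho_i th_o th_i in
  let scaled (eps : R) := [set eps *: t | t in closure om] in
  0 < eps_c ->
  (forall eps : R, `|eps| < eps_c -> scaled eps `<=` Om) ->
  (forall eps : R, `|eps| < eps_c -> cvgn (series (fun n => `|c n * eps ^+ n|))) ->
  (forall eps : R, 0 < eps < eps_c ->
     Cap Om (scaled eps) ua ub = limn (series (fun n => c n * eps ^+ n))) ->
  forall eps : R, 0 < eps < eps_c ->
    Cap Om (scaled eps) ua ub
    = eps ^+ (ka + kb + d - 2)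
      * (volint (~` closure om) (fun t => dot (grad fa t) (grad fb t))
         + volint om (fun t => dot (grad (usharp ua ka) t) (grad (usharp ub kb) t)))
      + limn (fun m => \sum_(ka + kb + d - 1 <= n < m) eps ^+ n * c n).
Proof.
move=> d3 /andP[al0 _] [[oOm bdOm _] [_ Om0 _]] [[oom bdom _] [som _ _]].
move=> [H1a na] [H1b nb] _ _ [va _] [vb _] [[cfa _] hfa fab fai] [[cfb _] hfb fbb fbi] _ _.
move=> c sc eps0 KOm cc capE.
have d2 : (2 <= d)%N by exact: ltnW.
have aa : analytic_at ua 0 := nbhs_singleton na.
have ab : analytic_at ub 0 := nbhs_singleton nb.
have bounded_le (A : set 'rV[R]_d) : bounded_set A -> exists2 M : R, 0 <= M & forall x, A x -> `|x| <= M.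
  move=> [M [_ HM]]; exists (`|M| + 1) => [|x Ax]; first by rewrite addr_ge0.
  by apply: HM => //; rewrite (le_lt_trans (ler_norm M))// ltrDl.
have [M _ bOm] := bounded_le _ bdOm; have [Mo Mo0 bom] := bounded_le _ bdom.
have bcl x : closure om x -> `|x| <= Mo.
  have clB : closed [set y : 'rV[R]_d | `|y| <= Mo].
    apply: (@closed_comp _ _ (fun y : 'rV[R]_d => `|y|) [set t | t <= Mo]); last exact: closed_le.
    by move=> y _; exact: norm_continuous.
  by move=> cx; have := closure_subset bom cx; rewrite -(closure_id _).1.
have com : compact (closure om).
  apply: (subclosed_compact (@closed_closure _ om) (@compact_norm_le R d 0 Mo)) => x /bcl.
  by rewrite /= subr0.
have [Ya [sYa Yae Yai oYa tYa]] := trial_functions oOm bOm Om0 oom Mo0 bcl H1a aa va cfa hfa fab fai.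
have [Yb [sYb Ybe Ybi oYb tYb]] := trial_functions oOm bOm Om0 oom Mo0 bcl H1b ab vb cfb hfb fbb fbi.
have KOm' e : 0 < e < eps_c -> scaled om e `<=` Om.
  by move=> /andP[e0 ee]; apply: KOm; rewrite gtr0_norm.
have asym := Cap_asymptotics oOm bOm com d2 eps0 KOm' sYa sYb oYa oYb tYa tYb.
rewrite (vip_split oom (leb_bdry al0 som) sYa sYb Yae Ybe Yai Ybi) in asym.
(* Subtraction on [nat] is truncated: d >= 2 reconciles the exponents of the asymptotics with those
   of the statement. *)
have [EN EN1] : ((ka + kb + (d - 2))%N = (ka + kb + d - 2)%N /\
    (ka + kb + (d - 2)).+1 = (ka + kb + d - 1)%N).
  by rewrite addnBA//; split => //; rewrite -subSn ?subSS// (leq_trans d2)// leq_addl.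
move=> eps /andP[e0 ee]; rewrite capE ?e0//.
rewrite -EN1 -EN; apply: (power_series_split eps0 cc) => [eta eta0|]; last by rewrite gtr0_norm.
(* The capacity is the sum of the series for arguments below [eps_c], hence the minimum. *)
have [dl dl0 Hdl] := asym eta eta0; exists (Num.min dl eps_c); first by rewrite lt_min dl0.
move=> x /andP[x0]; rewrite lt_min => /andP[xdl xe].
by rewrite -capE ?x0//; apply: Hdl; rewrite x0.
Qed.
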